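(* Let $d\ge2$, let $\mathcal{O}\subset\mathbb{R}^d$ be a near half space with boundary $S=\partial\mathcal{O}$, and fix $z_0\in\mathcal{O}$. There exists $\eta>0$, depending only on $S$ and $z_0$, such that the following holds. Let $u:\mathcal{O}\to\mathbb{R}$ be a positive harmonic function such that (1) for every $t>0$ the function $z\mapsto u(z+t\vec{e_d})$ is bounded on $\mathcal{O}$, and (2) for every $t>0$, $u(x+t\vec{e_d})\to0$ as $\|x\|\to\infty$, $x\in S$. Let $V$ be the mean vertical variation of $u$ and $\mathcal{V}=\{x\in S: V(x)<\infty\}$. Then for any ball $B=B(x,r)$ with $x\in S$ and $r>0$ the Hausdorff dimension satisfies $$\dim(\mathcal{V}\cap B)\ge (d-1)\,\frac{1+\eta}{2+\eta}.$$
   Context: Near half space: a domain $\mathcal{O}=\{(x,y)\in\mathbb{R}^{d-1}\times\mathbb{R}: y>\Phi(x)\}$, where $\Phi:\mathbb{R}^{d-1}\to\mathbb{R}$ is Lipschitz and there is $\varrho\in(0,1)$ with $\Phi=0$ outside $B^{d-1}(0,\varrho)$. Its boundary is $S=\{(x,\Phi(x)):x\in\mathbb{R}^{d-1}\}$. For $x\in\mathbb{R}^d$, $t\in\mathbb{R}$ write $x_t=x+t\vec{e_d}$, with $\vec{e_d}$ the $d$-th standard unit vector; for a function $\varphi$ write $\varphi_t(x)=\varphi(x_t)$. Harmonic measure: $\omega^{z}$, $z\in\mathcal{O}$, is the harmonic measure of $\mathcal{O}$ with pole $z$, i.e. the law on $S$ of the exit point from $\mathcal{O}$ of Brownian motion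 started at $z$. The Martin kernel $k:\mathcal{O}\times S\to(0,\infty)$ is the continuous function, harmonic in the first variable, with $\omega^{z}(A)=\int_A k(z,\xi)\,\mathrm{d}\omega^{z_0}(\xi)$ for all Borel $A\subset S$; put $k_t(x,\xi)=k(x_t,\xi)$ for $x,\xi\in S$, $t>0$. Mean vertical variation: let $\sigma(z)=\nabla u(z)/\|\nabla u(z)\|$ if $\nabla u(z)\ne0$ and $\sigma(z)=0$ otherwise. For $t>0$ and $x,\xi\in S$ let $c_t(x,\xi)=\langle\nabla^1k(x_t,\xi),\sigma(x_{2t})\rangle$ ($\nabla^1$ is the gradient in the first variable), $b_t(x,\xi)=\int_S k_t(x,\zeta)c_t(\zeta,\xi)\,\mathrm{d}\omega^{z_0}(\zeta)$, and $(B_t f)(x)=\int_S b_t(x,\xi)f(\xi)\,\mathrm{d}\omega^{z_0}(\xi)$. Then $$V(x)=\int_0^1 (B_tu_t)(x)\,\mathrm{d}t=\int_0^1\int_S \|\nabla u(\xi_{2t})\|\,\mathrm{d}\omega^{x_t}(\xi)\,\mathrm{d}t\in[0,\infty].$$ *)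

(* Defs.v *)
From HB Require Import structures.
From mathcomp Require Import all_boot all_order all_algebra.
From mathcomp Require Import all_classical all_reals all_analysis.
Set Implicit Arguments.
Unset Strict Implicit.
Unset Printing Implicit Defensive.
Import Order.TTheory GRing.Theory Num.Theory.
Import numFieldNormedType.Exports.
Local Open Scope classical_set_scope.
Local Open Scope ring_scope.

(** * Euclidean geometry of row vectors

    The norm [`|x|] that the library puts on ['rV[R]_d] is the sup norm; the
    inner product, norm and balls below are the Euclidean ones. *)

Definition dotp (R : realType) (d : nat) (x y : 'rV[R]_d) : R :=
  \sum_(i < d) x 0 i * y 0 i.

Definition enorm (R : realType) (d : nat) (x : 'rV[R]_d) : R :=
  Num.sqrt (dotp x x).

Definition eball (R : realType) (d : nat) (x : 'rV[R]_d) (r : R)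
  : set 'rV[R]_d := [set y | enorm (y - x) < r].

Definition borel_rV (R : realType) (d : nat) :=
  g_sigma_algebraType (@open 'rV[R]_d).

(** * Gradient and harmonic functions *)

Definition basis_vec (R : realType) (d : nat) (i : 'I_d) : 'rV[R]_d :=
  delta_mx 0 i.
Arguments basis_vec : clear implicits.

Definition grad (R : realType) (d : nat) (f : 'rV[R]_d -> R) (z : 'rV[R]_d)
  : 'rV[R]_d := \row_(i < d) 'D_(basis_vec R d i) f z.

(** Values of [f] outside the open set [O] play no role in [harmonic_on O f]:
    derivatives at a point of [O] only see [f] near that point. *)
Definition harmonic_on (R : realType) (d : nat) (O : set 'rV[R]_d)
    (f : 'rV[R]_d -> R) : Prop :=
  (forall i z, O z -> derivable f z (basis_vec R d i)) /\
  (forall i j z, O z ->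
     derivable ('D_(basis_vec R d i) f) z (basis_vec R d j)) /\
  (forall i j z, O z ->
     {for z, continuous
        ('D_(basis_vec R d j) ('D_(basis_vec R d i) f))}) /\
  (forall z, O z ->
     \sum_(i < d) 'D_(basis_vec R d i) ('D_(basis_vec R d i) f) z = 0).

(** * Hausdorff dimension *)

(** Diameter, with the convention that the empty set has diameter 0. *)
Definition ediam (R : realType) (d : nat) (A : set 'rV[R]_d) : \bar R :=
  ereal_sup ([set 0%E] `|`
             [set (enorm (p.1 - p.2))%:E | p in A `*` A]).

Definition hausdorff_premeasure (R : realType) (d : nat) (s delta : R)
    (A : set 'rV[R]_d) : \bar R :=
  ereal_inf [set (\sum_(0 <= i <oo) poweR (ediam (U i)) s)%E |
    U in [set U : nat -> set 'rV[R]_d |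
           A `<=` \bigcup_i U i /\
           forall i, (ediam (U i) <= delta%:E)%E]].

Definition hausdorff_measure (R : realType) (d : nat) (s : R)
    (A : set 'rV[R]_d) : \bar R :=
  ereal_sup [set hausdorff_premeasure s delta A |
              delta in [set delta : R | 0 < delta]].

(** Only exponents [s > 0] enter the infimum, so no convention for [0 ^ 0] is
    needed; the empty set has dimension 0. *)
Definition hausdorff_dim (R : realType) (d : nat) (A : set 'rV[R]_d)
  : \bar R :=
  ereal_inf [set s%:E | s in
              [set s : R | 0 < s /\ hausdorff_measure s A = 0%E]].

(** * Brownian motion and harmonic measure *)

(** The processes are indexed by [R], but only nonnegative times matter.
    The last condition says at once that the increments over consecutive time
    intervals are independent, and that the one over [[s, t]] is a centred
    Gaussian vector with independent coordinates of variance [t - s]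
    ([normal_prob m sigma] takes the standard deviation as its argument). *)
Definition brownian_motion (R : realType) (d : nat) (disp : measure_display)
    (T : measurableType disp) (P : probability T R)
    (z : 'rV[R]_d) (W : R -> T -> 'rV[R]_d) : Prop :=
  (forall w, W 0 w = z) /\
  (forall w, {within [set t : R | 0 <= t], continuous (fun t => W t w)}) /\
  (forall t, 0 <= t ->
     measurable_fun [set: T] (W t : T -> borel_rV R d)) /\
  (forall (m : nat) (t : nat -> R) (A : nat -> 'I_d -> set (measurableTypeR R)),
     0 <= t 0%N ->
     (forall j, (j < m)%N -> t j < t j.+1) ->
     (forall j i, measurable (A j i)) ->
     P [set w | forall (j : 'I_m) (i : 'I_d),
                  A j i ((W (t j.+1) w - W (t j) w) 0 i)]
     = (\prod_(j < m) \prod_(i < d)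
          normal_prob 0 (Num.sqrt (t j.+1 - t j)) (A j i))%E).

(** On a path that never leaves [O], the infimum of the empty set is 0, so the
    exit point is the starting point, which does not lie on the boundary. *)
Definition exit_time (R : realType) (d : nat) (T : Type) (O : set 'rV[R]_d)
    (W : R -> T -> 'rV[R]_d) (w : T) : R :=
  inf [set t : R | 0 <= t /\ ~ O (W t w)].

Definition exit_point (R : realType) (d : nat) (T : Type) (O : set 'rV[R]_d)
    (W : R -> T -> 'rV[R]_d) (w : T) : 'rV[R]_d :=
  W (exit_time O W w) w.

(** [omega z] is, for every [z] in [O], the law of the exit point from [O] of a
    Brownian motion started at [z]. *)
Definition harmonic_measure (R : realType) (d : nat) (O : set 'rV[R]_d)
    (omega : 'rV[R]_d -> probability (borel_rV R d) R) : Prop :=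
  forall z, O z ->
    exists (disp : measure_display) (T : measurableType disp)
           (P : probability T R) (W : R -> T -> 'rV[R]_d),
      brownian_motion P z W /\
      forall A : set (borel_rV R d), measurable A ->
        omega z A = P (exit_point O W @^-1` A).

(** [k] is the density of [omega z] with respect to [omega z0]; only its values
    on [O `*` S] matter. *)
Definition martin_kernel (R : realType) (d : nat) (O S : set 'rV[R]_d)
    (omega : 'rV[R]_d -> probability (borel_rV R d) R) (z0 : 'rV[R]_d)
    (k : 'rV[R]_d -> 'rV[R]_d -> R) : Prop :=
  (forall z xi, O z -> S xi -> 0 < k z xi) /\
  {within O `*` S, continuous (fun p => k p.1 p.2)} /\
  (forall xi, S xi -> harmonic_on O (k^~ xi)) /\
  (forall z (A : set (borel_rV R d)), O z -> measurable A -> A `<=` S ->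
     omega z A = (\int[omega z0]_(xi in A) (k z xi)%:E)%E).

(** * Near half spaces

    The ambient dimension is [d = n.+1]; the first [n] coordinates of
    [z : 'rV[R]_n.+1] form [base z] and the last one is [height z]. *)

Definition base (R : realType) (n : nat) (z : 'rV[R]_n.+1) : 'rV[R]_n :=
  \row_(i < n) z 0 (widen_ord (leqnSn n) i).

Definition height (R : realType) (n : nat) (z : 'rV[R]_n.+1) : R :=
  z 0 ord_max.

Definition near_half_space_fun (R : realType) (n : nat)
    (Phi : 'rV[R]_n -> R) : Prop :=
  (exists L : R, forall x y, `|Phi x - Phi y| <= L * enorm (x - y)) /\
  (exists rho : R, 0 < rho < 1 /\ forall x, ~ eball 0 rho x -> Phi x = 0).

Definition near_half_space (R : realType) (n : nat) (Phi : 'rV[R]_n -> R)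
  : set 'rV[R]_n.+1 := [set z | Phi (base z) < height z].

Definition nhs_boundary (R : realType) (n : nat) (Phi : 'rV[R]_n -> R)
  : set 'rV[R]_n.+1 := [set z | height z = Phi (base z)].

Definition vshift (R : realType) (n : nat) (t : R) (x : 'rV[R]_n.+1)
  : 'rV[R]_n.+1 := x + t *: basis_vec R n.+1 ord_max.

(** * Mean vertical variation *)

Definition grad_direction (R : realType) (d : nat) (u : 'rV[R]_d -> R)
    (z : 'rV[R]_d) : 'rV[R]_d :=
  if grad u z == 0 then 0 else (enorm (grad u z))^-1 *: grad u z.

Definition c_kernel (R : realType) (n : nat)
    (k : 'rV[R]_n.+1 -> 'rV[R]_n.+1 -> R) (u : 'rV[R]_n.+1 -> R)
    (t : R) (x xi : 'rV[R]_n.+1) : R :=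
  dotp (grad (k^~ xi) (vshift t x)) (grad_direction u (vshift (2 * t) x)).

Definition b_kernel (R : realType) (n : nat) (S : set 'rV[R]_n.+1)
    (mu : probability (borel_rV R n.+1) R)
    (k : 'rV[R]_n.+1 -> 'rV[R]_n.+1 -> R) (u : 'rV[R]_n.+1 -> R)
    (t : R) (x xi : 'rV[R]_n.+1) : R :=
  \int[mu]_(zeta in S) (k (vshift t x) zeta * c_kernel k u t zeta xi).

Definition B_operator (R : realType) (n : nat) (S : set 'rV[R]_n.+1)
    (mu : probability (borel_rV R n.+1) R)
    (k : 'rV[R]_n.+1 -> 'rV[R]_n.+1 -> R) (u : 'rV[R]_n.+1 -> R)
    (t : R) (f : 'rV[R]_n.+1 -> R) (x : 'rV[R]_n.+1) : R :=
  \int[mu]_(xi in S) (b_kernel S mu k u t x xi * f xi).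

(** [mu] stands for the harmonic measure with pole [z0]. *)
Definition mean_vertical_variation (R : realType) (n : nat)
    (S : set 'rV[R]_n.+1) (mu : probability (borel_rV R n.+1) R)
    (k : 'rV[R]_n.+1 -> 'rV[R]_n.+1 -> R) (u : 'rV[R]_n.+1 -> R)
    (x : 'rV[R]_n.+1) : \bar R :=
  (\int[lebesgue_measure]_(t in `]0%R, 1%R[%classic)
     (B_operator S mu k u t (u \o vshift t) x)%:E)%E.

(* Main.v *)
Require Import Defs.
From HB Require Import structures.
From mathcomp Require Import all_boot all_order all_algebra.
From mathcomp Require Import all_classical all_reals all_analysis.
From mathcomp Require Import measurable_realfun.
From mathcomp Require Import ring lra.
Set Implicit Arguments.
Unset Strict Implicit.
Unset Printing Implicit Defensive.
Import Order.TTheory GRing.Theory Num.Theory.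
Import numFieldNormedType.Exports.
Local Open Scope classical_set_scope.
Local Open Scope ring_scope.

(** A barrier [rho ^ - gamma * G (1 + cos theta)] gives some [gamma > n / 2] with
    [omega^z (B (y, r)) <= C (r / |z - y|) ^ gamma].  At scale [b = 2 ^ -j], let
    [Q_j f (x)] be the average of [f] against harmonic measure after two vertical
    steps of length [b], the second one tilted by [eps] against the direction in
    which [u] varies most near height [3 b]; then
    [Q_j u_(2 b) = u_(4 b) - eps * A_j], where [A_j] dominates, up to a constant,
    the part of [V] coming from [3 b / 2 < t <= 3 b].  Let [nu_m] be the law of
    the chain with kernels [Q_k0], ..., [Q_(k0+m-1)] started at a boundary point
    [x0].  The values of [u] telescope along the chain, so
    [eps * nu_m (sum_j A_j) <= C * u]; a kernel [Q_j] hardly moves functions that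
    are smooth at a scale much larger than [2 ^ -j], so that
    [nu_m (B (x0, rho)) >= c]; and reaching scale [2 ^ -l] costs at most a factor
    [(1 + C * eps) ^ l], so that [nu_m (B (y, r)) <= C * r ^ alpha] for some
    [alpha > n / 2].  If the points of [B (x0, rho)] with [V < oo] had
    [s]-dimensional measure zero for some [s <= alpha], then finitely many balls
    with small [sum_i r_i ^ alpha] would cover the points of [B (x0, rho)] where
    [sum_j A_j <= M], which contradicts the lower bound as soon as [M] is large.

    The only information on Brownian motion that is needed is the inequality
    [int v d omega^z <= v z] for nonnegative superharmonic [v]; it is obtained by
    sampling the paths at dyadic times and expanding [v] one coordinate at a
    time. *)

(** * Maximum principle *)

(** No boundary values of [u] and no limit law of the chain enter the argument. Everything happens
    after finitely many steps, with bounds independent of their number: the functionals [nu] act on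
    bounded nonnegative Borel functions on the boundary, positivity of [u] disposes of the last term
    of the telescoping sum, and compactness of a boundary ball stands in for a limit measure. The
    obstacle is that the tilt depends on [u] while the kernels must be positive and of mass one on
    all such functions. Harnack's inequality settles this: the increment of any positive harmonic
    function over an admissible displacement is at most [C2] times its value, so [eps] times it can
    be subtracted once [eps * C2 <= 2^-1]. Since each scale multiplies the upper bound by
    [1 + eps * C2], the decay exponent must exceed n/2 with room to spare: half of the excess pays
    for the tilts and the other half is the gain in dimension. In dimensions two and three that
    excess comes from the Lipschitz graph: seen from a point below it, the domain stays in a cone
    around the upward vertical that omits a neighbourhood of the downward direction. *)

Section norms.
Context {R : realType} {d : nat}.
Implicit Types x y z v : 'rV[R]_d.

Lemma coord_le_norm x i : `|x 0 i| <= `|x|.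
Proof.
rewrite /Num.norm/= mx_normrE.
by apply: (le_bigmax _ (fun ij : 'I_1 * 'I_d => `|x ij.1 ij.2|) (0, i)).
Qed.

Lemma norm_le_coord x r : 0 <= r -> (forall i, `|x 0 i| <= r) -> `|x| <= r.
Proof.
move=> r0 xr; rewrite /Num.norm/= mx_normrE; apply/bigmax_leP; split => // -[i j] _/=.
by rewrite (ord1 i).
Qed.

Lemma norm_lt_coord x r : 0 < r -> (forall i, `|x 0 i| < r) -> `|x| < r.
Proof.
move=> r0 xr; rewrite /Num.norm/= mx_normrE; apply/bigmax_ltP; split => // -[i j] _/=.
by rewrite (ord1 i).
Qed.

Lemma basis_vecE i j : basis_vec R d i 0 j = (i == j)%:R.
Proof. by rewrite mxE eqxx/= eq_sym. Qed.

Lemma norm_basis_vec i : `|basis_vec R d i| = 1.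
Proof.
apply/eqP; rewrite eq_le; apply/andP; split.
  apply: norm_le_coord => // j; rewrite basis_vecE.
  by case: (i == j); rewrite ?normr0 ?normr1.
by have := coord_le_norm (basis_vec R d i) i; rewrite basis_vecE eqxx normr1.
Qed.

Lemma dotp_ge0 x : 0 <= dotp x x.
Proof. by apply: sumr_ge0 => i _; rewrite -expr2 sqr_ge0. Qed.

Lemma sqr_enorm x : enorm x ^+ 2 = dotp x x.
Proof. by rewrite sqr_sqrtr ?dotp_ge0. Qed.

Lemma enorm_ge0 x : 0 <= enorm x. Proof. exact: sqrtr_ge0. Qed.

Lemma sqr_coord_le_dotp x i : x 0 i ^+ 2 <= dotp x x.
Proof.
rewrite /dotp (bigD1 i)//= -expr2 lerDl.
by apply: sumr_ge0 => j _; rewrite -expr2 sqr_ge0.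
Qed.

Lemma norm_le_enorm x : `|x| <= enorm x.
Proof.
apply: norm_le_coord => [|i]; first exact: enorm_ge0.
by rewrite -sqrtr_sqr ler_sqrt ?dotp_ge0// sqr_coord_le_dotp.
Qed.

Lemma dotp_le_norm x : dotp x x <= d%:R * `|x| ^+ 2.
Proof.
have -> : d%:R * `|x| ^+ 2 = \sum_(i < d) `|x| ^+ 2.
  by rewrite sumr_const card_ord mulr_natl.
apply: ler_sum => i _; rewrite -expr2 -real_normK ?num_real//.
by rewrite lerXn2r ?nnegrE ?normr_ge0// coord_le_norm.
Qed.

Lemma enorm_le_norm x : enorm x <= d%:R * `|x|.
Proof.
rewrite -(@ler_pXn2r _ 2)// ?nnegrE ?mulr_ge0 ?enorm_ge0//.
rewrite sqr_enorm (le_trans (dotp_le_norm x))// exprMn ler_wpM2r ?sqr_ge0//.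
by case: (d) => [|k]; rewrite ?expr0n// -natrX ler_nat expnS leq_pmulr ?expn_gt0.
Qed.

Lemma dotp_eq0 x : dotp x x = 0 -> x = 0.
Proof.
move=> x0; apply/eqP; rewrite -normr_eq0 eq_le normr_ge0 andbT.
by rewrite (le_trans (norm_le_enorm x))// /enorm x0 sqrtr0.
Qed.

End norms.

(** * Directional derivatives as derivatives along lines *)

Section lines.
Context {R : realType} {d : nat}.
Implicit Types (z v : 'rV[R]_d) (f : 'rV[R]_d -> R).

Lemma line_cvg z v : (fun t : R => z + t *: v) @ 0 --> z.
Proof.
rewrite -[X in _ --> X]addr0 -(scale0r v); apply: cvgD; first exact: cvg_cst.
by apply: cvgZr_tmp; exact: cvg_id.
Qed.

Lemma near_line z v (A : set 'rV[R]_d) :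
  nbhs z A -> \forall t \near (0 : R), A (z + t *: v).
Proof. by move=> zA; have H : (fun t : R => z + t *: v) @ 0 --> z := @line_cvg z v; exact: H. Qed.

Lemma line_quotient z v a f :
  (fun h : R => h^-1 *: ((f \o shift (z + a *: v)) (h *: v) - f (z + a *: v))) =
  (fun h : R => h^-1 *: (((fun t : R => f (z + t *: v)) \o shift a) (h *: 1)
                          - (fun t : R => f (z + t *: v)) a)).
Proof.
apply/funext => h /=; congr (_ *: (f _ - _)).
by rewrite -[h *: 1]/(h * 1) mulr1 scalerDl addrCA.
Qed.

Lemma is_derive_lineP z v a f df :
  is_derive (z + a *: v) v f df <-> is_derive a (1 : R) (fun t : R => f (z + t *: v)) df.
Proof.
split=> -[]; rewrite /derivable /derive => fd fE; split; move: fd fE;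
  by rewrite /derivable /derive line_quotient.
Qed.

Lemma is_derive_line0P z v f df :
  is_derive z v f df <-> is_derive (0 : R) (1 : R) (fun t : R => f (z + t *: v)) df.
Proof. by have := is_derive_lineP z v 0 f df; rewrite scale0r addr0. Qed.

End lines.

(** * The second derivative test at a local maximum *)

Section second_derivative_test.
Context {R : realType}.
Implicit Types (phi g : R -> R).

Lemma is_derive_cvg phi (c a : R) : is_derive a (1 : R) phi c ->
  (fun t => t^-1 * (phi (a + t) - phi a)) @ 0^' --> c.
Proof.
move=> [] /[swap] <-; rewrite /derivable /derive => fd.
have -> : (fun t => t^-1 * (phi (a + t) - phi a)) =
  (fun h => h^-1 *: ((phi \o shift a) (h *: 1) - phi a)).
  apply/funext => h; rewrite /= (_ : h%:A = h); last exact: mulr1.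
  by rewrite [h + a]addrC.
exact: fd.
Qed.

Lemma derive_gt0_right g c : is_derive (0 : R) (1 : R) g c -> 0 < c ->
  exists2 e : R, 0 < e & forall t, 0 < t < e -> g 0 < g t.
Proof.
move=> /is_derive_cvg gc c0.
have : \forall t \near (0 : R)^', 0 < t^-1 * (g (0 + t) - g 0).
  exact: cvgr_gt gc _ c0.
rewrite near_withinE => /nbhs_ballP[e /= e0 H]; exists e => // t /andP[t0 te].
have := H t; rewrite /ball/= sub0r normrN gtr0_norm// => /(_ te).
rewrite add0r (gt_eqF t0) => /(_ isT).
by rewrite pmulr_rgt0 ?invr_gt0// subr_gt0.
Qed.

(** Fermat gives [g 0 = 0]. A positive [c] would make [g] positive just to the right of 0, and the
    mean value theorem would then lift [phi] above its maximum. Only the derivative of [g] at the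
    single point 0 enters. *)
Lemma second_derivative_max phi g c :
  (\forall t \near (0 : R), is_derive t (1 : R) phi (g t)) -> is_derive (0 : R) (1 : R) g c ->
  (\forall t \near (0 : R), phi t <= phi 0) -> c <= 0.
Proof.
move=> /nbhs_ballP[e1 /= e10 H1] gc /nbhs_ballP[e2 /= e20 H2].
rewrite leNgt; apply/negP => c0.
have [e3 e30 H3] := derive_gt0_right gc c0.
pose e := Num.min e1 (Num.min e2 e3).
have e0 : 0 < e by rewrite !lt_min e10 e20.
have dphi t : `|t| < e -> is_derive t (1 : R) phi (g t).
  by rewrite lt_min => /andP[te _]; apply: H1; rewrite /ball/= sub0r normrN.
have g0 : g 0 = 0.
  have d0 : is_derive (0 : R) (1 : R) phi (g 0) by apply: dphi; rewrite normr0.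
  have d1 : is_derive (0 : R) (1 : R) phi 0.
    apply: (@derive1_at_max _ phi (- e) e).
    - by rewrite ge0_cp// ltW.
    - by move=> t; rewrite in_itv/= -ltr_norml => /dphi[].
    - by rewrite in_itv/= oppr_lt0 e0.
    - move=> t; rewrite in_itv/= -ltr_norml !lt_min => /and3P[_ te _].
      by apply: H2; rewrite /ball/= sub0r normrN.
  by rewrite -(@derive_val _ _ _ _ _ _ _ d0) (@derive_val _ _ _ _ _ _ _ d1).
pose b := e / 2.
have b0 : 0 < b by rewrite divr_gt0.
have be : b < e by rewrite ltr_pdivrMr// ltr_pMr// ltr1n.
have [s sb] : exists2 s, s \in `]0, b[%R & phi b - phi 0 = g s * (b - 0).
  apply: MVT => // [s|].
    rewrite in_itv/= => /andP[s0 sb]; apply: dphi.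
    by rewrite gtr0_norm// (lt_trans sb).
  apply: derivable_within_continuous => s; rewrite in_itv/= => /andP[s0 sb].
  have [] : is_derive s (1 : R) phi (g s) => //.
  by apply: dphi; rewrite ger0_norm// (le_lt_trans sb).
move: sb; rewrite in_itv/= subr0 => /andP[s0 sb] E.
have : 0 < g s * b.
  rewrite mulr_gt0// -g0 H3// s0/=; move: (lt_trans sb be).
  by rewrite !lt_min => /and3P[].
rewrite -E subr_gt0 ltNge => /negP; apply; apply: H2.
rewrite /ball/= sub0r normrN gtr0_norm//.
by move: be; rewrite !lt_min => /and3P[].
Qed.

Lemma derive_le0_right g c e : is_derive (0 : R) (1 : R) g c -> g 0 = 0 -> 0 < e ->
  (forall t, 0 < t < e -> g t <= 0) -> c <= 0.
Proof.
move=> gc g0 e0 gle; rewrite leNgt; apply/negP => c0.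
have [e3 e30 H3] := derive_gt0_right gc c0.
pose b := Num.min e e3 / 2.
have m0 : 0 < Num.min e e3 by rewrite lt_min e0.
have b0 : 0 < b by rewrite divr_gt0.
have : b < Num.min e e3 by rewrite ltr_pdivrMr// ltr_pMr// ltr1n.
rewrite lt_min => /andP[be be3].
have := H3 b; rewrite b0 be3 => /(_ isT).
by rewrite g0 ltNge gle// b0.
Qed.

End second_derivative_test.

(** * Calculus of twice differentiable functions and the weak maximum principle *)

Section c2.
Context {R : realType} {d : nat}.
Implicit Types (U V K : set 'rV[R]_d) (f : 'rV[R]_d -> R)
  (g h : 'I_d -> 'rV[R]_d -> R).
Local Notation e := (basis_vec R d).

(** [h i] is the pure second derivative along [e i]; mixed derivatives are
    never used. *)
Definition c2 U f g h := forall z, U z -> {for z, continuous f} /\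
  forall i, [/\ is_derive z (e i) f (g i z), is_derive z (e i) (g i) (h i z),
    {for z, continuous (g i)} & {for z, continuous (h i)}].

Lemma c2S U V f g h : U `<=` V -> c2 V f g h -> c2 U f g h.
Proof. by move=> UV cV z /UV/cV. Qed.

Lemma c2_ext U f g h f' g' h' : c2 U f g h -> (forall z, f z = f' z) ->
  (forall i z, g i z = g' i z) -> (forall i z, h i z = h' i z) -> c2 U f' g' h'.
Proof.
move=> cf /funext <- gE hE.
have <- : g = g' by apply/funext => i; apply/funext => z.
by have <- : h = h' by apply/funext => i; apply/funext => z.
Qed.

Lemma c2D U f1 g1 h1 f2 g2 h2 : c2 U f1 g1 h1 -> c2 U f2 g2 h2 ->
  c2 U (fun z => f1 z + f2 z) (fun i z => g1 i z + g2 i z)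
       (fun i z => h1 i z + h2 i z).
Proof.
move=> c1 c2' z Uz; have [cf1 H1] := c1 _ Uz; have [cf2 H2] := c2' _ Uz.
split; first exact: (@cvgD _ _ _ _ _ _ _ _ _ cf1 cf2).
move=> i; have [a1 b1 p1 q1] := H1 i; have [a2 b2 p2 q2] := H2 i.
split; [exact: is_deriveD|exact: is_deriveD|
  exact: (@cvgD _ _ _ _ _ _ _ _ _ p1 p2)|exact: (@cvgD _ _ _ _ _ _ _ _ _ q1 q2)].
Qed.

Lemma c2_cst U (c : R) : c2 U (fun=> c) (fun _ _ => 0) (fun _ _ => 0).
Proof.
move=> z _; split; first exact: cst_continuous.
by move=> i; split; [exact: is_derive_cst|exact: is_derive_cst|
  exact: cst_continuous|exact: cst_continuous].
Qed.

Lemma c2M U f1 g1 h1 f2 g2 h2 : c2 U f1 g1 h1 -> c2 U f2 g2 h2 ->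
  c2 U (fun z => f1 z * f2 z) (fun i z => g1 i z * f2 z + f1 z * g2 i z)
       (fun i z => h1 i z * f2 z + 2 * (g1 i z * g2 i z) + f1 z * h2 i z).
Proof.
move=> c1 c2' z Uz; have [cf1 H1] := c1 _ Uz; have [cf2 H2] := c2' _ Uz.
split; first exact: (@cvgM _ _ _ _ _ _ _ _ cf1 cf2).
move=> i; have [a1 b1 p1 q1] := H1 i; have [a2 b2 p2 q2] := H2 i.
split.
- apply: is_derive_eq; rewrite /= -![_ *: _]/(_ * _); ring.
- apply: is_derive_eq; rewrite /= -![_ *: _]/(_ * _); ring.
- apply: (@cvgD _ _ _ _ _ _ _ _ _ (@cvgM _ _ _ _ _ _ _ _ p1 cf2)
                                  (@cvgM _ _ _ _ _ _ _ _ cf1 p2)).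
- apply: (@cvgD _ _ _ _ _ _ _ _ _ _ (@cvgM _ _ _ _ _ _ _ _ cf1 q2)).
  apply: (@cvgD _ _ _ _ _ _ _ _ _ (@cvgM _ _ _ _ _ _ _ _ q1 cf2)).
  exact: (@cvgM _ _ _ _ (fun=> 2) _ _ _ (cvg_cst _) (@cvgM _ _ _ _ _ _ _ _ p1 p2)).
Qed.

Lemma c2Z U (c : R) f g h : c2 U f g h ->
  c2 U (fun z => c * f z) (fun i z => c * g i z) (fun i z => c * h i z).
Proof.
move=> cf; apply: c2_ext (c2M (@c2_cst U c) cf) _ _ _ => //.
- by move=> i z; rewrite mul0r add0r.
- by move=> i z; ring.
Qed.

Lemma c2_coord U i : c2 U (fun z => z 0 i) (fun j _ => (j == i)%:R) (fun _ _ => 0).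
Proof.
move=> z _; split; first exact: coord_continuous.
move=> j; split; [|exact: is_derive_cst|exact: cst_continuous|exact: cst_continuous].
apply/is_derive_line0P.
have -> : (fun t : R => (z + t *: e j) 0 i) = (fun t => z 0 i + t * (j == i)%:R).
  by apply/funext => t; rewrite !mxE eqxx/= eq_sym.
apply: is_derive_eq; rewrite -![_ *: _]/(_ * _); ring.
Qed.

Lemma c2_sum U n (F : 'I_n -> 'rV[R]_d -> R) G H :
  (forall k, c2 U (F k) (G k) (H k)) ->
  c2 U (fun z => \sum_k F k z) (fun i z => \sum_k G k i z)
    (fun i z => \sum_k H k i z).
Proof.
elim: n F G H => [|n IH] F G H cF.
  by apply: c2_ext (@c2_cst U 0) _ _ _ => [z|i z|i z]; rewrite big_ord0.
apply: c2_ext (c2D (cF ord0) (IH (fun k => F (lift ord0 k)) _ _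
  (fun k => cF (lift ord0 k)))) _ _ _ => [z|i z|i z]; exact/esym/big_ord_recl.
Qed.

Lemma c2_comp1 U (A : set R) (phi phi1 phi2 : R -> R) f g h :
  (forall s, A s -> [/\ is_derive s (1 : R) phi (phi1 s), is_derive s (1 : R) phi1 (phi2 s) &
     {for s, continuous phi2}]) ->
  (forall z, U z -> A (f z)) ->
  c2 U f g h -> c2 U (phi \o f) (fun i z => phi1 (f z) * g i z)
    (fun i z => phi2 (f z) * g i z ^+ 2 + phi1 (f z) * h i z).
Proof.
move=> Hphi UA cf z Uz; have [d1 d2 cphi2] := Hphi _ (UA _ Uz).
have c1 : {for f z, continuous phi1}.
  apply: differentiable_continuous; apply/derivable1_diffP; exact: ex_derive.
have c0 : {for f z, continuous phi}.
  apply: differentiable_continuous; apply/derivable1_diffP; exact: ex_derive.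
have [fz H] := cf _ Uz.
split; first exact: continuous_comp.
have dcomp (psi : R -> R) (psi1 : R) (i : 'I_d) : is_derive (f z) (1 : R) psi psi1 ->
    is_derive z (e i) (psi \o f) (psi1 * g i z).
  move=> dpsi; have [a _ _ _] := H i; apply/is_derive_line0P.
  move: a => /is_derive_line0P a.
  apply: (@is_derive1_comp _ psi (fun t => f (z + t *: e i))) => //.
  by rewrite scale0r addr0.
have k1 : {for z, continuous (phi1 \o f)} by apply: continuous_comp.
have k2 : {for z, continuous (phi2 \o f)} by apply: continuous_comp.
move=> i; have [a b p q] := H i; split.
- exact: dcomp.
- have := dcomp phi1 _ i d2 => D.
  have := @is_deriveM _ _ (phi1 \o f) (g i) z (e i) _ _ D b.
  move=> D2; apply: is_derive_eq; rewrite /= -![_ *: _]/(_ * _); ring.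
- exact: (@cvgM _ _ _ _ _ _ _ _ k1 p).
- apply: (@cvgD _ _ _ _ _ _ _ _ _ _ (@cvgM _ _ _ _ _ _ _ _ k1 q)).
  apply: (@cvgM _ _ _ _ _ _ _ _ k2).
  exact: (@cvgM _ _ _ _ _ _ _ _ p p).
Qed.

(** Covers both changes of variable used later: translations, where all signs are 1, and the
    reflection in a coordinate hyperplane, where one sign is -1. The square of the sign disappears
    from the second derivatives, so harmonicity is kept. *)
Lemma c2_precomp U (phi : 'rV[R]_d -> 'rV[R]_d) (s : 'I_d -> R) f g h :
  continuous phi -> (forall i, s i = 1 \/ s i = -1) ->
  (forall z i t, phi (z + t *: e i) = phi z + (s i * t) *: e i) ->
  c2 U f g h ->
  c2 (phi @^-1` U) (f \o phi) (fun i z => s i * g i (phi z)) (fun i => h i \o phi).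
Proof.
move=> cphi s1 phiE cf z Uz; have [fz H] := cf _ Uz.
split; first by apply: continuous_comp => //; exact: cphi.
have dcomp k k1 (i : 'I_d) : is_derive (phi z) (e i) k k1 ->
    is_derive z (e i) (k \o phi) (s i * k1).
  move=> /is_derive_line0P dk; apply/is_derive_line0P.
  have -> : (fun t : R => (k \o phi) (z + t *: e i)) =
     (fun t => k (phi z + t *: e i)) \o (fun t => s i * t).
    by apply/funext => t /=; rewrite phiE.
  rewrite mulrC; apply: is_derive1_comp; first by rewrite mulr0.
  by apply: is_derive_eq; rewrite -![_ *: _]/(_ * _); ring.
move=> i; have [a b p q] := H i; split.
- exact: dcomp.
- have D := dcomp _ _ i b.
  have := @is_deriveZ _ _ _ (g i \o phi) (s i) z (e i) _ D => D2.
  apply: (is_derive_eq D2); rewrite -![_ *: _]/(_ * _) mulrA.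
  by case: (s1 i) => ->; rewrite ?mulrNN !mul1r.
- have pp : {for z, continuous (g i \o phi)} by apply: continuous_comp => //; exact: cphi.
  exact: (@cvgM _ _ _ _ (fun=> s i) _ _ _ (cvg_cst _) pp).
- by apply: continuous_comp => //; exact: cphi.
Qed.

Lemma c2_continuous_within U K f g h : K `<=` U -> c2 U f g h ->
  {within K, continuous f}.
Proof.
move=> KU cf; apply: continuous_in_subspaceT => x; rewrite inE => /KU/cf[].
by [].
Qed.

Lemma c2_sqdist U (a : 'rV[R]_d) : c2 U (fun z => dotp (z - a) (z - a))
  (fun i z => 2 * (z - a) 0 i) (fun _ _ => 2).
Proof.
have cA k : c2 U (fun z => (z - a) 0 k) (fun j _ => (j == k)%:R) (fun _ _ => 0).
  apply: c2_ext (c2D (@c2_coord U k) (@c2_cst U (- a 0 k))) _ _ _ => [z|i z|i z].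
  - by rewrite !mxE.
  - by rewrite addr0.
  - by rewrite addr0.
apply: c2_ext (c2_sum (fun k => c2M (cA k) (cA k))) _ _ _ => [z|i z|i z] //.
- rewrite (bigD1 i)//= big1 ?addr0.
    by rewrite eqxx mulr1n mul1r mulr1 mulr_natl mulr2n.
  by move=> k /negbTE; rewrite eq_sym => ->; rewrite mul0r mulr0 addr0.
- rewrite (bigD1 i)//= big1 ?addr0.
    by rewrite eqxx mulr1n mul0r mulr0 add0r addr0 !mulr1.
  by move=> k /negbTE; rewrite eq_sym => ->; rewrite /= !(mul0r, mulr0, mulr0n, addr0).
Qed.

(** Adding [eps] times the squared norm makes the Laplacian strictly positive at the points of [K]
    off [B], which are interior to [K]; the maximum over the compact set [K] therefore lies in [B].
    Boundedness of [K] then lets [eps] tend to 0. *)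
Lemma max_principle U K (B : set 'rV[R]_d) f g h : compact K -> K `<=` U ->
  c2 U f g h -> (forall x, K x -> ~ B x -> nbhs x K) ->
  (forall x, K x -> ~ B x -> 0 <= \sum_i h i x) ->
  (forall x, K x -> B x -> f x <= 0) -> (0 < d)%N -> forall x, K x -> f x <= 0.
Proof.
move=> cK KU cf KB hge0 fB d0 x0 Kx0.
have cp : c2 U (fun z => dotp (z - 0) (z - 0)) _ _ := @c2_sqdist U 0.
have [C CP] : exists C, forall x, K x -> dotp x x <= C.
  have [c _ cmax] := @EVT_max_rV _ _ (fun z => dotp (z - 0) (z - 0)) K
    (ex_intro _ _ Kx0) cK (c2_continuous_within KU cp).
  by exists (dotp (c - 0) (c - 0)) => x Kx; have := cmax x (mem_set Kx); rewrite !subr0.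
have C0 : 0 <= C by rewrite (le_trans (dotp_ge0 x0))// CP.
suff H eps : 0 < eps -> f x0 <= eps * C.
  apply/ler_addgt0Pr => eps eps0; rewrite add0r.
  have C1 : 0 < C + 1 by rewrite ltr_wpDl.
  apply: (le_trans (H (eps / (C + 1)) _)); first by rewrite divr_gt0.
  by rewrite -mulrA ler_piMr ?(ltW eps0)// mulrC ler_pdivrMr ?mul1r ?lerDl.
move=> eps0.
have cF := c2D cf (c2Z eps cp).
have [xm Kxm xmax] := EVT_max_rV (ex_intro _ _ Kx0) cK (c2_continuous_within KU cF).
rewrite inE in Kxm; have := xmax _ (mem_set Kx0); rewrite /= !subr0 => Fx0.
have {}Fx0 : f x0 <= f xm + eps * dotp xm xm.
  by apply: (le_trans _ Fx0); rewrite lerDl mulr_ge0 ?dotp_ge0// ltW.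
have [Bxm|nBxm] := pselect (B xm).
  apply: (le_trans Fx0); rewrite -[leRHS]add0r lerD ?fB// ler_pM2l// CP//.
exfalso; have Kn := KB _ Kxm nBxm.
have [_ H] := cF _ (KU _ Kxm).
have neg i : h i xm + eps * 2 <= 0.
  have [a b _ _] := H i.
  apply: (@second_derivative_max _
      (fun t => f (xm + t *: e i) + eps * dotp (xm + t *: e i - 0) (xm + t *: e i - 0))
      (fun t => g i (xm + t *: e i) + eps * (2 * (xm + t *: e i - 0) 0 i))).
  - near=> t.
    have Kt : K (xm + t *: e i) by near: t; exact: near_line.
    have [_ /(_ i)[a' _ _ _]] := cF _ (KU _ Kt).
    exact/is_derive_lineP.
  - exact/is_derive_line0P.
  - near=> t.
    have Kt : K (xm + t *: e i) by near: t; exact: near_line.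
    by rewrite !scale0r !addr0; apply: xmax; rewrite inE.
have : \sum_i (h i xm + eps * 2) <= 0 by rewrite sumr_le0.
rewrite big_split/= sumr_const card_ord leNgt => /negP; apply.
by rewrite ltr_wpDl ?hge0// pmulrn_lgt0// mulr_gt0.
Unshelve. all: by end_near. Qed.

End c2.

(** * Gradient estimate *)

Section cubes.
Context {R : realType} {d : nat}.
Implicit Types (x y z : 'rV[R]_d) (f : 'rV[R]_d -> R) (g h : 'I_d -> 'rV[R]_d -> R).
Local Notation e := (basis_vec R d).

Lemma closed_preimage_le f (c : R) : continuous f -> closed [set x | f x <= c].
Proof. by move=> /continuous_closedP /(_ _ (@closed_le _ c)). Qed.

Lemma closed_preimage_ge f (c : R) : continuous f -> closed [set x | c <= f x].
Proof. by move=> /continuous_closedP /(_ _ (@closed_ge _ c)). Qed.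

Lemma continuous_norm_sub z : continuous (fun x => `|x - z|).
Proof.
move=> x.
have H : (fun y : 'rV[R]_d => y - z) @ x --> x - z.
  exact: (@cvgB _ _ _ (nbhs x) _ id (cst z) x z cvg_id (cvg_cst _)).
exact: (cvg_norm H).
Qed.

Lemma bounded_set_cube z r : bounded_set [set x | `|x - z| <= r].
Proof.
exists (r + `|z|); split; first by rewrite num_real.
move=> M rM x /= xr; apply: le_trans (ltW rM).
by rewrite -[x](subrK z) (le_trans (ler_normD _ _))// lerD2r.
Qed.

Lemma compact_sub_cube z r (K : set 'rV[R]_d) : closed K ->
  (forall x, K x -> `|x - z| <= r) -> compact K.
Proof.
move=> cK Kr; apply: bounded_closed_compact => //.
have [M [Mr H]] := bounded_set_cube z r.
by exists M; split=> // M' MM' x Kx; exact: H (Kr _ Kx).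
Qed.

(** The coordinates are changed one at a time. All points on the way stay in the sup-norm ball
    around [z], and the mean value theorem on each edge involves one partial derivative only. *)
Lemma coord_path_lipschitz z (rho G : R) f g :
  (forall x, `|x - z| <= rho -> forall i, is_derive x (e i) f (g i x)) ->
  (forall x, `|x - z| <= rho -> forall i, `|g i x| <= G) ->
  forall y, `|y - z| <= rho -> `|f y - f z| <= d%:R * G * `|y - z|.
Proof.
move=> fg gG y yrho.
have step x i (a : R) : (forall t : R, 0 <= t <= 1 -> `|x + (t * a) *: e i - z| <= rho) ->
    `|f (x + a *: e i) - f x| <= G * `|a|.
  move=> Hx.
  have [t t01] : exists2 t : R, t \in `[0, 1]%R &
      f (x + (1 * a) *: e i) - f (x + (0 * a) *: e i) =
      (g i (x + (t * a) *: e i) * a) * (1 - 0).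
    have D (t : R) : 0 <= t <= 1 -> is_derive t (1 : R) (fun t : R => f (x + (t * a) *: e i))
        (g i (x + (t * a) *: e i) * a).
      move=> t01; have /is_derive_lineP := fg _ (Hx _ t01) i.
      move=> D1; apply: (@is_derive1_comp _ (fun t => f (x + t *: e i)) (fun t => t * a)).
      by apply: is_derive_eq; rewrite -![_ *: _]/(_ * _); ring.
    apply: (@MVT_segment _ (fun t => f (x + (t * a) *: e i))) => //.
      by move=> t; rewrite in_itv/= => /andP[t0 t1]; apply: D; rewrite !ltW.
    apply: derivable_within_continuous => t; rewrite in_itv/= => t01.
    by have [] := D _ t01.
  rewrite mul1r mul0r scale0r addr0 subr0 mulr1 => ->.
  by rewrite normrM ler_wpM2r// gG// Hx// -in_itv.
pose w (k : nat) : 'rV[R]_d := \row_i (if (i < k)%N then y 0 i else z 0 i).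
have wS k (kd : (k < d)%N) : w k.+1 = w k + (y 0 (Ordinal kd) - z 0 (Ordinal kd)) *: e (Ordinal kd).
  apply/rowP => i; rewrite !mxE/= ltnS leq_eqVlt.
  have [ik|ik] := eqVneq (val i) k.
    have -> : Ordinal kd = i by apply/val_inj.
    by rewrite /= eqxx -ik ltnn /= mulr1 addrC subrK.
  have /negbTE -> : i != Ordinal kd by apply: contra_neq ik => ->.
  by rewrite /= mulr0 addr0.
have G0 : (0 < d)%N -> 0 <= G.
  move=> d0; rewrite (le_trans _ (gG z _ (Ordinal d0)))// subrr normr0.
  by rewrite (le_trans _ yrho).
have main k : (k <= d)%N -> `|f (w k) - f z| <= k%:R * (G * `|y - z|).
  elim: k => [_|k IH kd].
    rewrite (_ : w 0%N = z); last by apply/rowP => i; rewrite !mxE.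
    by rewrite subrr normr0 mul0r.
  rewrite -(subrK (f (w k)) (f (w k.+1))) -addrA (le_trans (ler_normD _ _))//.
  rewrite (_ : k.+1%:R * (G * `|y - z|) = G * `|y - z| + k%:R * (G * `|y - z|)); last first.
    by rewrite -add1n natrD mulrDl mul1r.
  rewrite lerD ?IH ?(ltnW kd)//.
  rewrite wS (le_trans (step _ _ _ _))//; last first.
    rewrite ler_wpM2l ?G0 ?(leq_ltn_trans _ kd)//.
    by have := coord_le_norm (y - z) (Ordinal kd); rewrite !mxE.
  move=> t /andP[t0 t1]; apply: norm_le_coord => [|i]; first by rewrite (le_trans _ yrho).
  rewrite !mxE/=; apply: le_trans yrho; apply: le_trans (coord_le_norm _ i).
  rewrite !mxE; have [->|_] := eqVneq i (Ordinal kd).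
    rewrite /= ltnn mulr1 addrAC subrr add0r normrM ger0_norm//.
    by rewrite ler_piMl.
  by rewrite mulr0 addr0; case: ifP => // _; rewrite subrr normr0.
have := main d (leqnn d).
rewrite (_ : w d = y) ?mulrA//; apply/rowP => i; rewrite mxE ltn_ord//.
Qed.

End cubes.

Section gradient_estimate.
Context {R : realType} {d : nat}.
Implicit Types (x y z : 'rV[R]_d) (f : 'rV[R]_d -> R) (g h : 'I_d -> 'rV[R]_d -> R).
Local Notation e := (basis_vec R d).

(** The odd part of [f] under the reflection in the hyperplane [x j = z j] is
    compared with a quadratic barrier on half of the cube. *)
Lemma gradient_bound_cube U z (r M : R) f g h : 0 < r ->
  (forall x, `|x - z| <= r -> U x) -> c2 U f g h ->
  (forall x, `|x - z| <= r -> \sum_i h i x = 0) ->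
  (forall x, `|x - z| <= r -> `|f x| <= M) ->
  forall j, `|g j z| <= d%:R * M / r.
Proof.
move=> r0 QU cf hf fM j.
have d0 : (0 < d)%N by rewrite (leq_ltn_trans _ (ltn_ord j)).
have d1 : (1 : R) <= d%:R by rewrite ler1n.
have M0 : 0 <= M by rewrite (le_trans _ (fM z _))// subrr normr0 ltW.
suff main (s : R) : s = 1 \/ s = -1 -> s * g j z <= d%:R * M / r.
  by rewrite ler_norml lerNl -[- g j z]mulN1r -[X in _ && (X <= _)]mul1r !main//;
    [left|right].
move=> s1.
pose refl x := x - (2 * (x 0 j - z 0 j)) *: e j.
pose sg (i : 'I_d) : R := if i == j then -1 else 1.
have reflE x i : refl x 0 i - z 0 i = sg i * (x 0 i - z 0 i).
  rewrite !mxE /sg; have [->|ij] := eqVneq i j; first by rewrite eqxx/=; ring.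
  by rewrite /= mulr0 subr0 mul1r.
have sgE i : sg i = 1 \/ sg i = -1 by rewrite /sg; case: ifP => _; [right|left].
have normsg i : `|sg i| = 1 by case: (sgE i) => ->; rewrite ?normrN normr1.
have reflle x : `|x - z| <= r -> `|refl x - z| <= r.
  move=> xr; apply: norm_le_coord; rewrite ?ltW// => i.
  have := reflE x i; rewrite [in X in X -> _]mxE => _.
  rewrite mxE [X in _ + X]mxE reflE normrM normsg mul1r (le_trans _ xr)//.
  by have := coord_le_norm (x - z) i; rewrite mxE [X in _ + X]mxE.
have crefl : continuous refl.
  move=> x.
  have H1 : (fun x : 'rV[R]_d => x 0 j - z 0 j) @ x --> x 0 j - z 0 j.
    exact: (@cvgB _ _ _ (nbhs x) _ _ (cst (z 0 j)) _ _ (@coord_continuous _ _ _ 0 j x) (cvg_cst _)).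
  have H2 : (fun x : 'rV[R]_d => 2 * (x 0 j - z 0 j)) @ x --> 2 * (x 0 j - z 0 j).
    exact: (@cvgM _ _ (nbhs x) _ (cst 2) _ _ _ (cvg_cst _) H1).
  exact: (@cvgB _ _ _ (nbhs x) _ id _ _ _ cvg_id (@cvgZ _ _ _ (nbhs x) _ _ (cst (e j)) _ _ H2 (cvg_cst _))).
have reflD x i t : refl (x + t *: e i) = refl x + (sg i * t) *: e i.
  apply/rowP => k; rewrite !mxE /sg eqxx/=.
  have [->|ij] := eqVneq i j.
    by case: (k == j) => /=; ring.
  by rewrite /= mulr0 addr0 mul1r addrAC.
pose V := U `&` (refl @^-1` U).
have QV x : `|x - z| <= r -> V x by move=> xr; split; apply: QU => //; exact: reflle.
pose A := M / r ^+ 2.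
have A0 : 0 <= A by rewrite divr_ge0 ?sqr_ge0.
have cy : c2 V (fun x => x 0 j - z 0 j) (fun i _ => (i == j)%:R) (fun _ _ => 0).
  by apply: c2_ext (c2D (@c2_coord _ _ V j) (@c2_cst _ _ V (- z 0 j))) _ _ _ => *;
    rewrite ?addr0.
(* With [y] the distance to the mirror, the barrier is the squared distance to [z] plus
   [d * y * (r - y)]. Its Laplacian is [2 * d - 2 * d = 0]; it is nonnegative on the mirror and at
   least [r ^+ 2] on the outer faces, so [A] times it dominates [M] there. *)
have cphi : c2 V
    (fun x => dotp (x - z) (x - z) + (d%:R * r * (x 0 j - z 0 j) +
              - d%:R * ((x 0 j - z 0 j) * (x 0 j - z 0 j)))) _ _ :=
  c2D (@c2_sqdist _ _ V z) (c2D (c2Z (d%:R * r) cy) (c2Z (- d%:R) (c2M cy cy))).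
have cf1 : c2 V f g h by apply: c2S cf => x [].
have cf2 : c2 V (f \o refl) _ _ :=
  c2S (@subIsetr _ _ _) (c2_precomp crefl sgE reflD cf).
have cF := c2D (c2D (c2Z (s / 2) cf1) (c2Z (- (s / 2)) cf2)) (c2Z (- A) cphi).
pose K : set 'rV[R]_d := [set x | `|x - z| <= r] `&` [set x | z 0 j <= x 0 j].
pose B : set 'rV[R]_d := [set x | x 0 j = z 0 j \/ exists i, `|x 0 i - z 0 i| = r].
have cK : compact K.
  apply: (@compact_sub_cube _ _ z r) => [|x []//].
  apply: closedI; first by apply: closed_preimage_le; exact: continuous_norm_sub.
  by apply: closed_preimage_ge; exact: coord_continuous.
have KV : K `<=` V by move=> x [/QV].
have Fle0 : forall x, K x -> s / 2 * f x + - (s / 2) * f (refl x) +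
   - A * (dotp (x - z) (x - z) + (d%:R * r * (x 0 j - z 0 j) +
              - d%:R * ((x 0 j - z 0 j) * (x 0 j - z 0 j)))) <= 0.
  apply: (max_principle (B := B) cK KV cF _ _ _ d0) => x Kx.
  - move=> nB; case: Kx => xr zx.
    have xr' : `|x - z| < r.
      apply: norm_lt_coord => // i; rewrite lt_neqAle; apply/andP; split.
        by apply/eqP => E; apply: nB; right; exists i; rewrite -E !mxE.
      exact: le_trans (coord_le_norm _ i) xr.
    have zx' : z 0 j < x 0 j.
      by rewrite lt_neqAle zx andbT; apply/eqP => E; apply: nB; left.
    near=> y; split => /=; apply: ltW; near: y.
      by apply: cvgr_lt xr'; exact: continuous_norm_sub.
    by apply: cvgr_gt zx'; exact: coord_continuous.
  - move=> _; case: Kx => xr zx; rewrite !big_split/= -!mulr_sumr hf// hf; last exact: reflle.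
    rewrite (_ : \sum_(i < d) _ = 0) ?mulr0 ?addr0//.
    rewrite (eq_bigr (fun i => 2 + - (d%:R * 2) * (i == j)%:R)); last first.
      by move=> i _; case: (i == j) => /=; ring.
    rewrite big_split/= sumr_const card_ord (bigD1 j)//= big1 ?addr0; last first.
      by move=> i /negbTE ->; rewrite mulr0.
    by rewrite (_ : (j == j)%:R = 1 :> R) ?eqxx// mulr1 -[2 *+ d]mulr_natl; ring.
  - case: Kx => xr zx Bx.
    have yr : x 0 j - z 0 j <= r.
      rewrite (le_trans _ xr)// (le_trans _ (coord_le_norm _ j))// !mxE.
      exact: ler_norm.
    have y0 : 0 <= x 0 j - z 0 j by rewrite subr_ge0.
    have p0 := dotp_ge0 (x - z).
    have E : d%:R * r * (x 0 j - z 0 j) + - d%:R * ((x 0 j - z 0 j) * (x 0 j - z 0 j)) =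
      d%:R * ((x 0 j - z 0 j) * (r - (x 0 j - z 0 j))) by ring.
    have E0 : 0 <= d%:R * ((x 0 j - z 0 j) * (r - (x 0 j - z 0 j))).
      by rewrite !mulr_ge0// subr_ge0.
    rewrite E /=; case: Bx => [xz|[i xi]].
      have -> : refl x = x by rewrite /refl xz subrr mulr0 scale0r subr0.
      rewrite mulNr subrr add0r mulNr oppr_le0 mulr_ge0// addr_ge0//.
    have pr : r ^+ 2 <= dotp (x - z) (x - z).
      by rewrite -xi real_normK ?num_real// (le_trans _ (sqr_coord_le_dotp _ i))// !mxE.
    have MA : M <= A * (dotp (x - z) (x - z) + d%:R * ((x 0 j - z 0 j) * (r - (x 0 j - z 0 j)))).
      rewrite -[leLHS](@divfK _ (r ^+ 2)) ?expf_neq0 ?gt_eqF// ler_wpM2l//.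
      by rewrite (le_trans pr)// lerDl.
    have N : s / 2 * f x + - (s / 2) * f (refl x) <= M.
      have /ler_normlP[? ?] := fM _ xr; have /ler_normlP[? ?] := fM _ (reflle _ xr).
      by case: s1 => ->; lra.
    by rewrite [- A * _]mulNr subr_le0 (le_trans N).
(* On the axis through [z] the barrier equals [d * r * t - (d - 1) * t ^+ 2], so the odd part of [f]
   lies below the line of slope [d * M / r]; comparing derivatives at 0 gives the claim. *)
pose psi t := s / 2 * (f (z + t *: e j) - f (z + (- t) *: e j)) - d%:R * M / r * t.
have dfz : is_derive z (e j) f (g j z).
  by have [|_ /(_ j)[]] := cf z; first by apply: QU; rewrite subrr normr0 ltW.
have dpsi : is_derive (0 : R) (1 : R) psi (s * g j z - d%:R * M / r).
  have /is_derive_line0P D1 := dfz.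
  have D2 : is_derive (0 : R) (1 : R) (fun t => f (z + (- t) *: e j)) (g j z * -1).
    apply: (@is_derive1_comp _ (fun t => f (z + t *: e j)) (fun t => - t)).
    by rewrite oppr0.
  apply: is_derive_eq; rewrite -![_ *: _]/(_ * _).
  by field; rewrite gt_eqF.
rewrite -subr_le0; apply: (derive_le0_right dpsi _ r0).
  by rewrite /psi oppr0 subrr !mulr0 subrr.
move=> t /andP[t0 tr].
have Kt : K (z + t *: e j).
  split => /=; first by rewrite addrC addKr normrZ norm_basis_vec mulr1 gtr0_norm// ltW.
  by rewrite !mxE !eqxx/= mulr1 lerDl ltW.
have := Fle0 _ Kt.
have -> : refl (z + t *: e j) = z + (- t) *: e j.
  by rewrite reflD /sg eqxx mulN1r /refl subrr mulr0 scale0r subr0.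
have -> : z + t *: e j - z = t *: e j by rewrite addrC addKr.
have -> : (z + t *: e j) 0 j - z 0 j = t by rewrite !mxE !eqxx/= mulr1 addrC addKr.
have -> : dotp (t *: e j) (t *: e j) = t * t.
  rewrite /dotp (bigD1 j)//= big1 ?addr0; first by rewrite !mxE !eqxx/= mulr1.
  by move=> i /negbTE ij; rewrite !mxE eqxx ij/= !mulr0.
rewrite /psi; move=> H.
have E : d%:R * M / r * t = A * (d%:R * r * t) by rewrite /A; field; rewrite gt_eqF.
have E2 : 0 <= A * ((d%:R - 1) * (t * t)).
  by rewrite mulr_ge0// mulr_ge0 ?subr_ge0// mulr_ge0// ltW.
rewrite E; move: H E2; lra.
Unshelve. all: by end_near. Qed.

End gradient_estimate.

(** * Harnack inequality *)

Section harnack.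
Context {R : realType} {d : nat}.
Implicit Types (x y z : 'rV[R]_d) (f : 'rV[R]_d -> R) (g h : 'I_d -> 'rV[R]_d -> R).
Local Notation e := (basis_vec R d).

Lemma c2_powR (U : set 'rV[R]_d) (a : R) f g h : (forall z, U z -> 0 < f z) ->
  c2 U f g h ->
  c2 U (fun z => f z `^ a) (fun i z => a * f z `^ (a - 1) * g i z)
    (fun i z => a * ((a - 1) * f z `^ (a - 1 - 1)) * g i z ^+ 2 + a * f z `^ (a - 1) * h i z).
Proof.
move=> f0 cf.
apply: (@c2_comp1 _ _ U [set s | 0 < s] (fun s => s `^ a) (fun s => a * s `^ (a - 1))
   (fun s => a * ((a - 1) * s `^ (a - 1 - 1)))) => // s /= s0.
have D b : is_derive s 1 (fun s => s `^ b) (b * s `^ (b - 1)) := is_derive1_powR b s0.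
split; first exact: D.
- by have := @is_deriveZ _ _ _ _ a _ _ _ (D (a - 1)).
- have c1 : {for s, continuous (fun s => s `^ (a - 1 - 1))}.
    apply: differentiable_continuous; apply/derivable1_diffP.
    by have [] := D (a - 1 - 1).
  apply: (@cvgM _ _ (nbhs s) _ (cst a) _ _ _ (cvg_cst _)).
  exact: (@cvgM _ _ (nbhs s) _ (cst (a - 1)) _ _ _ (cvg_cst _) c1).
Qed.

Lemma sumsq_coord x : \sum_i (x 0 i) ^+ 2 = dotp x x.
Proof. by apply: eq_bigr => i _; rewrite expr2. Qed.

Lemma continuous_sqdist z : continuous (fun x => dotp (x - z) (x - z)).
Proof. by move=> x; have [] := @c2_sqdist _ _ setT z x I. Qed.

(** Comparison with the subharmonic function [|x - y|^(-2d)] on an annulus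
    spreads a lower bound from a small ball to the centre. *)
Lemma annulus_lower_bound U y z (sigma rho A : R) f g h : (0 < d)%N ->
  0 < sigma -> sigma <= rho -> 0 < A ->
  (forall x, enorm (x - y) <= rho -> U x) -> c2 U f g h ->
  (forall x, U x -> \sum_i h i x = 0) -> (forall x, U x -> 0 < f x) ->
  (forall x, enorm (x - y) <= sigma -> A <= f x) ->
  enorm (z - y) <= rho / 2 -> A * (sigma / rho) ^+ (2 * d) <= f z.
Proof.
move=> d0 s0 sr A0 QU cf hf f0 fA zy.
have r0 : 0 < rho := lt_le_trans s0 sr.
have sr1 : (sigma / rho) ^+ (2 * d) <= 1.
  by apply: exprn_ile1; [rewrite divr_ge0 ?ltW|rewrite ler_pdivrMr// mul1r].
have [zs|zs] := leP (enorm (z - y)) sigma.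
  by rewrite (le_trans _ (fA _ zs))// ler_piMr// ltW.
pose q x := dotp (x - y) (x - y).
have qE x : q x = enorm (x - y) ^+ 2 by rewrite sqr_enorm.
have lesq (a b : R) : 0 <= a -> 0 <= b -> (a ^+ 2 <= b ^+ 2) = (a <= b).
  by move=> a0 b0; rewrite ler_sqr.
pose K : set 'rV[R]_d := [set x | sigma ^+ 2 <= q x] `&` [set x | q x <= rho ^+ 2].
pose B : set 'rV[R]_d := [set x | q x = sigma ^+ 2 \/ q x = rho ^+ 2].
pose V : set 'rV[R]_d := U `&` [set x | 0 < q x].
(* A power of the squared distance, hence the exponent [- 2 * d] of the distance. It is below the
   Newtonian exponent, and the Laplacian is a positive multiple of [2 * d * (d + 2)] in every
   dimension. *)
pose m : R := - d%:R.
have cK : compact K.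
  apply: (@compact_sub_cube _ _ y rho) => [|x [_ /=]].
    by apply: closedI; [apply: closed_preimage_ge|apply: closed_preimage_le];
      exact: continuous_sqdist.
  rewrite qE lesq ?enorm_ge0 ?(ltW r0)//; exact: le_trans (norm_le_enorm _).
have KV : K `<=` V.
  move=> x [/= qs qr]; split; last by rewrite /= (lt_le_trans _ qs)// exprn_gt0.
  by apply: QU; move: qr; rewrite qE lesq ?enorm_ge0 ?(ltW r0).
pose A' := A * sigma ^+ (2 * d).
have A'0 : 0 < A' by rewrite mulr_gt0// exprn_gt0.
have cq : c2 V q (fun i x => 2 * (x - y) 0 i) (fun _ _ => 2) by exact: c2_sqdist.
have cp := @c2_powR V m q _ _ (fun z Vz => Vz.2) cq.
have cF := c2D (c2D (c2Z A' cp) (@c2_cst _ _ V (- (A' * (rho ^+ 2) `^ m)))) (c2Z (-1) (c2S (@subIsetl _ _ _) cf)).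
have powE (t : R) : 0 < t -> (t ^+ 2) `^ m = (t ^+ (2 * d))^-1.
  by move=> t0; rewrite powR_invn ?sqr_ge0// exprM.
have F0 : forall x, K x -> A' * q x `^ m + - (A' * (rho ^+ 2) `^ m) + -1 * f x <= 0.
  apply: (max_principle (B := B) cK KV cF _ _ _ d0) => x Kx.
  - move=> nB; case: (Kx) => /= qs qr.
    have qs' : sigma ^+ 2 < q x.
      by rewrite lt_neqAle qs andbT; apply/eqP => E; apply: nB; left.
    have qr' : q x < rho ^+ 2.
      by rewrite lt_neqAle qr andbT; apply/eqP => E; apply: nB; right.
    near=> w; split => /=; apply: ltW; near: w.
      by apply: cvgr_gt qs'; exact: continuous_sqdist.
    by apply: cvgr_lt qr'; exact: continuous_sqdist.
  - move=> _; have [Ux /= qx] := KV _ Kx.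
    under eq_bigr do rewrite addr0.
    rewrite big_split/= -mulr_sumr -[X in _ + X]mulr_sumr hf// mulr0 addr0.
    rewrite mulr_ge0 ?(ltW A'0)// big_split/= -mulr_sumr.
    rewrite (eq_bigr (fun i => 2 ^+ 2 * ((x - y) 0 i) ^+ 2)); last by move=> i _; rewrite exprMn.
    rewrite -mulr_sumr sumsq_coord -/(q x) sumr_const card_ord.
    have -> : q x `^ (m - 1) = q x `^ (m - 1 - 1) * q x.
      by rewrite -[X in _ * X]powRr1 ?(ltW qx)// -powRD ?subrK// (gt_eqF qx) implybT.
    have p0 := powR_ge0 (q x) (m - 1 - 1).
    rewrite -[_ *+ d]mulr_natl.
    have -> : m * ((m - 1) * q x `^ (m - 1 - 1)) * (2 ^+ 2 * q x) +
      d%:R * (m * (q x `^ (m - 1 - 1) * q x) * 2) =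
      q x `^ (m - 1 - 1) * q x * (2 * d%:R * (d%:R + 2)) by rewrite /m; ring.
    by apply: mulr_ge0; [exact: mulr_ge0 p0 (ltW qx)|rewrite !mulr_ge0// addr_ge0].
  - have [Ux qx] := KV _ Kx; move=> [] E; rewrite /= E mulN1r subr_le0.
      rewrite powE// mulfK; last by rewrite gt_eqF// exprn_gt0.
      have : A <= f x by apply: fA; rewrite -lesq ?enorm_ge0 ?(ltW s0)// -qE E.
      by apply: le_trans; rewrite gerBl mulr_ge0 ?powR_ge0 ?(ltW A'0).
    by rewrite subrr ltW// f0.
have Kz : K z.
  split; rewrite /= qE lesq ?enorm_ge0 ?(ltW s0) ?(ltW r0) ?(ltW zs)//.
  by rewrite (le_trans zy)// ler_pdivrMr// ler_peMr ?(ltW r0)// ler1n.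
have := F0 _ Kz; rewrite mulN1r subr_le0; apply: le_trans.
have -> : A * (sigma / rho) ^+ (2 * d) = A' * (rho ^+ 2) `^ m.
  by rewrite powE// expr_div_n mulrA.
rewrite -mulrBr ler_pM2l// lerBrDr.
(* At distance at most [rho / 2] the power is at least [4 ^ d] times its value on the outer sphere,
   so the subtracted outer value takes away at most half of it. *)
have : (rho ^+ 2 / 4) `^ m <= q z `^ m.
  rewrite /m !powRN lef_pV2 ?posrE ?powR_gt0 ?divr_gt0 ?exprn_gt0//; last first.
    by have [] := KV _ Kz.
  rewrite ge0_ler_powR ?nnegrE ?dotp_ge0 ?divr_ge0 ?sqr_ge0//.
  have -> : rho ^+ 2 / 4 = (rho / 2) ^+ 2 by field.
  by rewrite qE lesq ?enorm_ge0 ?divr_ge0// ltW.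
apply: le_trans; rewrite powRM ?sqr_ge0 ?invr_ge0// -mulr2n -[leLHS]mulr_natr.
rewrite ler_wpM2l ?powR_ge0// /m powRN powR_mulrn ?invr_ge0// exprVn invrK -natrX ler_nat.
by case: (d) d0 => // k _; rewrite expnS (leq_trans (isT : (2 <= 4 * 1)%N))// leq_mul2l expn_gt0.
Unshelve. all: by end_near. Qed.

Definition harnack_half_const : R := 2 * (8 * d%:R ^+ 3 * 4 ^+ d.+1) ^+ (2 * d).

(** The weighted function [W] is maximised over the cube of radius [a]. Around the maximum point
    [ys], up to half the remaining distance [D], the values of [f] are at most [4 ^ d] times
    [F = f ys]; the gradient estimate then gives a ball where [f] is at least [F / 2], and
    [annulus_lower_bound] carries this to [z]. The weight has the exponent [2 * d] lost in that
    step, so [D] cancels. *)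
Lemma harnack_half U z (r : R) f g h : (0 < d)%N -> 0 < r ->
  (forall x, `|x - z| <= r -> U x) -> c2 U f g h ->
  (forall x, U x -> \sum_i h i x = 0) -> (forall x, U x -> 0 < f x) ->
  forall y, `|y - z| <= r / (8 * d%:R) -> f y <= harnack_half_const * f z.
Proof.
move=> d0 r0 QU cf hf f0 y yz.
have d1 : (1 : R) <= d%:R by rewrite ler1n.
have dp : (0 : R) < d%:R by rewrite ltr0n.
pose a := r / (4 * d%:R).
have a0 : 0 < a by rewrite divr_gt0// mulr_gt0.
have ar : a * (4 * d%:R) = r by rewrite divfK// gt_eqF// mulr_gt0.
have a4 : 4 * a <= r by rewrite -ar mulrC ler_wpM2l ?(ltW a0)// ler_peMr.
have QaU x : `|x - z| <= a -> U x by move=> xa; apply: QU; lra.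
pose W x := f x * (a - `|x - z|) ^+ (2 * d).
have cQ : compact [set x | `|x - z| <= a].
  apply: (@compact_sub_cube _ _ z a) => //.
  by apply: closed_preimage_le; exact: continuous_norm_sub.
have cW : {within [set x | `|x - z| <= a], continuous W}.
  apply: continuous_in_subspaceT => x; rewrite inE => /QaU/cf[cfx _].
  apply: (@cvgM _ _ (nbhs x) _ _ _ _ _ cfx).
  have c1 : {for x, continuous (fun w : 'rV[R]_d => a - `|w - z|)}.
    exact: (@cvgB _ _ _ (nbhs x) _ (cst a) _ _ _ (cvg_cst _) (@continuous_norm_sub _ _ z x)).
  by apply: (continuous_comp c1 (@exprn_continuous _ (2 * d) _)).
have Qz : [set x | `|x - z| <= a] z by rewrite /= subrr normr0 ltW.
have [ys Qys Wmax] := EVT_max_rV (ex_intro _ z Qz) cQ cW.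
rewrite inE/= in Qys.
pose D := a - `|ys - z|.
have D0 : 0 < D.
  rewrite lt_neqAle subr_ge0 Qys andbT eq_sym; apply/eqP => DE.
  have := Wmax z (mem_set Qz).
  rewrite /W -/D DE subrr normr0 subr0 expr0n muln_eq0/= (gtn_eqF d0) mulr0 leNgt.
  by rewrite mulr_gt0 ?exprn_gt0//; apply/f0/QaU; rewrite subrr normr0 ltW.
have Da : D <= a by rewrite gerBl.
pose F := f ys.
have F0 : 0 < F by apply/f0/QaU.
pose del := D / 2.
have del0 : 0 < del by rewrite divr_gt0.
have delD : 2 * del = D by rewrite mulrC divfK.
have near_ys x : `|x - ys| <= del -> `|x - z| <= a - del.
  move=> xd; rewrite -(subrKA ys) (le_trans (ler_normD _ _))//.
  have E : `|ys - z| = a - D by rewrite /D; lra.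
  by rewrite E; move: xd delD; lra.
have DE : D ^+ (2 * d) = 4 ^+ d * del ^+ (2 * d).
  rewrite -[in LHS]delD exprMn [in X in X * _ = _]exprM; congr (_ ^+ _ * _); ring.
have sup_del x : `|x - ys| <= del -> f x <= 4 ^+ d * F.
  move=> /near_ys xd.
  have xa : `|x - z| <= a by lra.
  have := Wmax x (mem_set xa); rewrite /W -/D -/F.
  have le1 : f x * del ^+ (2 * d) <= f x * (a - `|x - z|) ^+ (2 * d).
    rewrite ler_wpM2l ?(ltW (f0 _ (QaU _ xa)))// lerXn2r ?nnegrE; lra.
  move=> /(le_trans le1); rewrite DE mulrA ler_pM2r ?exprn_gt0//.
  by rewrite mulrC.
pose G := d%:R * (4 ^+ d * F) / (del / 2).
have gradG x i : `|x - ys| <= del / 2 -> `|g i x| <= G.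
  move=> xd; apply: (gradient_bound_cube (U := U) (f := f) (h := h)) => //.
  - by rewrite divr_gt0.
  - move=> w wx; apply: QaU.
    have : `|w - ys| <= del by rewrite -(subrKA x) (le_trans (ler_normD _ _))//; lra.
    by move=> /near_ys; lra.
  - move=> w wx; apply: hf; apply: QaU.
    have : `|w - ys| <= del by rewrite -(subrKA x) (le_trans (ler_normD _ _))//; lra.
    by move=> /near_ys; lra.
  - move=> w wx.
    have wd : `|w - ys| <= del by rewrite -(subrKA x) (le_trans (ler_normD _ _))//; lra.
    rewrite gtr0_norm ?sup_del//; apply/f0/QaU; have := near_ys _ wd; lra.
(* With this [c] the gradient bound [G], used over the distance [c * del], lowers [f] by exactly
   [F / 2]. *)
pose c := (4 ^+ d.+1 * d%:R ^+ 2 : R)^-1.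
have c0 : 0 < c by rewrite invr_gt0 mulr_gt0// exprn_gt0.
have d21 : (1 : R) <= d%:R ^+ 2 by rewrite exprn_ege1.
have c12 : c <= 1 / 2.
  rewrite /c div1r lef_pV2 ?posrE ?mulr_gt0 ?exprn_gt0//.
  have : (4 : R) <= 4 ^+ d.+1 by rewrite exprS ler_peMr ?exprn_ege1 ?ler1n.
  nra.
pose sigma := c * del.
have sigma0 : 0 < sigma by rewrite mulr_gt0.
have lowF x : `|x - ys| <= sigma -> F / 2 <= f x.
  move=> xs.
  have sdel : sigma <= del / 2 by rewrite /sigma; nra.
  have fg w : `|w - ys| <= sigma -> forall i, is_derive w (e i) f (g i w).
    move=> ws i; have [] : is_derive w (e i) f (g i w) /\ True; last by [].
    have /cf[_ /(_ i)[]] : U w; last by [].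
    apply: QaU; have : `|w - ys| <= del by lra.
    by move/near_ys; lra.
  have gG w : `|w - ys| <= sigma -> forall i, `|g i w| <= G.
    by move=> ws i; apply: gradG; lra.
  have := coord_path_lipschitz fg gG xs; rewrite -/F.
  have : d%:R * G * `|x - ys| <= F / 2.
    have Fn := ltW F0; have dn := ltW del0.
    have G0 : 0 <= d%:R * G.
      by rewrite mulr_ge0// /G divr_ge0//; [rewrite mulr_ge0// mulr_ge0// exprn_ge0//|rewrite divr_ge0].
    apply: (le_trans (ler_wpM2l G0 xs)).
    rewrite /G /sigma /c.
    have -> : d%:R * (d%:R * (4 ^+ d * F) / (del / 2)) * ((4 ^+ d.+1 * d%:R ^+ 2)^-1 * del) = F / 2.
      rewrite exprS; field.
      by rewrite !gt_eqF// exprn_gt0.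
    by [].
  move=> le1 /le_trans /(_ le1); rewrite ler_norml => /andP[? _]; lra.
pose rho := 2 * d%:R * a.
have rho0 : 0 < rho by rewrite /rho mulr_gt0// mulr_gt0.
have Qrho x : enorm (x - ys) <= rho -> `|x - z| <= r.
  move=> xr; rewrite -(subrKA ys) (le_trans (ler_normD _ _))//.
  have := le_trans (norm_le_enorm _) xr; have da : a <= d%:R * a by rewrite ler_peMl// ltW.
  by move: ar; rewrite /rho; lra.
have dela : del <= a / 2 by rewrite /del; lra.
have sr : sigma <= rho.
  have da : a <= d%:R * a by rewrite ler_peMl// ltW.
  by rewrite /sigma /rho; nra.
have main : F / 2 * (sigma / rho) ^+ (2 * d) <= f z.
  apply: (annulus_lower_bound (U := U) (y := ys) d0 sigma0 sr _ _ cf) => //.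
  - by rewrite divr_gt0.
  - by move=> x /Qrho/QU.
  - by move=> x xs; apply: lowF; rewrite (le_trans (norm_le_enorm _)).
  - rewrite (le_trans (enorm_le_norm _))// /rho distrC.
    have -> : 2 * d%:R * a / 2 = d%:R * a by field.
    by rewrite ler_pM2l.
have sE : sigma / rho = D / a / (4 * d%:R ^+ 3 * 4 ^+ d.+1).
  rewrite /sigma /rho /c /del; field.
  by rewrite !gt_eqF// exprn_gt0.
have ya : `|y - z| <= a / 2.
  have -> : a / 2 = r / (8 * d%:R) by rewrite /a; field; rewrite gt_eqF.
  exact: yz.
have ya' : `|y - z| <= a by lra.
have := Wmax y (mem_set ya'); rewrite /W -/D -/F.
have le1 : f y * (a / 2) ^+ (2 * d) <= f y * (a - `|y - z|) ^+ (2 * d).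
  rewrite ler_wpM2l ?(ltW (f0 _ (QaU _ ya')))// lerXn2r ?nnegrE; lra.
move=> /(le_trans le1) {le1} H.
pose b := 4 * d%:R ^+ 3 * 4 ^+ d.+1 : R.
have b0 : 0 < b by rewrite !mulr_gt0// exprn_gt0.
move: main; rewrite sE -/b expr_div_n (expr_div_n D) => main.
have E1 : F * D ^+ (2 * d) <= 2 * b ^+ (2 * d) * a ^+ (2 * d) * f z.
  have bp : 0 < 2 * b ^+ (2 * d) * a ^+ (2 * d) by rewrite !mulr_gt0// exprn_gt0.
  apply: le_trans (ler_wpM2l (ltW bp) main).
  apply/eqP; rewrite eq_le.
  have -> : 2 * b ^+ (2 * d) * a ^+ (2 * d) * (F / 2 * (D ^+ (2 * d) / a ^+ (2 * d) / b ^+ (2 * d))) = F * D ^+ (2 * d).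
    by field; rewrite !gt_eqF// exprn_gt0.
  by rewrite lexx.
move: (le_trans H E1); rewrite expr_div_n => H2.
have p2 : (0 : R) < 2 ^+ (2 * d) by rewrite exprn_gt0.
have pa : 0 < a ^+ (2 * d) by rewrite exprn_gt0.
have -> : harnack_half_const = 2 * b ^+ (2 * d) * 2 ^+ (2 * d).
  rewrite /harnack_half_const -[RHS]mulrA -[in RHS]exprMn /b; congr (_ * _ ^+ _); ring.
have : f y * (a ^+ (2 * d) / 2 ^+ (2 * d)) * (2 ^+ (2 * d) / a ^+ (2 * d)) <=
  2 * b ^+ (2 * d) * a ^+ (2 * d) * f z * (2 ^+ (2 * d) / a ^+ (2 * d)).
  by rewrite ler_wpM2r// divr_ge0 ?ltW.
have -> : f y * (a ^+ (2 * d) / 2 ^+ (2 * d)) * (2 ^+ (2 * d) / a ^+ (2 * d)) = f y.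
  by field; rewrite !gt_eqF.
suff -> : 2 * b ^+ (2 * d) * a ^+ (2 * d) * f z * (2 ^+ (2 * d) / a ^+ (2 * d)) =
  2 * b ^+ (2 * d) * 2 ^+ (2 * d) * f z by [].
by field; rewrite gt_eqF.
Qed.

End harnack.

Theorem harnack (R : realType) (d : nat) : (0 < d)%N -> exists2 C : R, 1 <= C &
  forall (U : set 'rV[R]_d) (z : 'rV[R]_d) (r : R) f g h, 0 < r ->
  (forall x, `|x - z| <= r -> U x) -> c2 U f g h ->
  (forall x, U x -> \sum_i h i x = 0) -> (forall x, U x -> 0 < f x) ->
  (forall y, `|y - z| <= r / C -> `|f y - f z| <= C * (`|y - z| / r) * f z) /\
  (forall i, `|g i z| <= C / r * f z).
Proof.
move=> d0; have d1 : (1 : R) <= d%:R by rewrite ler1n.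
have dp : (0 : R) < d%:R by rewrite ltr0n.
pose C1 := @harnack_half_const R d.
have C11 : 1 <= C1.
  rewrite /C1 /harnack_half_const.
  have h1 : (1 : R) <= (8 * d%:R ^+ 3 * 4 ^+ d.+1) ^+ (2 * d).
    rewrite exprn_ege1// !mulr_ege1 ?exprn_ege1// ler1n//.
  lra.
pose C := 16 * d%:R ^+ 3 * C1.
have d3 : (d%:R : R) <= d%:R ^+ 3 by rewrite -[leLHS]expr1 ler_weXn2l.
have d23 : (d%:R ^+ 2 : R) <= d%:R ^+ 3 by rewrite ler_weXn2l.
have CD : 16 * d%:R <= C by rewrite /C; nra.
exists C; first by lra.
move=> U z r f g h r0 QU cf hf f0.
have fz : 0 < f z by apply/f0/QU; rewrite subrr normr0 ltW.
pose a := r / (16 * d%:R).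
have a0 : 0 < a by rewrite divr_gt0// mulr_gt0.
have ar : a * (16 * d%:R) = r by rewrite divfK// gt_eqF// mulr_gt0.
have a2 : a * 2 = r / (8 * d%:R).
  by rewrite -ar; field; rewrite gt_eqF.
have a16 : 2 * a <= r by rewrite -ar; nra.
have gB y i : `|y - z| <= a -> `|g i y| <= 16 * d%:R ^+ 2 * C1 / r * f z.
  move=> ya.
  have -> : 16 * d%:R ^+ 2 * C1 / r * f z = d%:R * (C1 * f z) / a.
    by rewrite -ar; field; rewrite !gt_eqF.
  have wz w : `|w - y| <= a -> `|w - z| <= a * 2.
    by move=> wy; rewrite -(subrKA y) (le_trans (ler_normD _ _))//; lra.
  apply: (gradient_bound_cube (U := U) (f := f) (h := h)) => // w /wz wz2.
  - by apply: QU; lra.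
  - by apply: hf; apply: QU; lra.
  - rewrite gtr0_norm; last by apply/f0/QU; lra.
    by apply: (harnack_half d0 r0 QU cf hf f0); rewrite -a2.
split; last first.
  move=> i; have := gB z i; rewrite subrr normr0 => /(_ (ltW a0)) H.
  apply: (le_trans H); rewrite ler_pM2r// ler_pM2r ?invr_gt0// /C.
  by rewrite ler_pM2r ?(lt_le_trans ltr01)// ler_pM2l.
move=> y yz.
have ya : `|y - z| <= a.
  rewrite (le_trans yz)// /a ler_pM2l// lef_pV2 ?posrE//; nra.
have fg w : `|w - z| <= a -> forall i, is_derive w (basis_vec R d i) f (g i w).
  move=> wa i; have /cf[_ /(_ i)[]] : U w by apply: QU; lra.
  by [].
have := coord_path_lipschitz fg (fun w wa i => gB w i wa) ya.
move=> /le_trans; apply; apply/eqP; rewrite eq_le.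
have -> : d%:R * (16 * d%:R ^+ 2 * C1 / r * f z) * `|y - z| = C * (`|y - z| / r) * f z.
  by rewrite /C; field; rewrite gt_eqF.
by rewrite lexx.
Qed.

(** * Near half spaces *)

Section harmonic_c2.
Context {R : realType} {d : nat}.
Implicit Types (x y z : 'rV[R]_d) (f u : 'rV[R]_d -> R).
Local Notation e := (basis_vec R d).

Lemma lipschitz_at_continuous f z (rho C : R) : 0 < rho ->
  (forall y, `|y - z| <= rho -> `|f y - f z| <= C * `|y - z|) ->
  {for z, continuous f}.
Proof.
move=> rho0 fC; apply/(@cvgrPdist_lt _ _ _ (nbhs z)) => eps eps0.
have C1 : 0 < `|C| + 1 by rewrite ltr_wpDl.
have r0 : 0 < Num.min rho (eps / (`|C| + 1)) by rewrite lt_min rho0 divr_gt0.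
near=> y.
have : `|z - y| < Num.min rho (eps / (`|C| + 1)).
  by near: y; exact: (@cvgr_dist_lt _ _ _ (nbhs z) _ id z cvg_id).
rewrite lt_min ltr_pdivlMr// => /andP[y1 y2].
rewrite distrC (le_lt_trans (fC y _)) 1?distrC ?(ltW y1)//.
rewrite (le_lt_trans _ y2)// mulrC distrC ler_wpM2l//.
by rewrite (le_trans (ler_norm _))// lerDl.
Unshelve. all: by end_near. Qed.

(** [harmonic_on] states continuity for the second derivatives only. Applied twice, this recovers it
    for the first derivatives and for the function: continuous partial derivatives are locally
    bounded, hence the function is Lipschitz at [z]. *)
Lemma locally_bounded_partials_continuous f (g : 'I_d -> 'rV[R]_d -> R) z :
  (\forall y \near z, forall i, is_derive y (e i) f (g i y)) ->
  (forall i, {for z, continuous (g i)}) -> {for z, continuous f}.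
Proof.
move=> fg cg; pose M := \sum_i (`|g i z| + 1).
have gM : \forall y \near z, forall i, `|g i y| <= M.
  apply: (@filter_forall _ _ _ (nbhs z)) => i; near=> y.
  rewrite (@le_trans _ _ (`|g i z| + 1))//.
    apply: ltW; near: y.
    apply: (@cvgr_lt _ _ (nbhs z) _ (fun y => `|g i y|) `|g i z|); last by rewrite ltrDl.
    exact: (@cvg_norm _ _ _ (nbhs z) _ (g i) _ (cg i)).
  by rewrite /M (bigD1 i)//= lerDl sumr_ge0// => j _; rewrite addr_ge0.
have [rho /= rho0 H] := (nbhs_ballP z _).1 (@filterI _ (nbhs z) _ _ _ fg gM).
have rho20 : 0 < rho / 2 by rewrite divr_gt0.
apply: (@lipschitz_at_continuous f z (rho / 2) (d%:R * M)) => // y yr.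
have Hb x : `|x - z| <= rho / 2 -> ball z rho x.
  by move=> xr; rewrite -ball_normE /ball_/= distrC; lra.
by apply: (@coord_path_lipschitz _ _ z (rho / 2) M f g) => // x /Hb/H[].
Unshelve. all: by end_near. Qed.

Lemma harmonic_on_c2 (O : set 'rV[R]_d) u : open O -> harmonic_on O u ->
  c2 O u (fun i => 'D_(e i) u) (fun i => 'D_(e i) ('D_(e i) u)).
Proof.
move=> oO [du [ddu [cddu _]]].
have c1 i z : O z -> {for z, continuous ('D_(e i) u)}.
  move=> Oz; apply: (@locally_bounded_partials_continuous _ (fun j => 'D_(e j) ('D_(e i) u))).
    near=> y => j; apply: DeriveDef => //; apply: ddu; near: y.
    exact: open_nbhs_nbhs.
  by move=> j; exact: cddu.
move=> z Oz; split.
  apply: (@locally_bounded_partials_continuous _ (fun j => 'D_(e j) u)).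
    near=> y => j; apply: DeriveDef => //; apply: du; near: y.
    exact: open_nbhs_nbhs.
  by move=> j; exact: c1.
move=> i; split.
- by apply: DeriveDef => //; exact: du.
- by apply: DeriveDef => //; exact: ddu.
- exact: c1.
- exact: cddu.
Unshelve. all: by end_near. Qed.

End harmonic_c2.

Section near_half_space.
Context {R : realType} {n : nat}.
Implicit Types (x y z v : 'rV[R]_n.+1) (Phi : 'rV[R]_n -> R).
Local Notation e := (basis_vec R n.+1).
Local Notation ez := (basis_vec R n.+1 ord_max).

Lemma base_coord z (i : 'I_n) : base z 0 i = z 0 (widen_ord (leqnSn n) i).
Proof. by rewrite mxE. Qed.

Lemma baseB x y : base (x - y) = base x - base y.
Proof. by apply/rowP => i; rewrite !mxE. Qed.

Lemma base_vshift t z : base (vshift t z) = base z.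
Proof.
apply/rowP => i; rewrite !mxE/= (_ : (_ == _) = false) ?mulr0 ?addr0//.
by apply/negbTE; rewrite -val_eqE/= neq_ltn ltn_ord.
Qed.

Lemma height_vshift t z : height (vshift t z) = height z + t.
Proof. by rewrite /height !mxE !eqxx/= mulr1. Qed.

Lemma norm_base_le z : `|base z| <= `|z|.
Proof. by apply: norm_le_coord => // i; rewrite base_coord coord_le_norm. Qed.

Lemma vshiftD s t z : vshift s (vshift t z) = vshift (t + s) z.
Proof. by rewrite /vshift scalerDl addrA. Qed.

Lemma vshift0 z : vshift 0 z = z.
Proof. by rewrite /vshift scale0r addr0. Qed.

(** Vertical height above the graph. It replaces the distance to the boundary: it is Lipschitz, and
    a vertical shift by [t] raises it by exactly [t]. *)
Definition gap Phi z := height z - Phi (base z).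

Lemma nhsE Phi z : near_half_space Phi z = (0 < gap Phi z) :> Prop.
Proof. by rewrite /near_half_space/= subr_gt0. Qed.

Lemma nhs_boundaryP Phi z : nhs_boundary Phi z <-> gap Phi z = 0.
Proof.
by rewrite /nhs_boundary/= /gap; split => [->|/eqP]; rewrite ?subrr// subr_eq0 => /eqP.
Qed.

Lemma gap_vshift Phi t z : gap Phi (vshift t z) = gap Phi z + t.
Proof. by rewrite /gap base_vshift height_vshift addrAC. Qed.

Context (Phi : 'rV[R]_n -> R) (K : R).
Context (K0 : 0 <= K) (PhiK : forall x y : 'rV[R]_n, `|Phi x - Phi y| <= K * `|x - y|).
Local Notation O := (near_half_space Phi).
Local Notation S := (nhs_boundary Phi).
Local Notation gp := (gap Phi).

Lemma gap_lipschitz x y : `|gp x - gp y| <= (1 + K) * `|x - y|.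
Proof.
have -> : gp x - gp y = (height x - height y) - (Phi (base x) - Phi (base y)).
  by rewrite /gap; ring.
rewrite mulrDl mul1r (le_trans (ler_normB _ _))// lerD//.
  by have := coord_le_norm (x - y) ord_max; rewrite /height !mxE.
by rewrite (le_trans (PhiK _ _))// ler_wpM2l// -baseB norm_base_le.
Qed.

Lemma continuous_gap : continuous gp.
Proof.
by move=> z; apply: (@lipschitz_at_continuous _ _ _ z 1 (1 + K)) => // y _; exact: gap_lipschitz.
Qed.

Lemma open_nhs : open O.
Proof.
rewrite (_ : O = gp @^-1` [set t | 0 < t]).
  by apply: open_comp => [z _|]; [exact: continuous_gap|exact: open_gt].
by apply/funext => z; rewrite nhsE.
Qed.

Lemma closed_nhs_boundary : closed S.
Proof.
rewrite (_ : S = gp @^-1` [set 0]).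
  by apply: (continuous_closedP _).1; [exact: continuous_gap|exact: closed_eq].
by apply/funext => z; apply/propext; exact: nhs_boundaryP.
Qed.

Lemma nhs_vshift z t : O z -> 0 <= t -> O (vshift t z).
Proof. by rewrite !nhsE gap_vshift => z0 t0; rewrite ltr_wpDr. Qed.

Lemma boundary_vshift z t : S z -> 0 < t -> O (vshift t z).
Proof. by move=> /nhs_boundaryP z0; rewrite nhsE gap_vshift z0 add0r. Qed.

Lemma harmonic_vshift (U : set 'rV[R]_n.+1) f g h s : c2 U f g h ->
  c2 [set z | U (vshift s z)] (f \o vshift s) (fun i => g i \o vshift s)
    (fun i => h i \o vshift s).
Proof.
move=> cf; have cv : continuous (@vshift R n s).
  move=> z; exact: (@cvgD _ _ _ (nbhs z) _ id (cst (s *: ez)) _ _ cvg_id (cvg_cst _)).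
apply: c2_ext (c2_precomp (s := fun=> 1) cv _ _ cf) _ _ _ => // [i|z i t|i z].
- by left.
- by rewrite /vshift mul1r addrAC.
- by rewrite mul1r.
Qed.

Definition pos_harmonic (h : 'rV[R]_n.+1 -> R) :=
  harmonic_on O h /\ forall z, O z -> 0 < h z.

Lemma nhs_harnack : exists2 C : R, 1 <= C &
  forall h, pos_harmonic h -> forall z, O z ->
  (forall y, `|y - z| <= gp z / C ->
    O y /\ `|h y - h z| <= C * (`|y - z| / gp z) * h z) /\
  (forall i, `|'D_(e i) h z| <= C / gp z * h z).
Proof.
have [C C1 H] := @harnack R n.+1 isT.
(* On the cube of radius [gp z / k] the Lipschitz function [gp] drops by at most half of [gp z], so
   the cube lies in the domain. *)
pose k := 2 * (1 + K); have k1 : 2 <= k by rewrite /k mulrDr mulr1 lerDl mulr_ge0.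
have Ck : C <= C * k by rewrite ler_peMr; lra.
exists (C * k); first by lra.
move=> h [hh h0] z Oz.
have t0 : 0 < gp z by move: Oz; rewrite nhsE.
have k0 : 0 < k by lra.
have C0 : 0 < C by lra.
have r0 : 0 < gp z / k by rewrite divr_gt0.
have QO y : `|y - z| <= gp z / k -> O y.
  move=> yz; rewrite nhsE; have := gap_lipschitz y z.
  have : (1 + K) * `|y - z| <= gp z / 2.
    have := ler_wpM2l (_ : 0 <= 1 + K) yz; rewrite addr_ge0// => /(_ isT).
    by rewrite (_ : (1 + K) * (gp z / k) = gp z / 2)// /k; field; rewrite gt_eqF// ltr_wpDr.
  by move=> le1 /le_trans/(_ le1); rewrite ler_norml => /andP[]; lra.
have [H1 H2] := H O z (gp z / k) h _ _ r0 QO (harmonic_on_c2 open_nhs hh) hh.2.2.2 h0.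
split => [y yz|i].
  have yz' : `|y - z| <= gp z / k / C by rewrite -mulrA -invfM mulrC [k * C]mulrC mulrC.
  split.
    apply: QO; rewrite (le_trans yz')// ler_pdivrMr// ler_peMr// ltW//.
  apply: le_trans (H1 y yz') _.
  rewrite (_ : C * (`|y - z| / (gp z / k)) = C * k * (`|y - z| / gp z))//.
  by field; rewrite !gt_eqF.
apply: le_trans (H2 i) _.
rewrite (_ : C / (gp z / k) = C * k / gp z)//.
by field; rewrite !gt_eqF.
Qed.

Definition harnack_at (C : R) := 1 <= C /\
  forall h, pos_harmonic h -> forall z, O z ->
  (forall y, `|y - z| <= gp z / C ->
    O y /\ `|h y - h z| <= C * (`|y - z| / gp z) * h z) /\
  (forall i, `|'D_(e i) h z| <= C / gp z * h z).

Lemma harnack_step C h z y : harnack_at C -> pos_harmonic h -> O z ->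
  `|y - z| <= gp z / C -> O y /\ h y <= 2 * h z.
Proof.
move=> [C1 H] hh Oz yz; have [H1 _] := H h hh z Oz.
have t0 : 0 < gp z by move: Oz; rewrite nhsE.
have [Oy le1] := H1 y yz; split=> //.
have hz := hh.2 _ Oz.
have : C * (`|y - z| / gp z) * h z <= h z.
  rewrite ler_piMl ?(ltW hz)// mulrC -ler_pdivlMr ?(lt_le_trans ltr01)//.
  by rewrite ler_pdivrMr// mulrC div1r.
by move=> le2; move: (le_trans le1 le2); rewrite ler_norml => /andP[]; lra.
Qed.

(** One Harnack step multiplies the height by [1 + C^-1] and costs a factor 2, so the number of
    steps is logarithmic in the ratio of the heights. *)
Lemma harnack_chain C h N : harnack_at C -> pos_harmonic h ->
  forall z t, O z -> 0 <= t -> gp z + t <= (1 + C^-1) ^+ N * gp z ->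
  h (vshift t z) <= 2 ^+ N * h z.
Proof.
move=> HC hh; have C0 : 0 < C by have [C1 _] := HC; lra.
have q1 : 1 <= 1 + C^-1 by rewrite lerDl invr_ge0 ltW.
elim: N => [|N IH] z t Oz t0.
  rewrite !expr0 !mul1r gerDl => t0'.
  by rewrite (_ : t = 0) ?vshift0//; apply/eqP; rewrite eq_le t0 t0'.
have zt0 : 0 < gp z by move: Oz; rewrite nhsE.
have hz := hh.2 _ Oz.
move=> tle.
pose q := 1 + C^-1; have q0 : 0 < q by rewrite /q; lra.
have [small|large] := leP (gp z + t) (q * gp z).
  have yz : `|vshift t z - z| <= gp z / C.
    rewrite /vshift addrC addKr normrZ norm_basis_vec mulr1 ger0_norm//.
    by move: small; rewrite /q mulrDl mul1r lerD2l mulrC.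
  have [_ /le_trans] := harnack_step HC hh Oz yz; apply.
  by rewrite ler_pM2r// -[leLHS]expr1 ler_weXn2l// ler1n.
pose t1 := (gp z + t) / q - gp z.
have t1E : gp z + t1 = (gp z + t) / q by rewrite /t1; ring.
have t10 : 0 <= t1 by rewrite /t1 subr_ge0 ler_pdivlMr// mulrC ltW.
have IH1 : h (vshift t1 z) <= 2 ^+ N * h z.
  by apply: IH => //; rewrite t1E ler_pdivrMr// mulrC mulrA -exprS.
have O1 := nhs_vshift Oz t10.
have t1t : t - t1 = (gp z + t1) / C.
  rewrite t1E /t1 /q; field.
  by rewrite gt_eqF//= gt_eqF//; lra.
have yz : `|vshift t z - vshift t1 z| <= gp (vshift t1 z) / C.
  rewrite gap_vshift -t1t /vshift opprD addrACA subrr add0r -scalerBl normrZ.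
  by rewrite norm_basis_vec mulr1 ger0_norm// t1t mulr_ge0 ?invr_ge0 ?(ltW C0)// addr_ge0// ltW.
have [_ /le_trans] := harnack_step HC hh O1 yz; apply.
by rewrite exprS -mulrA ler_pM2l.
Qed.

(** Displacements that may be long upwards, up to [3 * b] even when [b] is the whole height of [z],
    and are short, at most [b / C0], otherwise. The relative error is linear in [b / gp z]; this
    makes the errors of the chain summable over the scales. *)
Definition harnack_wide (C0 C2 : R) := [/\ 1 <= C0, 1 <= C2 &
  forall h, pos_harmonic h -> forall z (b a : R) v, O z -> 0 < b <= gp z ->
  0 <= a <= 3 -> `|v| <= C0^-1 ->
  O (z + b *: (a *: ez + v)) /\
  `|h (z + b *: (a *: ez + v)) - h z| <= C2 * (b / gp z) * h z].

(** When [b] is small against the height, a single application of Harnack gives the linear bound.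
    Otherwise [b / gp z] is bounded below, and any bound by a multiple of [h z] will do: a vertical
    chain followed by one short step. *)
Lemma harnack_wideP C : harnack_at C -> exists C2, harnack_wide C C2.
Proof.
move=> HC; have [C1 H] := HC; have C0 : 0 < C by lra.
(* By Bernoulli's inequality [N >= 3 * C] steps multiply the height by at least 4, enough for a rise
   of [3 * gp z]. *)
have [N NC] : exists N : nat, 3 * C <= N%:R.
  by exists (Num.truncn (3 * C)).+1; rewrite ltW// truncnS_gt.
have qN : 4 <= (1 + C^-1) ^+ N.
  have B : forall M : nat, 1 + M%:R * C^-1 <= (1 + C^-1) ^+ M.
    elim=> [|M IH]; first by rewrite mul0r addr0 expr0.
    have Ci : 0 < C^-1 by rewrite invr_gt0.
    rewrite exprS -natr1 (le_trans _ (ler_wpM2l _ IH))//; last by lra.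
    have : 0 <= M%:R * C^-1 * C^-1 by rewrite !mulr_ge0 ?(ltW Ci).
    lra.
  apply: le_trans (B N).
  have : 3 <= N%:R * C^-1 by rewrite ler_pdivlMr.
  lra.
have N1 : (1 : R) <= 2 ^+ N by rewrite exprn_ege1// ler1n.
exists (2 ^+ N.+1 * 4 * C); split => //.
  rewrite exprS; have : 1 * 1 <= 2 ^+ N * C by rewrite ler_pM.
  lra.
move=> h hh z b a v Oz /andP[b0 bz] /andP[a0 a3] vC.
have zt0 : 0 < gp z by move: Oz; rewrite nhsE.
have hz := hh.2 _ Oz.
have Ci1 : C^-1 <= 1 by rewrite invf_le1.
have [small|large] := leP b (gp z / (4 * C)).
  have yz : `|z + b *: (a *: ez + v) - z| <= 4 * b.
    rewrite addrC addKr normrZ gtr0_norm// mulrC ler_pM2r//.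
    rewrite (le_trans (ler_normD _ _))// normrZ norm_basis_vec mulr1 ger0_norm//; lra.
  have yz' : `|z + b *: (a *: ez + v) - z| <= gp z / C.
    rewrite (le_trans yz)//; move: small; rewrite ler_pdivlMr ?mulr_gt0// ler_pdivlMr//.
    by lra.
  have [Hz _] := H h hh z Oz; have [Oy le1] := Hz _ yz'; split=> //.
  apply: (le_trans le1); rewrite ler_pM2r//.
  have -> : 2 ^+ N.+1 * 4 * C * (b / gp z) = C * (2 ^+ N.+1 * (4 * b) / gp z) by ring.
  rewrite ler_pM2l// ler_pM2r ?invr_gt0// (le_trans yz)//.
  by rewrite ler_peMl ?mulr_ge0 ?(ltW b0)// exprn_ege1// ler1n.
have ba0 : 0 <= b * a by rewrite mulr_ge0// ltW.
have ba3 : b * a <= 3 * gp z by rewrite mulrC ler_pM ?(ltW b0).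
have O1 := nhs_vshift Oz ba0.
have h1 : h (vshift (b * a) z) <= 2 ^+ N * h z.
  apply: (harnack_chain HC hh Oz ba0).
  have : 4 * gp z <= (1 + C^-1) ^+ N * gp z by rewrite ler_pM2r.
  lra.
have yE : z + b *: (a *: ez + v) = vshift (b * a) z + b *: v.
  by rewrite /vshift scalerDr scalerA addrA.
have yz : `|z + b *: (a *: ez + v) - vshift (b * a) z| <= gp (vshift (b * a) z) / C.
  rewrite yE [_ + b *: v]addrC addrK normrZ gtr0_norm// gap_vshift.
  by rewrite ler_pM ?(ltW b0)//; lra.
have [Oy le1] := harnack_step HC hh O1 yz; split => //.
have hy := hh.2 _ Oy.
have le2 : h (z + b *: (a *: ez + v)) <= 2 ^+ N.+1 * h z.
  by rewrite (le_trans le1)// exprS -mulrA ler_pM2l.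
have le3 : `|h (z + b *: (a *: ez + v)) - h z| <= 2 ^+ N.+1 * h z.
  have : h z <= 2 ^+ N.+1 * h z.
    by rewrite ler_peMl ?(ltW hz)// exprn_ege1// ler1n.
  by rewrite ler_norml; lra.
apply: (le_trans le3); rewrite ler_pM2r// -[leLHS]mulr1.
have -> : 2 ^+ N.+1 * 4 * C * (b / gp z) = 2 ^+ N.+1 * ((4 * C) * (b / gp z)) by ring.
rewrite ler_wpM2l ?exprn_ge0// mulrA ler_pdivlMr// mul1r.
by move: large; rewrite ltr_pdivrMr ?mulr_gt0// mulrC => /ltW.
Qed.

End near_half_space.

(** * Measurability and Gaussian increments *)

Section borel.
Context {R : realType} {d : nat}.
Local Notation BV := (borel_rV R d).

Definition rat_point (k : nat) : 'rV[R]_d :=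
  map_mx ratr (odflt (0 : 'rV[rat]_d) (unpickle k)).

Lemma rat_point_dense (x : 'rV[R]_d) (e : R) : 0 < e ->
  exists k, `|x - rat_point k| < e.
Proof.
move=> e0.
have H i : exists q : rat, `|x 0 i - ratr q| < e.
  have xe : x 0 i - e < x 0 i + e by lra.
  have [q] := rat_in_itvoo xe.
  rewrite in_itv/= => /andP[q1 q2]; exists q.
  by rewrite ltr_norml; apply/andP; split; lra.
have [q qP] := choice H.
exists (pickle (\row_i q i : 'rV[rat]_d)).
rewrite /rat_point pickleK/=; apply: norm_lt_coord => // i.
by rewrite !mxE.
Qed.

Lemma measurable_countable_bigcup d' (T : measurableType d') (I : countType)
  (P : set I) (F : I -> set T) : (forall i, P i -> measurable (F i)) ->
  measurable (\bigcup_(i in P) F i).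
Proof.
move=> mF; rewrite bigcup_mkcond; apply: countable_bigcupT_measurable => // i.
by case: ifPn => [/[!inE]/mF|].
Qed.

Lemma open_rV_bigcup (U : set 'rV[R]_d) : open U ->
  U = \bigcup_(p in [set p : nat * nat |
        [set y | `|y - rat_point p.1| < p.2.+1%:R^-1] `<=` U])
      [set y | `|y - rat_point p.1| < p.2.+1%:R^-1].
Proof.
move=> oU; apply/seteqP; split => [x Ux|x [p /= pU /pU//]].
have [e /= e0 eU] := (nbhs_ballP x U).1 (open_nbhs_nbhs (conj oU Ux)).
have [m me] : exists m : nat, m.+1%:R^-1 < e / 2.
  have e20 : 0 < e / 2 by rewrite divr_gt0.
  exists (Num.truncn (e / 2)^-1).
  by rewrite invf_plt ?posrE// truncnS_gt.
have m0 : (0 : R) < m.+1%:R^-1 by rewrite invr_gt0.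
have [k xk] := rat_point_dense x m0.
exists (k, m) => //= y /= yk; apply: eU; rewrite -ball_normE /ball_/=.
rewrite -(subrKA (rat_point k)) (le_lt_trans (ler_normD _ _))//.
rewrite [`|rat_point k - y|]distrC.
by move: (m.+1%:R^-1) me xk yk => c; lra.
Qed.

Lemma borel_open (U : set 'rV[R]_d) : open U -> measurable (U : set BV).
Proof. exact: sub_sigma_algebra. Qed.

Lemma borel_closed (U : set 'rV[R]_d) : closed U -> measurable (U : set BV).
Proof. by move=> cU; rewrite -[U]setCK; apply: measurableC; apply: borel_open; exact: closed_openC. Qed.

(** Sup-norm balls are finite intersections of conditions on single coordinates, and countably many
    rational ones make up any open set. *)
Lemma measurable_fun_rV d' (T : measurableType d') (D : set T) (Y : T -> 'rV[R]_d) :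
  (forall i, measurable_fun D (fun t => Y t 0 i)) ->
  measurable_fun D (Y : T -> BV).
Proof.
move=> mY mD; apply: (@measurability _ _ T BV D Y _ erefl) => //.
move=> _ [U oU <-]; rewrite (open_rV_bigcup oU) preimage_bigcup setI_bigcupr.
apply: measurable_countable_bigcup => -[k m] _ /=.
rewrite (_ : _ `&` _ = D `&` \bigcap_(i in [set: 'I_d])
    (D `&` [set t | `|Y t 0 i - rat_point k 0 i| < m.+1%:R^-1])); last first.
  apply/seteqP; split => t /= [Dt H]; split => //.
    move=> i _; split => //=; apply: le_lt_trans H.
    by have := coord_le_norm (Y t - rat_point k) i; rewrite !mxE.
  apply: norm_lt_coord; first by rewrite invr_gt0.
  by move=> i; have [_ /=] := H i I; rewrite !mxE.
apply: measurableI => //; apply: fin_bigcap_measurable => // i _.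
have mf : measurable_fun D (fun t => `|Y t 0 i - rat_point k 0 i|).
  by apply: measurableT_comp => //; apply: measurable_funB.
have := mf mD `]-oo, m.+1%:R^-1[%classic (measurable_itv _).
by move=> h; apply: (eq_ind _ measurable h); congr (_ `&` _); apply/seteqP; split => t /=; rewrite in_itv.
Qed.

Lemma measurable_coord (i : 'I_d) : measurable_fun setT (fun z : BV => z 0 i).
Proof.
move=> _; apply: (measurability _ (RGenOpens.measurableE R)) => //.
move=> _ [_ [a [b ->] <-]]; rewrite setTI; apply: borel_open.
apply: open_comp; last exact: interval_open.
by move=> z _; exact: coord_continuous.
Qed.

Definition rel_continuous (D : set 'rV[R]_d) (f : 'rV[R]_d -> R) :=
  forall x, D x -> forall e : R, 0 < e -> exists2 r : R, 0 < r &
  forall y, D y -> `|y - x| < r -> `|f y - f x| < e.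

Lemma open_ballS (x : 'rV[R]_d) (r : R) : open [set y | `|y - x| < r].
Proof.
rewrite (_ : mkset _ = (fun y => `|y - x|) @^-1` [set t | t < r])//.
by apply: open_comp => [z _|]; [exact: continuous_norm_sub|exact: open_lt].
Qed.

Lemma continuous_rel D f : (forall x, D x -> {for x, continuous f}) ->
  rel_continuous D f.
Proof.
move=> cf x Dx e e0.
have H0 : nbhs x (fun t => `|f x - f t| < e).
  by apply: (@cvgr_dist_lt _ _ _ (nbhs x) _ f (f x)) => //; exact: cf.
have [r /= r0 H] := (nbhs_ballP x _).1 H0; exists r => // y Dy yx.
by rewrite distrC; apply: H; rewrite -ball_normE /ball_/= distrC.
Qed.

Lemma measurable_rel_continuous (D : set BV) f : measurable D ->
  rel_continuous D f -> measurable_fun D (f : BV -> R).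
Proof.
move=> mD cf _; apply: (measurability _ (RGenOpens.measurableE R)) => //.
move=> _ [_ [a [b ->] <-]].
pose V := \bigcup_(p in [set p : 'rV[R]_d * R | forall y, D y -> `|y - p.1| < p.2 ->
  f y \in `]a, b[%R]) [set y | `|y - p.1| < p.2].
rewrite (_ : _ `&` _ = D `&` V).
  by apply: measurableI => //; apply: borel_open; apply: bigcup_open => -[x r] _; exact: open_ballS.
apply/seteqP; split => [x [Dx]|x [Dx [[y r] /= H yx]]].
  rewrite /= in_itv/= => /andP[afx fxb]; split => //.
  have m0 : 0 < Num.min (f x - a) (b - f x) by rewrite lt_min !subr_gt0 afx.
  have [r r0 H] := cf x Dx _ m0.
  exists (x, r); last by rewrite /= subrr normr0.
  move=> y Dy /= yx; have := H y Dy yx; rewrite lt_min !ltr_norml in_itv/=.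
  by move=> /andP[/andP[? ?] /andP[? ?]]; apply/andP; split; lra.
by split => //=; exact: H.
Qed.

End borel.

(** * Borel functions on a product of two spaces of vectors *)

Section borel2.
Context {R : realType} {d1 d2 : nat}.
Local Notation B1 := (borel_rV R d1).
Local Notation B2 := (borel_rV R d2).

Lemma measurable_open2 (V : set (B1 * B2)) :
  (forall p, V p -> exists2 r : R, 0 < r &
     forall q : 'rV[R]_d1 * 'rV[R]_d2, `|q.1 - p.1| < r -> `|q.2 - p.2| < r -> V q) ->
  measurable V.
Proof.
move=> oV.
pose ba d k m := [set y : 'rV[R]_d | `|y - rat_point k| < m.+1%:R^-1].
rewrite (_ : V = \bigcup_(k in [set k : nat * nat * nat |
    ba d1 k.1.1 k.2 `*` ba d2 k.1.2 k.2 `<=` V]) (ba d1 k.1.1 k.2 `*` ba d2 k.1.2 k.2)).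
  apply: measurable_countable_bigcup => -[[k1 k2] m] _ /=.
  by apply: measurableX; apply: borel_open; exact: open_ballS.
apply/seteqP; split => [p Vp|p [k /= H /H]//].
have [r r0 H] := oV p Vp.
have [m me] : exists m : nat, m.+1%:R^-1 < r / 2.
  have e20 : 0 < r / 2 by rewrite divr_gt0.
  exists (Num.truncn (r / 2)^-1).
  by rewrite invf_plt ?posrE// truncnS_gt.
have m0 : (0 : R) < m.+1%:R^-1 by rewrite invr_gt0.
have [k1 pk1] := rat_point_dense (p.1 : 'rV[R]_d1) m0.
have [k2 pk2] := rat_point_dense (p.2 : 'rV[R]_d2) m0.
exists (k1, k2, m) => //= q [/= q1 q2]; apply: H.
  rewrite -(subrKA (rat_point k1)) (le_lt_trans (ler_normD _ _))//.
  rewrite [`|rat_point k1 - _|]distrC; rewrite /ba/= in q1.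
  by move: (m.+1%:R^-1) me pk1 q1 => c; lra.
rewrite -(subrKA (rat_point k2)) (le_lt_trans (ler_normD _ _))//.
rewrite [`|rat_point k2 - _|]distrC; rewrite /ba/= in q2.
by move: (m.+1%:R^-1) me pk2 q2 => c; lra.
Qed.

Lemma measurable_rel_continuous2 (D : set (B1 * B2)) (f : 'rV[R]_d1 * 'rV[R]_d2 -> R) :
  measurable D ->
  (forall p, D p -> forall e : R, 0 < e -> exists2 r : R, 0 < r &
     forall q : 'rV[R]_d1 * 'rV[R]_d2, D q -> `|q.1 - p.1| < r -> `|q.2 - p.2| < r ->
       `|f q - f p| < e) ->
  measurable_fun D (f : B1 * B2 -> R).
Proof.
move=> mD cf _; apply: (measurability _ (RGenOpens.measurableE R)) => //.
move=> _ [_ [a [b ->] <-]].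
pose V := [set q : B1 * B2 | exists p : ('rV[R]_d1 * 'rV[R]_d2) * R,
  [/\ `|q.1 - p.1.1| < p.2, `|q.2 - p.1.2| < p.2 &
   forall y : 'rV[R]_d1 * 'rV[R]_d2, D y -> `|y.1 - p.1.1| < p.2 -> `|y.2 - p.1.2| < p.2 ->
  f y \in `]a, b[%R]].
rewrite (_ : _ `&` _ = D `&` V).
  apply: measurableI => //; apply: measurable_open2 => q [[p r] /= [q1 q2 H]].
  pose r' := Num.min (r - `|q.1 - p.1|) (r - `|q.2 - p.2|).
  exists r'; first by rewrite lt_min !subr_gt0 q1.
  move=> w; rewrite !lt_min => /andP[w1 w1'] /andP[w2 w2'].
  exists (p, r); split => //=.
    rewrite -(subrKA q.1) (le_lt_trans (ler_normD _ _))//; lra.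
  rewrite -(subrKA q.2) (le_lt_trans (ler_normD _ _))//; lra.
apply/seteqP; split => [x [Dx]|x [Dx [[y r] /= [x1 x2 H]]]].
  rewrite /= in_itv/= => /andP[afx fxb]; split => //.
  have m0 : 0 < Num.min (f x - a) (b - f x) by rewrite lt_min !subr_gt0 afx.
  have [r r0 H] := cf x Dx _ m0.
  exists (x, r); split; rewrite /= ?subrr ?normr0//.
  move=> y Dy /= y1 y2; have := H y Dy y1 y2; rewrite lt_min !ltr_norml in_itv/=.
  by move=> /andP[/andP[? ?] /andP[? ?]]; apply/andP; split; lra.
by split => //=; exact: H.
Qed.

End borel2.

(** * Integration against a measure with a density *)

Section density.
Local Open Scope ereal_scope.
Context d (T : measurableType d) (R : realType).
Variables (m1 mu : {measure set T -> \bar R}) (D : set T) (k : T -> R).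
Hypotheses (mD : measurable D) (mk : measurable_fun D k)
  (k0 : forall x, D x -> (0 <= k x)%R)
  (m1k : forall A, measurable A -> A `<=` D -> m1 A = \int[mu]_(x in A) (k x)%:E).

Import HBNNSimple.

Let mkE : measurable_fun D (EFin \o k). Proof. exact/measurable_EFinP. Qed.

Let density_nnsfun (f : {nnsfun T >-> R}) :
  \int[m1]_(x in D) (f x)%:E = \int[mu]_(x in D) ((f x)%:E * (k x)%:E).
Proof.
under [LHS]eq_integral do rewrite fimfunE -fsumEFin//.
rewrite [LHS]ge0_integral_fsum//; last 2 first.
  - by move=> r; exact/measurable_EFinP/measurable_funTS/measurableT_comp.
  - by move=> n x _; rewrite EFinM nnfun_muleindic_ge0.
under [RHS]eq_integral.
  move=> x xD; rewrite fimfunE -fsumEFin// ge0_mule_fsuml; last first.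
    by move=> r; rewrite EFinM nnfun_muleindic_ge0.
  over.
rewrite [RHS]ge0_integral_fsum//; last 2 first.
  - move=> r; apply: emeasurable_funM => //; apply/measurable_EFinP/measurable_funTS.
    exact: measurableT_comp.
  - by move=> n x Dx; apply: mule_ge0; [rewrite EFinM nnfun_muleindic_ge0|rewrite lee_fin k0].
apply: eq_fsbigr => r _; rewrite integralZl_indic_nnsfun// integral_indic//.
rewrite m1k//; last exact: measurableI.
have [r0|r0] := leP 0%R r; last first.
  rewrite preimage_nnfun0// set0I integral_set0 mule0.
  rewrite integral0_eq// => x Dx; rewrite indicE (_ : (x \in _) = false) ?mulr0 ?mul0e//.
  by rewrite in_set0.
rewrite integral_mkcondl.
rewrite -ge0_integralZl//.
- apply: eq_integral => x _; rewrite patchE indicE.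
  by case: ifP => _ /=; rewrite ?mulr1 ?mulr0 ?mule0 ?mul0e.
- by apply/measurable_restrict => //; apply: measurable_funS mkE => //; exact: subIsetl.
- by move=> x Dx; rewrite patchE; case: ifP => // _; rewrite lee_fin k0.
Qed.

Lemma integral_density (f : T -> \bar R) : measurable_fun D f ->
  (forall x, D x -> 0 <= f x) ->
  \int[m1]_(x in D) f x = \int[mu]_(x in D) (f x * (k x)%:E).
Proof.
move=> mf f0.
pose f_ := nnsfun_approx mD mf.
transitivity (lim (\int[m1]_(x in D) (f_ n x)%:E @[n --> \oo])%E).
  rewrite -monotone_convergence//=.
  - apply: eq_integral => x /[!inE] xD; apply/esym/cvg_lim => //=.
    by apply: cvg_nnsfun_approx.
  - by move=> n; exact/measurable_EFinP/measurable_funTS.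
  - by move=> n ? _; rewrite lee_fin.
  - by move=> ? _ ? ? mn; rewrite lee_fin; exact/lefP/nd_nnsfun_approx.
rewrite [RHS](_ : _ = lim
    (\int[mu]_(x in D) ((f_ n x)%:E * (k x)%:E) @[n --> \oo])%E); last first.
  rewrite -monotone_convergence//=.
  - apply: eq_integral => x /[!inE] xD; apply/esym/cvg_lim => //.
    by apply: cvgeZr => //; apply: cvg_nnsfun_approx.
  - by move=> n; apply: emeasurable_funM => //; exact/measurable_EFinP/measurable_funTS.
  - by move=> n x Dx; rewrite mule_ge0 ?lee_fin ?k0.
  - move=> x Dx ? ? mn; rewrite lee_wpmul2r ?lee_fin ?k0//; exact/lefP/nd_nnsfun_approx.
by apply: congr_lim; apply/funext => n /=; exact: density_nnsfun.
Qed.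

End density.

(** * Centred Gaussian laws on the line *)

Section gauss.
Context {R : realType}.
Local Notation N := (@normal_prob R 0).
Local Notation leb := (@lebesgue_measure R).
Local Notation Iopen rho := (`](- rho)%R, rho%R[%classic : set R).

Lemma lebesgue_oppr (A : set R) : measurable A -> leb (-%R @^-1` A) = leb A.
Proof.
have mopp : measurable_fun [set: measurableTypeR R] (-%R : measurableTypeR R -> measurableTypeR R).
  exact: oppr_measurable.
move=> mA.
pose mu := @pushforward _ _ (measurableTypeR R) (measurableTypeR R) R leb -%R.
pose mum : {measure set (measurableTypeR R) -> \bar R} :=
  @measure_function_pushforward__canonical__measure_function_Measure _ _ _ _ _ leb _ mopp.
rewrite -[LHS]/(mum A).
apply/esym/(@lebesgue_measure_unique R mum) => // X [[a b] _ <-].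
rewrite /mum/= /pushforward lebesgue_measure_itv/=.
rewrite (_ : _ @^-1` _ = `[- b, - a[%classic); last first.
  by apply/seteqP; split => x /=; rewrite !in_itv/= ltrNr lerNl andbC.
by rewrite lebesgue_measure_itv/= !lte_fin ltrN2; case: ifP => // _; rewrite -?EFinN -?EFinD; congr EFin; ring.
Qed.

Lemma integral_normal (s : R) (D : set R) (f : R -> \bar R) : measurable D ->
  measurable_fun D f -> (forall x, D x -> 0 <= f x)%E ->
  (\int[N s]_(x in D) f x = \int[leb]_(x in D) (f x * (normal_pdf 0 s x)%:E))%E.
Proof.
move=> mD mf f0; apply: integral_density => //.
- by apply: measurable_funTS; exact: measurable_normal_pdf.
- by move=> x _; exact: normal_pdf_ge0.
Qed.

Lemma normal_oppr (s : R) (A : set R) : s != 0 -> measurable A -> N s (-%R @^-1` A) = N s A.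
Proof.
have mopp : measurable_fun [set: measurableTypeR R] (-%R : measurableTypeR R -> measurableTypeR R).
  exact: oppr_measurable.
move=> s0 mA.
pose mum : {measure set (measurableTypeR R) -> \bar R} :=
  @measure_function_pushforward__canonical__measure_function_Measure _ _ _ _ _ leb _ mopp.
rewrite /normal_prob.
transitivity (\int[mum]_(x in A) (normal_pdf 0 s x)%:E)%E; last first.
  by apply: eq_measure_integral => B mB _; exact: lebesgue_oppr.
rewrite (ge0_integral_pushforward mopp leb mA).
- apply: eq_integral => x _ /=; congr (_%:E).
  by rewrite !normal_pdfE// /normal_fun !subr0 sqrrN.
- by apply/measurable_EFinP/measurable_funTS; exact: measurable_normal_pdf.
- by move=> x _; rewrite lee_fin normal_pdf_ge0.
Qed.

(** Half of the Gaussian exponent is split off and the other half is absorbed into the density of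
    variance [2 * s ^+ 2]. Moment and tail bounds thus reduce to pointwise bounds integrated against
    a probability density. *)
Lemma normal_pdf_spread (s z : R) : 0 < s ->
  normal_pdf 0 s z <= 2 * expR (- (z ^+ 2 / (4 * s ^+ 2))) * normal_pdf 0 (Num.sqrt 2 * s) z.
Proof.
move=> s0; have s20 : 0 < Num.sqrt 2 * s by rewrite mulr_gt0// sqrtr_gt0.
rewrite !normal_pdfE ?gt_eqF// /normal_peak /normal_fun !subr0 !exprMn sqr_sqrtr//.
have -> : - z ^+ 2 / (s ^+ 2 *+ 2) = - (z ^+ 2 / (4 * s ^+ 2)) + - z ^+ 2 / (2 * s ^+ 2 *+ 2).
  by rewrite -[s ^+ 2 *+ 2]mulr_natr -[2 * s ^+ 2 *+ 2]mulr_natr; field; rewrite gt_eqF.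
rewrite expRD; set A := expR (- _); set B := expR _.
have AB0 : 0 < A * B by rewrite mulr_gt0 ?expR_gt0.
set p := (Num.sqrt (s ^+ 2 * pi *+ 2))^-1; set q := (Num.sqrt _)^-1.
have -> : 2 * A * (q * B) = 2 * q * (A * B) by ring.
rewrite ler_pM2r// /p /q.
have -> : 2 * s ^+ 2 * pi *+ 2 = 2 * (s ^+ 2 * pi *+ 2) by rewrite -mulrA mulrnAr.
rewrite [Num.sqrt (2 * _)]sqrtrM// invfM mulrA ler_peMl ?invr_ge0 ?sqrtr_ge0//.
have : Num.sqrt 2 <= 2 :> R.
  by rewrite -[leRHS]gtr0_norm// -sqrtr_sqr ler_sqrt// ?expr2; lra.
by move=> h; rewrite ler_pdivlMr ?sqrtr_gt0// mul1r.
Qed.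

Lemma normal_integral_le (s c : R) (D : set R) (F : R -> R) : 0 < s -> 0 <= c ->
  measurable D -> measurable_fun D F -> (forall z, D z -> 0 <= F z) ->
  (forall z, D z -> F z * (2 * expR (- (z ^+ 2 / (4 * s ^+ 2)))) <= c) ->
  (\int[N s]_(z in D) (F z)%:E <= c%:E)%E.
Proof.
move=> s0 c0 mD mF F0 Fc; rewrite integral_normal//; last first.
  exact/measurable_EFinP.
apply: (@le_trans _ _ (\int[leb]_(z in D) (c * normal_pdf 0 (Num.sqrt 2 * s) z)%:E)%E).
  apply: ge0_le_integral => //.
  - by move=> x Dx; rewrite mule_ge0// lee_fin ?F0// normal_pdf_ge0.
  - apply: emeasurable_funM; first exact/measurable_EFinP.
    by apply/measurable_EFinP/measurable_funTS; exact: measurable_normal_pdf.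
  - apply/measurable_EFinP/measurable_funM => //.
    by apply: measurable_funTS; exact: measurable_normal_pdf.
  - move=> x Dx; rewrite -EFinM lee_fin.
    rewrite (le_trans (ler_wpM2l (F0 _ Dx) (normal_pdf_spread x s0)))//.
    by rewrite mulrA ler_wpM2r ?normal_pdf_ge0// Fc.
under eq_integral do rewrite EFinM.
rewrite ge0_integralZl//; last 2 first.
- by apply/measurable_EFinP/measurable_funTS; exact: measurable_normal_pdf.
- by move=> x _; rewrite lee_fin normal_pdf_ge0.
rewrite -[leRHS]mule1; apply: lee_wpmul2l; first by rewrite lee_fin.
exact: (@probability_le1 _ _ _ (N (Num.sqrt 2 * s)) D).
Qed.

Lemma normal_second_moment (s : R) (D : set R) : 0 < s -> measurable D ->
  (\int[N s]_(z in D) (z ^+ 2)%:E <= (8 * s ^+ 2)%:E)%E.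
Proof.
move=> s0 mD; have s20 : 0 < 4 * s ^+ 2 by rewrite mulr_gt0// exprn_gt0.
apply: normal_integral_le => //.
- by rewrite mulr_ge0// sqr_ge0.
- by move=> z _; rewrite sqr_ge0.
- move=> z _; have := expR_ge1Dx (z ^+ 2 / (4 * s ^+ 2)).
  rewrite expRN => h; have e0 := expR_gt0 (z ^+ 2 / (4 * s ^+ 2)).
  rewrite mulrA ler_pdivrMr//.
  have : z ^+ 2 / (4 * s ^+ 2) <= expR (z ^+ 2 / (4 * s ^+ 2)) by lra.
  by rewrite ler_pdivrMr//; lra.
Qed.

(** The fourth power is what the discretisation needs: over about [delta^-1] steps of variance
    [delta], tails of order [delta ^+ 2 / rho ^+ 4] still add up to order [delta]. *)
Lemma normal_tail (s rho : R) : 0 < s -> 0 < rho ->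
  (N s [set z : R | rho <= `|z|]%R <= (128 * s ^+ 4 / rho ^+ 4)%:E)%E.
Proof.
move=> s0 r0.
have mD : measurable [set z : R | rho <= `|z|].
  rewrite (_ : mkset _ = (fun x : R => `|x|) @^-1` `[rho, +oo[); last first.
    by apply/seteqP; split => x /=; rewrite in_itv/= andbT.
  have mf : measurable_fun [set: R] (fun x : R => `|x|) by apply: measurableT_comp.
  by rewrite -[X in measurable X]setTI; exact: mf.
rewrite -[leLHS]mul1e -integral_cst//.
have s2 : 0 < s ^+ 2 by rewrite exprn_gt0.
have r2 : 0 < rho ^+ 2 by rewrite exprn_gt0.
apply: (@normal_integral_le s _ _ (fun=> 1)) => //.
  by have [h1 h2] := (ltW s0, ltW r0); rewrite divr_ge0 ?mulr_ge0// exprn_ge0.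
move=> z /= rz; rewrite mul1r.
pose x := rho ^+ 2 / (4 * s ^+ 2).
have x0 : 0 < x by rewrite divr_gt0// mulr_gt0.
have xz : x <= z ^+ 2 / (4 * s ^+ 2).
  by rewrite ler_pM2r ?invr_gt0 ?mulr_gt0// -[z ^+ 2]real_normK ?num_real// ler_sqr ?nnegrE// ltW.
apply: (@le_trans _ _ (2 * expR (- x))); first by rewrite ler_pM2l// ler_expR lerN2.
have e2 : (x / 2) ^+ 2 <= expR x.
  have -> : expR x = expR (x / 2) ^+ 2 by rewrite expr2 -expRD -splitr.
  have x2 : 0 <= x / 2 by rewrite divr_ge0// ltW.
  rewrite ler_sqr ?nnegrE ?expR_ge0 ?x2//.
  by have := expR_ge1Dx (x / 2); lra.
rewrite expRN (@le_trans _ _ (2 / (x / 2) ^+ 2))//.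
  by rewrite ler_pM2l// lef_pV2 ?posrE ?expR_gt0// exprn_gt0// divr_gt0.
rewrite /x; have -> : 2 / (rho ^+ 2 / (4 * s ^+ 2) / 2) ^+ 2 = 128 * s ^+ 4 / rho ^+ 4.
  by field; rewrite !gt_eqF.
by [].
Qed.

Lemma normal_itv_le (s a b : R) : 0 < s -> a <= b ->
  (N s `[a, b]%classic <= ((b - a) / s)%:E)%E.
Proof.
move=> s0 ab; rewrite /normal_prob.
apply: (@le_trans _ _ (\int[leb]_(z in `[a, b]) (s^-1)%:E)%E).
  apply: ge0_le_integral => //.
  - by move=> x _; rewrite lee_fin normal_pdf_ge0.
  - by apply/measurable_EFinP/measurable_funTS; exact: measurable_normal_pdf.
  - move=> x _; rewrite lee_fin (le_trans (normal_pdf_ub _ _ _)) ?gt_eqF//.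
    rewrite /normal_peak lef_pV2 ?posrE ?sqrtr_gt0//; last first.
      by rewrite pmulrn_lgt0// mulr_gt0 ?pi_gt0// exprn_gt0.
    rewrite -[leLHS]gtr0_norm// -sqrtr_sqr ler_sqrt; last first.
      by rewrite mulrn_wge0// mulr_ge0 ?pi_ge0// sqr_ge0.
    rewrite -[leRHS]mulr_natr -mulrA ler_peMr ?sqr_ge0//; have := pi_ge2 R; lra.
rewrite integral_cst//= lebesgue_measure_itv/= lte_fin.
case: ifP => ab'; first by rewrite -EFinD -EFinM mulrC.
by rewrite mule0 lee_fin divr_ge0 ?(ltW s0)// subr_ge0.
Qed.

Definition normal_m2 (s rho : R) : R :=
  fine (\int[N s]_(z in Iopen rho) (z ^+ 2)%:E).

Lemma normal_m2_bounds (s rho : R) : 0 < s ->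
  0 <= normal_m2 s rho <= 8 * s ^+ 2.
Proof.
move=> s0; have ge0 : (0 <= \int[N s]_(z in Iopen rho) (z ^+ 2)%:E)%E.
  by apply: integral_ge0 => z _; rewrite lee_fin sqr_ge0.
have le := @normal_second_moment s (Iopen rho) s0 (measurable_itv _).
rewrite /normal_m2 fine_ge0//= -lee_fin fineK//.
by rewrite ge0_fin_numE// (le_lt_trans le) ?ltry.
Qed.

Lemma bounded_integrable_normal (s rho : R) (f : R -> R) M :
  measurable_fun (Iopen rho) f ->
  (forall z, z \in `](- rho)%R, rho[%R -> `|f z| <= M) ->
  (N s).-integrable (Iopen rho) (EFin \o f).
Proof.
move=> mf fM; apply: measurable_bounded_integrable => //.
  by rewrite (le_lt_trans (probability_le1 _ _)) ?ltry.
by exists M; split; rewrite ?num_real// => x Mx z /= /fM /le_trans; apply; exact: ltW.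
Qed.

Lemma normal_odd_moment (s rho : R) : s != 0 ->
  (\int[N s]_(z in Iopen rho) z%:E = 0)%E.
Proof.
move=> s0.
have mopp : measurable_fun [set: measurableTypeR R] (-%R : measurableTypeR R -> measurableTypeR R).
  exact: oppr_measurable.
have iz : (N s).-integrable (Iopen rho) (EFin \o id).
  apply: (@bounded_integrable_normal _ _ _ rho) => // z.
  by rewrite in_itv/= => /andP[? ?]; rewrite ler_norml; apply/andP; split; apply: ltW.
have pre : -%R @^-1` (Iopen rho) = (Iopen rho) :> set R.
  by apply/seteqP; split => x /=; rewrite !in_itv/= ltrNr ltrNl opprK andbC.
pose X := (\int[N s]_(z in Iopen rho) z%:E)%E.
have XE : X = (- X)%E.
  pose mum : {measure set (measurableTypeR R) -> \bar R} :=
    @measure_function_pushforward__canonical__measure_function_Measure _ _ _ _ _ (N s) _ mopp.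
  transitivity (\int[mum]_(z in Iopen rho) z%:E)%E.
    by apply: eq_measure_integral => B mB _; apply/esym; exact: normal_oppr.
  rewrite integral_pushforward//=.
  - rewrite pre -integralN//=.
    by apply: integrable_add_def.
  - by rewrite pre; apply: eq_integrable (integrableN iz) => //= x _; rewrite EFinN.
have : X \is a fin_num by exact: integrable_fin_num.
rewrite -/X; move: XE; case: X => [r| |] //= [] r0 _; congr EFin; lra.
Qed.

(** One-dimensional Dynkin step: the linear term integrates to zero. *)
Lemma normal_taylor (s rho a b c : R) (g : R -> R) : 0 < s -> 0 <= a ->
  measurable_fun (Iopen rho) g ->
  (forall z, z \in `](- rho)%R, rho[%R -> 0 <= g z <= a + b * z + c * z ^+ 2) ->
  (\int[N s]_(z in Iopen rho) (g z)%:E <= (a + c * normal_m2 s rho)%:E)%E.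
Proof.
move=> s0 a0 mg gle; set I := (Iopen rho).
have mI : measurable I by exact: measurable_itv.
have i1 : (N s).-integrable I (EFin \o cst a).
  by apply: (@bounded_integrable_normal _ _ _ `|a|).
have zr z : z \in `](- rho)%R, rho[%R -> `|z| <= rho.
  by rewrite in_itv/= => /andP[? ?]; rewrite ler_norml; apply/andP; split; apply: ltW.
have i2 : (N s).-integrable I (EFin \o id).
  by apply: (@bounded_integrable_normal _ _ _ rho).
have i3 : (N s).-integrable I (EFin \o (fun z => z ^+ 2)).
  apply: (@bounded_integrable_normal _ _ _ (rho ^+ 2)) => // z /zr h.
  by rewrite normrX lerXn2r// nnegrE// (le_trans _ h).
apply: (@le_trans _ _ (\int[N s]_(z in I) (a%:E + b%:E * z%:E + c%:E * (z ^+ 2)%:E))%E).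
  apply: ge0_le_integral => //.
  - by move=> z /gle /andP[]; rewrite lee_fin.
  - exact/measurable_EFinP.
  - apply/measurable_EFinP; apply: measurable_funD; first apply: measurable_funD => //.
    exact: measurable_funM.
  - by move=> z /gle /andP[_]; rewrite -!EFinM -!EFinD lee_fin.
rewrite integralD//=; last 2 first.
- by apply: integrableD => //; exact: integrableZl.
- exact: integrableZl.
rewrite integralD//=; last exact: integrableZl.
rewrite !integralZl// normal_odd_moment ?gt_eqF// mule0 adde0 integral_cst//=.
rewrite EFinD; apply: leeD.
  by rewrite -[leRHS]mule1 lee_wpmul2l ?lee_fin// probability_le1.
rewrite EFinM /normal_m2 fineK//.
exact: integrable_fin_num.
Qed.

End gauss.

(** * Brownian motion sampled at discrete times *)

Section increments.
Context {R : realType} {d : nat} {disp : measure_display} {T : measurableType disp}.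
Context (P : probability T R) (z : 'rV[R]_d) (W : R -> T -> 'rV[R]_d).
Context (BM : brownian_motion P z W) (delta : R) (delta0 : 0 < delta).
Local Notation e := (basis_vec R d).
Local Notation N := (@normal_prob R 0 (Num.sqrt delta)).

Definition walk (j : nat) (w : T) : 'rV[R]_d := W (j%:R * delta) w.

Definition incr (j : nat) (c : 'I_d) (w : T) : R := (walk j.+1 w - walk j w) 0 c.

(** Lexicographic order of the pairs (time step, coordinate). The increments are revealed one real
    number at a time, and [past_cyl j c] is a pi-system for what is known just before coordinate [c]
    of step [j]. *)
Definition earlier (j c j' c' : nat) : bool := (j' < j)%N || ((j' == j) && (c' < c)%N).

Definition past_cyl (j c : nat) : set (set T) :=
  [set E | exists2 A : nat -> 'I_d -> set (measurableTypeR R),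
    (forall j' c', measurable (A j' c')) &
    E = [set w | forall j' (c' : 'I_d), earlier j c j' c' -> A j' c' (incr j' c' w)]].

Lemma measurable_walk j : measurable_fun setT (walk j : T -> borel_rV R d).
Proof. by have [_ [_ [H _]]] := BM; apply: H; rewrite mulr_ge0// ltW. Qed.

Lemma measurable_walk_coord j c : measurable_fun setT (fun w => walk j w 0 c).
Proof. exact: (measurableT_comp (measurable_coord c) (@measurable_walk j)). Qed.

Lemma measurable_incr j c : measurable_fun setT (incr j c).
Proof.
rewrite (_ : incr j c = (fun w => walk j.+1 w 0 c - walk j w 0 c)); last first.
  by apply/funext => w; rewrite /incr !mxE.
by apply: measurable_funB; exact: measurable_walk_coord.
Qed.

Lemma past_cyl_measurable j c : past_cyl j c `<=` measurable.
Proof.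
move=> _ [A mA ->].
rewrite (_ : mkset _ = \bigcap_j' \bigcap_(c' in [set: 'I_d])
   (if earlier j c j' c' then incr j' c' @^-1` A j' c' else setT)); last first.
  apply/seteqP; split => w H.
    by move=> j' _ c' _; case: ifPn => // /H.
  by move=> j' c' jc; have := H j' I c' I; rewrite jc.
apply: bigcapT_measurable => j'; apply: fin_bigcap_measurable => // c' _.
by case: ifPn => // _; rewrite -[X in measurable X]setTI; exact: (@measurable_incr j' c' measurableT _ (mA j' c')).
Qed.

Lemma past_cylI j c : setI_closed (past_cyl j c).
Proof.
move=> _ _ [A mA ->] [B mB ->].
exists (fun j' c' => A j' c' `&` B j' c'); first by move=> *; exact: measurableI.
apply/seteqP; split => w /=.
  by move=> [HA HB] j' c' jc; split; [exact: HA|exact: HB].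
by move=> H; split => j' c' /H[].
Qed.

Lemma past_cylT j c : past_cyl j c setT.
Proof. by exists (fun _ _ => setT) => //; apply/seteqP; split. Qed.

Lemma incr_law m (A : nat -> 'I_d -> set (measurableTypeR R)) :
  (forall j c, measurable (A j c)) ->
  P [set w | forall (j : 'I_m) c, A j c (incr j c w)] =
  (\prod_(j < m) \prod_(c < d) N (A j c))%E.
Proof.
move=> mA; have [_ [_ [_ H]]] := BM.
have := H m (fun j => j%:R * delta) A; rewrite mul0r lexx => /(_ isT).
have lt j : (j < m)%N -> j%:R * delta < j.+1%:R * delta.
  by move=> _; rewrite ltr_pM2r// ltr_nat.
move=> /(_ lt mA) ->; apply: eq_bigr => j _; apply: eq_bigr => c _.
by rewrite -mulrBl -natr1 [_ + 1]addrC addrK mul1r.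
Qed.

Lemma incr_indep_cyl j (c : 'I_d) (E : set T) (B : set (measurableTypeR R)) :
  past_cyl j c E -> measurable B -> P (E `&` incr j c @^-1` B) = (P E * N B)%E.
Proof.
move=> [A mA ->] mB.
pose A1 (X : set (measurableTypeR R)) (j' : nat) (c' : 'I_d) := if earlier j c j' c' then A j' c' else
  if (j' == j) && (c' == c) then X else setT.
have mA1 X : measurable X -> forall j' c', measurable (A1 X j' c').
  by move=> mX j' c'; rewrite /A1; case: ifP => // _; case: ifP.
have setE X : [set w | forall j' (c' : 'I_d), earlier j c j' c' -> A j' c' (incr j' c' w)]
    `&` incr j c @^-1` X = [set w | forall (j' : 'I_j.+1) c', A1 X j' c' (incr j' c' w)].
  apply/seteqP; split => w /=.
    move=> [H1 H2] j' c'; rewrite /A1; case: ifPn => [/H1//|_].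
    by case: ifPn => // /andP[/eqP -> /eqP ->].
  move=> H; split.
    move=> j' c' jc.
    have jj : (j' < j.+1)%N.
      by move: jc => /orP[/ltnW//|/andP[/eqP ->]].
    by have := H (Ordinal jj) c'; rewrite /A1 jc.
  have := H ord_max c; rewrite /A1 /= /earlier ltnn eqxx ltnn/= eqxx.
  by [].
rewrite (setE B) -[X in (P X * _)%E](setIT _) -(preimage_setT (incr j c)) (setE setT).
rewrite !incr_law//; [|exact: mA1|exact: mA1].
have E1 X : measurable X -> (\prod_(j' < j.+1) \prod_(c' < d) N (A1 X j' c') =
   (\prod_(j' < j) \prod_(c' < d) N (A j' c')) *
   (N X * \prod_(c' < d | c' != c) N (A1 setT j c')))%E.
  move=> mX; rewrite big_ord_recr/=; congr (_ * _)%E.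
    apply: eq_bigr => j' _; apply: eq_bigr => c' _.
    by rewrite /A1 /earlier ltn_ord.
  rewrite (bigD1 c)//=; congr (_ * _)%E.
    by rewrite /A1 /earlier ltnn eqxx ltnn/= eqxx.
  apply: eq_bigr => c' /negbTE cc; by rewrite /A1 cc andbF.
rewrite !E1// probability_setT mul1e; rewrite -!muleA; congr (_ * _)%E.
by rewrite muleC.
Qed.

(** Both sides are finite measures in [E] that agree on the pi-system of cylinders. *)
Lemma incr_indep j (c : 'I_d) (E : set T) (B : set (measurableTypeR R)) :
  <<s past_cyl j c >> E -> measurable B ->
  P (E `&` incr j c @^-1` B) = (P E * N B)%E.
Proof.
move=> FE mB.
have mZ : measurable (incr j c @^-1` B).
  by rewrite -[X in measurable X]setTI; exact: measurable_incr.
have fNB : N B \is a fin_num.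
  by rewrite ge0_fin_numE// (le_lt_trans (probability_le1 _ _))// ltry.
pose r : {nonneg R} := NngNum (fine_ge0 (measure_ge0 N B)).
have H : mrestr P mZ E = mscale r P E; last first.
  by move: H; rewrite /mrestr /mscale /= fineK// => ->; rewrite muleC.
apply: (@g_sigma_algebra_measure_unique _ R T (past_cyl j c) (@past_cyl_measurable j c)
  (fun=> setT) (fun=> @past_cylT j c) _ (mrestr P mZ) (mscale r P) (@past_cylI j c) _ _ E FE).
- by apply/seteqP; split => // w _; exists 0%N.
- move=> A cA; have := incr_indep_cyl cA mB; rewrite muleC.
  by rewrite -[N B in X in X -> _]fineK.
- by move=> k; rewrite /mrestr (le_lt_trans (probability_le1 _ _)) ?ltry//; apply: measurableI.
Qed.

(** * Integrating out one increment given the past *)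

Section fubini.
Context (j : nat) (c : 'I_d).
Local Notation TF := (g_sigma_algebraType (past_cyl j c)).

Lemma past_sub_measurable (E : set T) : <<s past_cyl j c >> E -> measurable E.
Proof. by move: E; apply: smallest_sub; [exact: sigma_algebra_measurable|exact: past_cyl_measurable]. Qed.

Lemma measurable_to_past : measurable_fun setT (id : T -> TF).
Proof. by move=> _ Y mY; rewrite setTI; exact: past_sub_measurable. Qed.

Lemma past_measurable_fun d' (U : measurableType d') (f : T -> U) :
  measurable_fun setT (f : TF -> U) -> measurable_fun setT f.
Proof.
move=> mf _ Y mY; apply: past_sub_measurable.
by have := mf measurableT Y mY.
Qed.

Let idF : {mfun T >-> TF} := HB.pack (id : T -> TF)
  (isMeasurableFun.Build _ _ _ _ (id : T -> TF) measurable_to_past).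

Let pairF (w : T) : TF * measurableTypeR R := (w, incr j c w).

Let mpairF : measurable_fun setT pairF.
Proof. apply: measurable_fun_pair; [exact: measurable_to_past|exact: measurable_incr]. Qed.

(** The first factor of the product space is [T] itself with the sigma-algebra of the past, so [f]
    may depend on the past in any measurable way; independence says that the pair has a product
    law. *)
Lemma incr_fubini (f : TF * measurableTypeR R -> \bar R) :
  measurable_fun setT f -> (forall x, 0 <= f x)%E ->
  (\int[P]_w f (w, incr j c w) = \int[P]_w \int[N]_x f (w, x))%E.
Proof.
move=> mf f0.
pose PF : probability TF R := distribution P idF.
pose mum : {measure set (TF * measurableTypeR R) -> \bar R} :=
  @measure_function_pushforward__canonical__measure_function_Measure _ _ _ _ _ P _ mpairF.
transitivity (\int[mum]_x f x)%E.
  by rewrite ge0_integral_pushforward//; apply: mpairF.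
transitivity (\int[(PF \x N)%E]_x f x)%E.
  apply: eq_measure_integral => X mX _; apply/esym/product_measure_unique => //.
  move=> A B mA mB.
  transitivity (P (A `&` incr j c @^-1` B)); last exact: incr_indep.
  by rewrite /mum/= /pushforward; congr (P _); apply/seteqP; split.
rewrite fubini_tonelli1//.
rewrite /PF /distribution ge0_integral_pushforward//.
- exact: measurable_fun_fubini_tonelli_F.
- by move=> x _; exact: integral_ge0.
Qed.

Lemma past_measurable_incr (j' : nat) (c' : 'I_d) : earlier j c j' c' ->
  measurable_fun setT (incr j' c' : TF -> R).
Proof.
move=> jc _ B mB; rewrite setTI; apply: sub_sigma_algebra.
exists (fun j1 c1 => if (j1 == j') && (c1 == c') then B else setT).
  by move=> j1 c1; case: ifP.
apply/seteqP; split => w /= H.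
  by move=> j1 c1 _; case: ifPn => // /andP[/eqP -> /eqP ->].
by have := H _ _ jc; rewrite !eqxx.
Qed.

Lemma past_measurable_walk i : (i <= j)%N ->
  measurable_fun setT (walk i : TF -> borel_rV R d).
Proof.
move=> ij; apply: measurable_fun_rV => c'.
elim: i ij => [_|i IH ij].
  rewrite (_ : (fun w => walk 0 w 0 c') = cst (z 0 c')); first exact: measurable_cst.
  by apply/funext => w; rewrite /walk mul0r; have [-> _] := BM.
rewrite (_ : (fun w => walk i.+1 w 0 c') = (fun w => walk i w 0 c' + incr i c' w)).
  apply: measurable_funD; first by apply: IH; exact: ltnW.
  by apply: past_measurable_incr; rewrite /earlier ij.
by apply/funext => w; rewrite /incr !mxE addrCA subrr addr0.
Qed.

(** The past is frozen and one real increment is integrated out: the linear term of the Taylor bound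
    vanishes by symmetry and the quadratic one becomes the truncated second moment. [Rf] carries the
    terms of the coordinates still to be revealed. *)
Lemma peel (rho : R) (A : set T) (vt : 'rV[R]_d -> R) (Y : T -> 'rV[R]_d)
    (Rf a b k out : T -> R) :
  <<s past_cyl j c >> A ->
  measurable_fun setT (vt : borel_rV R d -> R) ->
  measurable_fun setT (Y : TF -> borel_rV R d) ->
  measurable_fun setT (Rf : TF -> R) -> measurable_fun setT out ->
  (forall w, A w -> forall x, x \in `](- rho), rho[%R ->
     0 <= vt (Y w + x *: e c) + Rf w <= a w + b w * x + k w * x ^+ 2) ->
  (forall w, A w -> 0 <= a w /\ a w + k w * normal_m2 (Num.sqrt delta) rho <= out w) ->
  (forall w, A w -> 0 <= out w) ->
  (\int[P]_w (\1_(A `&` [set w | `|incr j c w| < rho]) w *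
      (vt (Y w + incr j c w *: e c) + Rf w))%:E <=
   \int[P]_w (\1_A w * out w)%:E)%E.
Proof.
move=> FA mvt mY mRf mout Hb Ha Hout.
have s0 : 0 < Num.sqrt delta by rewrite sqrtr_gt0.
pose I : set R := `](- rho), rho[%classic.
pose f (p : TF * measurableTypeR R) : \bar R :=
  (\1_A p.1 * \1_I p.2 * (vt (Y p.1 + p.2 *: e c) + Rf p.1))%:E.
have mYx : measurable_fun setT (fun p : TF * measurableTypeR R => Y p.1 + p.2 *: e c : borel_rV R d).
  apply: measurable_fun_rV => i.
  rewrite (_ : (fun _ => _) = (fun p : TF * measurableTypeR R => Y p.1 0 i + p.2 * (e c) 0 i)).
    apply: measurable_funD.
      apply: (measurableT_comp (measurable_coord i)).
      exact: (measurableT_comp mY measurable_fst).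
    by apply: measurable_funM => //; exact: measurable_snd.
  by apply/funext => p; rewrite !mxE.
have mf : measurable_fun setT f.
  apply/measurable_EFinP; apply: measurable_funM.
    apply: measurable_funM.
      by apply: (measurableT_comp _ measurable_fst); exact: measurable_indic.
    apply: (measurableT_comp _ measurable_snd).
    exact: (@measurable_indic _ (measurableTypeR R) R _ _ (measurable_itv _)).
  apply: measurable_funD; first exact: (measurableT_comp mvt mYx).
  exact: (measurableT_comp mRf measurable_fst).
have f0 p : (0 <= f p)%E.
  rewrite lee_fin !indicE; case: (boolP (p.1 \in A)) => /= [|_]; last by rewrite !mul0r.
  case: (boolP (p.2 \in I)) => /= [|_]; last by rewrite mulr0 mul0r.
  rewrite !inE => /Hb H /H; rewrite mulr1 mul1r.
  by move=> /andP[].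
have -> : (\int[P]_w (\1_(A `&` [set w | `|incr j c w| < rho]) w *
      (vt (Y w + incr j c w *: e c) + Rf w))%:E = \int[P]_w f (w, incr j c w))%E.
  apply: eq_integral => w _; rewrite /f/= !indicE in_setI; congr (_ * _)%:E.
  rewrite -natrM mulnb; congr (_ && _)%:R.
  by apply/idP/idP; rewrite !inE /I /= in_itv/= ltr_norml.
rewrite incr_fubini//; apply: ge0_le_integral => //.
- by move=> w _; apply: integral_ge0.
- apply: (@past_measurable_fun _ _ (fun w => \int[N]_x f (w, x))%E).
  exact: measurable_fun_fubini_tonelli_F.
- apply/measurable_EFinP/measurable_funM => //; apply: measurable_indic.
  exact: past_sub_measurable.
move=> w _; rewrite /f/= indicE; case: (boolP (w \in A)) => [|_] /=; last first.
  by rewrite mul0r integral0_eq// => x _; rewrite !mul0r.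
rewrite inE => Aw; rewrite mul1r.
rewrite (_ : (fun x => _) = (EFin \o (fun x => vt (Y w + x *: e c) + Rf w)) \_ I); last first.
  by apply/funext => x; rewrite patchE indicE; case: ifP => _; rewrite /= mul1r ?mul1r ?mul0r.
rewrite -integral_mkcond.
have [a0 le] := Ha w Aw.
apply: (@le_trans _ _ (a w + k w * normal_m2 (Num.sqrt delta) rho)%:E); last by rewrite lee_fin.
apply: (@normal_taylor _ _ _ _ (b w)) => //; last exact: Hb.
apply: measurable_funTS; apply: measurable_funD => //.
apply: (measurableT_comp mvt); apply: measurable_fun_rV => i.
rewrite (_ : (fun _ => _) = (fun x : R => Y w 0 i + x * (e c) 0 i)).
  by apply: measurable_funD => //; apply: measurable_funM.
by apply/funext => x; rewrite !mxE.
Qed.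

End fubini.

(** * One time step of the stopped walk *)

Section step.
Context (D : set 'rV[R]_d) (vt : 'rV[R]_d -> R) (g kappa : 'I_d -> 'rV[R]_d -> R).
Context (rho H eps M : R).
Context (mD : measurable (D : set (borel_rV R d))).
Context (mvt : measurable_fun setT (vt : borel_rV R d -> R)).
Context (mkappa : forall c, measurable_fun setT (kappa c : borel_rV R d -> R)).
Context (rho0 : 0 < rho) (M0 : 0 <= M) (eps0 : 0 <= eps).
Context (vtM : forall x, 0 <= vt x <= M).
Context (vt_taylor : forall x y c (s : R), D x -> `|y - x| < rho -> `|s| < rho ->
  vt (y + s *: e c) <= vt y + g c y * s + 2^-1 * kappa c x * s ^+ 2).
Context (vt_lower : forall x y, D x -> `|y - x| < 2 * rho -> 4 * delta * d%:R * H <= vt y).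
Context (kappaH : forall x c, D x -> `|kappa c x| <= H).
Context (kappa_eps : forall x, D x -> \sum_c kappa c x <= eps).

Definition alive (j : nat) : set T := [set w | forall i, (i <= j)%N -> D (walk i w)].

Lemma alive_past j (c : 'I_d) : <<s past_cyl j c >> (alive j).
Proof.
have -> : alive j = \bigcap_(i in [set i | (i <= j)%N]) (walk i @^-1` D) by [].
apply: (@fin_bigcap_measurable _ (g_sigma_algebraType (past_cyl j c)) _ _ (fun i => walk i @^-1` D)).
  by apply: (sub_finite_set _ (finite_II j.+1)) => i.
move=> i /= ij; have := @past_measurable_walk j c i ij measurableT _ mD.
by rewrite setTI.
Qed.

Definition partial_step (j c : nat) (w : T) : 'rV[R]_d :=
  walk j w + \sum_(c' < d | (c' < c)%N) incr j c' w *: e c'.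

Lemma partial_step0 j w : partial_step j 0 w = walk j w.
Proof. by rewrite /partial_step big_pred0 ?addr0. Qed.

Lemma partial_stepS j (c : 'I_d) w :
  partial_step j c.+1 w = partial_step j c w + incr j c w *: e c.
Proof.
rewrite /partial_step -addrA; congr (_ + _).
rewrite (bigD1 c)//= addrC; congr (_ + _); apply: eq_bigl => c'.
by rewrite ltnS [RHS]ltn_neqAle andbC.
Qed.

Lemma partial_step_d j w : partial_step j d w = walk j.+1 w.
Proof.
apply/rowP => i; rewrite !mxE summxE (bigD1 i)//= !mxE !eqxx mulr1 big1 ?addr0.
  by rewrite /incr !mxE addrCA subrr addr0.
by move=> c /andP[_ /negbTE ci]; rewrite !mxE eq_sym ci mulr0.
Qed.

Definition small_incr (j c : nat) : set T :=
  [set w | forall c' : 'I_d, (c' < c)%N -> `|incr j c' w| < rho].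

Lemma small_incrS j (c : 'I_d) :
  small_incr j c.+1 = small_incr j c `&` [set w | `|incr j c w| < rho].
Proof.
apply/seteqP; split => w /=.
  by move=> Hw; split; [move=> c' cc; apply: Hw; exact: ltnW|exact: Hw].
move=> [H1 H2] c'; rewrite ltnS leq_eqVlt => /orP[/eqP/val_inj ->//|]; exact: H1.
Qed.

Lemma small_incr_past j (c : 'I_d) : <<s past_cyl j c >> (small_incr j c).
Proof.
have -> : small_incr j c = \bigcap_(c' in [set c' : 'I_d | (c' < c)%N])
   ((incr j c') @^-1` `](- rho)%R, rho[%classic).
  by apply/seteqP; split => w Hw c' /= cc; have := Hw c' cc;
    rewrite /= ltr_norml in_itv.
apply: (@fin_bigcap_measurable _ (g_sigma_algebraType (past_cyl j c)) _ _
  (fun c' => (incr j c') @^-1` `](- rho)%R, rho[%classic)); first exact: finite_finset.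
move=> c' /= cc; have H1 : earlier j c j c' by rewrite /earlier eqxx cc orbT.
have := @past_measurable_incr j c j c' H1 measurableT _ (measurable_itv `](- rho)%R, rho[).
by rewrite setTI.
Qed.

Lemma partial_step_close j (c : nat) w : small_incr j c w -> `|partial_step j c w - walk j w| < rho.
Proof.
move=> Hs; rewrite /partial_step addrC addKr; apply: norm_lt_coord => // i.
rewrite summxE; case: (ltnP i c) => ic; last first.
  rewrite big1 ?normr0// => c' cc; rewrite !mxE.
  case: (eqVneq i c') => [ic'|_]; last by rewrite andbF mulr0.
  by move: cc; rewrite -ic' ltnNge ic.
rewrite (bigD1 i)//= !mxE !eqxx mulr1 big1 ?addr0; first exact: Hs.
by move=> c' /andP[_ /negbTE ci]; rewrite !mxE eq_sym ci mulr0.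
Qed.

Lemma past_partial_step j (c : 'I_d) : measurable_fun setT
  (partial_step j c : g_sigma_algebraType (past_cyl j c) -> borel_rV R d).
Proof.
apply: measurable_fun_rV => i.
rewrite (_ : (fun _ => _) = (fun w => walk j w 0 i +
   \sum_(c' < d) (if (c' < c)%N then incr j c' w * (e c') 0 i else 0))); last first.
  apply/funext => w; rewrite mxE summxE big_mkcond/=; congr (_ + _).
  by apply: eq_bigr => c' _; case: ifP => // _; rewrite !mxE.
apply: measurable_funD.
  have m1 := @past_measurable_walk j c j (leqnn j).
  exact: (measurableT_comp (measurable_coord i) m1).
apply: measurable_sum => c'; case: (boolP (c' < c)%N) => cc; last exact: measurable_cst.
apply: measurable_funM; last exact: measurable_cst.
by apply: past_measurable_incr; rewrite /earlier eqxx cc orbT.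
Qed.

Local Notation m2 := ( normal_m2 (Num.sqrt delta) rho).

Lemma m2_bounds : 0 <= m2 <= 8 * delta.
Proof.
have := @normal_m2_bounds R (Num.sqrt delta) rho; rewrite sqrtr_gt0 => /(_ delta0).
by rewrite sqr_sqrtr// ltW.
Qed.

(** Second-order terms of the coordinates not yet revealed. The single [kappa c'] may be positive
    and only their sum is small, so all of them are frozen at the start of the step and kept until
    the step is complete. *)
Definition remaining (j c : nat) (w : T) : R :=
  \sum_(c' < d | (c <= c')%N) 2^-1 * m2 * kappa c' (walk j w).

Lemma remainingS j (c : 'I_d) w :
  remaining j c w = 2^-1 * kappa c (walk j w) * m2 + remaining j c.+1 w.
Proof.
rewrite /remaining (bigD1 c)//=; congr (_ + _); first by rewrite mulrAC.
by apply: eq_bigl => c'; rewrite ltn_neqAle andbC eq_sym.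
Qed.

Lemma remaining_bound j c w : D (walk j w) -> `|remaining j c w| <= 4 * delta * d%:R * H.
Proof.
move=> Dw; have H0 : forall c : 'I_d, 0 <= H by move=> c0; exact: le_trans (normr_ge0 _) (kappaH c0 Dw).
apply: (le_trans (ler_norm_sum _ _ _)); rewrite big_mkcond/=.
apply: (@le_trans _ _ (\sum_(c' < d) 4 * delta * H)); last first.
  by rewrite sumr_const card_ord -[_ *+ _]mulr_natr mulrAC.
apply: ler_sum => c' _; case: ifP => _; last first.
  by rewrite !mulr_ge0// ?(ltW delta0)//; exact: H0 c'.
have /andP[h1 h2] := m2_bounds.
rewrite normrM ger0_norm ?mulr_ge0//; apply: ler_pM => //; first by rewrite mulr_ge0.
  by move: (m2) h2 => q h2; clear H0; lra.
exact: kappaH.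
Qed.

Lemma past_remaining j (c : 'I_d) c1 : measurable_fun setT
  (remaining j c1 : g_sigma_algebraType (past_cyl j c) -> R).
Proof.
rewrite (_ : remaining j c1 = (fun w => \sum_(c' < d)
   (if (c1 <= c')%N then 2^-1 * m2 * kappa c' (walk j w) else 0))); last first.
  by apply/funext => w; rewrite /remaining big_mkcond.
apply: measurable_sum => c'; case: (boolP (c1 <= c')%N) => cc; last exact: measurable_cst.
apply: measurable_funM; first exact: measurable_cst.
have m1 := @past_measurable_walk j c j (leqnn j).
exact: (measurableT_comp (@mkappa c') m1).
Qed.

Lemma peel_step j (c : 'I_d) :
  (\int[P]_w (\1_(alive j `&` small_incr j c.+1) w *
      (vt (partial_step j c.+1 w) + remaining j c.+1 w))%:E <=
   \int[P]_w (\1_(alive j `&` small_incr j c) w *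
      (vt (partial_step j c w) + remaining j c w))%:E)%E.
Proof.
rewrite small_incrS setIA.
under eq_integral do rewrite partial_stepS.
(* The margin in [vt_lower] exceeds the second-order terms, so only nonnegative functions are ever
   integrated. *)
have ge0 w y (c1 : nat) : D (walk j w) -> `|y - walk j w| < 2 * rho -> 0 <= vt y + remaining j c1 w.
  move=> Dw yw; have := vt_lower Dw yw; have := remaining_bound c1 Dw.
  rewrite ler_norml => /andP[]; lra.
have close w : (alive j `&` small_incr j c) w ->
  D (walk j w) /\ `|partial_step j c w - walk j w| < rho.
  by move=> [Aw /partial_step_close]; split => //; exact: Aw.
have rho2 : rho < 2 * rho by rewrite -[ltLHS]mul1r ltr_pM2r// ltr1n.
apply: (@peel j c rho _ vt _ _ (fun w => vt (partial_step j c w) + remaining j c.+1 w)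
  (fun w => g c (partial_step j c w)) (fun w => 2^-1 * kappa c (walk j w))).
- apply: (@measurableI _ (g_sigma_algebraType (past_cyl j c))); first exact: alive_past.
  exact: small_incr_past.
- exact: mvt.
- exact: past_partial_step.
- exact: past_remaining.
- apply: (@past_measurable_fun j c); apply: measurable_funD; last exact: past_remaining.
  exact: (measurableT_comp mvt (@past_partial_step j c)).
- move=> w /close[Dw Yw] x xI.
  have xr : `|x| < rho by move: xI; rewrite in_itv/= ltr_norml.
  apply/andP; split.
    apply: ge0 => //; rewrite addrAC; apply: (le_lt_trans (ler_normD _ _)).
    rewrite normrZ norm_basis_vec mulr1; move: (normr_ge0 x) Yw xr.
    set q := `|x|; set q' := `|_ - _|; lra.
  have := vt_taylor c Dw Yw xr; lra.
- move=> w /close[Dw Yw]; split.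
    by apply: ge0 => //; exact: lt_trans Yw rho2.
  by rewrite remainingS; lra.
- by move=> w /close[Dw Yw]; apply: ge0 => //; exact: lt_trans Yw rho2.
Qed.

(** The drift left by the approximate superharmonicity, plus the bound [M] times the probability
    that some coordinate moves by [rho] or more. *)
Definition step_error := 4 * delta * eps + M * d%:R * (128 * delta ^+ 2 / rho ^+ 4).

Lemma measurable_alive j : measurable (alive j).
Proof.
have -> : alive j = \bigcap_(i in [set i | (i <= j)%N]) (walk i @^-1` D) by [].
apply: fin_bigcap_measurable; first by apply: (sub_finite_set _ (finite_II j.+1)) => i.
by move=> i _; rewrite -[X in measurable X]setTI; exact: (@measurable_walk i measurableT _ mD).
Qed.

Lemma measurable_small_incr j c : measurable (small_incr j c).
Proof.
have -> : small_incr j c = \bigcap_(c' in [set c' : 'I_d | (c' < c)%N])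
   ((incr j c') @^-1` `](- rho)%R, rho[%classic).
  by apply/seteqP; split => w Hw c' /= cc; have := Hw c' cc;
    rewrite /= ltr_norml in_itv.
apply: fin_bigcap_measurable; first exact: finite_finset.
move=> c' /= cc; rewrite -[X in measurable X]setTI.
exact: (@measurable_incr j c' measurableT _ (measurable_itv _)).
Qed.

Lemma small_incr_tail j (c : nat) : (c <= d)%N ->
  (P (~` small_incr j c) <= (c%:R * (128 * delta ^+ 2 / rho ^+ 4))%:E)%E.
Proof.
have s0 : 0 < Num.sqrt delta by rewrite sqrtr_gt0.
elim: c => [_|c IH cd].
  have -> : small_incr j 0 = setT by apply/seteqP; split.
  by rewrite setCT measure0 mul0r.
rewrite -[c.+1]/(Ordinal cd).+1 small_incrS setCI.
have mB : measurable [set x : R | rho <= `|x|].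
  rewrite (_ : mkset _ = (fun x : R => `|x|) @^-1` `[rho, +oo[); last first.
    by apply/seteqP; split => x /=; rewrite in_itv/= andbT.
  have mf : measurable_fun [set: R] (fun x : R => `|x|) by apply: measurableT_comp.
  by rewrite -[X in measurable X]setTI; exact: mf.
have -> : ~` [set w | `|incr j (Ordinal cd) w| < rho] =
  setT `&` incr j (Ordinal cd) @^-1` [set x : R | rho <= `|x|].
  by rewrite setTI; apply/seteqP; split => w /=; [move/negP; rewrite -leNgt|move=> ?; apply/negP; rewrite -leNgt].
have mI : measurable (setT `&` incr j (Ordinal cd) @^-1` [set x : R | rho <= `|x|]).
  exact: (@measurable_incr j (Ordinal cd) measurableT _ mB).
apply: (le_trans (measureU2 _ _ _)) => //.
  by apply: measurableC; exact: measurable_small_incr.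
rewrite -natr1 mulrDl mul1r EFinD; apply: leeD; first by apply: IH; exact: ltnW.
apply: (le_trans (y := (P setT * N [set x : R | (rho <= `|x|)%R])%E)).
  by rewrite le_eqVlt; apply/orP; left; apply/eqP; exact: (@incr_indep_cyl j (Ordinal cd) setT _ (past_cylT _ _) mB).
rewrite [X in (X * _)%E]probability_setT mul1e.
have := @normal_tail R _ _ s0 rho0; rewrite -[4%N]/(2 * 2)%N exprM sqr_sqrtr ?(ltW delta0)//.
Qed.

(** On paths with small increments [peel_step] is iterated from the last coordinate back to the
    first, where the sum of the [kappa] is at most [eps]. Other paths, for which the Taylor bound
    fails, are charged the bound [M]. *)
Lemma step_le j :
  (\int[P]_w (\1_(alive j) w * vt (walk j.+1 w))%:E <=
   \int[P]_w (\1_(alive j) w * vt (walk j w))%:E + step_error%:E)%E.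
Proof.
have mA := measurable_alive j; have mG := measurable_small_incr j d.
have mvw i : measurable_fun setT (fun w => vt (walk i w)).
  exact: (measurableT_comp mvt (@measurable_walk i)).
have mI B : measurable B -> measurable_fun setT (\1_B : T -> R).
  exact: measurable_indic.
have vt0 x : 0 <= vt x by have /andP[] := vtM x.
have tail := small_incr_tail j (leqnn d).
set tl := (_ / _) in tail.
have iter c : (c <= d)%N -> (\int[P]_w (\1_(alive j `&` small_incr j c) w *
      (vt (partial_step j c w) + remaining j c w))%:E <=
   \int[P]_w (\1_(alive j) w * vt (walk j w))%:E + (4 * delta * eps)%:E)%E.
  elim: c => [_|c IH cd]; last first.
    exact: le_trans (peel_step j (Ordinal cd)) (IH (ltnW cd)).
  have sm0 : small_incr j 0 = setT by apply/seteqP; split.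
  rewrite sm0 setIT.
  have e4 : 0 <= 4 * delta * eps by rewrite !mulr_ge0// ltW.
  apply: (@le_trans _ _ (\int[P]_w ((\1_(alive j) w * vt (walk j w))%:E + (4 * delta * eps)%:E))%E).
    apply: ge0_le_integral => //.
    - move=> w _; rewrite lee_fin indicE; case: (boolP (w \in alive j)) => [|_]; last by rewrite mul0r.
      rewrite inE mul1r partial_step0 => Aw; have Dw : D (walk j w) by exact: Aw.
      have := vt_lower (y := walk j w) Dw; rewrite subrr normr0 mulr_gt0// => /(_ isT).
      by have := remaining_bound 0 Dw; rewrite ler_norml => /andP[]; lra.
    - apply/measurable_EFinP; apply: measurable_funM; first exact: mI.
      apply: measurable_funD.
        under eq_fun do rewrite partial_step0.
        exact: mvw.
      apply: measurable_sum => c'; apply: measurable_funM; first exact: measurable_cst.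
      exact: (measurableT_comp (@mkappa c') (@measurable_walk j)).
    - apply/measurable_EFinP; apply: measurable_funD => //.
      by apply: measurable_funM; [exact: mI|exact: mvw].
    move=> w _; rewrite -EFinD lee_fin partial_step0 indicE; case: (boolP (w \in alive j)) => [|_]; last first.
      by rewrite !mul0r add0r.
    rewrite inE !mul1r lerD2l => Aw; have Dw : D (walk j w) by exact: Aw.
    have -> : remaining j 0 w = 2^-1 * m2 * \sum_c kappa c (walk j w) by rewrite mulr_sumr.
    have /andP[h1 h2] := m2_bounds.
    apply: (@le_trans _ _ (2^-1 * m2 * eps)).
      by apply: ler_wpM2l; [rewrite mulr_ge0|exact: kappa_eps].
    apply: ler_wpM2r => //; move: (m2) h2 => q h2; lra.
  rewrite ge0_integralD//.
  - by rewrite integral_cst// [X in (_ * X)%E]probability_setT mule1.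
  - by move=> w _; rewrite lee_fin mulr_ge0.
  - by apply/measurable_EFinP; apply: measurable_funM; [exact: mI|exact: mvw].
apply: (@le_trans _ _ (\int[P]_w ((\1_(alive j `&` small_incr j d) w * vt (walk j.+1 w))%:E +
    (M * \1_(~` small_incr j d) w)%:E))%E).
  apply: ge0_le_integral => //.
  - by move=> w _; rewrite lee_fin mulr_ge0.
  - by apply/measurable_EFinP; apply: measurable_funM; [exact: mI|exact: mvw].
  - apply/measurable_EFinP; apply: measurable_funD; apply: measurable_funM => //; last exact/mI/measurableC.
    by apply: mI; exact: measurableI.
  move=> w _; rewrite -EFinD lee_fin !indicE in_setI in_setC.
  have /andP[v0 vM] := vtM (walk j.+1 w).
  case: (w \in alive j) => /=; case: (w \in small_incr j d) => /=; lra.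
rewrite ge0_integralD//; first last.
- by apply/measurable_EFinP; apply: measurable_funM => //; exact/mI/measurableC.
- by move=> w _; rewrite lee_fin mulr_ge0.
- apply/measurable_EFinP; apply: measurable_funM; last exact: mvw.
  by apply: mI; exact: measurableI.
- by move=> w _; rewrite lee_fin mulr_ge0.
rewrite /step_error EFinD [leRHS]addeA; apply: leeD.
  have := iter d (leqnn d); apply: le_trans; rewrite le_eqVlt; apply/orP; left; apply/eqP; apply: eq_integral => w _.
  rewrite partial_step_d; congr (_ * _)%:E.
  by rewrite /remaining big_pred0 ?addr0// => c'; rewrite leqNgt ltn_ord.
under eq_integral do rewrite EFinM.
rewrite ge0_integralZl//; last by apply/measurable_EFinP; exact/mI/measurableC.
rewrite integral_indic//; last exact: measurableC.
rewrite setIT -mulrA EFinM; apply: lee_wpmul2l => //; by rewrite lee_fin.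
Qed.

Fixpoint stopped (j : nat) (w : T) : 'rV[R]_d :=
  if j is i.+1 then (if w \in alive i then walk i.+1 w else stopped i w) else walk 0 w.

Lemma measurable_stopped m : measurable_fun setT (stopped m : T -> borel_rV R d).
Proof.
elim: m => [|m IH]; first exact: measurable_walk.
rewrite /=; apply: (@measurable_fun_ifT _ _ T (borel_rV R d) _ _ (fun w => w \in alive m)) => //.
  by apply: (measurable_fun_bool true); rewrite setTI preimage_mem_true; exact: measurable_alive.
exact: measurable_walk.
Qed.

Lemma stopped_le m :
  (\int[P]_w (vt (stopped m w))%:E <= (vt z + m%:R * step_error)%:E)%E.
Proof.
have mvs i : measurable_fun setT (fun w => vt (stopped i w)).
  exact: (measurableT_comp mvt (@measurable_stopped i)).
have mvw i : measurable_fun setT (fun w => vt (walk i w)).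
  exact: (measurableT_comp mvt (@measurable_walk i)).
have mI i : measurable_fun setT (\1_(alive i) : T -> R).
  exact: (measurable_indic (measurable_alive i)).
have mIC i : measurable_fun setT (\1_(~` alive i) : T -> R).
  by apply: measurable_indic; apply: measurableC; exact: measurable_alive.
have vt0 x : 0 <= vt x by have /andP[] := vtM x.
elim: m => [|m IH].
  rewrite mul0r addr0 /stopped.
  rewrite (eq_integral (cst (vt z)%:E)); last first.
    by move=> w _; rewrite /walk mul0r; have [-> _] := BM.
  by rewrite integral_cst// [X in (_ * X)%E]probability_setT mule1.
have split (i : nat) (f : T -> R) : measurable_fun setT f -> (forall w, 0 <= f w) ->
  (\int[P]_w (f w)%:E = \int[P]_w (\1_(alive i) w * f w)%:E +
    \int[P]_w (\1_(~` alive i) w * f w)%:E)%E.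
  move=> mf f0; rewrite -ge0_integralD//=; first last.
  - by apply/measurable_EFinP; apply: measurable_funM.
  - by move=> w _; rewrite lee_fin mulr_ge0.
  - by apply/measurable_EFinP; apply: measurable_funM.
  - by move=> w _; rewrite lee_fin mulr_ge0.
  apply: eq_integral => w _; rewrite -EFinD -mulrDl !indicE in_setC.
  by case: (w \in alive i); rewrite ?addr0 ?add0r mul1r.
rewrite (split m)//.
have -> : (\int[P]_w (\1_(alive m) w * vt (stopped m.+1 w))%:E =
   \int[P]_w (\1_(alive m) w * vt (walk m.+1 w))%:E)%E.
  apply: eq_integral => w _; rewrite !indicE /=.
  by case: ifPn => //; rewrite !mul0r.
have -> : (\int[P]_w (\1_(~` alive m) w * vt (stopped m.+1 w))%:E =
   \int[P]_w (\1_(~` alive m) w * vt (stopped m w))%:E)%E.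
  apply: eq_integral => w _; rewrite !indicE in_setC /=.
  by case: ifPn => //; rewrite !mul0r.
apply: le_trans (_ : (\int[P]_w (vt (stopped m w))%:E + step_error%:E <= _)%E); last first.
  by apply: (le_trans (leeD IH (lexx _))); rewrite -EFinD lee_fin -natr1; lra.
rewrite (split m)// addeAC; apply: leeD => //.
apply: (le_trans (step_le m)); apply: leeD => //.
rewrite le_eqVlt; apply/orP; left; apply/eqP; apply: eq_integral => w _.
rewrite !indicE; case: (boolP (w \in alive m)) => [|_]; last by rewrite !mul0r.
rewrite inE => Aw; congr (_ * vt _)%:E.
case: m Aw {IH} => //= m Aw; rewrite ifT// inE => i im; apply: Aw; exact: leqW.
Qed.

End step.

End increments.

(** * Dynkin's inequality up to a bounded time *)

Section limits.
Context {R : realType}.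

(** Two mean value theorems, the first for [f] minus its quadratic majorant and the second for [f1].
    Negative [s] is reduced to positive [s] by reflection. *)
Lemma second_order_upper (f f1 f2 : R -> R) (rho kappa : R) (s : R) :
  (forall t : R, `|t| < rho -> is_derive t (1 : R) f (f1 t) /\ is_derive t (1 : R) f1 (f2 t) /\ f2 t <= kappa) ->
  `|s| < rho -> f s <= f 0 + f1 0 * s + 2^-1 * kappa * s ^+ 2.
Proof.
wlog s0 : f f1 f2 s / 0 <= s.
  move=> W H sr; case: (leP 0 s) => s0; first exact: (W f f1 f2).
  have := W (f \o -%R) (fun t => - f1 (- t)) (f2 \o -%R) (- s).
  rewrite normrN /= !oppr0 opprK mulrNN sqrrN; apply => //; first by rewrite oppr_ge0 ltW.
  move=> t tr; have [d1 [d2 k]] := H (- t) ltac:(by rewrite normrN).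
  have dN : is_derive t (1 : R) (-%R : R -> R) (-1) by apply: is_deriveN.
  split; [|split => //].
    have := is_derive1_comp (f := f) (g := -%R) (x := t) (a := f1 (- t)) (b := -1).
    by rewrite mulrN1; apply.
  have : is_derive t (1 : R) (f1 \o -%R) (f2 (- t) * -1).
    by have := is_derive1_comp (f := f1) (g := -%R) (x := t) (a := f2 (- t)) (b := -1); apply.
  by move=> /(@is_deriveN _ _ _ _ _ _ _); rewrite mulrN1 opprK.
move=> H; rewrite ger0_norm// => sr.
have in_rho t : t \in `[0, s]%R -> `|t| < rho.
  by rewrite in_itv/= => /andP[t0 ts]; rewrite ger0_norm//; exact: le_lt_trans sr.
pose psi t := f t - (f1 0 * t + 2^-1 * kappa * t ^+ 2).
pose dpsi t := f1 t - (f1 0 + kappa * t).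
have dp (t : R) : `|t| < rho -> is_derive t (1 : R) psi (dpsi t).
  move=> /H[d1 _]; apply: is_deriveB.
  have -> : f1 0 + kappa * t = f1 0 * 1 + (2^-1 * kappa) * (2 * t) by field.
  have hA : is_derive t (1 : R) (fun x : R => f1 0 * x) (f1 0 * 1).
    exact: (@is_deriveZ _ _ _ (id : R -> R) (f1 0) t 1 1).
  have hB : is_derive t (1 : R) (fun x : R => 2^-1 * kappa * x ^+ 2) (2^-1 * kappa * (2 * t)).
    apply: (@is_deriveZ _ _ _ (fun t : R => t ^+ 2) (2^-1 * kappa) t 1 (2 * t)).
    have dm : is_derive t (1 : R) ((id : R -> R) * id) (t *: 1 + t *: 1).
      exact: is_deriveM.
    have -> : 2 * t = t *: (1 : R) + t *: (1 : R) by rewrite /GRing.scale/= mulr1 mulr_natl mulr2n.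
    exact: dm.
  exact: is_deriveD.
have dcont (g dg : R -> R) (a : R) : a <= s -> (forall t : R, `|t| < rho -> is_derive t (1 : R) g (dg t)) ->
  {within `[0, a], continuous g}.
  move=> as_ dg_; apply: derivable_within_continuous => t; rewrite in_itv/= => /andP[t0 ta].
  have tr : `|t| < rho by apply: in_rho; rewrite in_itv/= t0 (le_trans ta).
  by have := dg_ t tr; case.
have [|c cs] := @MVT_segment _ psi dpsi 0 s s0 _ (dcont _ _ _ (lexx s) dp).
  by move=> t /subset_itv_oo_cc /in_rho; exact: dp.
move: (cs); rewrite in_itv/= => /andP[c0 c_s].
have df1 t : `|t| < rho -> is_derive t (1 : R) f1 (f2 t) by move=> /H[_ []].
have [|c' c's] := @MVT_segment _ f1 f2 0 c c0 _ (dcont _ _ _ c_s df1).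
  move=> t; rewrite in_itv/= => /andP[t0 tc]; apply: df1; apply: in_rho.
  by rewrite in_itv/= (ltW t0) (le_trans (ltW tc)).
have f2c' : f2 c' <= kappa.
  have /H[_ [_ //]] : `|c'| < rho.
  apply: in_rho; move: c's; rewrite !in_itv/= => /andP[-> c'c]; exact: le_trans c_s.
rewrite /psi /dpsi !subr0 !mulr0 expr0n/= !mulr0 addr0 subr0 => E1 E2.
have : (f1 c - (f1 0 + kappa * c)) * s <= 0.
  rewrite opprD addrA E1 -mulrBl -mulrA mulr_le0_ge0 ?subr_le0//; exact: mulr_ge0.
rewrite -E2; lra.
Qed.

Lemma fatou_bound d (T : measurableType d) (mu : {measure set T -> \bar R}) (E : set T)
    (f : nat -> T -> R) (g : T -> R) (c : \bar R) : measurable E ->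
  (forall k, measurable_fun setT (f k)) -> (forall k w, 0 <= f k w) ->
  (forall w, E w -> f ^~ w @ \oo --> g w) ->
  (\forall k \near \oo, (\int[mu]_w (f k w)%:E <= c)%E) ->
  (\int[mu]_(w in E) (g w)%:E <= c)%E.
Proof.
move=> mE mf f0 fg [N _ HN].
pose f' k w := f (k + N)%N w.
have fg' w : E w -> f' ^~ w @ \oo --> g w.
  by move=> Ew; have := fg w Ew; rewrite -(cvg_shiftn N).
have := @fatou _ T R mu E mE (fun k w => (f' k w)%:E)
  (fun k => (measurable_EFinP _ _).2 (measurable_funTS (mf _)))
  (fun k w _ => (f0 _ w : (0 <= (f' k w)%:E)%E)).
have -> : (\int[mu]_(x in E) limn_einf (fun k => (f' k x)%:E) = \int[mu]_(w in E) (g w)%:E)%E.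
  apply: eq_integral => w; rewrite inE => Ew.
  have cv : (fun k => (f' k w)%:E) @ \oo --> (g w)%:E by apply: cvg_EFin; [exact: nearW|exact: fg'].
  rewrite is_cvg_limn_einfE; last by apply/cvg_ex; exists (g w)%:E.
  exact: cvg_lim.
move=> H; apply: (le_trans H); rewrite limn_einf_lim; apply: lime_le.
  by apply/cvg_ex; eexists; apply/ereal_nondecreasing_cvgn; exact: nondecreasing_einfs.
apply: nearW => k; apply: (@le_trans _ _ (\int[mu]_w (f' k w)%:E)%E).
  apply: (@le_trans _ _ (\int[mu]_(w in E) (f' k w)%:E)%E).
    by apply: ereal_inf_lbound; exists k => //=.
  apply: ge0_subset_integral => //.
    by apply/measurable_EFinP; exact: mf.
  by move=> w _; rewrite lee_fin; exact: f0.
by apply: HN => /=; rewrite leq_addl.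
Qed.

Lemma measurable_rV_cvg (m : nat) d (T : measurableType d) (E : set T)
    (f : nat -> T -> 'rV[R]_m) (g : T -> 'rV[R]_m) :
  (forall k, measurable_fun E (f k : T -> borel_rV R m)) ->
  (forall w, E w -> forall eta : R, 0 < eta -> exists N, forall k, (N <= k)%N -> `|f k w - g w| < eta) ->
  measurable_fun E (g : T -> borel_rV R m).
Proof.
move=> mf cv; apply: measurable_fun_rV => i.
apply: (@measurable_fun_cvg _ _ _ _ (fun k w => f k w 0 i)).
  by move=> k; apply: (measurableT_comp (measurable_coord i)).
move=> w Ew; apply/cvgrPdist_lt => eta eta0; have [N HN] := cv w Ew eta eta0.
exists N => // k /= /HN; apply: le_lt_trans.
by rewrite distrC; have := coord_le_norm (f k w - g w) i; rewrite !mxE.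
Qed.

(** A Lebesgue number: [Q] holds locally in both arguments, and compactness of [D] makes the radius
    uniform. *)
Lemma compact_uniform (m : nat) (D : set 'rV[R]_m) (Q : 'rV[R]_m -> 'rV[R]_m -> Prop) : compact D ->
  (forall x, D x -> exists2 r : R, 0 < r & forall y z, `|y - x| < r -> `|z - x| < r -> Q y z) ->
  exists2 r : R, 0 < r & forall y z, D y -> `|z - y| < r -> Q y z.
Proof.
move=> /compact_near_coveringP cD H.
have [|r /= r0 Hr] := cD R (0^'+) (fun r y => forall z, `|z - y| < r -> Q y z) _.
  move=> x Dx; have [r r0 Hr] := H x Dx.
  near_simpl.
  exists ([set y | `|y - x| < r / 2], [set s : R | s < r / 2]) => /=.
    split.
      by apply: open_nbhs_nbhs; split; [exact: open_ballS|rewrite /= subrr normr0 divr_gt0].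
    by apply: nbhs_right_lt; rewrite divr_gt0.
  move=> [y s] /= [yx sr] z zy; apply: Hr; first lra.
  have := ler_distD y z x; rewrite distrC in zy *; move: yx zy sr.
  set a := `|y - x|; set b := `|y - z|; rewrite distrC -/b; lra.
have r20 : 0 < r / 2 by rewrite divr_gt0.
exists (r / 2) => // y z Dy zy; apply: (Hr (r / 2)) => //=.
by rewrite sub0r normrN gtr0_norm// ltr_pdivrMr// ltr_pMr// ltr1n.
Unshelve. all: by end_near. Qed.

Context {d : nat}.

(** The time [T] caps the exit time and keeps the set nonempty, so that [inf] never takes its
    default value. *)
Definition stop_set (D : set 'rV[R]_d) (T : R) (gamma : R -> 'rV[R]_d) :=
  [set t : R | 0 <= t /\ ~ D (gamma t)] `|` [set T].

Definition stop D T gamma := inf (stop_set D T gamma).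

Section path.
Context (gamma : R -> 'rV[R]_d) (T : R) (T0 : 0 < T).
Context (gamma_cont : {within [set t : R | 0 <= t], continuous gamma}).

Lemma path_near (t eta : R) : 0 <= t -> 0 < eta ->
  exists2 r : R, 0 < r & forall s, 0 <= s -> `|s - t| < r -> `|gamma s - gamma t| < eta.
Proof.
move=> t0 eta0; have /(_ t t0) := (subspace_continuousP _ _).1 gamma_cont.
move=> /cvgrPdist_lt /(_ eta eta0); rewrite /= near_withinE => -[r /= r0 Hr].
exists r => // s s0 st; rewrite distrC; apply: Hr => //=; by rewrite distrC.
Qed.

Lemma stop_has_inf D : has_inf (stop_set D T gamma).
Proof.
split; first by exists T; right.
by exists 0 => t [[]//|->]; exact: ltW.
Qed.

Lemma stop_ge0 D : 0 <= stop D T gamma.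
Proof. by apply: lb_le_inf; [exists T; right|move=> t [[]//|->]; exact: ltW]. Qed.

Lemma stop_leT D : stop D T gamma <= T.
Proof. by apply: ge_inf; [exact: (stop_has_inf D).2|right]. Qed.

Lemma stop_le D t : 0 <= t -> ~ D (gamma t) -> stop D T gamma <= t.
Proof. by move=> *; apply: ge_inf; [exact: (stop_has_inf D).2|left]. Qed.

Lemma before_stop D t : 0 <= t -> t < stop D T gamma -> D (gamma t).
Proof. by move=> t0 ts; apply: contrapT => nD; have := stop_le t0 nD; rewrite leNgt ts. Qed.

Lemma stop_closed D : closed D -> D (gamma 0) -> D (gamma (stop D T gamma)).
Proof.
move=> cD D0; case: (ltgtP 0 (stop D T gamma)) (stop_ge0 D) => // [s0 _|<- _//].
apply: cD => /= B /nbhs_ballP[r /= r0 Br].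
have [q q0 Hq] := path_near (ltW s0) r0.
set s := stop D T gamma in s0 Hq *.
pose t := Num.max 0 (s - q / 2).
have t0 : 0 <= t by rewrite le_max lexx.
have ts : t < s by rewrite gt_max s0/= ltrBlDr ltrDl divr_gt0.
exists (gamma t); split; first exact: before_stop.
apply: Br; rewrite -ball_normE/= distrC; apply: Hq => //.
rewrite distrC ger0_norm ?subr_ge0 ?(ltW ts)//.
have : s - q / 2 <= t by rewrite le_max lexx orbT.
lra.
Qed.

Lemma stop_open D : open D -> stop D T gamma < T -> ~ D (gamma (stop D T gamma)).
Proof.
move=> oD sT Ds; set s := stop D T gamma in sT Ds *.
have [r /= r0 Hr] := (nbhs_ballP _ _).1 (open_nbhs_nbhs (conj oD Ds)).
have [q q0 Hq] := path_near (stop_ge0 D) r0.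
have sq : s < s + Num.min q (T - s) by rewrite ltrDl lt_min q0 subr_gt0.
have [t [[t0 nD]|tT] ts] := inf_lt (stop_has_inf D).1 sq; last first.
  by move: ts; rewrite tT -ltrBlDl lt_min ltxx andbF.
have st : s <= t by exact: stop_le.
apply: nD; apply: Hr; rewrite -ball_normE/= distrC; apply: Hq => //.
by rewrite ger0_norm ?subr_ge0//; move: ts; rewrite -ltrBlDl lt_min => /andP[].
Qed.

End path.

Lemma compact_bounded_fun (D : set 'rV[R]_d) (f : 'rV[R]_d -> R) : compact D ->
  (forall x, D x -> {for x, continuous f}) -> exists2 M : R, 0 <= M & forall x, D x -> `|f x| <= M.
Proof.
move=> cD cf.
have cw : {within D, continuous f}.
  by apply: continuous_in_subspaceT => x; rewrite inE => /cf.
have [M [_ HM]] := compact_bounded (continuous_compact cw cD).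
exists (`|M| + 1); first by rewrite addr_ge0.
move=> x Dx; apply: HM; last by exists x.
by rewrite (le_lt_trans (ler_norm _))// ltrDl.
Qed.

Lemma dyadic_small (T A B : R) : 0 <= T -> 0 < B ->
  exists N0, forall N, (N0 <= N)%N -> A * (T / 2 ^+ N) <= B.
Proof.
move=> T0 B0; pose N0 := (Num.truncn (A * T / B)).+1.
have HN0 : A * T / B <= N0%:R by rewrite ltW// truncnS_gt.
exists N0 => N NN; rewrite mulrA ler_pdivrMr ?exprn_gt0//.
rewrite -ler_pdivrMl// mulrC; apply: (le_trans HN0).
rewrite -natrX ler_nat; apply: (leq_trans NN); exact: ltnW (ltn_expl _ _).
Qed.

(** * From dyadic walks to the Brownian path *)

Section dynkin.
Context {disp : measure_display} {Om : measurableType disp}.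
Context (P : probability Om R) (z : 'rV[R]_d) (W : R -> Om -> 'rV[R]_d).
Context (BM : brownian_motion P z W).

Let path_cont w : {within [set t : R | 0 <= t], continuous (W ^~ w)}.
Proof. by have [_ [H _]] := BM. Qed.

Let path0 w : W 0 w = z.
Proof. by have [H _] := BM. Qed.

Lemma stopped_spec delta D m w : exists j, [/\ (j <= m)%N,
  stopped W delta D m w = walk W delta j w,
  forall i, (i < j)%N -> D (walk W delta i w) &
  (j < m)%N -> ~ D (walk W delta j w)].
Proof.
elim: m => [|m [j [jm E Hi Hn]]]; first by exists 0%N; split.
rewrite /=; case: ifPn => [|].
  by rewrite inE => Aw; exists m.+1; split => //; rewrite ltnn.
move=> nA; exists j; split => //; first exact: leqW.
move=> _; move: jm; rewrite leq_eqVlt => /orP[/eqP jm|]; last exact: Hn.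
apply: contraNnot nA => Dj; rewrite inE => i; rewrite leq_eqVlt => /orP[/eqP ->|im].
  by rewrite -jm.
by apply: Hi; rewrite jm.
Qed.

(** Shortly after the stopping time [s] there is a time [t] at which the path is outside [D], unless
    [t = T]. As [D] is closed the path stays outside for a while, and a mesh finer than that while
    cannot overlook it. So the walk stops within [[s, t + del]], and continuity of the path
    concludes. *)
Lemma stopped_cvg (D : set 'rV[R]_d) (T : R) w (eta : R) : closed D -> 0 < T -> 0 < eta ->
  exists N0, forall N, (N0 <= N)%N ->
    `|stopped W (T / 2 ^+ N) D (2 ^ N) w - W (stop D T (W ^~ w)) w| < eta.
Proof.
move=> cD T0 eta0; pose gam := W ^~ w; pose s := stop D T gam.
have s0 : 0 <= s by exact: stop_ge0.
have sT : s <= T by exact: stop_leT.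
have [q q0 Hq] := path_near (@path_cont w) s0 eta0.
have sq : s < s + q / 2 by rewrite ltrDl divr_gt0.
have [t ts tq] := inf_lt (stop_has_inf gam T0 D).1 sq.
have [q' q'0 Hq'] : exists2 q' : R, 0 < q' & (t = T \/ 0 <= t /\
   forall r, 0 <= r -> `|r - t| < q' -> ~ D (gam r)).
  case: ts => [[t0 nD]|->]; last by exists 1 => //; left.
  have [r /= r0 Hr] := (nbhs_ballP _ _).1 (open_nbhs_nbhs (conj (closed_openC cD) nD)).
  have [q' q'0 H] := path_near (@path_cont w) t0 r0.
  exists q' => //; right; split => // u u0 ut; apply: Hr.
  by rewrite -ball_normE/= distrC; exact: H.
have [N0 HN0] := @dyadic_small T 1 (Num.min q' (q / 2) / 2) (ltW T0) ltac:(by rewrite divr_gt0// lt_min q'0 divr_gt0).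
exists N0 => N /HN0; rewrite mul1r; set del := T / _ => del1.
have del0 : 0 < del by rewrite divr_gt0// exprn_gt0.
have delq' : del < q'.
  apply: (le_lt_trans del1); rewrite ltr_pdivrMr//.
  by apply: (@le_lt_trans _ _ q'); [rewrite ge_min lexx|rewrite ltr_pMr// ltr1n].
have delq : del < q / 2.
  apply: (le_lt_trans del1); rewrite ltr_pdivrMr//.
  by apply: (@le_lt_trans _ _ (q / 2)); [rewrite ge_min lexx orbT|rewrite ltr_pMr ?divr_gt0// ltr1n].
have mdel : (2 ^ N)%N%:R * del = T by rewrite natrX mulrC divfK// gt_eqF// exprn_gt0.
have [j [jm -> Hi Hn]] := stopped_spec del D (2 ^ N) w.
rewrite /walk; apply: Hq; first by rewrite mulr_ge0// ltW.
have jT : j%:R * del <= T by rewrite -mdel ler_pM2r// ler_nat.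
have sj : s <= j%:R * del.
  move: jm; rewrite leq_eqVlt => /orP[/eqP ->|]; first by rewrite mdel.
  by move=> /Hn; apply: stop_le => //; rewrite mulr_ge0// ltW.
rewrite -/s ger0_norm ?subr_ge0//.
have : j%:R * del <= t + del; last lra.
case: Hq' => [->|[t0 Hq']]; first lra.
pose i := (Num.truncn (t / del)).+1.
have [i1 i2] : i%:R * del <= t + del /\ t < i%:R * del.
  have td : 0 <= t / del by rewrite divr_ge0// ltW.
  split; last by rewrite -ltr_pdivrMr// truncnS_gt.
  rewrite /i -natr1 mulrDl mul1r lerD2r -ler_pdivlMr//.
  by rewrite truncn_le.
apply: le_trans (i1); rewrite ler_pM2r// ler_nat leqNgt; apply/negP => /Hi.
apply: Hq'; first by rewrite mulr_ge0// ltW.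
by rewrite ger0_norm ?subr_ge0 1?ltW//; lra.
Qed.

Lemma measurable_stop (D : set 'rV[R]_d) (T : R) : closed D -> 0 < T ->
  measurable_fun setT (fun w => W (stop D T (W ^~ w)) w : borel_rV R d).
Proof.
move=> cD T0; apply: (@measurable_rV_cvg _ _ _ _ (fun N => stopped W (T / 2 ^+ N) D (2 ^ N))).
  move=> N; apply: (measurable_stopped BM); first by rewrite divr_gt0// exprn_gt0.
  exact: borel_closed.
by move=> w _ eta eta0; exact: stopped_cvg.
Qed.

(** The lower bound [c0] leaves room for the second-order terms, which are of the order of the mesh
    [del]. The accumulated errors tend to at most [err / 2] with the mesh, and Fatou's lemma passes
    to the stopped path. *)
Lemma stop_dynkin (D U : set 'rV[R]_d) v g h (T c0 : R) : compact D -> open U -> D `<=` U ->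
  c2 U v g h -> (forall x, U x -> \sum_i h i x <= 0) -> 0 < c0 ->
  (forall x, U x -> c0 <= v x) -> D z -> 0 < T ->
  (\int[P]_w (v (W (stop D T (W ^~ w)) w))%:E <= (v z)%:E)%E.
Proof.
move=> cD oU DU cv lap c00 vc Dz T0.
have clD : closed D by apply: compact_closed => //; exact: norm_hausdorff.
have cvx x : U x -> {for x, continuous v} by move=> /cv[].
have chx i x : U x -> {for x, continuous (h i)} by move=> /cv[_ /(_ i)[]].
apply/lee_addgt0Pr => err err0.
(* The drift accumulated up to time [T] is at most [4 * eps * T], half of [err]; the other half is
   kept for the tails. *)
pose eps := err / (8 * T).
have eps0 : 0 < eps by rewrite divr_gt0// mulr_gt0.
pose eps1 := eps / d.+1%:R.
have eps10 : 0 < eps1 by rewrite divr_gt0.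
have [r r0 Hr] : exists2 r : R, 0 < r & forall x y, D x -> `|y - x| < r ->
   [/\ U y, v y <= v x + 1 & forall i, h i y <= h i x + eps1].
  apply: (compact_uniform cD) => x Dx; have Ux := DU _ Dx.
  have : \forall y \near x, [/\ U y, `|v x - v y| < 2^-1 & forall i, `|h i x - h i y| < eps1 / 2].
    have n1 : \forall y \near x, U y by exact: open_nbhs_nbhs.
    have n2 : \forall y \near x, `|v x - v y| < 2^-1.
      by apply: (@cvgr_dist_lt _ _ _ (nbhs x) _ v (v x)) => //; exact: cvx.
    have n3 : \forall y \near x, forall i, `|h i x - h i y| < eps1 / 2.
      apply: (@filter_forall _ _ _ (nbhs x)) => i.
      by apply: (@cvgr_dist_lt _ _ _ (nbhs x) _ (h i) (h i x)); [exact: chx|rewrite divr_gt0].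
    by near=> y; split; near: y.
  move=> /(nbhs_ballP _ _).1[r /= r0 Hr]; exists r => // y y' yx y'x.
  have [] := Hr y; first by rewrite -ball_normE/= distrC.
  move=> Uy v1 h1; have [] := Hr y'; first by rewrite -ball_normE/= distrC.
  move=> Uy' v2 h2; split => //.
    by move: v1 v2; rewrite !ltr_distl => /andP[? ?] /andP[? ?]; lra.
  move=> i; have := h1 i; have := h2 i.
  by rewrite !ltr_distl => /andP[? ?] /andP[? ?]; lra.
pose rho := r / 3.
have rho0 : 0 < rho by rewrite divr_gt0.
have rho_r : rho < r by rewrite /rho; lra.
have rhor : 2 * rho < r by rewrite /rho; lra.
have [Mv Mv0 HMv] := compact_bounded_fun cD (fun x Dx => cvx x (DU _ Dx)).
have /choice[H0 HH0] : forall i : 'I_d, exists M : R, 0 <= M /\ forall x, D x -> `|h i x| <= M.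
  move=> i; by have [M M0 HM] := compact_bounded_fun cD (fun x Dx => chx i x (DU _ Dx)); exists M.
pose H := \sum_i H0 i + eps1.
pose Nr : set 'rV[R]_d := [set y | exists2 x, D x & `|y - x| < r].
have oNr : open Nr.
  rewrite (_ : Nr = \bigcup_(x in D) [set y | `|y - x| < r]); last by [].
  by apply: bigcup_open => x _; exact: open_ballS.
have NrU y : Nr y -> U y by move=> [x Dx /(Hr _ _ Dx)[]].
have DNr x : D x -> Nr x by move=> Dx; exists x => //; rewrite subrr normr0.
(* Cut to 0 off a neighbourhood of [D]: the result is bounded, Borel and nonnegative everywhere, and
   equal to [v] wherever the Taylor bound is used. *)
pose vt : 'rV[R]_d -> R := v \_ Nr.
have vtE y : Nr y -> vt y = v y by move=> Ny; rewrite /vt patchE mem_set.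
have mvt : measurable_fun setT (vt : borel_rV R d -> R).
  apply/(measurable_restrictT _ _).1; first exact: borel_open.
  apply: measurable_rel_continuous; first exact: borel_open.
  by apply: continuous_rel => x /NrU; exact: cvx.
pose kappa i : 'rV[R]_d -> R := (fun x => h i x + eps1) \_ D.
have kapE i x : D x -> kappa i x = h i x + eps1 by move=> Dx; rewrite /kappa patchE mem_set.
have mkap i : measurable_fun setT (kappa i : borel_rV R d -> R).
  apply/(measurable_restrictT _ _).1; first exact: borel_closed.
  apply: measurable_funD => //; apply: measurable_rel_continuous; first exact: borel_closed.
  by apply: continuous_rel => x /DU; exact: chx.
have vtM x : 0 <= vt x <= Mv + 1.
  rewrite /vt patchE; case: ifPn => [|_]; last by rewrite lexx addr_ge0.
  rewrite inE => Nx; rewrite (le_trans (ltW c00) (vc _ (NrU _ Nx)))/=.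
  have [y Dy xy] := Nx; have [_ vxy _] := Hr _ _ Dy xy.
  by apply: (le_trans vxy); rewrite lerD2r (le_trans (ler_norm _))// HMv.
have vt_taylor x y i (s : R) : D x -> `|y - x| < rho -> `|s| < rho ->
  vt (y + s *: basis_vec R d i) <= vt y + g i y * s + 2^-1 * kappa i x * s ^+ 2.
  move=> Dx yx sr.
  have close (t : R) : `|t| < rho -> `|y + t *: basis_vec R d i - x| < r.
    move=> tr; rewrite addrAC; apply: (le_lt_trans (ler_normD _ _)).
    rewrite normrZ norm_basis_vec mulr1; move: yx tr rhor.
    by set a := `|_ - _|; set b := `|t|; lra.
  rewrite !vtE; [|by exists x => //; exact: lt_trans yx rho_r|by exists x => //; exact: close].
  have := @second_order_upper (fun t => v (y + t *: basis_vec R d i))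
    (fun t => g i (y + t *: basis_vec R d i)) (fun t => h i (y + t *: basis_vec R d i)) rho (kappa i x) s.
  rewrite scale0r addr0; apply => // t tr.
  have [Uy _ hy] := Hr _ _ Dx (close t tr).
  have [_ /(_ i)[dv dg _ _]] := cv _ Uy.
  by split; [exact/is_derive_lineP|split; [exact/is_derive_lineP|rewrite kapE]].
have [N1 HN1] := @dyadic_small T (4 * d%:R * H) c0 (ltW T0) c00.
have [N2 HN2] := @dyadic_small T (T * (Mv + 1) * d%:R * 128 / rho ^+ 4) (err / 2) (ltW T0)
  ltac:(by rewrite divr_gt0).
rewrite -[(_ + _)%E]/((v z + err)%:E).
apply: (@fatou_bound _ _ P setT (fun N w => vt (stopped W (T / 2 ^+ N) D (2 ^ N) w))) => //.
- move=> N; apply: (measurableT_comp mvt); apply: (measurable_stopped BM).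
    by rewrite divr_gt0// exprn_gt0.
  exact: borel_closed.
- by move=> N w; have /andP[] := vtM (stopped W (T / 2 ^+ N) D (2 ^ N) w).
- move=> w _; set x := W _ w.
  have Dx : D x.
    by have := @stop_closed (W ^~ w) T T0 (@path_cont w) D clD; rewrite path0; apply.
  apply/cvgrPdist_lt => eta eta0.
  have : \forall y \near x, Nr y /\ `|v x - v y| < eta.
    have n1 : \forall y \near x, Nr y by apply: open_nbhs_nbhs; split => //; exact: DNr.
    have n2 : \forall y \near x, `|v x - v y| < eta.
      by apply: (@cvgr_dist_lt _ _ _ (nbhs x) _ v (v x)) => //; exact/cvx/DU.
    by near=> y; split; near: y.
  move=> /(nbhs_ballP _ _).1[q /= q0 Hq].
  have [N0 HN0] := stopped_cvg w clD T0 q0.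
  exists N0 => // N /= /HN0; rewrite distrC => NN.
  have := Hq (stopped W (T / 2 ^+ N) D (2 ^ N) w); rewrite -ball_normE/= => /(_ NN)[NrN].
  by rewrite vtE.
exists (maxn N1 N2) => // N /=; rewrite geq_max => /andP[/HN1 le1 /HN2 le2].
set del := T / 2 ^+ N in le1 le2 *.
have del0 : 0 < del by rewrite divr_gt0// exprn_gt0.
have vtz : vt z = v z by rewrite vtE//; exact: DNr.
have := @stopped_le R d _ _ P z W BM del del0 D vt g kappa rho H eps (Mv + 1)
   (borel_closed clD) mvt mkap rho0 ltac:(by rewrite addr_ge0) (ltW eps0) vtM vt_taylor.
rewrite vtz; move=> /(_ _ _ _ (2 ^ N)%N) HS; apply: le_trans (HS _ _ _) _.
- move=> x y Dx yx; have yr := lt_trans yx rhor.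
  rewrite vtE; last by exists x.
  have [Uy _ _] := Hr _ _ Dx yr; apply: le_trans (vc _ Uy).
  by apply: le_trans le1; rewrite le_eqVlt; apply/orP; left; apply/eqP; ring.
- move=> x i Dx; rewrite kapE// (le_trans (ler_normD _ _))// (gtr0_norm eps10) lerD2r.
  have [_ HHi] := HH0 i; apply: (le_trans (HHi _ Dx)).
  by rewrite (bigD1 i)//= lerDl sumr_ge0// => j _; have [] := HH0 j.
- move=> x Dx; under eq_bigr do rewrite kapE//.
  rewrite big_split/= sumr_const card_ord; have := lap _ (DU _ Dx).
  have : eps1 *+ d <= eps.
    rewrite -mulr_natr /eps1 mulrAC ler_pdivrMr// ler_pM2l// ler_nat //.
  lra.
rewrite lee_fin lerD2l /step_error.
have mdel : (2 ^ N)%N%:R * del = T by rewrite natrX mulrC divfK// gt_eqF// exprn_gt0.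
have -> : (2 ^ N)%N%:R * (4 * del * eps + (Mv + 1) * d%:R * (128 * del ^+ 2 / rho ^+ 4)) =
  4 * eps * ((2 ^ N)%N%:R * del) + ((2 ^ N)%N%:R * del) * (Mv + 1) * d%:R * 128 / rho ^+ 4 * del by ring.
rewrite mdel; have -> : 4 * eps * T = err / 2.
  by rewrite /eps; field; rewrite gt_eqF.
lra.
Unshelve. all: by end_near. Qed.

End dynkin.

End limits.

(** * Exit points *)

Section exhaustion.
Context {R : realType} {n : nat} (Phi : 'rV[R]_n -> R) (K : R).
Context (K0 : 0 <= K) (PhiK : forall x y : 'rV[R]_n, `|Phi x - Phi y| <= K * `|x - y|).
Local Notation O := (near_half_space Phi).
Local Notation S := (nhs_boundary Phi).
Local Notation gp := (gap Phi).
Let gpC : continuous gp := continuous_gap K0 PhiK.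

Definition exhaustion (k : nat) : set 'rV[R]_n.+1 :=
  [set y | k.+1%:R^-1 <= gp y /\ `|y| <= k.+1%:R].

Lemma exhaustion_sub k : exhaustion k `<=` O.
Proof. by move=> y [H _]; rewrite nhsE; apply: lt_le_trans H; rewrite invr_gt0. Qed.

Lemma exhaustion_compact k : compact (exhaustion k).
Proof.
apply: bounded_closed_compact.
  by exists k.+1%:R; split => // x kx y [_ ?]; apply: le_trans (ltW kx).
rewrite (_ : exhaustion k = [set y | k.+1%:R^-1 <= gp y] `&` [set y | `|y| <= k.+1%:R]) //.
apply: closedI.
  by apply: (@closed_preimage_ge _ _ gp) => //; exact: gpC.
by apply: (@closed_preimage_le _ _ (fun y => `|y|)) => //; exact: norm_continuous.
Qed.

Lemma exhaustion_near (A : set 'rV[R]_n.+1) : compact A -> A `<=` O ->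
  \forall k \near \oo, A `<=` exhaustion k.
Proof.
move=> /compact_near_coveringP cA AO.
have := cA nat \oo (fun k y => exhaustion k y) _; apply => x Ax.
have gx : 0 < gp x by rewrite -nhsE; exact: AO.
have n1 : \forall y \near x, gp x / 2 < gp y.
  by apply: (@cvgr_gt _ _ (nbhs x) _ gp (gp x)); [exact: gpC|rewrite ltr_pdivrMr// ltr_pMr// ltr1n].
have n2 : \forall y \near x, `|y| < `|x| + 1.
  by apply: (@cvgr_lt _ _ (nbhs x) _ (fun y => `|y|) `|x|); [exact: norm_continuous|rewrite ltrDl].
have n3 : \forall k \near \oo, k.+1%:R^-1 <= gp x / 2.
  by near=> k; rewrite ltW//; near: k; apply: near_infty_natSinv_lt (PosNum _); rewrite divr_gt0.
have n4 : \forall k \near \oo, `|x| + 1 <= k.+1%:R.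
  exists (Num.truncn (`|x| + 1)) => // k /=; rewrite -ltnS => kx.
  by apply/ltW/(lt_le_trans (truncnS_gt _)); rewrite ler_nat.
exists ([set y | gp x / 2 < gp y /\ `|y| < `|x| + 1],
        [set k | k.+1%:R^-1 <= gp x / 2 /\ `|x| + 1 <= k.+1%:R]) => /=.
  split; near=> y; split; near: y => //.
move=> [y k] /= [[y1 y2] [k1 k2]]; split; first exact: le_trans (ltW y1).
exact: le_trans (ltW y2) k2.
Unshelve. all: by end_near. Qed.

Section path.
Context (gamma : R -> 'rV[R]_n.+1) (T : R) (T0 : 0 < T) (gamma0 : O (gamma 0)).
Context (gamma_cont : {within [set t : R | 0 <= t], continuous gamma}).

Lemma stop_sub (A B : set 'rV[R]_n.+1) : A `<=` B -> stop A T gamma <= stop B T gamma.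
Proof.
move=> AB; apply: lb_le_inf; first by exists T; right.
move=> t [[t0 nB]|->]; last exact: stop_leT.
by apply: stop_le => // /AB.
Qed.

(** Up to a time [t1] before the exit, the path traces a compact subset of the domain, which is
    contained in [exhaustion k] for all large [k]. *)
Lemma exhaustion_stop (eta : R) : 0 < eta ->
  \forall k \near \oo, stop O T gamma - eta <= stop (exhaustion k) T gamma.
Proof.
move=> eta0; set t1 := stop O T gamma - eta.
case: (ltP t1 0) => t10; first by near=> k; rewrite (le_trans (ltW t10))// stop_ge0.
have t1s : t1 < stop O T gamma by rewrite /t1 ltrBlDr ltrDl.
have cA : compact (gamma @` `[0, t1]).
  apply: continuous_compact; last exact: segment_compact.
  by apply: continuous_subspaceW gamma_cont => t /=; rewrite in_itv/= => /andP[].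
have AO : gamma @` `[0, t1] `<=` O.
  move=> _ [t + <-]; rewrite /= in_itv/= => /andP[t0 tt1].
  by apply: (@before_stop _ _ gamma T T0) => //; exact: le_lt_trans tt1 t1s.
near=> k; apply: lb_le_inf; first by exists T; right.
move=> t [[t0 nD]|->]; last exact: (le_trans (ltW t1s) (stop_leT _ _ _)).
rewrite leNgt; apply/negP => tt1; apply: nD.
have : gamma @` `[0, t1] `<=` exhaustion k by near: k; exact: exhaustion_near.
by apply; exists t => //; rewrite /= in_itv/= t0 ltW.
Unshelve. all: by end_near. Qed.

Lemma exhaustion_stop_cvg (eta : R) : 0 < eta -> exists N, forall k, (N <= k)%N ->
  `|gamma (stop (exhaustion k) T gamma) - gamma (stop O T gamma)| < eta.
Proof.
move=> eta0; have [q q0 Hq] := path_near gamma_cont (stop_ge0 gamma T0 O) eta0.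
have q20 : 0 < q / 2 by rewrite divr_gt0.
have [N _ HN] := exhaustion_stop q20.
exists N => k /HN /= le1; apply: Hq; first exact: stop_ge0.
have le2 := stop_sub (@exhaustion_sub k).
by rewrite ler0_norm ?subr_le0//; lra.
Qed.

Lemma until_stop t : 0 <= t -> t <= stop O T gamma -> 0 <= gp (gamma t).
Proof.
move=> t0; rewrite le_eqVlt => /orP[/eqP ->|ts]; last first.
  by apply/ltW; rewrite -nhsE; exact: (@before_stop _ _ gamma T T0).
rewrite leNgt; apply/negP => gs.
set s := stop O T gamma in gs *.
have : \forall y \near gamma s, gp y < 0.
  by apply: (@cvgr_lt _ _ (nbhs (gamma s)) _ gp (gp (gamma s))) => //; exact: gpC.
move=> /(nbhs_ballP _ _).1[r /= r0 Hr].
have [q q0 Hq] := path_near gamma_cont (stop_ge0 gamma T0 O) r0.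
have s0 : 0 < s.
  rewrite lt_neqAle stop_ge0// andbT; apply/eqP => s0.
  by move: gs; rewrite -s0 ltNge => /negP; apply; apply/ltW; rewrite -nhsE.
pose t' := Num.max 0 (s - q / 2).
have t'0 : 0 <= t' by rewrite le_max lexx.
have ts : t' < s by rewrite gt_max s0/= ltrBlDr ltrDl divr_gt0.
have := @before_stop _ _ gamma T T0 _ _ t'0 ts; rewrite nhsE ltNge => /negP; apply; apply/ltW.
apply: (Hr (gamma t')); rewrite -ball_normE/= distrC; apply: Hq => //.
rewrite -/s distrC ger0_norm ?subr_ge0 ?(ltW ts)//.
have : s - q / 2 <= t' by rewrite le_max lexx orbT.
lra.
Qed.

End path.

End exhaustion.

(** * Almost sure exit and Dynkin's inequality at the exit point *)

Section exit.
Context {R : realType} {n : nat} (Phi : 'rV[R]_n -> R) (K B : R).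
Context (K0 : 0 <= K) (PhiK : forall x y : 'rV[R]_n, `|Phi x - Phi y| <= K * `|x - y|).
Context (PhiB : forall x, `|Phi x| <= B).
Local Notation O := (near_half_space Phi).
Local Notation S := (nhs_boundary Phi).
Local Notation gp := (gap Phi).
Context {disp : measure_display} {Om : measurableType disp}.
Context (P : probability Om R) (z : 'rV[R]_n.+1) (W : R -> Om -> 'rV[R]_n.+1).
Context (BM : brownian_motion P z W) (Oz : O z).

Let path_cont w : {within [set t : R | 0 <= t], continuous (W ^~ w)}.
Proof. by have [_ [H _]] := BM. Qed.

Let path0 w : W 0 w = z.
Proof. by have [H _] := BM. Qed.

Let Opath0 w : O (W 0 w).
Proof. by rewrite path0. Qed.

Definition stopped_at (T : R) (w : Om) : 'rV[R]_n.+1 := W (stop O T (W ^~ w)) w.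

Lemma measurable_stopped_at (T : R) : 0 < T ->
  measurable_fun setT (stopped_at T : Om -> borel_rV R n.+1).
Proof.
move=> T0; apply: (@measurable_rV_cvg _ _ _ _ _ (fun k w => W (stop (exhaustion Phi k) T (W ^~ w)) w)).
  move=> k; apply: (measurable_stop BM) => //.
  by apply: compact_closed; [exact: norm_hausdorff|exact: exhaustion_compact K0 PhiK _].
move=> w _ eta eta0.
exact: (exhaustion_stop_cvg K0 PhiK T0 (@path_cont w) eta0).
Qed.

Lemma stopped_at_gap (T : R) w : 0 < T -> 0 <= gp (stopped_at T w).
Proof.
move=> T0; apply: (until_stop K0 PhiK T0 (@Opath0 w) (@path_cont w)) => //.
exact: stop_ge0.
Qed.

(** The function is superharmonic on the domain lowered by [s], hence continuous at the boundary as
    well. This allows the passage from the compact exhaustion to the domain by Fatou's lemma. *)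
Lemma stopped_at_dynkin (s : R) v g h (T c0 : R) : 0 < s ->
  c2 [set y | O (vshift s y)] v g h -> (forall x, O (vshift s x) -> \sum_i h i x <= 0) ->
  0 < c0 -> (forall x, O (vshift s x) -> c0 <= v x) -> 0 < T ->
  (\int[P]_w (v (stopped_at T w))%:E <= (v z)%:E)%E.
Proof.
move=> s0 cv lap c00 vc T0.
pose U : set 'rV[R]_n.+1 := [set y | O (vshift s y)].
have gU y : 0 <= gp y -> U y by move=> gy; rewrite /U/= nhsE gap_vshift ltr_wpDl.
have oU : open U.
  rewrite (_ : U = gp @^-1` [set t | - s < t]).
    by apply: open_comp; [move=> x _; exact: (continuous_gap K0 PhiK)|exact: open_gt].
  by apply/seteqP; split => y; rewrite /U/= nhsE gap_vshift; lra.
pose vt : 'rV[R]_n.+1 -> R := v \_ U.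
have vtE y : U y -> vt y = v y by move=> Uy; rewrite /vt patchE mem_set.
have mvt : measurable_fun setT (vt : borel_rV R n.+1 -> R).
  apply/(measurable_restrictT _ _).1; first exact: borel_open.
  apply: measurable_rel_continuous; first exact: borel_open.
  by apply: continuous_rel => x /cv[].
have clE k : closed (exhaustion Phi k).
  by apply: compact_closed; [exact: norm_hausdorff|exact: exhaustion_compact K0 PhiK _].
have [N _ HN] : \forall k \near \oo, [set z] `<=` exhaustion Phi k.
  apply: (exhaustion_near K0 PhiK); first exact: compact_set1.
  by move=> _ ->.
have OU : O `<=` U by move=> y; rewrite nhsE => /ltW/gU.
pose f k w := vt (W (stop (exhaustion Phi k) T (W ^~ w)) w).
apply: (@fatou_bound _ _ _ P setT f) => //.
- by move=> k; apply: (measurableT_comp mvt); apply: (measurable_stop BM).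
- move=> k w; rewrite /f /vt patchE; case: ifPn => // /set_mem Ux.
  exact: le_trans (ltW c00) (vc _ Ux).
- move=> w _; have Ux := gU _ (stopped_at_gap w T0).
  apply/cvgrPdist_lt => eta eta0.
  have : \forall y \near stopped_at T w, U y /\ `|v (stopped_at T w) - v y| < eta.
    have n1 : \forall y \near stopped_at T w, U y by exact: open_nbhs_nbhs.
    have n2 : \forall y \near stopped_at T w, `|v (stopped_at T w) - v y| < eta.
      apply: (@cvgr_dist_lt _ _ _ (nbhs (stopped_at T w)) _ v (v (stopped_at T w))) => //.
      by have [] := cv _ Ux.
    by near=> y; split; near: y.
  move=> /(nbhs_ballP _ _).1[q /= q0 Hq].
  have [N0 HN0] := exhaustion_stop_cvg K0 PhiK T0 (@path_cont w) q0.
  exists N0 => // k /= /HN0; rewrite distrC => kk.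
  have := Hq (W (stop (exhaustion Phi k) T (W ^~ w)) w); rewrite -ball_normE/= => /(_ kk)[Uk].
  by rewrite /f vtE.
exists N => // k /= /HN /(_ z erefl) zk.
have -> : (\int[P]_w (f k w)%:E = \int[P]_w (v (W (stop (exhaustion Phi k) T (W ^~ w)) w))%:E)%E.
  apply: eq_integral => w _; rewrite /f vtE//; apply/OU/(@exhaustion_sub _ _ _ k).
  by apply: (stop_closed T0 (@path_cont w) (clE k)); rewrite path0.
have DU : exhaustion Phi k `<=` U by move=> y /exhaustion_sub/OU.
have Z := stop_dynkin BM (@exhaustion_compact _ _ _ _ K0 PhiK k) oU DU cv lap c00 vc zk T0.
exact: Z.
Unshelve. all: by end_near. Qed.

Definition exits : set Om := [set w | exists2 t : R, 0 <= t & ~ O (W t w)].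

Lemma exits_stopped_at w (t : R) : 0 <= t -> ~ O (W t w) -> forall m : nat, t < m.+1%:R ->
  stopped_at m.+1%:R w = exit_point O W w /\ ~ O (exit_point O W w).
Proof.
move=> t0 nO m tm; have T0 : 0 < m.+1%:R :> R by [].
have st : stop O m.+1%:R (W ^~ w) <= t by exact: stop_le.
have E : stop O m.+1%:R (W ^~ w) = exit_time O W w.
  have lbA : has_lbound [set t : R | 0 <= t /\ ~ O (W t w)] by exists 0 => ? [].
  apply/eqP; rewrite eq_le; apply/andP; split.
    apply: lb_le_inf; first by exists t.
    by move=> t' [t'0 nO']; exact: stop_le.
  apply: lb_le_inf; first by exists m.+1%:R; right.
  move=> t' [H'|->]; first exact: ge_inf.
  by apply: le_trans (ltW tm); apply: ge_inf.
have EE : stopped_at m.+1%:R w = exit_point O W w by rewrite /stopped_at E.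
split => //; rewrite -EE.
apply: (@stop_open _ _ (W ^~ w) m.+1%:R T0 (@path_cont w) O (open_nhs K0 PhiK)).
exact: le_lt_trans st tm.
Qed.

Lemma exitsE : exits = \bigcup_m (stopped_at m.+1%:R @^-1` (~` O)).
Proof.
apply/seteqP; split => [w [t t0 nO]|w [m _ nO]].
  exists (Num.truncn t) => //=.
  by have [-> ] := exits_stopped_at t0 nO (truncnS_gt t).
by exists (stop O m.+1%:R (W ^~ w)) => //; exact: stop_ge0.
Qed.

Lemma measurable_exits : measurable exits.
Proof.
rewrite exitsE; apply: bigcup_measurable => m _.
have mO : measurable (~` O : set (borel_rV R n.+1)).
  by apply: measurableC; apply: borel_open; exact: open_nhs K0 PhiK.
by rewrite -[X in measurable X]setTI; exact: (@measurable_stopped_at m.+1%:R _ measurableT _ mO).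
Qed.

Lemma exit_point_boundary w : exits w -> S (exit_point O W w).
Proof.
move=> [t t0 nO]; apply/nhs_boundaryP.
have [E nO'] := exits_stopped_at t0 nO (truncnS_gt t).
apply/eqP; rewrite eq_le; apply/andP; split.
  by move: nO'; rewrite nhsE => /negP; rewrite -leNgt.
by rewrite -E; exact: stopped_at_gap.
Qed.

Lemma exit_point_never w : ~ exits w -> exit_point O W w = z.
Proof.
move=> nE; rewrite /exit_point /exit_time.
rewrite (_ : [set t : R | _] = set0) ?inf0 ?path0//.
by apply/seteqP; split => // t [t0 nO]; apply: nE; exists t.
Qed.

Lemma measurable_exit_point : measurable_fun setT (exit_point O W : Om -> borel_rV R n.+1).
Proof.
rewrite -(setUv exits); apply/measurable_funU; [exact: measurable_exits|exact/measurableC/measurable_exits|split].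
  apply: (@measurable_rV_cvg _ _ _ _ _ (fun m => stopped_at m.+1%:R)).
    by move=> m; apply: measurable_funTS; exact: measurable_stopped_at.
  move=> w [t t0 nO] eta eta0; exists (Num.truncn t) => m mt.
  have [|-> _] := exits_stopped_at t0 nO (m := m); last by rewrite subrr normr0.
  by apply: (lt_le_trans (truncnS_gt t)); rewrite ler_nat ltnS.
apply: (@eq_measurable_fun _ _ _ (borel_rV R n.+1) _ (cst z)); last exact: measurable_cst.
by move=> w; rewrite inE => nE; rewrite exit_point_never.
Qed.

Lemma stopped_at_never (T : R) w : 0 < T -> ~ exits w -> stopped_at T w = W T w.
Proof.
move=> T0 nE; rewrite /stopped_at /stop /stop_set (_ : mkset _ = set0) ?set0U ?inf1//.
by apply/seteqP; split => // t [t0 nO]; apply: nE; exists t.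
Qed.

Lemma height_law_le (T a b : R) : 0 < T -> a <= b ->
  (P [set w | (a <= height (W T w) - height z <= b)%R] <= ((b - a) / Num.sqrt T)%:E)%E.
Proof.
move=> T0 ab; pose A (_ : nat) (i : 'I_n.+1) : set (measurableTypeR R) :=
  if i == ord_max then `[a, b]%classic else setT.
have mA j i : measurable (A j i) by rewrite /A; case: ifP => _; [exact: measurable_itv|exact: measurableT].
have := incr_law BM T0 1 mA.
rewrite big_ord1 (bigD1 ord_max)//= big1; last first.
  by move=> i /negbTE ni; rewrite /A ni probability_setT.
rewrite mule1 {2}/A eqxx => EP.
have s0 : 0 < Num.sqrt T by rewrite sqrtr_gt0.
apply: le_trans (normal_itv_le s0 ab); rewrite -EP le_eqVlt; apply/orP; left; apply/eqP.
congr (P _); apply/seteqP; split => w /=.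
  move=> H j i; rewrite /A; case: ifP => // /eqP ->.
  rewrite ord1 /incr /walk/= mul1r mul0r path0 in_itv/= !mxE; exact: H.
move=> /(_ ord0 ord_max); rewrite /A eqxx /= /incr /walk/= mul1r mul0r path0 in_itv/= !mxE.
by [].
Qed.

(** Two bounds at time [k ^+ 4] are compared. A path that has not left the domain has height above
    [- B]. Dynkin's inequality for the height makes heights beyond about [k] improbable, of order
    [k^-1]; and the Gaussian law, of deviation [k ^+ 2], gives a window of length about [k] a
    probability of the same order. *)
Lemma exits_ae : P (~` exits) = 0%E.
Proof.
(* On the domain lowered by 1 the height exceeds [- B - 1], so the shifted height is at least 1
   there. *)
have mE := measurable_exits; pose shift : R := B + 2.
have B0 : 0 <= B by exact: le_trans (normr_ge0 _) (PhiB 0).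
pose v (y : 'rV[R]_n.+1) : R := height y + shift.
have PhiBl x : - B <= Phi x by have := PhiB x; rewrite ler_norml => /andP[].
have vz0 : 0 <= v z.
  have : 0 < gp z by rewrite -nhsE.
  by rewrite /gap /v /shift; have := PhiBl (base z); lra.
have cv : c2 [set y | O (vshift 1 y)] v (fun j y => (j == ord_max)%:R + 0) (fun _ _ => 0 + 0).
  exact: (c2D (@c2_coord _ _ _ ord_max) (@c2_cst _ _ _ shift)).
have main (k : R) : 1 <= k -> (P (~` exits) <= ((v z + shift + 1) / k)%:E)%E.
  move=> k1; have k0 : 0 < k by lra.
  have T0 : 0 < k ^+ 4 by rewrite exprn_gt0.
  have lap0 (x : 'rV[R]_n.+1) : O (vshift 1 x) -> \sum_(i < n.+1) (0 + 0 : R) <= 0.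
    by rewrite big1// => i _; rewrite addr0.
  have v1 x : O (vshift 1 x) -> 1 <= v x.
    rewrite nhsE gap_vshift /gap /v /shift; have := PhiBl (base x); lra.
  have dyn := @stopped_at_dynkin 1 v _ _ (k ^+ 4) 1 ltr01 cv lap0 ltr01 v1 T0.
  have mv : measurable_fun setT (fun w => v (stopped_at (k ^+ 4) w)).
    apply: measurable_funD => //.
    exact: (measurableT_comp (measurable_coord ord_max) (measurable_stopped_at T0)).
  pose A := [set w | k <= v (stopped_at (k ^+ 4) w)].
  have mA : measurable A.
    rewrite -[X in measurable X]setTI (_ : A = (fun w => v (stopped_at (k ^+ 4) w)) @^-1` `[k, +oo[).
      by apply: mv => //; exact: measurable_itv.
    by apply/seteqP; split => w /=; rewrite in_itv/= andbT.
  have PA : (P A <= (v z / k)%:E)%E.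
    rewrite mulrC EFinM -lee_pdivrMl//; last by rewrite invr_gt0.
    rewrite invrK.
    apply: le_trans dyn; rewrite -(setIT A) -integral_indic// -ge0_integralZl//; first last.
    - by rewrite lee_fin ltW.
    - by apply/measurable_EFinP; exact: measurable_indic.
    apply: ge0_le_integral => //.
    - by move=> w _; rewrite -EFinM lee_fin mulr_ge0// ltW.
    - by apply/measurable_EFinP; apply: measurable_funM => //; exact: measurable_indic.
    - exact/measurable_EFinP.
    move=> w _; rewrite -EFinM lee_fin indicE.
    case: (boolP (w \in A)) => [|_]; first by rewrite inE mulr1.
    rewrite mulr0; apply: le_trans ler01 (v1 _ _); rewrite nhsE gap_vshift.
    by rewrite ltr_wpDl// stopped_at_gap.
  pose Bk := [set w | - B - height z <= height (W (k ^+ 4) w) - height z <= k - height z].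
  have mB : measurable Bk.
    have mW : measurable_fun setT (fun w => height (W (k ^+ 4) w) - height z).
      apply: measurable_funB => //; apply: (measurableT_comp (measurable_coord ord_max)).
      by have [_ [_ [H _]]] := BM; apply: H; exact: ltW.
    rewrite -[X in measurable X]setTI (_ : Bk = (fun w => height (W (k ^+ 4) w) - height z) @^-1` `[- B - height z, k - height z]).
      by apply: mW => //; exact: measurable_itv.
    by apply/seteqP; split => w /=; rewrite in_itv.
  have PB : (P Bk <= ((k + B) / k ^+ 2)%:E)%E.
    have := @height_law_le (k ^+ 4) (- B - height z) (k - height z) T0.
    rewrite (_ : k - height z - (- B - height z) = k + B); last by ring.
    rewrite -[4%N]/(2 * 2)%N exprM sqrtr_sqr ger0_norm ?exprn_ge0 ?(ltW k0)// -exprM.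
    by apply; lra.
  have sub : ~` exits `<=` A `|` Bk.
    move=> w nE; have E := stopped_at_never T0 nE.
    case: (leP k (v (stopped_at (k ^+ 4) w))) => [H|H]; [by left|right].
    have : 0 < gp (W (k ^+ 4) w).
      by rewrite -nhsE; apply: contrapT => nO; apply: nE; exists (k ^+ 4) => //; exact: ltW.
    rewrite /Bk /= /gap; move: H; rewrite E /v /shift; have := PhiBl (base (W (k ^+ 4) w)) => ? ? ?.
    by apply/andP; split; lra.
  apply: (@le_trans _ _ (P (A `|` Bk))); first by apply: le_measure => //; rewrite inE; [exact: measurableC|exact: measurableU].
  apply: (le_trans (measureU2 _ mA mB)); apply: (le_trans (leeD PA PB)).
  rewrite -EFinD lee_fin ler_pdivlMr// mulrDl divfK ?gt_eqF//.
  have -> : (k + B) / k ^+ 2 * k = 1 + B / k by field; rewrite gt_eqF.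
  have : B / k <= B by rewrite ler_pdivrMr// ler_peMr.
  rewrite /shift; lra.
apply/eqP; rewrite eq_le measure_ge0 andbT; apply/lee_addgt0Pr => e e0; rewrite add0e.
pose c := v z + shift + 1; pose k := Num.max 1 (c / e).
have k1 : 1 <= k by rewrite le_max lexx.
apply: (le_trans (main k k1)); rewrite lee_fin -/c ler_pdivrMr; last by lra.
by rewrite mulrC -ler_pdivrMr// le_max lexx orbT.
Qed.

Lemma exits_preimage : exit_point O W @^-1` S = exits.
Proof.
apply/seteqP; split => w; last exact: exit_point_boundary.
move=> Sw; apply: contrapT => /exit_point_never E; move: Sw; rewrite /= E => /nhs_boundaryP gz.
by move: Oz; rewrite nhsE gz ltxx.
Qed.

(** Adding [e] supplies the positive lower bound required at bounded times. On a path that exits,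
    the stopped positions are eventually equal to the exit point, so Fatou's lemma removes the time
    cap, and [e] is arbitrary. *)
Lemma exit_dynkin (s : R) v g h : 0 < s ->
  c2 [set y | O (vshift s y)] v g h -> (forall x, O (vshift s x) -> \sum_i h i x <= 0) ->
  (forall x, O (vshift s x) -> 0 <= v x) ->
  (\int[P]_(w in exits) (v (exit_point O W w))%:E <= (v z)%:E)%E.
Proof.
move=> s0 cv lap v0; have mE := measurable_exits.
have gU y : 0 <= gp y -> O (vshift s y) by move=> gy; rewrite nhsE gap_vshift ltr_wpDl.
apply/lee_addgt0Pr => e e0; rewrite -EFinD.
pose v' y := v y + e.
have cv' : c2 [set y | O (vshift s y)] v' (fun i y => g i y + 0) (fun i y => h i y + 0).
  exact: (c2D cv (@c2_cst _ _ _ e)).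
have mU : measurable ([set y | O (vshift s y)] : set (borel_rV R n.+1)).
  apply: borel_open; rewrite (_ : mkset _ = gp @^-1` [set t | - s < t]).
    by apply: open_comp; [move=> x _; exact: (continuous_gap K0 PhiK)|exact: open_gt].
  by apply/seteqP; split => y; rewrite /= nhsE gap_vshift; lra.
pose vt : 'rV[R]_n.+1 -> R := v' \_ [set y | O (vshift s y)].
have vtE y : O (vshift s y) -> vt y = v' y by move=> Uy; rewrite /vt patchE mem_set.
have mvt : measurable_fun setT (vt : borel_rV R n.+1 -> R).
  apply/(measurable_restrictT _ _).1 => //.
  apply: measurable_rel_continuous => //.
  by apply: continuous_rel => x /cv'[].
have lap' x : O (vshift s x) -> \sum_i (h i x + 0) <= 0.
  by move=> Ox; under eq_bigr do rewrite addr0; exact: lap.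
have ve x : O (vshift s x) -> e <= v' x by move=> /v0 ?; rewrite /v' lerDr.
have bd k : (\int[P]_w (vt (stopped_at k.+1%:R w))%:E <= (v z + e)%:E)%E.
  have T0 : 0 < k.+1%:R :> R by [].
  apply: le_trans (stopped_at_dynkin s0 cv' lap' e0 ve T0).
  rewrite le_eqVlt; apply/orP; left; apply/eqP; apply: eq_integral => w _.
  by rewrite vtE//; apply/gU/stopped_at_gap.
apply: (@le_trans _ _ (\int[P]_(w in exits) (vt (exit_point O W w))%:E)%E).
  have mve : measurable_fun exits (fun w => vt (exit_point O W w)).
    by apply: measurable_funTS; exact: (measurableT_comp mvt measurable_exit_point).
  have Ue w : exits w -> O (vshift s (exit_point O W w)).
    by move=> /exit_point_boundary/nhs_boundaryP gw; apply: gU; rewrite gw.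
  apply: ge0_le_integral => //.
  - by move=> w /Ue/v0; rewrite lee_fin.
  - apply/measurable_EFinP.
    apply: (@eq_measurable_fun _ _ _ _ _ (fun w => vt (exit_point O W w) - e)).
      by move=> w; rewrite inE => /Ue Uw; rewrite vtE// /v' addrK.
    by apply: measurable_funB.
  - exact/measurable_EFinP.
  - by move=> w /Ue Uw; rewrite lee_fin vtE// lerDl ltW.
apply: (@fatou_bound _ _ _ P exits (fun k w => vt (stopped_at k.+1%:R w))) => //.
- by move=> k; apply: (measurableT_comp mvt); exact: measurable_stopped_at.
- move=> k w; rewrite /vt patchE; case: ifPn => // /set_mem Ux.
  exact: le_trans (ltW e0) (ve _ Ux).
- move=> w [t t0 nO]; apply: cvg_near_cst; exists (Num.truncn t) => // m /= tm.
  have [|-> //] := exits_stopped_at t0 nO (m := m).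
  by apply: (lt_le_trans (truncnS_gt t)); rewrite ler_nat ltnS.
- by exists 0%N.
Qed.

End exit.

(** * Transfer to harmonic measure *)

Section harmonic_measure.
Context {R : realType} {n : nat} (Phi : 'rV[R]_n -> R) (K B : R).
Context (K0 : 0 <= K) (PhiK : forall x y : 'rV[R]_n, `|Phi x - Phi y| <= K * `|x - y|).
Context (PhiB : forall x, `|Phi x| <= B).
Local Notation O := (near_half_space Phi).
Local Notation S := (nhs_boundary Phi).
Context (omega : 'rV[R]_n.+1 -> probability (borel_rV R n.+1) R).
Context (hmO : harmonic_measure O omega).

Lemma measurable_boundary : measurable (S : set (borel_rV R n.+1)).
Proof. by apply: borel_closed; exact: closed_nhs_boundary K0 PhiK. Qed.

Lemma harmonic_measure_boundary z : O z -> omega z S = 1%E.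
Proof.
move=> Oz; have [disp [Om [P [W [BM E]]]]] := hmO Oz.
have mE := measurable_exits K0 PhiK BM.
rewrite E; last exact: measurable_boundary.
rewrite (exits_preimage K0 PhiK BM Oz) -(setCK (exits Phi W)).
by rewrite probability_setC ?(exits_ae K0 PhiK PhiB BM Oz) ?sube0//; exact: measurableC.
Qed.

Lemma harmonic_measure_dynkin z (s : R) v g h : O z -> 0 < s ->
  c2 [set y | O (vshift s y)] v g h -> (forall x, O (vshift s x) -> \sum_i h i x <= 0) ->
  (forall x, O (vshift s x) -> 0 <= v x) ->
  (\int[omega z]_(xi in S) (v xi)%:E <= (v z)%:E)%E.
Proof.
move=> Oz s0 cv lap v0; have [disp [Om [P [W [BM E]]]]] := hmO Oz.
have gU y : S y -> O (vshift s y) by move=> Sy; exact: boundary_vshift.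
have mex := measurable_exit_point K0 PhiK BM.
pose mum : {measure set (borel_rV R n.+1) -> \bar R} :=
  @measure_function_pushforward__canonical__measure_function_Measure _ _ _ _ _ P _ mex.
have Z := exit_dynkin K0 PhiK BM Oz s0 cv lap v0.
apply: le_trans Z.
rewrite le_eqVlt; apply/orP; left; apply/eqP.
transitivity (\int[mum]_(xi in S) (v xi)%:E)%E.
  by apply: eq_measure_integral => A mA _; exact: E.
rewrite ge0_integral_pushforward//.
- by rewrite (exits_preimage K0 PhiK BM Oz).
- exact: measurable_boundary.
- apply/measurable_EFinP; apply: measurable_rel_continuous; first exact: measurable_boundary.
  by apply: continuous_rel => x /gU/cv[].
- by move=> x; rewrite inE => /gU/v0; rewrite lee_fin.
Qed.

End harmonic_measure.

(** * Decay and mass of harmonic measure *)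

Lemma mul_measure_le_integral {R : realType} d (T : measurableType d) (mu : {measure set T -> \bar R})
    (A D : set T) (f : T -> R) (c : R) : measurable A -> measurable D -> A `<=` D -> 0 <= c ->
  measurable_fun D f -> (forall x, D x -> 0 <= f x) -> (forall x, A x -> c <= f x) ->
  (c%:E * mu A <= \int[mu]_(x in D) (f x)%:E)%E.
Proof.
move=> mA mD AD c0 mf f0 cf; have mfE : measurable_fun D (EFin \o f) by exact/measurable_EFinP.
rewrite -integral_cst//; apply: (@le_trans _ _ (\int[mu]_(x in A) (f x)%:E)%E).
  by apply: ge0_le_integral => //; exact: measurable_funS mfE.
exact: ge0_subset_integral.
Qed.

(** The inequality on [G] says that [rho ^ - gamma * G (1 + cos theta)] is
    superharmonic in dimension [n + 1], [theta] being the angle with the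
    vertical. *)
Definition barrier_profile {R : realType} (n : nat) (kappa gamma : R) (G G1 G2 : R -> R) (m M : R) :=
  0 < m /\ forall t : R, kappa <= t <= 2 ->
  [/\ is_derive t (1 : R) G (G1 t), is_derive t (1 : R) G1 (G2 t), {for t, continuous G2},
      m <= G t <= M &
      gamma * (gamma + 1 - n%:R) * G t + t * (2 - t) * G2 t - n%:R * (t - 1) * G1 t <= 0].

(** The Laplacian of the barrier after summation over the coordinates: [y * r] stands for the
    cosine, [N] for the dimension minus one, and the values of the profile and its derivatives are
    independent letters. *)
Lemma barrier_algebra (R : fieldType) (F q Gt G1t G2t y r g N : R) : q != 0 -> 2 != 0 :> R ->
  F / q * Gt * (- g / 2 * ((- g / 2 - 1) * 4 / q * q + ((N + 1) + (N + 1)))) +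
  - g / 2 * (F / q) * 4 * G1t * 0 + F * G2t * ((1 - (y * r) ^+ 2) / q) +
  F * G1t * (-2 * r / q * y) + F * G1t * y * r * (3 / q ^+ 2 * q + - q^-1 * (N + 1)) =
  F / q * (g * (g + 1 - N) * Gt + (1 + y * r) * (2 - (1 + y * r)) * G2t - N * (1 + y * r - 1) * G1t).
Proof. by move=> q0 two0; field; rewrite q0 two0. Qed.

(** * Profiles for the barrier *)

Section profiles.
Context {R : realType}.

Lemma is_derive_inv (t : R) : t != 0 -> is_derive t (1 : R) (fun x : R => x^-1) (- (t ^+ 2)^-1).
Proof.
move=> t0; have := @is_deriveV _ (id : R -> R) t 1 1 t0 (is_derive_id _ _).
by rewrite /GRing.scale/= mulr1 -exprVn.
Qed.

(** In the plane, [rho ^ (-1/2)] times [sqrt (1 + cos theta)] is harmonic off the downward ray;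
    subtracting [delta] from the root leaves the slack [- delta / 4], part of which is spent on
    raising the exponent above 1/2. In dimension three the zeroth-order term vanishes at exponent 1,
    and [- t^-1] gives the strictly negative [- 2 * t^-1 ^+ 2]. In higher dimensions the Newtonian
    kernel, of exponent [n - 1 > n / 2], is enough. *)
Lemma barrier_profileP (n : nat) (kappa : R) : (0 < n)%N -> 0 < kappa <= 1 ->
  exists gamma G G1 G2 m M, n%:R / 2 < gamma :> R /\ barrier_profile n kappa gamma G G1 G2 m M.
Proof.
case: n => // -[|[|n]] _ /andP[k0 k1].
- pose delta := Num.sqrt kappa / 2.
  have sk0 : 0 < Num.sqrt kappa by rewrite sqrtr_gt0.
  have sk1 : Num.sqrt kappa <= 1 by rewrite -(sqrtr1 R) ler_wsqrtr.
  have d0 : 0 < delta by rewrite divr_gt0.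
  exists (2^-1 + delta / 100), (fun t => Num.sqrt t - delta), (fun t => (2 * Num.sqrt t)^-1),
    (fun t => - (2 * ((2 * Num.sqrt t) ^-1) ^+ 3)), delta, 2.
  split; first by lra.
  split; first exact: d0.
  move=> t /andP[kt t2]; have t0 : 0 < t by lra.
  have [s0 s2] : Num.sqrt kappa <= Num.sqrt t /\ Num.sqrt t <= 2.
    split; first exact: ler_wsqrtr.
    rewrite -[leRHS](ger0_norm (ler0n R 2)) -sqrtr_sqr; apply: ler_wsqrtr.
    by rewrite expr2; lra.
  have sp : 0 < Num.sqrt t by lra.
  have sn : 2 * Num.sqrt t != 0 by rewrite gt_eqF// mulr_gt0.
  have cs : {for t, continuous (fun t : R => (2 * Num.sqrt t)^-1)}.
    apply: (@cvgV _ _ (nbhs t) _ (fun t => 2 * Num.sqrt t) (2 * Num.sqrt t)) => //.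
    apply: (@cvgM _ _ (nbhs t) _ (cst 2) _ _ _ (cvg_cst _)); exact: sqrt_continuous.
  split.
  - by rewrite -[(_)^-1]subr0; have H1 := is_derive1_sqrt t0; exact: is_deriveB.
  - have H2 : is_derive t (1 : R) (fun t : R => 2 * Num.sqrt t) (2 * (2 * Num.sqrt t)^-1).
      exact: (@is_deriveZ _ _ _ (@Num.sqrt R) 2 t 1 _ (is_derive1_sqrt t0)).
    have := @is_derive1_comp _ (fun x : R => x^-1) (fun t : R => 2 * Num.sqrt t) t _ _ (is_derive_inv sn) H2.
    rewrite (_ : - (2 * (2 * Num.sqrt t)^-1 ^+ 3) = - ((2 * Num.sqrt t) ^+ 2)^-1 * (2 * (2 * Num.sqrt t)^-1)) //.
    by rewrite -exprVn; set x := (2 * Num.sqrt t)^-1; ring.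
  - apply: (@cvgN _ _ _ (nbhs t)); apply: (@cvgM _ _ (nbhs t) _ (cst 2) _ _ _ (cvg_cst _)).
    by apply: (@cvgM _ _ (nbhs t) _ _ (fun t : R => (2 * Num.sqrt t)^-1 ^+ 2)) => //; apply: (@cvgM _ _ (nbhs t)).
  - by rewrite /delta in d0 *; apply/andP; split; lra.
  - set s := Num.sqrt t in s0 s2 sp *.
    have st : t = s ^+ 2 by rewrite sqr_sqrtr// ltW.
    rewrite st; clearbody s.
    have -> : (2^-1 + delta / 100) * (2^-1 + delta / 100 + 1 - 1) * (s - delta) +
       s ^+ 2 * (2 - s ^+ 2) * - (2 * (2 * s)^-1 ^+ 3) - 1 * (s ^+ 2 - 1) * (2 * s)^-1 =
       (delta / 100 + (delta / 100) ^+ 2) * (s - delta) - 4^-1 * delta.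
      by field; rewrite gt_eqF.
    have d1 : delta <= 1 by rewrite /delta; lra.
    have : (delta / 100 + (delta / 100) ^+ 2) * (s - delta) <= (delta / 50) * 2.
      apply: ler_pM; [by nra|by rewrite /delta in d0 *; lra|by nra|lra].
    lra.
- exists (1 + kappa / 100), (fun t => 2 / kappa - t^-1), (fun t => (t ^+ 2)^-1),
    (fun t => - 2 * (t ^+ 3)^-1), kappa^-1, (2 / kappa).
  split; first by lra.
  have kV : 0 < kappa^-1 by rewrite invr_gt0.
  split; first exact: kV.
  move=> t /andP[kt t2]; have t0 : 0 < t by lra.
  have tk : t^-1 <= kappa^-1 by rewrite lef_pV2.
  have tV : 0 < t^-1 by rewrite invr_gt0.
  have tn : t != 0 by rewrite gt_eqF.
  split.
  - have -> : (t ^+ 2)^-1 = 0 - (- (t ^+ 2)^-1) by rewrite sub0r opprK.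
    by apply: is_deriveB; exact: is_derive_inv.
  - have H := @is_deriveM _ _ (fun x : R => x^-1) (fun x : R => x^-1) t 1 _ _ (is_derive_inv tn) (is_derive_inv tn).
    have -> : - 2 * (t ^+ 3)^-1 = t^-1 *: - (t ^+ 2)^-1 + t^-1 *: - (t ^+ 2)^-1.
      by rewrite /GRing.scale/=; field.
    rewrite (_ : (fun t => (t ^+ 2)^-1) = (fun x : R => x^-1) * (fun x : R => x^-1)) //.
    by apply/funext => x; rewrite [RHS]/(x^-1 * x^-1) expr2 invfM.
  - apply: (@cvgM _ _ (nbhs t) _ (cst (- 2)) _ _ _ (cvg_cst _)).
    apply: cvgV; first by rewrite expf_neq0.
    exact: exprn_continuous.
  - by apply/andP; split; lra.
  - have -> : (1 + kappa / 100) * (1 + kappa / 100 + 1 - 2) * (2 / kappa - t^-1) +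
       t * (2 - t) * (- 2 * (t ^+ 3)^-1) - 2 * (t - 1) * (t ^+ 2)^-1 =
       (1 + kappa / 100) * (kappa / 100) * (2 / kappa - t^-1) - 2 * t^-1 ^+ 2.
      by field; rewrite tn gt_eqF.
    have : (1 + kappa / 100) * (kappa / 100) * (2 / kappa - t^-1) <= 2 * (1 / 100) * 2.
      rewrite -mulrA; apply: le_trans (_ : 2 * ((kappa / 100) * (2 / kappa)) <= _).
        apply: ler_pM; [lra| |lra|].
          by rewrite mulr_ge0//; lra.
        by apply: ler_wpM2l; lra.
      by rewrite le_eqVlt; apply/orP; left; apply/eqP; field; rewrite gt_eqF.
    have : 2^-1 <= t^-1 by rewrite lef_pV2 ?posrE.
    nra.
- exists (n.+2%:R), (fun=> 1), (fun=> 0), (fun=> 0), 1, 1.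
  split; first by rewrite -!(natr1 n.+2) -!(natr1 n.+1) -!(natr1 n); have := ler0n R n; lra.
  split=> // t _; split; [exact: is_derive_cst|exact: is_derive_cst|exact: cst_continuous|by rewrite lexx|].
  by rewrite !mulr0 !mulr1 subr0 addr0 -(natr1 n.+2) subrr mulr0.
Unshelve. all: by end_near. Qed.

End profiles.

(** * Superharmonicity of the barrier *)

Section barrier.
Context {R : realType} {n : nat} (p : 'rV[R]_n.+1).
Local Notation q := (fun x : 'rV[R]_n.+1 => dotp (x - p) (x - p)).
Local Notation e := ord_max.

Definition cosine (x : 'rV[R]_n.+1) : R := (x - p) 0 e * q x `^ (- 2^-1).

Lemma cosine_bound x : 0 < q x -> -1 <= cosine x <= 1.
Proof.
move=> q0; rewrite -ler_norml -(@ler_pXn2r _ 2)// ?nnegrE//.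
rewrite expr1n real_normK ?num_real// /cosine exprMn -[(_ `^ _) ^+ 2]powR_mulrn ?powR_ge0// -powRrM.
have -> : - 2^-1 * 2%:R = -1 :> R by field.
rewrite powR_inv1 ?(ltW q0)// ler_pdivrMr// mul1r.
exact: sqr_coord_le_dotp.
Qed.

Context (gamma kappa : R) (G G1 G2 : R -> R) (m M : R).
Context (profile : barrier_profile n kappa gamma G G1 G2 m M).

Definition barrier (x : 'rV[R]_n.+1) : R := q x `^ (- gamma / 2) * G (1 + cosine x).

Lemma barrier_superharmonic (U : set 'rV[R]_n.+1) :
  (forall x, U x -> 0 < q x /\ kappa <= 1 + cosine x) ->
  exists g h, c2 U barrier g h /\ forall x, U x -> \sum_i h i x <= 0.
Proof.
move=> HU; have q0 x : U x -> 0 < q x by move=> /HU[].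
have cq := @c2_sqdist R n.+1 U p.
have cF := c2_powR (- gamma / 2) q0 cq.
have cr := c2_powR (- 2^-1) q0 cq.
have cy : c2 U (fun x => (x - p) 0 e) (fun j _ => (j == e)%:R + 0) (fun _ _ => 0 + 0).
  apply: c2_ext (c2D (@c2_coord _ _ U e) (@c2_cst _ _ U (- p 0 e))) _ _ _ => //.
  by move=> x; rewrite !mxE.
have ctau := c2D (@c2_cst _ _ U 1) (c2M cy cr).
have cG := @c2_comp1 _ _ U [set t | kappa <= t <= 2] G G1 G2 _ _ _
   (fun t kt => let: And5 a b c _ _ := profile.2 t kt in And3 a b c) _ ctau.
have {}cG := cG ltac:(by move=> x Ux /=; have [Q1 Q2] := HU x Ux;
  rewrite Q2 /=; have /andP[_] := cosine_bound Q1; rewrite /cosine; lra).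
have cb := c2M cF cG.
do 2 eexists; split; first exact: cb.
move=> x Ux /=; have Q := q0 x Ux; have [_ Hk] := HU x Ux.
have /andP[c1 c2'] := cosine_bound Q.
have tk : kappa <= 1 + cosine x <= 2 by rewrite Hk/=; lra.
have [_ _ _ /andP[Gm GM] Gineq] := profile.2 _ tk.
set X := x - p in Q *; set y := X 0 e; set Qx := dotp X X in Q *.
set r := Qx `^ (- 2^-1); set F := Qx `^ (- gamma / 2).
have Qn : Qx != 0 by rewrite gt_eqF.
have pS a : Qx `^ (a - 1) = Qx `^ a / Qx.
  by rewrite powRD ?(negbTE Qn) ?implybT// powR_inv1// ltW.
have rr : r ^+ 2 = Qx^-1.
  rewrite -powR_mulrn ?powR_ge0// -powRrM (_ : - 2^-1 * 2%:R = -1) ?powR_inv1 ?ltW//.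
  by field.
have cE : 1 + (X 0 e * r) = 1 + cosine x by [].
have F0 : 0 < F by rewrite powR_gt0.
have SX : \sum_i X 0 i ^+ 2 = Qx by rewrite sumsq_coord.
have Sd (f : 'I_n.+1 -> R) : \sum_i (i == e)%:R * f i = f e.
  by rewrite (bigD1 e)//= eqxx mul1r big1 ?addr0// => i /negbTE ->; rewrite mul0r.
rewrite !pS -/r -/F.
set Gt := G _; set G1t := G1 _; set G2t := G2 _.
(* [D] is the gradient of the cosine. The cosine is constant along rays, so [D] is orthogonal to
   [X], and its square is [(1 - cos ^ 2) / Qx]. *)
pose D (i : 'I_n.+1) : R := (i == e)%:R * r - y * r / Qx * X 0 i.
have SD2 : \sum_i D i ^+ 2 = (1 - (y * r) ^+ 2) / Qx.
  have E i : D i ^+ 2 = (i == e)%:R * (r ^+ 2 - 2 * r * (y * r / Qx) * X 0 i) + (y * r / Qx) ^+ 2 * X 0 i ^+ 2.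
    by rewrite /D; case: (i == e); rewrite /=; ring.
  under eq_bigr do rewrite E.
  rewrite big_split/= Sd -mulr_sumr SX -/y exprMn rr; field => //.
have SXD : \sum_i X 0 i * D i = 0.
  have E i : X 0 i * D i = (i == e)%:R * (r * X 0 i) + (- (y * r / Qx)) * X 0 i ^+ 2.
    by rewrite /D; case: (i == e); rewrite /=; ring.
  under eq_bigr do rewrite E.
  by rewrite big_split/= Sd -mulr_sumr SX -/y; field.
have gE : gamma * (gamma + 1 - n%:R) * Gt + (1 + y * r) * (2 - (1 + y * r)) * G2t - n%:R * (1 + y * r - 1) * G1t <= 0 := Gineq.
rewrite (eq_bigr (fun i => (F / Qx * Gt) * ((- gamma / 2) * ((- gamma / 2 - 1) * 4 / Qx * X 0 i ^+ 2 + 2)) +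
   (- gamma / 2 * (F / Qx) * 4 * G1t) * (X 0 i * D i) + F * G2t * D i ^+ 2 +
   (i == e)%:R * (F * G1t * (- 2 * r / Qx * X 0 i)) +
   F * G1t * y * r * (3 / Qx ^+ 2 * X 0 i ^+ 2 - Qx^-1))); last first.
  move=> i _; rewrite /D -/y; case: (i == e); rewrite /=; field => //.
rewrite !big_split/= -!mulr_sumr SXD SD2 Sd -/y !big_split/= -!mulr_sumr SX !sumr_const card_ord.
apply: le_trans (_ : F / Qx * (gamma * (gamma + 1 - n%:R) * Gt + (1 + y * r) * (2 - (1 + y * r)) * G2t - n%:R * (1 + y * r - 1) * G1t) <= _); last first.
  by rewrite pmulr_rle0// divr_gt0.
rewrite le_eqVlt; apply/orP; left; apply/eqP; rewrite -[- Qx^-1 *+ n.+1]mulr_natr -(natr1 n).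
by apply: barrier_algebra => //; rewrite pnatr_eq0.
Qed.

End barrier.

(** * Decay and mass of harmonic measure near a boundary point *)

Section estimates.
Context {R : realType} {n : nat} (Phi : 'rV[R]_n -> R) (K B : R).
Context (n0 : (0 < n)%N) (K0 : 0 <= K).
Context (PhiK : forall x y : 'rV[R]_n, `|Phi x - Phi y| <= K * `|x - y|).
Context (PhiB : forall x, `|Phi x| <= B).
Local Notation O := (near_half_space Phi).
Local Notation S := (nhs_boundary Phi).
Local Notation gp := (gap Phi).
Local Notation BV := (borel_rV R n.+1).

Definition surface_ball (y : 'rV[R]_n.+1) (r : R) : set 'rV[R]_n.+1 :=
  [set xi | S xi /\ `|xi - y| < r].

Lemma measurable_surface_ball y r : measurable (surface_ball y r : set BV).
Proof.
apply: measurableI; first exact: measurable_boundary K0 PhiK.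
by apply: borel_open; exact: open_ballS.
Qed.

Lemma dotp_base (x : 'rV[R]_n.+1) : dotp x x = dotp (base x) (base x) + height x ^+ 2.
Proof.
rewrite /dotp big_ord_recr/= -expr2; congr (_ + _).
by apply: eq_bigr => i _; rewrite base_coord.
Qed.

(** If [gp p < gp x], the vector [x - p] has height at least [- K] times the length of its base, so
    its cosine is at least [- K / sqrt (1 + K ^+ 2)]. This is the least value of one plus that
    cosine, and it is positive. *)
Definition cone_aperture : R := 1 - Num.sqrt (K ^+ 2 / (1 + K ^+ 2)).

Lemma cone_aperture_bounds : 0 < cone_aperture <= 1.
Proof.
have K2 : 0 <= K ^+ 2 by rewrite exprn_ge0.
rewrite /cone_aperture; apply/andP; split; last by rewrite lerBlDr lerDl sqrtr_ge0.
have K21 : 0 < 1 + K ^+ 2 by lra.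
by rewrite subr_gt0 -[ltRHS](sqrtr1 R) ltr_sqrt// ltr_pdivrMr// mul1r ltrDr.
Qed.

Lemma cone_of_gap (p x : 'rV[R]_n.+1) : gp p < gp x ->
  0 < dotp (x - p) (x - p) /\ cone_aperture <= 1 + cosine p x.
Proof.
move=> px.
have Q0 : 0 < dotp (x - p) (x - p).
  rewrite lt_neqAle dotp_ge0 andbT eq_sym; apply: contraTneq px => /dotp_eq0/eqP.
  by rewrite subr_eq0 => /eqP ->; rewrite ltxx.
split => //; rewrite /cone_aperture lerBlDr -addrA lerDl.
set X := x - p in Q0 *; set Q := dotp X X in Q0 *.
have aE : X 0 ord_max = gp x - gp p + (Phi (base x) - Phi (base p)).
  by rewrite /gap /height !mxE; ring.
have ab : - (K * `|base X|) <= X 0 ord_max.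
  rewrite aE /X baseB; have := PhiK (base x) (base p); rewrite ler_norml => /andP[]; lra.
have bQ : `|base X| ^+ 2 <= Q - X 0 ord_max ^+ 2.
  rewrite /Q dotp_base addrK -sqr_enorm ler_pXn2r ?nnegrE ?enorm_ge0//.
  exact: norm_le_enorm.
rewrite /cosine -/X -/Q; set a := X 0 ord_max in ab bQ *.
have r0 : 0 < Q `^ (- 2^-1) by exact: powR_gt0.
case: (leP 0 a) => a0; first by rewrite addr_ge0 ?sqrtr_ge0// mulr_ge0// ltW.
rewrite -lerBlDl sub0r -mulNr; apply: le_trans (_ : Num.sqrt (((- a) * Q `^ (- 2^-1)) ^+ 2) <= _).
  by rewrite sqrtr_sqr ger0_norm// mulr_ge0 ?(ltW r0)//; lra.
apply: ler_wsqrtr; rewrite exprMn sqrrN -[(_ `^ _) ^+ 2]powR_mulrn ?powR_ge0// -powRrM.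
have -> : - 2^-1 * 2%:R = -1 :> R by field.
have K2 : 0 <= K ^+ 2 by rewrite exprn_ge0.
rewrite powR_inv1 ?(ltW Q0)// ler_pdivrMr// mulrAC ler_pdivlMr; last by lra.
have : a ^+ 2 <= K ^+ 2 * `|base X| ^+ 2.
  rewrite -exprMn -[a ^+ 2]sqrrN ler_pXn2r ?nnegrE ?mulr_ge0//; lra.
have := ler_wpM2l K2 bQ; lra.
Qed.

Lemma norm_vshift_sub (t : R) (y : 'rV[R]_n.+1) : `|vshift t y - y| = `|t|.
Proof. by rewrite /vshift addrC addKr normrZ norm_basis_vec mulr1. Qed.

Lemma powR_neg_le (a b c : R) : 0 <= c -> 0 < a -> a <= b -> b `^ (- c) <= a `^ (- c).
Proof.
move=> c0 a0 ab; rewrite !powRN lef_pV2 ?posrE ?powR_gt0//; last exact: lt_le_trans ab.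
by apply: ge0_ler_powR; rewrite ?nnegrE// ?ltW//; exact: lt_le_trans ab.
Qed.

(** The pole of the barrier sits at distance [r] below [y]. Thus the domain lowered by [r / 2] is in
    the cone above the pole, the barrier is at least of order [r ^ - gamma] on the ball, and at [z]
    it is at most of order [|z - y| ^ - gamma]. *)
Lemma ball_decay : exists gamma C, [/\ n%:R / 2 < gamma :> R, 1 <= C &
  forall omega : 'rV[R]_n.+1 -> probability BV R, harmonic_measure O omega ->
  forall z y r, O z -> S y -> 0 < r -> r <= `|z - y| ->
  (omega z (surface_ball y r) <= (C * (r / `|z - y|) `^ gamma)%:E)%E].
Proof.
have [gamma [G [G1 [G2 [m [M [gn prof]]]]]]] := barrier_profileP n0 cone_aperture_bounds.
have m0 : 0 < m by case: prof.
have g0 : 0 < gamma by apply: lt_trans gn; rewrite divr_gt0// ltr0n.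
have /andP[ka0 ka1] := cone_aperture_bounds.
have mM : m <= M.
  have [|_ _ _ /andP[a b] _] := prof.2 1; first by rewrite ka1/= ler1n.
  exact: le_trans a b.
pose D : R := n.+1%:R.
have D1 : 1 <= D by rewrite ler1n.
pose C := M / m * (16 * D) `^ (gamma / 2).
have MM1 : 1 <= M / m by rewrite ler_pdivlMr// mul1r.
pose a := gamma / 2; have a0 : 0 < a by rewrite divr_gt0.
have ge1 x : 1 <= x -> 1 <= x `^ a.
  move=> x1; rewrite -[leLHS](congr1 (@^~ a) (powR1 R)).
  by apply: ge0_ler_powR; rewrite ?nnegrE ?(ltW a0)//; lra.
exists gamma, C; split => //; first by rewrite /C mulr_ege1// ge1//; lra.
move=> omega hm z y r Oz Sy r0 ry.
have mE := measurable_surface_ball y r; have mS := measurable_boundary K0 PhiK.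
have zy0 : 0 < `|z - y| by exact: lt_le_trans ry.
set zy := `|z - y| in ry zy0 *.
have -> : C * (r / zy) `^ gamma = M / m * (16 * D * (r / zy) ^+ 2) `^ a.
  have hA : 0 <= 16 * D by lra.
  rewrite /C -mulrA; congr (_ * _); rewrite [RHS]powRM ?sqr_ge0//.
  congr (_ * _); rewrite -powR_mulrn ?divr_ge0 ?(ltW r0) ?(ltW zy0)// -powRrM; congr (_ `^ _).
  by rewrite /a; field.
(* For [zy < 2 * r] the asserted bound exceeds 1. Otherwise lowering the pole by [r] at most halves
   its distance to [z]. *)
case: (ltP zy (2 * r)) => far.
  apply: (le_trans (probability_le1 _ mE)); rewrite lee_fin mulr_ege1// ge1//.
  have : 2^-1 <= r / zy by rewrite ler_pdivlMr//; lra.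
  nra.
pose p := vshift (- r) y.
have gpp : gp p = - r by rewrite gap_vshift (nhs_boundaryP _ _).1// add0r.
have r20 : 0 < r / 2 by rewrite divr_gt0.
have HU x : O (vshift (r / 2) x) -> 0 < dotp (x - p) (x - p) /\ cone_aperture <= 1 + cosine p x.
  by rewrite nhsE gap_vshift => gx; apply: cone_of_gap; rewrite gpp; lra.
have [g [h [cv lap]]] := barrier_superharmonic prof (U := [set x | O (vshift (r / 2) x)]) HU.
have Gm x : O (vshift (r / 2) x) -> m <= G (1 + cosine p x) <= M.
  move=> /HU[Q Hk]; have /andP[_ c1] := cosine_bound Q.
  by have [|_ _ _ -> //] := prof.2 (1 + cosine p x); rewrite Hk/=; lra.
have v0 x : O (vshift (r / 2) x) -> 0 <= barrier p gamma G x.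
  by move=> /Gm/andP[+ _] => Gx; rewrite mulr_ge0 ?powR_ge0//; lra.
have dyn := harmonic_measure_dynkin K0 PhiK hm Oz r20 cv lap v0.
have EU x : S x -> O (vshift (r / 2) x) by move=> Sx; exact: boundary_vshift.
have yp : `|y - p| = r by rewrite distrC norm_vshift_sub normrN gtr0_norm.
pose vmin := (4 * D * r ^+ 2) `^ (- a) * m.
have vmin0 : 0 < vmin by rewrite mulr_gt0// powR_gt0// !mulr_gt0//; lra.
have vminP x : surface_ball y r x -> vmin <= barrier p gamma G x.
  move=> [Sx xy]; have [Q _] := HU _ (EU _ Sx); have /andP[Gx _] := Gm _ (EU _ Sx).
  rewrite /vmin /barrier mulNr; apply: ler_pM => //; [exact: powR_ge0|exact: ltW|].
  apply: powR_neg_le => //; first exact: ltW.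
  apply: (le_trans (dotp_le_norm _)); rewrite -/D [4 * D]mulrC -mulrA ler_pM2l; last by lra.
  have xp : `|x - p| <= 2 * r by have := ler_distD y x p; rewrite yp; move: xy; set q := `|x - y|; lra.
  by have := normr_ge0 (x - p); move: xp; set q := `|_|; nra.
have zp : zy / 2 <= `|z - p|.
  have := ler_distD p z y; rewrite [`|p - y|]distrC yp -/zy; set q := `|z - p|; lra.
have OU : O (vshift (r / 2) z) by apply: nhs_vshift => //; exact: ltW.
have vz : barrier p gamma G z <= (zy ^+ 2 / 4) `^ (- a) * M.
  have [Q _] := HU _ OU; have /andP[Gm' GM] := Gm _ OU.
  rewrite /barrier mulNr; apply: ler_pM => //; [exact: powR_ge0|by lra|].
  apply: powR_neg_le; [exact: ltW|by rewrite divr_gt0// exprn_gt0|].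
  rewrite -sqr_enorm; have := norm_le_enorm (z - p); move: zp; set q := `|_|; set q' := enorm _; nra.
have mv : measurable_fun (S : set BV) (barrier p gamma G : BV -> R).
  apply: measurable_rel_continuous => //.
  by apply: continuous_rel => x /EU/cv[].
have lower : (vmin%:E * omega z (surface_ball y r) <= \int[omega z]_(xi in S) (barrier p gamma G xi)%:E)%E.
  have [mSb bS] : measurable (surface_ball y r : set BV) /\ surface_ball y r `<=` S.
    by split; [exact: measurable_surface_ball|move=> x []].
  apply: (mul_measure_le_integral _ mSb mS bS (ltW vmin0) mv); first by move=> x /EU/v0.
  exact: vminP.
have {lower dyn} := le_trans lower dyn; rewrite -lee_pdivlMl// => H.
apply: (le_trans H); rewrite -EFinM lee_fin.
apply: le_trans (_ : vmin^-1 * ((zy ^+ 2 / 4) `^ (- a) * M) <= _).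
  by rewrite ler_pM2l ?invr_gt0.
have X0 : 0 < zy ^+ 2 / 4 by rewrite divr_gt0// exprn_gt0.
have -> : 16 * D * (r / zy) ^+ 2 = (4 * D * r ^+ 2) * (zy ^+ 2 / 4)^-1.
  by field; rewrite gt_eqF.
rewrite powRM; [| |by rewrite invr_ge0 ltW]; last by rewrite !mulr_ge0 ?exprn_ge0 ?(ltW r0)//; lra.
rewrite -[(_ / 4)^-1]powR_inv1 ?(ltW X0)// -powRrM mulN1r /vmin [(4 * _ * _) `^ (- a)]powRN invfM invrK.
by rewrite le_eqVlt; apply/orP; left; apply/eqP; ring.
Qed.

(** The power [a] of the squared distance to the point [p], at depth [r] below [y], is subharmonic.
    It equals [(4 * r ^+ 2) ^ a] at the pole of harmonic measure but is at most [(16 * r ^+ 2) ^ a]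
    on the boundary outside the ball, so a fixed part of the mass lies in the ball. *)
Lemma ball_mass : exists2 c : R, 0 < c &
  forall omega : 'rV[R]_n.+1 -> probability BV R, harmonic_measure O omega ->
  forall y r, S y -> 0 < r -> (c%:E <= omega (vshift r y) (surface_ball y (5 * r)))%E.
Proof.
(* By the Lipschitz bound on [gp], points of the domain lowered by [r / 2] are at distance at least
   [r / (2 * (1 + K))] from [p], that is, at squared distance at least [r ^+ 2 / L]. *)
pose a : R := - n.+1%:R; pose L := 4 * (1 + K) ^+ 2.
have K0' := K0.
have L0 : 0 < L by rewrite mulr_gt0// exprn_gt0//; lra.
have N1 : 1 <= n.+1%:R :> R by rewrite ler1n.
have c0 : 0 < (4 `^ a - 16 `^ a) * L `^ a.
  rewrite mulr_gt0 ?powR_gt0// subr_gt0 /a !powRN ltf_pV2 ?posrE ?powR_gt0//.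
  by apply: gt0_ltr_powR; rewrite ?nnegrE//; lra.
exists ((4 `^ a - 16 `^ a) * L `^ a) => // omega hm y r Sy r0.
have mE := measurable_surface_ball y (5 * r); have mS := measurable_boundary K0 PhiK.
have Oz : O (vshift r y) by exact: boundary_vshift.
pose p := vshift (- r) y.
have gpp : gp p = - r by rewrite gap_vshift (nhs_boundaryP _ _).1// add0r.
have r20 : 0 < r / 2 by rewrite divr_gt0.
pose q x := dotp (x - p) (x - p).
have qlow x : O (vshift (r / 2) x) -> r ^+ 2 / L <= q x.
  rewrite nhsE gap_vshift => gx.
  have : r / 2 <= (1 + K) * `|x - p|.
    by apply: le_trans (gap_lipschitz K0 PhiK x p); apply: le_trans (ler_norm _); rewrite gpp; lra.
  move=> H; rewrite ler_pdivrMr// /L /q -sqr_enorm; move: H; have := norm_le_enorm (x - p).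
  set b := `|_|; set b' := enorm _ => bb' H.
  have : r / 2 <= (1 + K) * b' by apply: (le_trans H); rewrite ler_pM2l//; lra.
  nra.
have rL : 0 < r ^+ 2 / L by rewrite divr_gt0// exprn_gt0.
have q0 x : O (vshift (r / 2) x) -> 0 < q x by move=> /qlow; exact: lt_le_trans.
have cq := c2_powR a q0 (@c2_sqdist R n.+1 [set x | O (vshift (r / 2) x)] p).
pose c := (r ^+ 2 / L) `^ a.
have cv := c2D (@c2_cst _ _ _ c) (c2Z (-1) cq).
have a0 : 0 <= - a by rewrite opprK.
have qpow s t : 0 < s -> s <= t -> t `^ a <= s `^ a.
  by move=> s0 st; have := powR_neg_le a0 s0 st; rewrite opprK.
have v0 x : O (vshift (r / 2) x) -> 0 <= c + -1 * q x `^ a.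
  by move=> Ux; rewrite mulN1r subr_ge0; apply: qpow => //; exact: qlow.
have lap (x : 'rV[R]_n.+1) : O (vshift (r / 2) x) -> \sum_i (0 + -1 * (a * ((a - 1) * q x `^ (a - 1 - 1)) * (2 * (x - p) 0 i) ^+ 2 +
     a * q x `^ (a - 1) * 2)) <= 0.
  move=> Ux; have Q := q0 _ Ux.
  have pS b : q x `^ (b - 1) = q x `^ b / q x.
    by rewrite powRD; [rewrite powR_inv1// ltW|rewrite (gt_eqF Q) implybT].
  rewrite (eq_bigr (fun i => - (4 * a * (a - 1) * (q x `^ a / q x / q x)) * (x - p) 0 i ^+ 2 - 2 * a * (q x `^ a / q x))); last first.
    by move=> i _; rewrite !pS; ring.
  rewrite big_split/= -mulr_sumr sumsq_coord -/(q x) sumr_const card_ord -[_ *+ n.+1]mulr_natr.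
  have -> : n.+1%:R = - a by rewrite opprK.
  have -> : - (4 * a * (a - 1) * (q x `^ a / q x / q x)) * q x + - (2 * a * (q x `^ a / q x)) * - a =
     - ((2 * a * (a - 2)) * (q x `^ a / q x)) by field; rewrite gt_eqF.
  rewrite oppr_le0 mulr_ge0//; last by rewrite divr_ge0 ?powR_ge0// ltW.
  rewrite /a; nra.
have dyn := harmonic_measure_dynkin K0 PhiK hm Oz r20 cv lap v0.
have EU x : S x -> O (vshift (r / 2) x) by move=> Sx; exact: boundary_vshift.
have yp : `|y - p| = r by rewrite distrC norm_vshift_sub normrN gtr0_norm.
pose be := (16 * r ^+ 2) `^ a.
have r2 : 0 < r ^+ 2 by rewrite exprn_gt0.
have L4 : 1 <= L by rewrite /L; nra.
have bec : be <= c.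
  apply: qpow => //; rewrite ler_pdivrMr//; nra.
have vE x : S x -> ~ surface_ball y (5 * r) x -> c - be <= c + -1 * q x `^ a.
  move=> Sx nE; rewrite mulN1r lerB//; apply: qpow; first by rewrite mulr_gt0.
  have xy : 5 * r <= `|x - y| by rewrite leNgt; apply/negP => ?; apply: nE.
  rewrite /q -sqr_enorm; have := norm_le_enorm (x - p); have := ler_distD p x y.
  rewrite [`|p - y|]distrC yp; move: xy; set s := `|x - y|; set b := `|x - p|; set b' := enorm _.
  nra.
pose E' := S `\` surface_ball y (5 * r).
have mE' : measurable (E' : set BV) by exact: measurableD.
have mv : measurable_fun (S : set BV) ((fun x => c + -1 * q x `^ a) : BV -> R).
  apply: measurable_rel_continuous => //.
  by apply: continuous_rel => x /EU/cv[].
have lower : ((c - be)%:E * omega (vshift r y) E' <= \int[omega (vshift r y)]_(xi in S) (c + -1 * q xi `^ a)%:E)%E.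
  have ES : E' `<=` S by move=> x [].
  have cb : 0 <= c - be by rewrite subr_ge0.
  apply: (mul_measure_le_integral _ mE' mS ES cb mv); first by move=> x /EU/v0.
  by move=> x [Sx nE]; exact: vE.
have {lower dyn} H := le_trans lower dyn.
have qz : q (vshift r y) = 4 * r ^+ 2.
  rewrite /q (_ : vshift r y - p = (2 * r) *: basis_vec R n.+1 ord_max); last first.
    by rewrite /p /vshift opprD addrACA subrr add0r -scaleNr opprK -scalerDl; congr (_ *: _); ring.
  rewrite /dotp (bigD1 ord_max)//= !mxE !eqxx /= mulr1 big1 ?addr0; first by ring.
  by move=> i ie; rewrite !mxE (negbTE ie) andbF mulr0 mul0r.
move: H; rewrite qz; set om := omega (vshift r y).
have omE' : om E' = (1 - om (surface_ball y (5 * r)))%E.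
  rewrite /E' measureD//; last by rewrite (le_lt_trans (probability_le1 _ _)) ?ltry.
  rewrite setIidr; last by move=> x [].
  congr (_ - _)%E; exact: (harmonic_measure_boundary K0 PhiK PhiB hm Oz).
have fin : om (surface_ball y (5 * r)) \is a fin_num.
  by rewrite ge0_fin_numE// (le_lt_trans (probability_le1 _ _)) ?ltry.
rewrite omE' -(fineK fin); set w := fine _.
rewrite -EFinB -EFinM !lee_fin => H.
have w0 : 0 <= w by rewrite fine_ge0.
have p4 b : 0 < b -> (b * r ^+ 2) `^ a = b `^ a * (r ^+ 2) `^ a by move=> b0; rewrite powRM// ltW.
have tp : 0 < (r ^+ 2) `^ a by rewrite powR_gt0.
have cE : c * L `^ a = (r ^+ 2) `^ a.
  by rewrite /c -powRM ?(ltW rL) ?(ltW L0)// divfK// gt_eqF.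
have La : 0 < L `^ a by rewrite powR_gt0.
have be0 : 0 <= be by exact: powR_ge0.
rewrite -(ler_pM2r tp).
have : (4 * r ^+ 2) `^ a - be <= c * w by have := mulr_ge0 be0 w0; lra.
rewrite /be !p4// -mulrBl => H2.
have : (4 `^ a - 16 `^ a) * (r ^+ 2) `^ a * L `^ a <= (r ^+ 2) `^ a * w.
  by rewrite -[X in _ <= X * w]cE [leRHS]mulrAC ler_pM2r.
by rewrite mulrAC [leRHS]mulrC.
Qed.

End estimates.

(** * Poisson integrals *)

Section tonelli.
Context {R : realType} {d1 d2 : measure_display} {T1 : measurableType d1} {T2 : measurableType d2}.
Context (m1 : {sigma_finite_measure set T1 -> \bar R}) (m2 : {sigma_finite_measure set T2 -> \bar R}).

Lemma tonelli_on (D1 : set T1) (D2 : set T2) (f : T1 * T2 -> \bar R) :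
  measurable D1 -> measurable D2 -> measurable_fun (D1 `*` D2) f ->
  (forall p, (D1 `*` D2) p -> 0 <= f p)%E ->
  (\int[m1]_(x in D1) \int[m2]_(y in D2) f (x, y) = \int[m2]_(y in D2) \int[m1]_(x in D1) f (x, y))%E.
Proof.
move=> mD1 mD2 mf f0; have mD : measurable (D1 `*` D2) by exact: measurableX.
pose F := f \_ (D1 `*` D2).
have mF : measurable_fun setT F by apply/(measurable_restrictT _ _).1.
have F0 p : (0 <= F p)%E by rewrite /F patchE; case: ifPn => // /set_mem/f0.
have := @fubini_tonelli _ _ T1 T2 R m1 m2 F mF F0.
have E1 x : (\int[m2]_y F (x, y) = (fun x => \int[m2]_(y in D2) f (x, y)) \_ D1 x)%E.
  rewrite patchE; case: ifPn => [|xD].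
    rewrite inE => Dx; rewrite [RHS]integral_mkcond; apply: eq_integral => y _.
    by rewrite /F !patchE in_setX mem_set.
  by rewrite integral0_eq// => y _; rewrite /F patchE in_setX (negbTE xD).
have E2 y : (\int[m1]_x F (x, y) = (fun y => \int[m1]_(x in D1) f (x, y)) \_ D2 y)%E.
  rewrite patchE; case: ifPn => [|yD].
    rewrite inE => Dy; rewrite [RHS]integral_mkcond; apply: eq_integral => x _.
    by rewrite /F !patchE in_setX [y \in D2]mem_set// andbT.
  by rewrite integral0_eq// => x _; rewrite /F patchE in_setX (negbTE yD) andbF.
under eq_integral do rewrite E1.
under [RHS]eq_integral do rewrite E2.
by rewrite -!integral_mkcond.
Qed.

Lemma measurable_inner_integral (D1 : set T1) (D2 : set T2) (f : T1 * T2 -> \bar R) :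
  measurable D1 -> measurable D2 -> measurable_fun (D1 `*` D2) f ->
  (forall p, (D1 `*` D2) p -> 0 <= f p)%E ->
  measurable_fun D1 (fun x => \int[m2]_(y in D2) f (x, y))%E.
Proof.
move=> mD1 mD2 mf f0; have mD : measurable (D1 `*` D2) by exact: measurableX.
pose F := f \_ (D1 `*` D2).
have mF : measurable_fun setT F by apply/(measurable_restrictT _ _).1.
have F0 p : (0 <= F p)%E by rewrite /F patchE; case: ifPn => // /set_mem/f0.
apply: (@eq_measurable_fun _ _ _ _ _ (fun x => \int[m2]_y F (x, y))%E).
  move=> x; rewrite inE => Dx; rewrite [RHS]integral_mkcond; apply: eq_integral => y _.
  by rewrite /F !patchE in_setX mem_set.
by apply: measurable_funTS; exact: (@measurable_fun_fubini_tonelli_F _ _ _ _ _ m2 F mF F0).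
Qed.

End tonelli.

(** * Extension of bounded boundary functions *)

Section poisson.
Context {R : realType} {n : nat} (Phi : 'rV[R]_n -> R) (K B : R).
Context (K0 : 0 <= K).
Context (PhiK : forall x y : 'rV[R]_n, `|Phi x - Phi y| <= K * `|x - y|).
Context (PhiB : forall x, `|Phi x| <= B).
Local Notation O := (near_half_space Phi).
Local Notation S := (nhs_boundary Phi).
Local Notation gp := (gap Phi).
Local Notation BV := (borel_rV R n.+1).
Local Notation ez := (basis_vec R n.+1 ord_max).
Context (omega : 'rV[R]_n.+1 -> probability BV R) (k : 'rV[R]_n.+1 -> 'rV[R]_n.+1 -> R).
Context (z0 : 'rV[R]_n.+1) (Oz0 : O z0).
Context (hm : harmonic_measure O omega) (mk : martin_kernel O S omega z0 k).
Local Notation mu := (omega z0).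

Let mS : measurable (S : set BV) := measurable_boundary K0 PhiK.

Definition bdd (f : 'rV[R]_n.+1 -> R) :=
  measurable_fun (S : set BV) (f : BV -> R) /\ exists M : R, forall x, S x -> 0 <= f x <= M.

Definition poisson (f : 'rV[R]_n.+1 -> R) (z : 'rV[R]_n.+1) : R :=
  fine (\int[omega z]_(xi in S) (f xi)%:E).
Local Notation H := poisson.

Lemma boundary_nonempty : exists x, S x.
Proof.
exists (vshift (- gp z0) z0); apply/nhs_boundaryP.
by rewrite gap_vshift subrr.
Qed.

Lemma bdd_bound f : bdd f -> exists2 M : R, 0 <= M & forall x, S x -> f x <= M.
Proof.
move=> [_ [M HM]]; have [x Sx] := boundary_nonempty.
exists M; first by have /andP[] := HM x Sx; exact: le_trans.
by move=> y /HM/andP[].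
Qed.

Lemma bdd_ge0 f x : bdd f -> S x -> 0 <= f x.
Proof. by move=> [_ [M HM]] /HM/andP[]. Qed.

Lemma bddD f g : bdd f -> bdd g -> bdd (fun x => f x + g x).
Proof.
move=> [mf [M HM]] [mg [M' HM']]; split; first exact: measurable_funD.
by exists (M + M') => x Sx; have /andP[? ?] := HM x Sx; have /andP[? ?] := HM' x Sx;
  rewrite addr_ge0//= lerD.
Qed.

Lemma bddZ (c : R) f : 0 <= c -> bdd f -> bdd (fun x => c * f x).
Proof.
move=> c0 [mf [M HM]]; split; first exact: measurable_funM.
by exists (c * M) => x Sx; have /andP[? ?] := HM x Sx; rewrite mulr_ge0//= ler_wpM2l.
Qed.

Lemma bdd_cst (c : R) : 0 <= c -> bdd (fun=> c).
Proof. by move=> c0; split; [exact: measurable_cst|exists c => x _; rewrite c0 lexx]. Qed.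

Lemma poissonE f z : bdd f -> O z ->
  (\int[omega z]_(xi in S) (f xi)%:E = (H f z)%:E)%E.
Proof.
move=> bf Oz; have [M M0 HM] := bdd_bound bf; rewrite /H fineK// ge0_fin_numE; last first.
  by apply: integral_ge0 => x Sx; rewrite lee_fin (bdd_ge0 bf).
apply: (@le_lt_trans _ _ (\int[omega z]_(xi in S) M%:E)%E).
  apply: ge0_le_integral => //.
  - by move=> x Sx; rewrite lee_fin (bdd_ge0 bf).
  - by apply/measurable_EFinP; case: bf.
rewrite integral_cst// lte_mul_pinfty ?lee_fin//.
by rewrite (le_lt_trans (probability_le1 _ _)) ?ltry.
Qed.

Lemma poisson_ge0 f z : bdd f -> 0 <= H f z.
Proof.
by move=> bf; rewrite fine_ge0//; apply: integral_ge0 => x Sx; rewrite lee_fin (bdd_ge0 bf).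
Qed.

Lemma poisson_le f g z : bdd f -> bdd g -> O z -> (forall x, S x -> f x <= g x) -> H f z <= H g z.
Proof.
move=> bf bg Oz fg; rewrite -lee_fin -!poissonE//; apply: ge0_le_integral => //.
- by move=> x Sx; rewrite lee_fin (bdd_ge0 bf).
- by apply/measurable_EFinP; case: bf.
- by apply/measurable_EFinP; case: bg.
Qed.

Lemma poissonD f g z : bdd f -> bdd g -> O z -> H (fun x => f x + g x) z = H f z + H g z.
Proof.
move=> bf bg Oz; apply: EFin_inj; rewrite EFinD -!poissonE//; last exact: bddD.
under eq_integral do rewrite EFinD.
rewrite ge0_integralD//.
- by move=> x Sx; rewrite lee_fin (bdd_ge0 bf).
- by apply/measurable_EFinP; case: bf.
- by move=> x Sx; rewrite lee_fin (bdd_ge0 bg).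
- by apply/measurable_EFinP; case: bg.
Qed.

Lemma poissonZ (c : R) f z : 0 <= c -> bdd f -> O z -> H (fun x => c * f x) z = c * H f z.
Proof.
move=> c0 bf Oz; apply: EFin_inj; rewrite EFinM -!poissonE//; last exact: bddZ.
under eq_integral do rewrite EFinM.
rewrite ge0_integralZl//.
- by apply/measurable_EFinP; case: bf.
- by move=> x Sx; rewrite lee_fin (bdd_ge0 bf).
Qed.

Lemma poisson_cst (c : R) z : 0 <= c -> O z -> H (fun=> c) z = c.
Proof.
move=> c0 Oz; apply: EFin_inj; rewrite -poissonE//; last exact: bdd_cst.
transitivity (c%:E * omega z S)%E; first exact: integral_cst.
by rewrite (harmonic_measure_boundary K0 PhiK PhiB hm Oz) mule1.
Qed.

Lemma poisson_complement (M : R) f z : 0 <= M -> bdd f -> (forall x, S x -> f x <= M) -> O z ->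
  bdd (fun x => M - f x) /\ H (fun x => M - f x) z = M - H f z.
Proof.
move=> M0 bf fM Oz.
have bg : bdd (fun x => M - f x).
  split; first by apply: measurable_funB => //; case: bf.
  by exists M => x Sx; rewrite subr_ge0 fM//= gerBl (bdd_ge0 bf).
split => //; apply/eqP; rewrite eq_sym subr_eq -poissonD//; apply/eqP.
rewrite -[LHS](@poisson_cst M z)//; congr H; apply/funext => x.
by rewrite subrK.
Qed.

Lemma kernel_gt0 z x : O z -> S x -> 0 < k z x.
Proof. by case: mk => H _; exact: H. Qed.

Lemma kernel_pos_harmonic x : S x -> pos_harmonic Phi (k^~ x).
Proof. by move=> Sx; case: mk => H1 [_ [H2 _]]; split; [exact: H2|move=> z Oz; exact: H1]. Qed.

Lemma kernel_near z x (eta : R) : O z -> S x -> 0 < eta -> exists2 r : R, 0 < r &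
  forall z' x', O z' -> S x' -> `|z' - z| < r -> `|x' - x| < r -> `|k z' x' - k z x| < eta.
Proof.
move=> Oz Sx eta0; case: mk => _ [kc _].
have := (subspace_continuousP _ _).1 kc (z, x) (conj Oz Sx).
move=> /cvgrPdist_lt /(_ eta eta0); rewrite /= near_withinE => /(nbhs_ballP _ _).1[r /= r0 Hr].
exists r => // z' x' Oz' Sx' zz xx; rewrite distrC; apply: (Hr (z', x')) => //.
by split => /=; rewrite -ball_normE/= distrC.
Qed.

Lemma measurable_kernel z : O z -> measurable_fun (S : set BV) (k z : BV -> R).
Proof.
move=> Oz; apply: measurable_rel_continuous => // x Sx eta eta0.
have [r r0 Hr] := kernel_near Oz Sx eta0.
by exists r => // y Sy yx; apply: Hr => //; rewrite subrr normr0.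
Qed.

Lemma poisson_kernel f z : bdd f -> O z ->
  (H f z)%:E = (\int[mu]_(xi in S) (k z xi * f xi)%:E)%E.
Proof.
move=> bf Oz; rewrite -poissonE//.
rewrite (@integral_density _ BV R (omega z) mu S (k z)) //.
- by apply: eq_integral => x _; rewrite -EFinM mulrC.
- exact: measurable_kernel.
- by move=> x Sx; rewrite ltW// kernel_gt0.
- by move=> A mA AS; case: mk => _ [_ [_ Hk]]; exact: Hk.
- by apply/measurable_EFinP; case: bf.
- by move=> x Sx; rewrite lee_fin (bdd_ge0 bf).
Qed.

(** Inequalities between values of the kernel, known by Harnack at each boundary point, are
    integrated against [f]. Extensions thereby inherit Harnack's inequality before they are known to
    be harmonic. *)
Lemma poisson_compare f (a b : R) z y w : bdd f -> O z -> O y -> O w -> 0 <= a -> 0 <= b ->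
  (forall x, S x -> k y x <= a * k z x + b * k w x) -> H f y <= a * H f z + b * H f w.
Proof.
move=> bf Oz Oy Ow a0 b0 le; rewrite -lee_fin EFinD !EFinM !poisson_kernel//.
have mkf v : O v -> measurable_fun (S : set BV) (fun xi => (k v xi * f xi)%:E).
  by move=> Ov; apply/measurable_EFinP; apply: measurable_funM; [exact: measurable_kernel|case: bf].
have kf0 v x : O v -> S x -> (0 <= (k v x * f x)%:E)%E.
  by move=> Ov Sx; rewrite lee_fin mulr_ge0// ?(bdd_ge0 bf)// ltW// kernel_gt0.
rewrite -!ge0_integralZl//=; first last.
- by move=> x; exact: kf0.
- exact: mkf.
- by move=> x; exact: kf0.
- exact: mkf.
rewrite -ge0_integralD//=; first last.
- by apply: measurable_funeM; exact: mkf.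
- by move=> x Sx; rewrite mule_ge0 ?lee_fin//; exact: kf0.
- by apply: measurable_funeM; exact: mkf.
- by move=> x Sx; rewrite mule_ge0 ?lee_fin//; exact: kf0.
apply: ge0_le_integral => //.
- by move=> x; exact: kf0.
- exact: mkf.
- by apply: emeasurable_funD; apply: measurable_funeM; exact: mkf.
move=> x Sx; rewrite -!EFinM -EFinD lee_fin !mulrA -mulrDl.
by apply: ler_wpM2r; [exact: bdd_ge0 bf Sx|exact: le].
Qed.

Lemma poisson_dist f (q : R) z y : bdd f -> O z -> O y -> 0 <= q ->
  (forall x, S x -> `|k y x - k z x| <= q * k z x) -> `|H f y - H f z| <= q * H f z.
Proof.
move=> bf Oz Oy q0 le; rewrite ler_norml; apply/andP; split.
  have := @poisson_compare f 1 q y z z bf Oy Oz Oz ler01 q0; rewrite mul1r.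
  move=> /(_ _)/wrap[|]; last lra.
  by move=> x Sx; have := le x Sx; rewrite ler_norml => /andP[]; lra.
have := @poisson_compare f 1 q z y z bf Oz Oy Oz ler01 q0; rewrite mul1r.
move=> /(_ _)/wrap[|]; last lra.
by move=> x Sx; have := le x Sx; rewrite ler_norml => /andP[]; lra.
Qed.

Section harnack.
Context (C0 C2 : R) (HC : harnack_at Phi C0) (HW : harnack_wide Phi C0 C2).

Lemma poisson_wide f z (b a : R) v : bdd f -> O z -> 0 < b <= gp z ->
  0 <= a <= 3 -> `|v| <= C0^-1 ->
  O (z + b *: (a *: ez + v)) /\
  `|H f (z + b *: (a *: ez + v)) - H f z| <= C2 * (b / gp z) * H f z.
Proof.
move=> bf Oz bz a3 v1; have [x0 Sx0] := boundary_nonempty.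
have [_ C21 HW'] := HW; have [Oy _] := HW' _ (kernel_pos_harmonic Sx0) z b a v Oz bz a3 v1.
split => //; apply: poisson_dist => //.
  by have /andP[b0 _] := bz; rewrite mulr_ge0//; [lra|rewrite divr_ge0// ltW// -?nhsE//].
by move=> x Sx; have [] := HW' _ (kernel_pos_harmonic Sx) z b a v Oz bz a3 v1.
Qed.

Lemma poisson_continuous f z : bdd f -> O z -> {for z, continuous (H f)}.
Proof.
move=> bf Oz; have [C01 HC'] := HC; have gz : 0 < gp z by rewrite -nhsE.
apply: (@lipschitz_at_continuous _ _ _ _ (gp z / C0) (C0 / gp z * H f z)).
  by rewrite divr_gt0//; lra.
move=> y yz; have [x0 Sx0] := boundary_nonempty.
have [Oy _] := (HC' _ (kernel_pos_harmonic Sx0) z Oz).1 y yz.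
have -> : C0 / gp z * H f z * `|y - z| = C0 * (`|y - z| / gp z) * H f z by ring.
apply: poisson_dist => //.
  by rewrite mulr_ge0//; [lra|rewrite divr_ge0// ltW].
by move=> x Sx; have [] := (HC' _ (kernel_pos_harmonic Sx) z Oz).1 y yz.
Qed.

Lemma bdd_poisson_shift f (v : 'rV[R]_n.+1) : bdd f -> (forall x, S x -> O (x + v)) ->
  bdd (fun x => H f (x + v)).
Proof.
move=> bf Ov; split.
  apply: measurable_rel_continuous => //; apply: continuous_rel => x Sx.
  have cs : {for x, continuous (fun y : 'rV[R]_n.+1 => y + v)}.
    by apply: (@cvgD _ _ _ (nbhs x)); [exact: cvg_id|exact: cvg_cst].
  exact: (continuous_comp cs (poisson_continuous bf (Ov _ Sx))).
have [M M0 HM] := bdd_bound bf; exists M => x Sx; rewrite poisson_ge0//=.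
have Ox := Ov x Sx; rewrite -[leRHS](@poisson_cst M (x + v) M0 Ox).
by apply: (poisson_le bf (bdd_cst M0) Ox).
Qed.

Definition smooth (s : R) (f : 'rV[R]_n.+1 -> R) : 'rV[R]_n.+1 -> R := fun x => H f (vshift s x).

Lemma bdd_smooth (s : R) f : 0 < s -> bdd f -> bdd (smooth s f).
Proof. by move=> s0 bf; apply: bdd_poisson_shift => // x Sx; exact: boundary_vshift. Qed.

Lemma vshift_kernel_dynkin z x (s : R) : O z -> S x -> 0 < s ->
  (\int[omega z]_(xi in S) (k (vshift s xi) x)%:E <= (k (vshift s z) x)%:E)%E.
Proof.
move=> Oz Sx s0; have [hk kpos] := kernel_pos_harmonic Sx.
have oO : open O := open_nhs K0 PhiK.
have c := harmonic_vshift (s:=s) (harmonic_on_c2 oO hk).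
apply: (harmonic_measure_dynkin K0 PhiK hm Oz s0 c).
- by move=> y Oy; have [_ [_ [_ lap]]] := hk; rewrite le_eqVlt; apply/orP; left; apply/eqP; exact: lap.
- by move=> y Oy; rewrite ltW//; exact: kpos.
Qed.

(** Tonelli's theorem moves the vertical shift onto the kernel, where Dynkin's inequality applies
    for each fixed boundary point. *)
Lemma poisson_smooth_le f z (s : R) : bdd f -> O z -> 0 < s -> H (smooth s f) z <= H f (vshift s z).
Proof.
move=> bf Oz s0; have Ozs : O (vshift s z) by apply: nhs_vshift => //; exact: ltW.
have Os x : S x -> O (vshift s x) by move=> Sx; exact: boundary_vshift.
rewrite -lee_fin poisson_kernel//; last exact: bdd_smooth.
rewrite (eq_integral (fun zeta : BV => \int[mu]_(xi in S) (k z zeta * k (vshift s zeta) xi * f xi)%:E)%E); last first.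
  move=> x; rewrite inE => Sx; have Ox := Os x Sx; rewrite EFinM /smooth poisson_kernel//.
  rewrite -ge0_integralZl//.
  - by apply: eq_integral => y _; rewrite -EFinM mulrA.
  - have mk1 := measurable_kernel (Os x Sx); have [mf _] := bf.
    by apply/measurable_EFinP; apply: measurable_funM.
  - by move=> y Sy; rewrite lee_fin mulr_ge0 ?(bdd_ge0 bf)// ltW// kernel_gt0//; exact: Os.
  - by rewrite lee_fin ltW// kernel_gt0.
have mSS : measurable ((S : set BV) `*` (S : set BV)) by exact: measurableX.
have mkk : measurable_fun ((S : set BV) `*` (S : set BV)) (fun p : BV * BV => k (vshift s p.1) p.2).
  apply: measurable_rel_continuous2 => // -[x y] /= [Sx Sy] eta eta0.
  have [r r0 Hr] := kernel_near (Os _ Sx) Sy eta0.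
  exists r => // -[x' y'] /= [Sx' Sy'] xx yy; apply: Hr => //; first exact: Os.
  by rewrite /vshift opprD addrACA subrr addr0.
have mfst : measurable_fun ((S : set BV) `*` (S : set BV)) (fun p : BV * BV => k z p.1).
  apply: (measurable_comp (F := S : set BV)) => //; [by move=> _ [p [] + _ <-]|exact: measurable_kernel|].
  by apply: measurable_funTS; exact: measurable_fst.
have mf2 : measurable_fun ((S : set BV) `*` (S : set BV)) (fun p : BV * BV => f p.2).
  apply: (measurable_comp (F := S : set BV)) => //; [by move=> _ [p [] _ + <-]|by case: bf|].
  by apply: measurable_funTS; exact: measurable_snd.
rewrite (@tonelli_on _ _ _ BV BV mu mu S S (fun p : BV * BV => (k z p.1 * k (vshift s p.1) p.2 * f p.2)%:E))//; first last.
- move=> [x y] /= [Sx Sy]; rewrite lee_fin !mulr_ge0 ?(bdd_ge0 bf)// ltW// kernel_gt0//; exact: Os.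
- by apply/measurable_EFinP; apply: measurable_funM => //; exact: measurable_funM.
rewrite poisson_kernel//; apply: ge0_le_integral => //.
- move=> y Sy; apply: integral_ge0 => x Sx.
  by rewrite lee_fin !mulr_ge0 ?(bdd_ge0 bf)// ltW// kernel_gt0//; exact: Os.
- apply: (@measurable_inner_integral _ _ _ BV BV mu S S (fun p : BV * BV => (k z p.2 * k (vshift s p.2) p.1 * f p.1)%:E)) => //.
    apply/measurable_EFinP.
    have msw : measurable_fun ((S : set BV) `*` (S : set BV)) (fun p : BV * BV => k z p.1 * k (vshift s p.1) p.2 * f p.2).
      by apply: measurable_funM => //; exact: measurable_funM.
    have sub : (fun p : BV * BV => (p.2, p.1)) @` ((S : set BV) `*` (S : set BV)) `<=` (S : set BV) `*` (S : set BV).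
      by move=> _ [p [? ?] <-].
    have msp : measurable_fun ((S : set BV) `*` (S : set BV)) (fun p : BV * BV => (p.2, p.1)).
      by apply: measurable_funTS; apply: measurable_fun_pair; [exact: measurable_snd|exact: measurable_fst].
    exact: (measurable_comp mSS sub msw msp).
  by move=> [x y] /= [Sx Sy]; rewrite lee_fin !mulr_ge0 ?(bdd_ge0 bf)// ltW// kernel_gt0//; exact: Os.
- by apply/measurable_EFinP/measurable_funM; [exact: measurable_kernel|case: bf].
move=> y Sy.
have mky : measurable_fun (S : set BV) (fun x : BV => k (vshift s x) y).
  apply: measurable_rel_continuous => // x Sx eta eta0.
  have [r r0 Hr] := kernel_near (Os _ Sx) Sy eta0.
  exists r => // x' Sx' xx; apply: Hr => //; [exact: Os| |by rewrite subrr normr0].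
  by rewrite /vshift opprD addrACA subrr addr0.
have -> : (\int[mu]_(x in S) (k z x * k (vshift s x) y * f y)%:E =
   (f y)%:E * \int[mu]_(x in S) ((k (vshift s x) y)%:E * (k z x)%:E))%E.
  rewrite -ge0_integralZl//.
  - by apply: eq_integral => x _; rewrite -!EFinM; congr _%:E; ring.
  - by apply: emeasurable_funM; apply/measurable_EFinP => //; exact: measurable_kernel.
  - by move=> x Sx; rewrite -EFinM lee_fin mulr_ge0// ltW// kernel_gt0//; exact: Os.
  - by rewrite lee_fin (bdd_ge0 bf).
rewrite mulrC EFinM; apply: lee_wpmul2l; first by rewrite lee_fin (bdd_ge0 bf).
rewrite -(@integral_density _ BV R (omega z) mu S (k z)) //.
- exact: vshift_kernel_dynkin.
- exact: measurable_kernel.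
- by move=> x Sx; rewrite ltW// kernel_gt0.
- by move=> A mA AS; case: mk => _ [_ [_ Hk]]; exact: Hk.
- exact/measurable_EFinP.
- by move=> x Sx; rewrite lee_fin ltW// kernel_gt0//; exact: Os.
Qed.

(** Total mass one turns the superharmonic inequality into the semigroup law. *)
Lemma poisson_smooth f z (s : R) : bdd f -> O z -> 0 < s -> H (smooth s f) z = H f (vshift s z).
Proof.
move=> bf Oz s0; have [M M0 HM] := bdd_bound bf.
have Ozs : O (vshift s z) by apply: nhs_vshift => //; exact: ltW.
apply/eqP; rewrite eq_le poisson_smooth_le//=.
have [bg Hg] := poisson_complement M0 bf HM Ozs.
have bs := bdd_smooth s0 bf.
have sM x : S x -> smooth s f x <= M.
  move=> Sx; have Ox : O (vshift s x) by exact: boundary_vshift.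
  rewrite -[leRHS](@poisson_cst M (vshift s x) M0 Ox).
  by apply: (poisson_le bf (bdd_cst M0) Ox).
have [bg' Hg'] := poisson_complement M0 bs sM Oz.
have := poisson_smooth_le bg Oz s0; rewrite Hg.
have -> : H (smooth s (fun x => M - f x)) z = H (fun x => M - smooth s f x) z.
  rewrite /H; congr fine; apply: eq_integral => x; rewrite inE => Sx; congr _%:E.
  by have [_] := poisson_complement M0 bf HM (boundary_vshift Sx s0).
rewrite Hg'; lra.
Qed.

End harnack.

(** * Poisson representation of the vertical shifts of [u] *)

Section harmonic_function.
Context (u : 'rV[R]_n.+1 -> R) (hu : harmonic_on O u) (u0 : forall z, O z -> 0 < u z).
Context (ub : forall t : R, 0 < t -> exists M : R, forall z, O z -> `|u (vshift t z)| <= M).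

Lemma bdd_vshift (s : R) : 0 < s -> bdd (u \o vshift s).
Proof.
move=> s0; have oO : open O := open_nhs K0 PhiK.
have s20 : 0 < s / 2 by rewrite divr_gt0.
have Os x : S x -> O (vshift s x) by move=> Sx; exact: boundary_vshift.
split.
  apply: measurable_rel_continuous => //; apply: continuous_rel => x Sx.
  by have [] := harmonic_vshift (s:=s) (harmonic_on_c2 oO hu) (Os x Sx).
have [M HM] := ub s20; exists M => x Sx /=; rewrite (ltW (u0 (Os _ Sx)))/=.
apply: le_trans (ler_norm _) _; have := HM _ (boundary_vshift Sx s20).
by rewrite vshiftD -splitr.
Qed.

(** With [M] a bound for the shifted [u] on the domain lowered by [s / 2], both this function and
    its difference to [M] are nonnegative and harmonic there; Dynkin's inequality for the two gives
    equality. *)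
Lemma poisson_vshift (s : R) z : 0 < s -> O z -> H (u \o vshift s) z = u (vshift s z).
Proof.
move=> s0 Oz; have oO : open O := open_nhs K0 PhiK.
have s20 : 0 < s / 2 by rewrite divr_gt0.
have bu := bdd_vshift s0.
have [M HM] := ub s20.
have HM' y : O (vshift (s / 2) y) -> u (vshift s y) <= M.
  by move=> Oy; apply: le_trans (ler_norm _) _; have := HM _ Oy; rewrite vshiftD -splitr.
have Ozs : O (vshift (s / 2) z) by apply: nhs_vshift => //; exact: ltW.
have M0 : 0 <= M by exact: le_trans (normr_ge0 _) (HM _ Oz).
have sub : [set y | O (vshift (s / 2) y)] `<=` [set y | O (vshift s y)].
  by move=> y Oy; rewrite /= [s]splitr -vshiftD; apply: nhs_vshift => //; exact: ltW.
have c := c2S sub (harmonic_vshift (s:=s) (harmonic_on_c2 oO hu)).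
have lap y : O (vshift (s / 2) y) -> \sum_i ((fun i => 'D_(basis_vec R n.+1 i) ('D_(basis_vec R n.+1 i) u)) i \o vshift s) y = 0.
  by move=> /sub Oy; have [_ [_ [_ lap]]] := hu; exact: lap.
apply/eqP; rewrite eq_le; apply/andP; split.
  rewrite -lee_fin -poissonE//; apply: (harmonic_measure_dynkin K0 PhiK hm Oz s20 c).
    by move=> y /lap ->.
  by move=> y /sub Oy; rewrite ltW// u0.
have uM x : S x -> (u \o vshift s) x <= M by move=> Sx; exact/HM'/boundary_vshift.
have [bg Hg] := poisson_complement M0 bu uM Oz.
have cM := c2D (@c2_cst _ _ _ M) (c2Z (-1) c).
have := harmonic_measure_dynkin K0 PhiK hm Oz s20 cM.
under eq_integral do rewrite mulN1r.
rewrite poissonE// lee_fin Hg mulN1r => Hd.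
have := Hd _ _; move=> /(_ _ _)/wrap[||]; last by rewrite /=; lra.
  by move=> y Oy; rewrite big_split/= big1// add0r -mulr_sumr lap// mulr0.
by move=> y Oy; rewrite mulN1r subr_ge0; exact: HM'.
Qed.

End harmonic_function.

End poisson.

(** * Iterated kernels *)

Section chain.
Context {R : realType} {n : nat} (Phi : 'rV[R]_n -> R) (K B : R).
Context (K0 : 0 <= K).
Context (PhiK : forall x y : 'rV[R]_n, `|Phi x - Phi y| <= K * `|x - y|).
Context (PhiB : forall x, `|Phi x| <= B).
Local Notation O := (near_half_space Phi).
Local Notation S := (nhs_boundary Phi).
Local Notation gp := (gap Phi).
Local Notation BV := (borel_rV R n.+1).
Context (omega : 'rV[R]_n.+1 -> probability BV R) (k : 'rV[R]_n.+1 -> 'rV[R]_n.+1 -> R).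
Context (z0 : 'rV[R]_n.+1).
Context (hm : harmonic_measure O omega) (mk : martin_kernel O S omega z0 k).
Context (C0 : R) (HC : harnack_at Phi C0).
Local Notation bdd := (bdd Phi).
Local Notation H := (poisson Phi omega).
Local Notation smooth := (smooth Phi omega).
Local Notation ball y r := (surface_ball Phi y r).
Local Notation poissonE := (poissonE K0 PhiK omega z0).
Local Notation poisson_smooth := (poisson_smooth K0 PhiK PhiB hm mk HC).
Local Notation bdd_smooth := (bdd_smooth K0 PhiK PhiB hm mk HC).
Local Notation poisson_le := (poisson_le K0 PhiK omega z0).
Local Notation poissonZ := (poissonZ K0 PhiK omega z0).

Definition scale (j : nat) : R := 2^-1 ^+ j.

Lemma scale_gt0 j : 0 < scale j. Proof. by rewrite exprn_gt0. Qed.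

Lemma scaleD i j : scale (i + j) = scale i * scale j. Proof. exact: exprD. Qed.

Lemma scaleS j : scale j = 2 * scale j.+1.
Proof. by rewrite /scale exprS mulrA divff ?mul1r// pnatr_eq0. Qed.

Lemma scale_le1 j : scale j <= 1.
Proof. by rewrite exprn_ile1//; lra. Qed.

Lemma scale_small (e : R) : 0 < e -> exists j, forall i, (j <= i)%N -> scale i <= e.
Proof.
move=> e0; have [j Hj] := @dyadic_small R 1 1 e ler01 e0; exists j => i /Hj.
by rewrite mul1r mul1r /scale exprVn.
Qed.

Lemma bdd_indic (A : set 'rV[R]_n.+1) : measurable (A : set BV) -> bdd \1_A.
Proof.
move=> mA; split; first by apply: measurable_funTS; exact: measurable_indic.
by exists 1 => x _; rewrite indicE; case: (_ \in _); rewrite /= ?lexx ?ler01.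
Qed.

Lemma poisson_indic (A : set 'rV[R]_n.+1) z : measurable (A : set BV) -> A `<=` S -> O z ->
  (H \1_A z)%:E = omega z A.
Proof.
move=> mA AS Oz; rewrite -poissonE//; last exact: bdd_indic.
by rewrite integral_indic ?setIidl//; exact: measurable_boundary K0 PhiK.
Qed.

Context (Q : nat -> ('rV[R]_n.+1 -> R) -> 'rV[R]_n.+1 -> R) (C3 kap : R) (C30 : 0 <= C3) (kap0 : 0 <= kap).
Context (bddQ : forall j f, bdd f -> bdd (Q j f)).
Context (QD : forall j f g x, bdd f -> bdd g -> S x -> Q j (fun x => f x + g x) x = Q j f x + Q j g x).
Context (QZ : forall j (c : R) f x, 0 <= c -> bdd f -> S x -> Q j (fun x => c * f x) x = c * Q j f x).
Context (Qeq : forall j f g x, (forall x, S x -> f x = g x) -> S x -> Q j f x = Q j g x).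
Context (Q1 : forall j x, S x -> Q j (fun=> 1) x = 1).
Context (Q_smooth : forall j f x, bdd f -> S x -> Q j f x <= (1 + kap) * smooth (2 * scale j) f x).
Context (Q_near : forall j f (s : R) x, bdd f -> S x -> scale j <= s ->
  `|Q j (smooth s f) x - smooth s f x| <= C3 * (scale j / s) * smooth s f x).

Context (x0 : 'rV[R]_n.+1) (Sx0 : S x0) (k0 : nat).

(** The law of the chain with kernels [Q] after [m] steps from [x0], as a
    functional. *)
Fixpoint nu (m : nat) (f : 'rV[R]_n.+1 -> R) : R :=
  if m is m'.+1 then nu m' (Q (k0 + m') f) else f x0.

Lemma nu_eq m f g : (forall x, S x -> f x = g x) -> nu m f = nu m g.
Proof.
elim: m f g => [|m IH] f g fg /=; first exact: fg.
by apply: IH => x Sx; exact: Qeq.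
Qed.

Lemma nuD m f g : bdd f -> bdd g -> nu m (fun x => f x + g x) = nu m f + nu m g.
Proof.
elim: m f g => [//|m IH] f g bf bg /=.
by rewrite -IH//; try exact: bddQ; apply: nu_eq => x Sx; exact: QD.
Qed.

Lemma nuZ m (c : R) f : 0 <= c -> bdd f -> nu m (fun x => c * f x) = c * nu m f.
Proof.
elim: m f => [//|m IH] f c0 bf /=.
by rewrite -IH//; try exact: bddQ; apply: nu_eq => x Sx; exact: QZ.
Qed.

Lemma nu_ge0 m f : bdd f -> 0 <= nu m f.
Proof. by elim: m f => [|m IH] f bf /=; [exact: bdd_ge0 bf Sx0|exact/IH/bddQ]. Qed.

Lemma nu_le m f g : bdd f -> bdd g -> (forall x, S x -> f x <= g x) -> nu m f <= nu m g.
Proof.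
move=> bf bg fg.
have bd : bdd (fun x => g x - f x).
  have [mf _] := bf; have [mg [M HM]] := bg.
  split; first exact: measurable_funB.
  exists M => x Sx; rewrite subr_ge0 fg//=; have /andP[_ gM] := HM x Sx.
  have := bdd_ge0 bf Sx; lra.
rewrite -subr_ge0 (_ : nu m g - nu m f = nu m (fun x => g x - f x)); first exact: nu_ge0.
apply/eqP; rewrite subr_eq -nuD//; apply/eqP; apply: nu_eq => x _; by rewrite subrK.
Qed.

Lemma nu_sum m (I : Type) (r : seq I) (F : I -> 'rV[R]_n.+1 -> R) : (forall i, bdd (F i)) ->
  bdd (fun x => \sum_(i <- r) F i x) /\ nu m (fun x => \sum_(i <- r) F i x) = \sum_(i <- r) nu m (F i).
Proof.
move=> bF; elim: r => [|i r [IH1 IH2]].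
  have b0 : bdd (fun=> 0) by exact: bdd_cst.
  have E : (fun x : 'rV[R]_n.+1 => \sum_(i <- [::]) F i x) = (fun=> 0).
    by apply/funext => x; rewrite big_nil.
  rewrite E big_nil; split => //.
  have H0 := nuZ m (lexx 0) b0; rewrite mul0r in H0.
  by rewrite H0 mul0r.
have E : (fun x : 'rV[R]_n.+1 => \sum_(i <- i :: r) F i x) = (fun x => F i x + \sum_(i <- r) F i x).
  by apply/funext => x; rewrite big_cons.
by rewrite E big_cons -IH2 -nuD//; split => //; exact: bddD.
Qed.

Lemma nu_cst m (c : R) : 0 <= c -> nu m (fun=> c) = c.
Proof.
move=> c0; have b1 : bdd (fun=> 1) by exact: bdd_cst.
have N1 : nu m (fun=> 1) = 1 by elim: m => //= m {2}<-; apply: nu_eq => x Sx; exact: Q1.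
by rewrite -[RHS]mulr1 -[in RHS]N1 -nuZ//; apply: nu_eq => x _; rewrite mulr1.
Qed.

(** The steps after the [i]-th change a function smooth at scale [s] by relative errors at most
    [C3 * scale l]. Their partial sums are [C3 * (2 * (1 - scale l))], the exponent carried by the
    induction. *)
Lemma nu_upper f (s : R) i l : bdd f -> scale (k0 + i) <= s ->
  nu (i + l) (smooth s f) <= expR (2 * C3) * nu i (smooth s f).
Proof.
move=> bf bs; have C30' := C30.
have s0 : 0 < s := lt_le_trans (scale_gt0 _) bs.
have bg := bdd_smooth s0 bf; have g0 := nu_ge0 i bg.
have key : nu (i + l) (smooth s f) <= expR (C3 * (2 * (1 - scale l))) * nu i (smooth s f).
  elim: l => [|l IH]; first by rewrite addn0 /scale expr0 subrr !mulr0 expR0 mul1r.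
  have c0 : 0 <= C3 * scale l by rewrite mulr_ge0// ltW// scale_gt0.
  have h : nu (i + l.+1) (smooth s f) <= (1 + C3 * scale l) * nu (i + l) (smooth s f).
    rewrite addnS /= -nuZ//; last by lra.
    apply: nu_le; [exact: bddQ|by apply: bddZ => //; lra|move=> x Sx].
    have bls : scale (k0 + (i + l)) <= s.
      rewrite addnA scaleD; apply: le_trans bs; rewrite ler_piMr ?scale_le1// ltW// scale_gt0//.
    have := Q_near (j := k0 + (i + l)) bf Sx bls; rewrite ler_norml => /andP[_ h].
    have gx := bdd_ge0 bg Sx.
    have : C3 * (scale (k0 + (i + l)) / s) * smooth s f x <= C3 * scale l * smooth s f x.
      apply: ler_wpM2r => //; apply: ler_wpM2l => //.
      rewrite addnA scaleD mulrAC ler_piMl ?(ltW (scale_gt0 _))// ler_pdivrMr// mul1r//.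
    lra.
  apply: (le_trans h).
  apply: le_trans (_ : expR (C3 * scale l) * (expR (C3 * (2 * (1 - scale l))) * nu i (smooth s f)) <= _).
    by apply: ler_pM => //; [lra|exact/nu_ge0|exact: expR_ge1Dx].
  rewrite mulrA -expRD; apply: ler_wpM2r => //; rewrite ler_expR (scaleS l); lra.
apply: (le_trans key); apply: ler_wpM2r => //; rewrite ler_expR.
have := mulr_ge0 C30' (ltW (scale_gt0 l)); lra.
Qed.

Lemma nu_lower f (s : R) m : bdd f -> 2 * C3 * (scale k0 / s) <= 1 -> scale k0 <= s ->
  (1 - 2 * C3 * (scale k0 / s)) * smooth s f x0 <= nu m (smooth s f).
Proof.
move=> bf c1 bs; have C30' := C30.
have s0 : 0 < s := lt_le_trans (scale_gt0 _) bs.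
have bg := bdd_smooth s0 bf; have g0 := bdd_ge0 bg Sx0.
set c := C3 * (scale k0 / s).
have cE : 2 * C3 * (scale k0 / s) = 2 * c by rewrite /c; ring.
have c0 : 0 <= c by rewrite mulr_ge0// divr_ge0// ltW// scale_gt0.
rewrite cE in c1 *.
have key : (1 - 2 * c * (1 - scale m)) * smooth s f x0 <= nu m (smooth s f).
  elim: m => [|m IH]; first by rewrite /scale expr0 subrr mulr0 subr0 mul1r.
  have cm1 : scale m <= 1 by exact: scale_le1.
  have cm0 : 0 < scale m by exact: scale_gt0.
  have cc0 : 0 <= c * scale m by rewrite mulr_ge0// ltW.
  have cc1 : c * scale m <= 1 by apply: le_trans (_ : c <= _); [rewrite ler_piMr|lra].
  have h : (1 - c * scale m) * nu m (smooth s f) <= nu m.+1 (smooth s f).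
    rewrite /= -nuZ ?subr_ge0//; apply: nu_le; [by apply: bddZ; rewrite ?subr_ge0|exact: bddQ|move=> x Sx].
    have bls : scale (k0 + m) <= s.
      by rewrite scaleD; apply: le_trans bs; rewrite ler_piMr// ltW// scale_gt0.
    have := Q_near (j := k0 + m) bf Sx bls; rewrite ler_norml => /andP[h _].
    move: h; rewrite (_ : C3 * (scale (k0 + m) / s) = c * scale m); last first.
      by rewrite /c scaleD; ring.
    by lra.
  apply: le_trans h; apply: le_trans (_ : (1 - c * scale m) * ((1 - 2 * c * (1 - scale m)) * smooth s f x0) <= _); last first.
    by apply: ler_wpM2l => //; rewrite subr_ge0.
  rewrite mulrA; apply: ler_wpM2r => //.
  have : 0 <= (c * scale m) * (c * (1 - scale m)) by apply: mulr_ge0 => //; apply: mulr_ge0 => //; lra.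
  have := scaleS m; nra.
apply: le_trans key; apply: ler_wpM2r => //.
have := mulr_ge0 c0 (ltW (scale_gt0 m)); lra.
Qed.

(** Each kernel is dominated by [1 + kap] times a vertical step of length [2 * scale j]. The
    semigroup law adds these steps up to a height comparable to [scale k0], where the decay of
    harmonic measure applies. *)
Lemma nu_harmonic f m : bdd f ->
  nu m.+1 f <= (1 + kap) ^+ m.+1 * H f (vshift (4 * (scale k0 - scale (k0 + m.+1))) x0).
Proof.
have kap0' := kap0; have k1 : 0 <= 1 + kap by lra.
elim: m f => [|m IH] f bf.
  rewrite /= addn0 expr1; apply: (le_trans (Q_smooth k0 bf Sx0)).
  rewrite /smooth addn1 (_ : 4 * (scale k0 - scale k0.+1) = 2 * scale k0)//.
  by have := scaleS k0; lra.
have t0 : 0 < 2 * scale (k0 + m.+1) by rewrite mulr_gt0// scale_gt0.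
have bs := bdd_smooth t0 bf.
apply: (@le_trans _ _ (nu m.+1 (fun x => (1 + kap) * smooth (2 * scale (k0 + m.+1)) f x))).
  by apply: (@nu_le m.+1); [exact: bddQ|exact: bddZ|move=> x Sx; exact: Q_smooth].
rewrite nuZ// [in leRHS]exprS -mulrA; apply: ler_wpM2l => //.
apply: (le_trans (IH _ bs)); apply: ler_wpM2l; first exact: exprn_ge0.
have Ox : O (vshift (4 * (scale k0 - scale (k0 + m.+1))) x0).
  apply: boundary_vshift => //; rewrite mulr_gt0// subr_gt0.
  rewrite scaleD gtr_pMr ?scale_gt0//; apply: (@le_lt_trans _ _ (scale 1)).
    by rewrite -add1n scaleD ler_piMr ?scale_le1// ltW// scale_gt0.
  by rewrite /scale expr1; lra.
rewrite poisson_smooth// vshiftD.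
rewrite (_ : 4 * _ + _ = 4 * (scale k0 - scale (k0 + m.+2)))//.
by rewrite [X in _ = 4 * (_ - scale X)]addnS (scaleS (k0 + m.+1)); ring.
Qed.

Context (gamma Cd c1 : R) (gamma0 : 0 < gamma) (Cd1 : 1 <= Cd) (c10 : 0 < c1).
Context (decay : forall z y (r : R), O z -> S y -> 0 < r -> r <= `|z - y| ->
  (omega z (surface_ball Phi y r) <= (Cd * (r / `|z - y|) `^ gamma)%:E)%E).
Context (mass : forall y (r : R), S y -> 0 < r -> (c1%:E <= omega (vshift r y) (surface_ball Phi y (5 * r)))%E).

Let mball y (r : R) : measurable (ball y r : set BV) := measurable_surface_ball K0 PhiK y r.

Let ballS y (r : R) : ball y r `<=` S.
Proof. by move=> x []. Qed.

(** Indicators are not smooth at any scale, so [nu_upper] does not apply to them. The mass bound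
    replaces one by the smoothed indicator of the ball six times as large, [6 * r] being
    [r + 5 * r]. *)
Lemma indic_le_smooth y (r : R) x : S x -> 0 < r ->
  c1 * \1_(ball y r) x <= smooth r \1_(ball y (6 * r)) x.
Proof.
move=> Sx r0; have bI := bdd_indic (mball y (6 * r)).
rewrite indicE; case: (boolP (x \in _)) => [|_]; last first.
  by rewrite mulr0; exact: (poisson_ge0 omega _ bI).
rewrite inE mulr1 => -[_ xy]; have Ox : O (vshift r x) by exact: boundary_vshift.
rewrite -lee_fin /smooth poisson_indic//; apply: (le_trans (mass Sx r0)).
apply: le_measure; rewrite ?inE//; try exact: mball.
move=> w [Sw wx]; split => //; have := ler_distD x w y.
by move: wx xy; set a := `|w - x|; set b := `|x - y|; lra.
Qed.

Lemma ball_vshift_decay y (r t : R) : S y -> 0 < r -> 0 < t ->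
  H \1_(ball y r) (vshift t x0) <= Cd * (((1 + K) / t) * r) `^ gamma.
Proof.
move=> Sy r0 t0; have K0' := K0; have Ox : O (vshift t x0) by exact: boundary_vshift.
have dist : t <= (1 + K) * `|vshift t x0 - y|.
  have := gap_lipschitz K0 PhiK (vshift t x0) y; rewrite gap_vshift.
  by rewrite !(nhs_boundaryP _ _).1// add0r subr0 gtr0_norm.
set D := `|_ - y| in dist *.
have K1 : 0 < 1 + K by lra.
have D0 : 0 < D by have := lt_le_trans t0 dist; rewrite pmulr_rgt0.
have tD : r / D <= (1 + K) / t * r.
  rewrite ler_pdivrMr// mulrAC ler_peMl//; first exact: ltW.
  by rewrite mulrAC ler_pdivlMr// mul1r.
have rD : 0 <= r / D by rewrite divr_ge0// ltW.
have mono : Cd * (r / D) `^ gamma <= Cd * (((1 + K) / t) * r) `^ gamma.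
  have Cd1' := Cd1; apply: ler_wpM2l; first lra.
  by apply: ge0_ler_powR; rewrite ?nnegrE// ?(ltW gamma0)//; exact: le_trans tD.
apply: le_trans mono; case: (leP r D) => rDc.
  by rewrite -lee_fin poisson_indic//; exact: decay.
apply: le_trans (_ : 1 <= _).
  by rewrite -lee_fin poisson_indic//; exact: probability_le1.
apply: mulr_ege1 => //; rewrite -[leLHS](congr1 (@^~ gamma) (powR1 R)).
apply: ge0_ler_powR; rewrite ?nnegrE ?(ltW gamma0)//.
by rewrite ler_pdivlMr// mul1r ltW.
Qed.

Definition ball_const : R :=
  c1^-1 * (expR (2 * C3) * (Cd * (6 * ((1 + K) / (2 * scale k0))) `^ gamma)).

(** The factor [1 + kap] is paid only for the first [l + 1] kernels, those coarser than the ball;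
    the finer ones hardly move a function smooth at scale [r] and cost the bounded factor
    [expR (2 * C3)] altogether. *)
Lemma nu_ball y (r : R) m l : S y -> 0 < r -> scale (k0 + l.+1) <= r ->
  nu m.+1 \1_(ball y r) <= ball_const * ((1 + kap) ^+ l.+1 * r `^ gamma).
Proof.
move=> Sy r0 lr; have kap0' := kap0; have K0' := K0; have Cd1' := Cd1.
have k1 : 1 <= 1 + kap by lra.
have E1 : 1 <= expR (2 * C3) by rewrite -expR0 ler_expR mulr_ge0//; exact: C30.
have bI := bdd_indic (mball y r); have bI6 := bdd_indic (mball y (6 * r)).
have bg := bdd_smooth r0 bI6.
have step1 : c1 * nu m.+1 \1_(ball y r) <= nu m.+1 (smooth r \1_(ball y (6 * r))).
  rewrite -nuZ ?(ltW c10)//; apply: nu_le => //; first by apply: bddZ => //; exact: ltW.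
  by move=> x Sx; exact: indic_le_smooth.
have sk0 := scale_gt0 k0.
have Hbound i : nu i.+1 (smooth r \1_(ball y (6 * r))) <=
    (1 + kap) ^+ i.+1 * (Cd * (6 * ((1 + K) / (2 * scale k0))) `^ gamma * r `^ gamma).
  apply: (le_trans (nu_harmonic i bg)); apply: ler_wpM2l; first by apply: exprn_ge0; lra.
  set t := 4 * _; have t2 : 2 * scale k0 <= t.
    rewrite /t scaleD; have : scale i.+1 <= 2^-1.
      by rewrite -add1n scaleD /scale expr1 ler_piMr//; exact: scale_le1.
    by move: sk0; set a := scale k0; nra.
  have t0 : 0 < t by apply: lt_le_trans t2; rewrite mulr_gt0.
  have Ox : O (vshift t x0) by exact: boundary_vshift.
  rewrite poisson_smooth// vshiftD.
  have tr0 : 0 < t + r by rewrite addr_gt0.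
  apply: (le_trans (@ball_vshift_decay y (6 * r) (t + r) Sy _ tr0)); first by rewrite mulr_gt0.
  have q0 : 0 <= 6 * ((1 + K) / (2 * scale k0)).
    by rewrite mulr_ge0// divr_ge0//; [lra|rewrite mulr_ge0// ltW].
  rewrite -[leRHS]mulrA -powRM ?(ltW r0)//; apply: ler_wpM2l; first lra.
  apply: ge0_ler_powR; rewrite ?nnegrE ?(ltW gamma0)//.
  - by rewrite mulr_ge0 ?divr_ge0 ?mulr_ge0 ?(ltW tr0) ?(ltW r0)//; lra.
  - by rewrite mulr_ge0// ltW.
  rewrite mulrCA mulrA; apply: ler_wpM2r; first exact: ltW.
  rewrite ler_pM2l//; apply: ler_wpM2l; first by lra.
  rewrite lef_pV2 ?posrE//; [lra|by rewrite mulr_gt0].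
set X := Cd * _ * _ in Hbound.
have X0 : 0 <= X by rewrite !mulr_ge0 ?powR_ge0//; lra.
have main : nu m.+1 (smooth r \1_(ball y (6 * r))) <= expR (2 * C3) * ((1 + kap) ^+ l.+1 * X).
  (* If the chain ends before it resolves the ball, the harmonic bound for all its steps is already
     smaller than required. *)
  case: (leqP l m) => lm.
    have := nu_upper (m - l) bI6 lr; rewrite addSn subnKC// => h.
    apply: (le_trans h); apply: ler_wpM2l; last exact: Hbound.
    exact: expR_ge0.
  apply: (le_trans (Hbound m)); apply: le_trans (_ : (1 + kap) ^+ l.+1 * X <= _).
    by apply: ler_wpM2r => //; apply: ler_weXn2l => //; exact: ltnW.
  by rewrite ler_peMl// mulr_ge0// exprn_ge0//; lra.
have {step1 main} := le_trans step1 main.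
rewrite -ler_pdivlMl// => h; apply: (le_trans h).
by rewrite le_eqVlt; apply/orP; left; apply/eqP; rewrite /ball_const /X; ring.
Qed.

(** The test function is the indicator of the ball of radius [5 * delta] smoothed at scale [delta].
    It is at least [c1] at [x0], the chain loses at most half of that, and by the decay estimate it
    is at most [c1 / 4] off the ball of radius [rho]. *)
Lemma nu_ball_lower (rho delta : R) m : 0 < delta -> 10 * delta <= rho ->
  Cd * (10 * delta / rho) `^ gamma <= c1 / 4 -> 4 * C3 * scale k0 <= delta -> scale k0 <= delta ->
  c1 / 4 <= nu m \1_(ball x0 rho).
Proof.
move=> d0 drho small kd1 kd2; have c10' := c10; have C30' := C30; have Cd1' := Cd1.
have bI := bdd_indic (mball x0 rho); have b5 := bdd_indic (mball x0 (5 * delta)).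
have bg := bdd_smooth d0 b5.
have c14 : 0 <= c1 / 4 by lra.
have ratio : 2 * C3 * (scale k0 / delta) <= 2^-1.
  by rewrite mulrA ler_pdivrMr//; lra.
have gx0 : c1 <= smooth delta \1_(ball x0 (5 * delta)) x0.
  by rewrite -lee_fin poisson_indic//; [exact: mass|exact: boundary_vshift].
have low : c1 / 2 <= nu m (smooth delta \1_(ball x0 (5 * delta))).
  apply: le_trans (nu_lower m b5 (le_trans ratio _) kd2); last by lra.
  move: ratio gx0; set a := 2 * C3 * _; set g := smooth _ _ _; nra.
have up : nu m (smooth delta \1_(ball x0 (5 * delta))) <= nu m \1_(ball x0 rho) + c1 / 4.
  rewrite -[X in _ + X](nu_cst m c14) -nuD//; last exact: bdd_cst.
  apply: nu_le => //; first by apply: bddD => //; exact: bdd_cst.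
  move=> x Sx; have Ox : O (vshift delta x) by exact: boundary_vshift.
  rewrite indicE; case: (boolP (x \in _)) => /= xb.
    apply: le_trans (_ : 1 <= _); last by lra.
    by rewrite -lee_fin poisson_indic//; exact: probability_le1.
  rewrite add0r; apply: le_trans small.
  have xfar : rho <= `|x - x0|.
    by rewrite leNgt; apply/negP => xl; move: xb; rewrite notin_setE; apply.
  have far : rho / 2 <= `|vshift delta x - x0|.
    have := ler_distD (vshift delta x) x x0.
    rewrite (distrC x (vshift delta x)) norm_vshift_sub gtr0_norm//.
    move: xfar; set a := `|x - x0|; set b := `|_ - x0|; lra.
  have rho0 : 0 < rho by lra.
  rewrite -lee_fin poisson_indic//; apply: le_trans (decay Ox Sx0 _ _) _.
  - by rewrite mulr_gt0.
  - by apply: le_trans far; lra.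
  rewrite lee_fin; apply: ler_wpM2l; first lra.
  have D0 : 0 < `|vshift delta x - x0| by apply: lt_le_trans far; rewrite divr_gt0.
  apply: ge0_ler_powR; rewrite ?nnegrE ?(ltW gamma0)//.
  - by rewrite divr_ge0 ?mulr_ge0// ltW.
  - by rewrite divr_ge0 ?mulr_ge0// ltW.
  rewrite ler_pdivrMr// mulrAC ler_pdivlMr//.
  by move: far; set D := `|_ - x0|; nra.
lra.
Qed.

Context (u : 'rV[R]_n.+1 -> R) (eps : R) (A : nat -> 'rV[R]_n.+1 -> R) (eps0 : 0 < eps).
Context (bu : forall s : R, 0 < s -> bdd (u \o vshift s)).
Context (bA : forall j, exists2 a, bdd a & A j = smooth (scale j) a).
Context (Qu : forall j x, S x -> Q j (u \o vshift (4 * scale j.+1)) x + eps * A j x = u (vshift (4 * scale j) x)).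

Lemma bddA j : bdd (A j).
Proof. by have [a ba ->] := bA j; apply: bdd_smooth => //; exact: scale_gt0. Qed.

Lemma nu_energy m : nu m (u \o vshift (4 * scale (k0 + m))) +
  eps * \sum_(i < m) nu i (A (k0 + i)) = u (vshift (4 * scale k0) x0).
Proof.
elim: m => [|m IH]; first by rewrite big_ord0 mulr0 addr0 addn0.
have s0 j : 0 < 4 * scale j by rewrite mulr_gt0// scale_gt0.
have E : nu m.+1 (u \o vshift (4 * scale (k0 + m.+1))) + eps * nu m (A (k0 + m)) =
    nu m (u \o vshift (4 * scale (k0 + m))).
  rewrite /= -(nuZ m (ltW eps0)); last exact: bddA.
  rewrite -nuD; [|by apply: bddQ; exact: bu|by apply: bddZ; [exact: ltW|exact: bddA]].
  by rewrite addnS; apply: nu_eq => x Sx; exact: Qu.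
rewrite big_ord_recr/= mulrDr -IH -E /=; ring.
Qed.

(** In [nu_energy] the function [A (k0 + i)] is seen by the law after [i] steps, here by the law
    after all [m]. It is smooth at scale [scale (k0 + i)], so the later steps cost the factor
    [expR (2 * C3)]. Positivity of [u] makes the bound independent of [m]. *)
Lemma nu_sum_variation m : nu m (fun x => \sum_(i < m) A (k0 + i) x) <=
  expR (2 * C3) / eps * u (vshift (4 * scale k0) x0).
Proof.
have [_ ->] := nu_sum m (index_enum 'I_m) (fun i => bddA (k0 + i)).
have s0 j : 0 < 4 * scale j by rewrite mulr_gt0// scale_gt0.
apply: le_trans (_ : \sum_(i < m) expR (2 * C3) * nu i (A (k0 + i)) <= _).
  apply: ler_sum => i _; have [a ba ->] := bA (k0 + i).
  by have := nu_upper (m - i) ba (lexx (scale (k0 + i))); rewrite subnKC// ltnW.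
rewrite -mulr_sumr -mulrA; apply: ler_wpM2l; first exact: expR_ge0.
rewrite ler_pdivlMl// -(nu_energy m) lerDr; apply: nu_ge0; exact: bu.
Qed.

End chain.

(** * Tilted kernels *)

Section tilt.
Context {R : realType} {n : nat} (Phi : 'rV[R]_n -> R) (K B : R).
Context (K0 : 0 <= K).
Context (PhiK : forall x y : 'rV[R]_n, `|Phi x - Phi y| <= K * `|x - y|).
Context (PhiB : forall x, `|Phi x| <= B).
Local Notation O := (near_half_space Phi).
Local Notation S := (nhs_boundary Phi).
Local Notation gp := (gap Phi).
Local Notation BV := (borel_rV R n.+1).
Local Notation ez := (basis_vec R n.+1 ord_max).
Context (omega : 'rV[R]_n.+1 -> probability BV R) (k : 'rV[R]_n.+1 -> 'rV[R]_n.+1 -> R).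
Context (z0 : 'rV[R]_n.+1).
Context (hm : harmonic_measure O omega) (mk : martin_kernel O S omega z0 k).
Context (C0 C2 : R) (HC : harnack_at Phi C0) (HW : harnack_wide Phi C0 C2).
Local Notation bdd := (bdd Phi).
Local Notation H := (poisson Phi omega).
Local Notation smooth := (smooth Phi omega).
Local Notation poissonE := (poissonE K0 PhiK omega z0).
Local Notation poissonD := (poissonD K0 PhiK omega z0).
Local Notation poissonZ := (poissonZ K0 PhiK omega z0).
Local Notation poisson_le := (poisson_le K0 PhiK omega z0).
Local Notation poisson_cst := (poisson_cst K0 PhiK PhiB z0 hm).
Local Notation poisson_smooth := (poisson_smooth K0 PhiK PhiB hm mk HC).
Local Notation bdd_smooth := (bdd_smooth K0 PhiK PhiB hm mk HC).

Let mS : measurable (S : set BV) := measurable_boundary K0 PhiK.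

Definition wide (w : 'rV[R]_n.+1) := exists (a : R) (v : 'rV[R]_n.+1),
  [/\ 0 <= a <= 3, `|v| <= C0^-1 & w = a *: ez + v].

Lemma wide0 : wide 0.
Proof.
have [C01 _] := HC; exists 0, 0; split; rewrite ?scale0r ?addr0 ?normr0//; first by lra.
by rewrite invr_ge0; lra.
Qed.

Lemma poisson_eq f g z : (forall x, S x -> f x = g x) -> H f z = H g z.
Proof. by move=> fg; rewrite /poisson; congr fine; apply: eq_integral => x; rewrite inE => /fg ->. Qed.

Lemma vshift_addr (s : R) (z w : 'rV[R]_n.+1) : vshift s (z + w) = vshift s z + w.
Proof. by rewrite /vshift addrAC. Qed.

Lemma poisson_wide_at f z (b : R) w : bdd f -> O z -> 0 < b <= gp z -> wide w ->
  O (z + b *: w) /\ `|H f (z + b *: w) - H f z| <= C2 * (b / gp z) * H f z.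
Proof. by move=> bf Oz bz [a [v [a3 v1 ->]]]; exact: (poisson_wide K0 PhiK mk HW). Qed.

Lemma measurable_piecewise (sel : BV -> nat) (F : nat -> BV -> R) :
  (forall i, measurable (S `&` sel @^-1` [set i] : set BV)) ->
  (forall i, measurable_fun (S : set BV) (F i)) ->
  measurable_fun (S : set BV) (fun x => F (sel x) x).
Proof.
move=> msel mF _ Y mY.
rewrite (_ : _ `&` _ = \bigcup_i ((S `&` sel @^-1` [set i]) `&` (S `&` F i @^-1` Y))).
  by apply: bigcup_measurable => i _; apply: measurableI => //; exact: mF.
apply/seteqP; split => [x [Sx Yx]|x [i _ [[Sx <-] [_ Yx]]]] //.
by exists (sel x).
Qed.

Context (eps : R) (eps0 : 0 < eps) (epsC2 : eps * C2 <= 2^-1).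

Let C21 : 1 <= C2. Proof. by case: HW. Qed.

Section level.
Context (b : R) (b0 : 0 < b) (wv : nat -> 'rV[R]_n.+1) (wwv : forall i, wide (wv i)).
Context (sel : 'rV[R]_n.+1 -> nat) (sg : 'rV[R]_n.+1 -> R).
Context (msel : forall i, measurable (S `&` sel @^-1` [set i] : set BV)).
Context (msg : measurable_fun (S : set BV) (sg : BV -> R)) (sg1 : forall x, `|sg x| <= 1).

(** With [wv (sel x)] and [sg x] the direction and the sign of a nearly maximal
    increment of [u], the correction lowers the average of [u] by [eps] times
    the variation of [u] at scale [b]. *)
Definition tilt f (x : 'rV[R]_n.+1) : R :=
  H f (vshift b x) - eps * (sg x * (H f (vshift b x + b *: wv (sel x)) - H f (vshift b x))).

Lemma gap_boundary_vshift (t : R) x : S x -> gp (vshift t x) = t.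
Proof. by move=> /nhs_boundaryP gx; rewrite gap_vshift gx add0r. Qed.

Let Ob x : S x -> O (vshift b x). Proof. by move=> Sx; exact: boundary_vshift. Qed.

Lemma tilt_abs (p : R) (q h e : R) : `|p| <= 1 -> `|h| <= e -> `|q - eps * (p * h) - q| <= eps * e.
Proof.
move=> p1 he; rewrite addrAC subrr sub0r normrN !normrM (gtr0_norm eps0) ler_pM2l//.
by apply: le_trans (_ : 1 * e <= _); [apply: ler_pM|rewrite mul1r].
Qed.

Lemma tilt_near f x : bdd f -> S x -> `|tilt f x - H f (vshift b x)| <= eps * C2 * H f (vshift b x).
Proof.
move=> bf Sx; rewrite -mulrA; apply: tilt_abs => //.
have [|_] := @poisson_wide_at f (vshift b x) b (wv (sel x)) bf (Ob Sx) _ (wwv _).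
  by rewrite gap_boundary_vshift// b0 lexx.
by rewrite gap_boundary_vshift// divff ?mulr1// gt_eqF.
Qed.

(** A function smooth at scale [s] extends to height [s] below the boundary, so the tilted step
    takes place at height [b + s], where a displacement of size [b] changes it by a relative amount
    of order [b / s] only. *)
Lemma tilt_smooth_near f (s : R) x : bdd f -> 0 < s -> S x ->
  `|tilt (smooth s f) x - H f (vshift (b + s) x)| <= eps * C2 * (b / s) * H f (vshift (b + s) x).
Proof.
move=> bf s0 Sx.
have bs0 : 0 < b + s by rewrite addr_gt0.
have Obs : O (vshift (b + s) x) by exact: boundary_vshift.
have bbs : 0 < b <= gp (vshift (b + s) x) by rewrite gap_boundary_vshift// b0 lerDl ltW.
have [_ le1] := poisson_wide_at bf Obs bbs (wwv (sel x)).
have [|Obw _] := @poisson_wide_at f (vshift b x) b (wv (sel x)) bf (Ob Sx) _ (wwv _).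
  by rewrite gap_boundary_vshift// b0 lexx.
rewrite /tilt !poisson_smooth//; last exact: Ob.
rewrite vshift_addr vshiftD.
have -> : eps * C2 * (b / s) * H f (vshift (b + s) x) = eps * (C2 * (b / s) * H f (vshift (b + s) x)) by ring.
apply: tilt_abs => //; apply: (le_trans le1).
rewrite gap_boundary_vshift//; apply: ler_wpM2r; first exact: (poisson_ge0 omega _ bf).
have C21' := C21; apply: ler_wpM2l; first lra.
by apply: ler_wpM2l; [exact: ltW|rewrite lef_pV2 ?posrE// lerDr ltW].
Qed.

(** Although direction and sign are chosen from [u], Harnack's inequality bounds the correction for
    every nonnegative [f] by [eps * C2] times its average. Since this factor is at most 1/2, the
    tilted operator stays positive. *)
Lemma tilt_bounds f x : bdd f -> S x -> 0 <= tilt f x <= (1 + eps * C2) * H f (vshift b x).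
Proof.
move=> bf Sx; have := tilt_near bf Sx; rewrite ler_norml => /andP[h1 h2].
have H0 := poisson_ge0 omega (vshift b x) bf; have := epsC2 => e2.
have : eps * C2 * H f (vshift b x) <= 2^-1 * H f (vshift b x) by exact: ler_wpM2r.
by move: h1 h2; set h := H f _ in H0 *; move=> h1 h2 h3; apply/andP; split; lra.
Qed.

Lemma bdd_tilt f : bdd f -> bdd (tilt f).
Proof.
move=> bf; have bb := bdd_smooth b0 bf; have [mb [M HM]] := bb; split.
  have mshift i : measurable_fun (S : set BV) (fun x : BV => H f (vshift b x + b *: wv i)).
    have Ov x : S x -> O (x + (b *: ez + b *: wv i)).
      move=> Sx; rewrite addrA.
      have [|Obw _] := @poisson_wide_at f (vshift b x) b (wv i) bf (Ob Sx) _ (wwv _).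
        by rewrite gap_boundary_vshift// b0 lexx.
      exact: Obw.
    have [+ _] := bdd_poisson_shift K0 PhiK PhiB hm mk HC bf Ov.
    by under eq_fun do rewrite addrA.
  apply: measurable_funB => //; apply: measurable_funM => //; apply: measurable_funM => //.
  apply: measurable_funB => //.
  exact: (@measurable_piecewise sel (fun i x => H f (vshift b x + b *: wv i)) msel mshift).
exists ((1 + eps * C2) * M) => x Sx; have /andP[-> le1] := tilt_bounds bf Sx.
rewrite (le_trans le1)//; apply: ler_wpM2l; last by have /andP[] := HM x Sx.
by rewrite addr_ge0// mulr_ge0//; [exact: ltW|have := C21; lra].
Qed.

Definition tilted f := smooth b (tilt f).

Lemma bdd_tilted f : bdd f -> bdd (tilted f).
Proof. by move=> bf; apply: bdd_smooth => //; exact: bdd_tilt. Qed.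

Let Obw f x : bdd f -> S x -> O (vshift b x + b *: wv (sel x)).
Proof.
move=> bf Sx; have [|//] := @poisson_wide_at f (vshift b x) b (wv (sel x)) bf (Ob Sx) _ (wwv _).
by rewrite gap_boundary_vshift// b0 lexx.
Qed.

Lemma tiltedD f g x : bdd f -> bdd g -> S x -> tilted (fun x => f x + g x) x = tilted f x + tilted g x.
Proof.
move=> bf bg Sx; rewrite /tilted /smooth; rewrite -poissonD//; try exact: bdd_tilt; last exact: Ob.
apply: poisson_eq => y Sy; rewrite /tilt !poissonD//; try exact: Ob; try exact: (Obw bf Sy).
ring.
Qed.

Lemma tiltedZ (c : R) f x : 0 <= c -> bdd f -> S x -> tilted (fun x => c * f x) x = c * tilted f x.
Proof.
move=> c0 bf Sx; rewrite /tilted /smooth; rewrite -poissonZ//; try exact: bdd_tilt; last exact: Ob.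
apply: poisson_eq => y Sy; rewrite /tilt !poissonZ//; try exact: Ob; try exact: (Obw bf Sy).
ring.
Qed.

Lemma tilted_eq f g x : (forall x, S x -> f x = g x) -> S x -> tilted f x = tilted g x.
Proof.
move=> fg Sx; rewrite /tilted /smooth; apply: poisson_eq => y Sy; rewrite /tilt.
by rewrite !(poisson_eq _ fg).
Qed.

Lemma tilted1 x : S x -> tilted (fun=> 1) x = 1.
Proof.
move=> Sx; have b1 : bdd (fun=> 1) by exact: bdd_cst.
rewrite /tilted /smooth -[RHS](@poisson_cst 1 (vshift b x) ler01); last exact: Ob.
apply: poisson_eq => y Sy; rewrite /tilt !poisson_cst//; try exact: Ob; try exact: (Obw b1 Sy).
by rewrite subrr !mulr0 subr0.
Qed.

Lemma tilted_smooth f x : bdd f -> S x -> tilted f x <= (1 + eps * C2) * smooth (2 * b) f x.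
Proof.
move=> bf Sx; have e0 : 0 <= 1 + eps * C2.
  by rewrite addr_ge0// mulr_ge0//; [exact: ltW|have := C21; lra].
have bs := bdd_smooth b0 bf.
have -> : smooth (2 * b) f x = H (smooth b f) (vshift b x).
  rewrite poisson_smooth//; last exact: Ob.
  by rewrite vshiftD /smooth; congr (H f (vshift _ x)); ring.
rewrite -poissonZ//; last exact: Ob.
apply: poisson_le; [exact: bdd_tilt|exact: bddZ|exact: Ob|].
by move=> y Sy; have /andP[] := tilt_bounds bf Sy.
Qed.

Lemma tilted_near f (s : R) x : bdd f -> S x -> b <= s ->
  `|tilted (smooth s f) x - smooth s f x| <= (2 * C2) * (b / s) * smooth s f x.
Proof.
move=> bf Sx bs; have s0 : 0 < s := lt_le_trans b0 bs.
have bs0 : 0 < b + s by rewrite addr_gt0.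
have bg := bdd_smooth s0 bf; have bG := bdd_smooth bs0 bf.
have Oxb : O (vshift b x) by exact: Ob.
have q0 : 0 <= b / s by rewrite divr_ge0// ltW.
have q1 : b / s <= 1 by rewrite ler_pdivrMr// mul1r.
have C21' := C21; have eps0' := eps0; have epsC2' := epsC2.
set e := eps * C2 * (b / s).
have ec0 : 0 <= eps * C2 by apply: mulr_ge0; [exact: ltW|lra].
have e0 : 0 <= e by exact: mulr_ge0.
have e1 : e <= 2^-1 by apply: le_trans epsC2; rewrite ler_piMr.
have near y : S y -> (1 - e) * smooth (b + s) f y <= tilt (smooth s f) y <= (1 + e) * smooth (b + s) f y.
  move=> Sy; have := tilt_smooth_near bf s0 Sy; rewrite -/e ler_norml.
  by rewrite /smooth => /andP[h1 h2]; apply/andP; split; lra.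
have HG : H (smooth (b + s) f) (vshift b x) = H f (vshift (s + 2 * b) x).
  by rewrite poisson_smooth// vshiftD; congr (H f (vshift _ x)); ring.
have up : tilted (smooth s f) x <= (1 + e) * H f (vshift (s + 2 * b) x).
  rewrite -HG -poissonZ//; last by lra.
  apply: poisson_le => //; [exact: bdd_tilt|by apply: bddZ => //; lra|].
  by move=> y /near/andP[].
have low : (1 - e) * H f (vshift (s + 2 * b) x) <= tilted (smooth s f) x.
  rewrite -HG -poissonZ//; last by lra.
  apply: poisson_le => //; [by apply: bddZ => //; lra|exact: bdd_tilt|].
  by move=> y /near/andP[].
have Oxs : O (vshift s x) by exact: boundary_vshift.
have w2 : wide (2 *: ez).
  have [C01 _] := HC; exists 2, 0; split; rewrite ?addr0 ?normr0//; first by lra.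
  by rewrite invr_ge0; lra.
have [|_] := @poisson_wide_at f (vshift s x) b _ bf Oxs _ w2.
  by rewrite gap_boundary_vshift// b0.
rewrite gap_boundary_vshift//.
have -> : vshift s x + b *: (2 *: ez) = vshift (s + 2 * b) x.
  by rewrite /vshift scalerA -addrA -scalerDl; congr (_ + _ *: _); ring.
rewrite ler_norml => /andP[h1 h2].
have g0 : 0 <= smooth s f x by exact: (poisson_ge0 omega _ bf).
have G0 : 0 <= H f (vshift (s + 2 * b) x) by exact: (poisson_ge0 omega _ bf).
move: up low h1 h2 g0 G0; rewrite -/(smooth s f x).
set T := tilted _ _; set G := H f _; set g := smooth s f x => up low h1 h2 g0 G0.
(* Both [eps] and [eps * C2] are at most 1/2, so the error of the tilt is no larger than that of the
   vertical step; together they give [2 * C2]. *)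
have eG : e * G <= C2 * (b / s) * g.
  apply: le_trans (_ : e * ((1 + C2) * g) <= _).
    apply: ler_wpM2l => //; have : C2 * (b / s) * g <= C2 * g by apply: ler_wpM2r => //; rewrite ler_piMr//; lra.
    lra.
  have -> : e * ((1 + C2) * g) = (eps * (1 + C2)) * (C2 * (b / s) * g) by rewrite /e; ring.
  have c0 : 0 <= C2 * (b / s) * g by apply: mulr_ge0 => //; apply: mulr_ge0 => //; lra.
  rewrite ler_piMl//.
  have : eps <= eps * C2 by rewrite ler_peMr// ltW.
  lra.
rewrite ler_norml; apply/andP; split; lra.
Qed.

End level.

(** * Measurable choice of the tilting direction *)

Section selection.
Context (u : 'rV[R]_n.+1 -> R) (hu : harmonic_on O u) (u0 : forall z, O z -> 0 < u z).
Context (ub : forall t : R, 0 < t -> exists M : R, forall z, O z -> `|u (vshift t z)| <= M).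
Local Notation bdd_vshift := (bdd_vshift K0 PhiK hu u0 ub).
Local Notation poisson_vshift := (poisson_vshift K0 PhiK PhiB z0 hm hu u0 ub).

(** Rational displacements: being countably many, they allow a nearly optimal one to be chosen
    measurably by least index. Inadmissible ones are replaced by 0. *)
Definition directions (i : nat) : 'rV[R]_n.+1 :=
  if `[< wide (rat_point i) >] then rat_point i else 0.

Lemma wide_directions i : wide (directions i).
Proof. by rewrite /directions; case: asboolP => // _; exact: wide0. Qed.

Section at_scale.
Context (b : R) (b0 : 0 < b).

(** The height [3 * b] is the length [b] of the tilted step plus the shift [2 * b] of the function
    [u \o vshift (2 * b)] to which the kernel is applied. *)
Definition diff (i : nat) (x : 'rV[R]_n.+1) : R :=
  u (vshift (3 * b) x + b *: directions i) - u (vshift (3 * b) x).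

(** The supremum of the increments need not be attained; the factor 2 guarantees an index. *)
Definition dominating (i : nat) (x : 'rV[R]_n.+1) := forall l, `|diff l x| <= 2 * `|diff i x|.

Let b3 : 0 < 3 * b. Proof. by rewrite mulr_gt0. Qed.

Lemma diff_wide i x : S x -> O (vshift (3 * b) x + b *: directions i) /\
  `|diff i x| <= C2 * u (vshift (3 * b) x).
Proof.
move=> Sx; have Ox : O (vshift (3 * b) x) by exact: boundary_vshift.
have [_ _ HW'] := HW; have [a [v [a3 v1 E]]] := wide_directions i.
have gE : gp (vshift (3 * b) x) = 3 * b by exact: gap_boundary_vshift.
have [|Oy le1] := HW' u (conj hu u0) (vshift (3 * b) x) b a v Ox _ a3 v1.
  by have b0' := b0; rewrite gE b0/=; lra.
rewrite /diff E; split => //; apply: (le_trans le1); rewrite gE.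
apply: ler_wpM2r; first exact/ltW/u0.
have C21' := C21; rewrite ler_piMr//; first by lra.
by have b0' := b0; rewrite ler_pdivrMr// ; lra.
Qed.

Lemma dominating_ex x : S x -> exists i, dominating i x.
Proof.
move=> Sx; pose A := [set `|diff l x| | l in [set: nat]].
have hA : has_sup A.
  split; first by exists `|diff 0 x|, 0%N.
  by exists (C2 * u (vshift (3 * b) x)) => _ [l _ <-]; have [] := diff_wide l Sx.
have le l : `|diff l x| <= sup A by apply: ub_le_sup; [exact: hA.2|exists l].
have := le 0%N; have := normr_ge0 (diff 0 x); set d0 := `|diff 0 x| => d00 d0s.
case: (ltP 0 (sup A)) => sA.
  have h : 0 < sup A / 2 by rewrite divr_gt0.
  have [_ [i _ <-] hi] := sup_adherent h hA.
  exists i => l; apply: (le_trans (le l)); lra.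
exists 0%N => l; apply: (le_trans (le l)); rewrite -/d0; lra.
Qed.

Lemma measurable_diff i : measurable_fun (S : set BV) (diff i : BV -> R).
Proof.
have oO : open O := open_nhs K0 PhiK; have c := harmonic_on_c2 oO hu.
apply: measurable_rel_continuous => //; apply: continuous_rel => x Sx.
have [Oy _] := diff_wide i Sx.
have Ox : O (vshift (3 * b) x) by exact: boundary_vshift.
have cv (v : 'rV[R]_n.+1) : {for x, continuous (fun y : 'rV[R]_n.+1 => y + v)}.
  by apply: (@cvgD _ _ _ (nbhs x)); [exact: cvg_id|exact: cvg_cst].
apply: (@cvgB _ _ _ (nbhs x)).
  have E : (fun y : 'rV[R]_n.+1 => u (vshift (3 * b) y + b *: directions i)) =
     u \o (fun y : 'rV[R]_n.+1 => y + ((3 * b) *: ez + b *: directions i)).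
    by apply/funext => y; rewrite /= addrA.
  have h : {for x, continuous (u \o (fun y : 'rV[R]_n.+1 => y + ((3 * b) *: ez + b *: directions i)))}.
    apply: continuous_comp; first exact: cv.
    by have [cu _] := c _ Oy; rewrite addrA.
  by rewrite -E in h.
by apply: (@continuous_comp _ _ _ (vshift (3 * b)) u); [exact: cv|have [] := c _ Ox].
Qed.

Definition select (x : 'rV[R]_n.+1) : nat :=
  if pselect (exists i, `[< dominating i x >]) is left e then ex_minn e else 0%N.

Lemma selectP x : S x -> dominating (select x) x /\ forall i, (i < select x)%N -> ~ dominating i x.
Proof.
move=> Sx; rewrite /select; case: pselect => [e|ne]; last first.
  by exfalso; apply: ne; have [i Hi] := dominating_ex Sx; exists i; exact/asboolP.
case: ex_minnP => m /asboolP Hm min; split => // i im Hi.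
by have := min i (introT (asboolP _) Hi); rewrite leqNgt im.
Qed.

Lemma measurable_select i : measurable (S `&` select @^-1` [set i] : set BV).
Proof.
have mdom l : measurable (S `&` [set x | dominating l x] : set BV).
  have -> : S `&` [set x | dominating l x] = \bigcap_m (S `&` [set x | `|diff m x| - 2 * `|diff l x| <= 0]).
    apply/seteqP; split => [x [Sx Dx] m _|x Hx].
      by split => //=; rewrite subr_le0; exact: Dx.
    by split; [have [] := Hx 0%N I|move=> m; have [_ /=] := Hx m I; rewrite subr_le0].
  apply: bigcapT_measurable => m.
  have mf : measurable_fun (S : set BV) (fun x : BV => `|diff m x| - 2 * `|diff l x|).
    apply: measurable_funB; first exact: (measurableT_comp (@normr_measurable R setT) (measurable_diff m)).
    apply: measurable_funM => //; exact: (measurableT_comp (@normr_measurable R setT) (measurable_diff l)).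
  rewrite (_ : mkset _ = (fun x : BV => `|diff m x| - 2 * `|diff l x|) @^-1` `]-oo, 0]%classic).
    by apply: mf => //; exact: measurable_itv.
  by apply/seteqP; split => x /=; rewrite in_itv.
have -> : S `&` select @^-1` [set i] = (S `&` [set x | dominating i x]) `\`
    \bigcup_(l in [set l | (l < i)%N]) (S `&` [set x | dominating l x]).
  apply/seteqP; split => [x [Sx <-]|x [[Sx Di] nD]].
    have [D1 D2] := selectP Sx; split => // -[l /= li [_ Dl]]; exact: D2 li Dl.
  split => //=; have [D1 D2] := selectP Sx; apply/eqP; rewrite eqn_leq; apply/andP; split.
    by rewrite leqNgt; apply/negP => lt; exact: D2 _ lt Di.
  by rewrite leqNgt; apply/negP => li; apply: nD; exists (select x).
apply: measurableD; first exact: mdom.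
by apply: bigcup_measurable => l _; exact: mdom.
Qed.

Definition diff_sign (x : 'rV[R]_n.+1) : R := Num.sg (diff (select x) x).

Definition variation (x : 'rV[R]_n.+1) : R := `|diff (select x) x|.

Lemma measurable_diff_select : measurable_fun (S : set BV) (fun x : BV => diff (select x) x).
Proof. exact: (@measurable_piecewise select diff measurable_select measurable_diff). Qed.

Lemma measurable_diff_sign : measurable_fun (S : set BV) (diff_sign : BV -> R).
Proof.
have E : diff_sign = (fun x => (0 < diff (select x) x)%R%:R - (diff (select x) x < 0)%R%:R).
  by apply/funext => x; rewrite /diff_sign; case: sgrP => [_|h|h] /=; rewrite ?ltxx ?subrr ?h ?(lt_gtF h) ?subr0 ?sub0r.
rewrite E; have md := measurable_diff_select.
have mi (f : BV -> bool) : measurable_fun (S : set BV) f -> measurable_fun (S : set BV) (fun x => (f x)%:R : R).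
  move=> mf; rewrite (_ : (fun x => _) = (fun x => if f x then 1 else 0)); last first.
    by apply/funext => x; case: (f x).
  by apply: measurable_fun_if => //; exact: measurable_cst.
by apply: measurable_funB; apply: mi; apply: measurable_fun_ltr.
Qed.

Lemma diff_sign_le1 x : `|diff_sign x| <= 1.
Proof. by rewrite /diff_sign normr_sg; case: (_ != 0). Qed.

Lemma bdd_variation : bdd variation.
Proof.
split; first exact: (measurableT_comp (@normr_measurable R setT) measurable_diff_select).
have [M M0 HM] := bdd_bound z0 (bdd_vshift b3).
exists (C2 * M) => x Sx; rewrite normr_ge0/=.
have [_ le1] := diff_wide (select x) Sx; apply: (le_trans le1).
by have C21' := C21; apply: ler_wpM2l; [lra|exact: HM].
Qed.

(** Continuity of [u] extends the bound from rational to real displacements. The strict inequality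
    on [v] leaves room for a rational approximation that is still admissible. *)
Lemma variation_wide x (a : R) v : S x -> 0 <= a <= 3 -> `|v| < C0^-1 ->
  `|u (vshift (3 * b) x + b *: (a *: ez + v)) - u (vshift (3 * b) x)| <= 2 * variation x.
Proof.
move=> Sx a3 v1; have oO : open O := open_nhs K0 PhiK; have c := harmonic_on_c2 oO hu.
have Ox : O (vshift (3 * b) x) by exact: boundary_vshift.
have [_ _ HW'] := HW; have gE : gp (vshift (3 * b) x) = 3 * b by exact: gap_boundary_vshift.
set y := _ + b *: _.
have Oy : O y.
  have [|//] := HW' u (conj hu u0) (vshift (3 * b) x) b a v Ox _ a3 (ltW v1).
  by have b0' := b0; rewrite gE b0/=; lra.
apply/ler_addgt0Pr => e e0.
have [cu _] := c _ Oy.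
have : \forall y' \near y, `|u y - u y'| < e.
  by apply: (@cvgr_dist_lt _ _ _ (nbhs y) _ u (u y)).
move=> /(nbhs_ballP _ _).1[r /= r0 Hr].
have gapv : 0 < C0^-1 - `|v| by rewrite subr_gt0.
have rb : 0 < Num.min (r / b) (C0^-1 - `|v|) by rewrite lt_min gapv divr_gt0.
have [i] := rat_point_dense (a *: ez + v) rb; rewrite lt_min => /andP[i1 i2].
have wi : wide (rat_point i).
  exists a, (rat_point i - a *: ez); split => //; last by rewrite addrC subrK.
  have -> : rat_point i - a *: ez = v - (a *: ez + v - rat_point i).
    by apply/rowP => l; rewrite !mxE; ring.
  by apply: (le_trans (ler_normB _ _)); move: i2; set q := `|_ - rat_point i|; lra.
have di : directions i = rat_point i by rewrite /directions; case: asboolP.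
have h : `|diff i x| <= 2 * variation x := (selectP Sx).1 i.
rewrite /diff di in h.
have uy : `|u y - u (vshift (3 * b) x + b *: rat_point i)| < e.
  apply: Hr; rewrite -ball_normE/= /y opprD addrACA subrr add0r -scalerBr normrZ gtr0_norm//.
  by rewrite mulrC -ltr_pdivlMr.
have := ler_distD (u (vshift (3 * b) x + b *: rat_point i)) (u y) (u (vshift (3 * b) x)).
lra.
Qed.

Local Notation Qb := (tilted b directions select diff_sign).

Lemma tilted_vshift x : S x ->
  Qb (u \o vshift (2 * b)) x + eps * smooth b variation x = u (vshift (4 * b) x).
Proof.
move=> Sx; have b2 : 0 < 2 * b by rewrite mulr_gt0.
have bu := bdd_vshift b2; have Oxb : O (vshift b x) by exact: boundary_vshift.
have bv := bdd_variation.
have bt : bdd (tilt b directions select diff_sign (u \o vshift (2 * b))).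
  apply: bdd_tilt => //; [exact: wide_directions|exact: measurable_select|exact: measurable_diff_sign|exact: diff_sign_le1].
rewrite /tilted /smooth -poissonZ//; last exact: ltW.
rewrite -poissonD//; last by apply: bddZ => //; exact: ltW.
have -> : u (vshift (4 * b) x) = H (u \o vshift (3 * b)) (vshift b x).
  by rewrite poisson_vshift// vshiftD; congr (u (vshift _ x)); ring.
apply: poisson_eq => y Sy; rewrite /tilt.
have Oyb : O (vshift b y) by exact: boundary_vshift.
have [|Oyw _] := @poisson_wide_at _ (vshift b y) b (directions (select y)) bu Oyb _ (wide_directions _).
  by rewrite gap_boundary_vshift// b0 lexx.
rewrite !poisson_vshift// vshift_addr vshiftD.
have -> : b + 2 * b = 3 * b by ring.
rewrite -/(diff (select y) y) /diff_sign /variation normrEsg /=; ring.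
Qed.

End at_scale.
End selection.
End tilt.

(** * The operators B_t *)

Section integration.
Context {R : realType}.

Lemma quotient_cvg (d : nat) (f : 'rV[R]_d -> R) (z v : 'rV[R]_d) (df : R) : is_derive z v f df ->
  (fun N => N.+1%:R * (f (z + N.+1%:R^-1 *: v) - f z)) @ \oo --> df.
Proof.
move=> /is_derive_line0P/is_derive_cvg/cvgrPdist_lt dv.
apply/cvgrPdist_lt => e e0; have := dv e e0.
rewrite near_withinE => /(nbhs_ballP _ _).1[r /= r0 Hr].
exists (Num.truncn r^-1) => // N /= rN.
have N0 : 0 < N.+1%:R^-1 :> R by rewrite invr_gt0.
have := Hr N.+1%:R^-1; rewrite /ball/= sub0r normrN gtr0_norm// invrK add0r scale0r addr0; apply.
  rewrite invf_plt ?posrE//; apply: (lt_le_trans (truncnS_gt _)).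
  by rewrite ler_nat ltnS.
by rewrite gt_eqF.
Qed.

(** The integral of a nonnegative function is the supremum over simple functions below it, hence
    monotone for arbitrary integrands. It is applied to integrals such as the one over [t] in [V],
    whose integrand is not shown to be measurable. *)
Lemma ge0_le_integral_nonmeasurable d (T : measurableType d) (mu : {measure set T -> \bar R}) (D : set T)
    (f g : T -> \bar R) : (forall x, D x -> 0 <= f x)%E -> (forall x, D x -> f x <= g x)%E ->
  (\int[mu]_(x in D) f x <= \int[mu]_(x in D) g x)%E.
Proof.
move=> f0 fg; have g0 x : D x -> (0 <= g x)%E by move=> Dx; apply: le_trans (f0 x Dx) (fg x Dx).
rewrite !ge0_integralE//; apply: le_ereal_sup => _ [h /= hf <-]; exists h => //= x.
apply: (le_trans (hf x)); rewrite !patchE; case: ifPn => // /set_mem; exact: fg.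
Qed.

Section fubini_on.
Context {d1 d2 : measure_display} {T1 : measurableType d1} {T2 : measurableType d2}.
Context (m1 : {sigma_finite_measure set T1 -> \bar R}) (m2 : {sigma_finite_measure set T2 -> \bar R}).

Lemma fubini_on (D1 : set T1) (D2 : set T2) (f : T1 * T2 -> \bar R) :
  measurable D1 -> measurable D2 -> measurable_fun (D1 `*` D2) f ->
  (\int[m1]_(x in D1) \int[m2]_(y in D2) `|f (x, y)| < +oo)%E ->
  (\int[m1]_(x in D1) \int[m2]_(y in D2) f (x, y) = \int[m2]_(y in D2) \int[m1]_(x in D1) f (x, y))%E.
Proof.
move=> mD1 mD2 mf foo; have mD : measurable (D1 `*` D2) by exact: measurableX.
pose F := f \_ (D1 `*` D2).
have mF : measurable_fun setT F by apply/(measurable_restrictT _ _).1.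
have E1 (G : \bar R -> \bar R) x : G 0%E = 0%E ->
    (\int[m2]_y G (F (x, y)) = (fun x => \int[m2]_(y in D2) G (f (x, y))) \_ D1 x)%E.
  move=> G0; rewrite patchE; case: ifPn => [|xD].
    rewrite inE => Dx; rewrite [RHS]integral_mkcond; apply: eq_integral => y _.
    by rewrite /F !patchE in_setX mem_set//=; case: ifP.
  by rewrite integral0_eq// => y _; rewrite /F patchE in_setX (negbTE xD).
have E2 y : (\int[m1]_x F (x, y) = (fun y => \int[m1]_(x in D1) f (x, y)) \_ D2 y)%E.
  rewrite patchE; case: ifPn => [|yD].
    rewrite inE => Dy; rewrite [RHS]integral_mkcond; apply: eq_integral => x _.
    by rewrite /F !patchE in_setX [y \in D2]mem_set// andbT.
  by rewrite integral0_eq// => x _; rewrite /F patchE in_setX (negbTE yD) andbF.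
have iF : (m1 \x m2)%E.-integrable setT F.
  apply/(integrable12ltyP m1 m2 mF).
  rewrite [X in (X < _)%E](_ : _ = \int[m1]_(x in D1) \int[m2]_(y in D2) `|f (x, y)|)%E//.
  rewrite [RHS]integral_mkcond; apply: eq_integral => x _.
  by have := E1 abse x abse0 => /= ->.
have := @Fubini _ _ T1 T2 R m1 m2 F iF.
under eq_integral do rewrite (E1 id)//.
under [RHS]eq_integral do rewrite E2.
by rewrite -!integral_mkcond.
Qed.

End fubini_on.
End integration.

(** * Closed form of [B_t u_t] *)

Section variation.
Context {R : realType} {n : nat} (Phi : 'rV[R]_n -> R) (K B : R).
Context (K0 : 0 <= K).
Context (PhiK : forall x y : 'rV[R]_n, `|Phi x - Phi y| <= K * `|x - y|).
Context (PhiB : forall x, `|Phi x| <= B).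
Local Notation O := (near_half_space Phi).
Local Notation S := (nhs_boundary Phi).
Local Notation gp := (gap Phi).
Local Notation BV := (borel_rV R n.+1).
Local Notation e := (basis_vec R n.+1).
Context (omega : 'rV[R]_n.+1 -> probability BV R) (k : 'rV[R]_n.+1 -> 'rV[R]_n.+1 -> R).
Context (z0 : 'rV[R]_n.+1).
Context (hm : harmonic_measure O omega) (mk : martin_kernel O S omega z0 k).
Context (C0 C2 : R) (HC : harnack_at Phi C0) (HW : harnack_wide Phi C0 C2).
Local Notation mu := (omega z0).
Local Notation bdd := (bdd Phi).
Local Notation H := (poisson Phi omega).
Local Notation smooth := (smooth Phi omega).
Context (u : 'rV[R]_n.+1 -> R) (hu : harmonic_on O u) (u0 : forall z, O z -> 0 < u z).
Context (ub : forall t : R, 0 < t -> exists M : R, forall z, O z -> `|u (vshift t z)| <= M).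
Local Notation bdd_vshift := (bdd_vshift K0 PhiK hu u0 ub).
Local Notation poisson_vshift := (poisson_vshift K0 PhiK PhiB z0 hm hu u0 ub).

Let mS : measurable (S : set BV) := measurable_boundary K0 PhiK.
Let mSS : measurable ((S : set BV) `*` (S : set BV)). Proof. exact: measurableX. Qed.

Let C01 : 1 <= C0. Proof. by case: HC. Qed.

Let kg0 z xi : O z -> S xi -> 0 < k z xi. Proof. exact: kernel_gt0 mk _ _. Qed.

Lemma measurable_kernel_shift (v : 'rV[R]_n.+1) : (forall x, S x -> O (x + v)) ->
  measurable_fun ((S : set BV) `*` (S : set BV)) (fun p : BV * BV => k (p.1 + v) p.2).
Proof.
move=> Ov; apply: measurable_rel_continuous2 => // -[x y] /= [Sx Sy] eta eta0.
have [r r0 Hr] := kernel_near mk (Ov _ Sx) Sy eta0.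
exists r => // -[x' y'] /= [Sx' Sy'] xx yy; apply: Hr => //; first exact: Ov.
by rewrite opprD addrACA subrr addr0.
Qed.

Section time.
Context (t : R) (t0 : 0 < t).

Let Ot x : S x -> O (vshift t x). Proof. by move=> Sx; exact: boundary_vshift. Qed.

Let gt x : S x -> gp (vshift t x) = t. Proof. exact: gap_boundary_vshift. Qed.

Definition dkernel (i : 'I_n.+1) (x xi : 'rV[R]_n.+1) : R := 'D_(e i) (k^~ xi) (vshift t x).

Lemma small_index : exists N0 : nat, forall N, (N0 <= N)%N -> N.+1%:R^-1 <= t / C0.
Proof.
have tC : 0 < t / C0 by rewrite divr_gt0//; have := C01; lra.
exists (Num.truncn (t / C0)^-1) => N h; rewrite invf_ple ?posrE//.
by apply/ltW/(lt_le_trans (truncnS_gt _)); rewrite ler_nat ltnS.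
Qed.

Lemma near_boundary_vshift i x (h : R) : S x -> 0 < h -> h <= t / C0 ->
  O (vshift t x + h *: e i) /\ forall xi, S xi ->
  `|k (vshift t x + h *: e i) xi - k (vshift t x) xi| <= C0 / t * h * k (vshift t x) xi.
Proof.
move=> Sx h0 hC; have dist : `|vshift t x + h *: e i - vshift t x| = h.
  by rewrite addrC addKr normrZ norm_basis_vec mulr1 gtr0_norm.
have [_ HC'] := HC.
have le xi : S xi -> O (vshift t x + h *: e i) /\
    `|k (vshift t x + h *: e i) xi - k (vshift t x) xi| <= C0 * (h / t) * k (vshift t x) xi.
  move=> Sxi; have := (HC' _ (kernel_pos_harmonic mk Sxi) _ (Ot Sx)).1 (vshift t x + h *: e i).
  by rewrite dist gt//; apply.
split; first by have [] := le x Sx.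
by move=> xi /le[_]; rewrite (_ : C0 / t * h = C0 * (h / t))//; ring.
Qed.

Lemma dkernel_cvg i x xi : S x -> S xi ->
  (fun N => N.+1%:R * (k (vshift t x + N.+1%:R^-1 *: e i) xi - k (vshift t x) xi)) @ \oo --> dkernel i x xi.
Proof.
move=> Sx Sxi; have [hk _] := kernel_pos_harmonic mk Sxi.
apply: (@quotient_cvg R n.+1 (k^~ xi) (vshift t x) (e i)); have [h1 _] := hk.
by apply/derivableP; exact: h1 (Ot Sx).
Qed.

Lemma dkernel_bound i x xi : S x -> S xi -> `|dkernel i x xi| <= C0 / t * k (vshift t x) xi.
Proof.
move=> Sx Sxi; have [_ HC'] := HC.
have := (HC' _ (kernel_pos_harmonic mk Sxi) _ (Ot Sx)).2 i.
by rewrite gt.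
Qed.

Lemma measurable_dkernel i :
  measurable_fun ((S : set BV) `*` (S : set BV)) (fun p : BV * BV => dkernel i p.1 p.2).
Proof.
have [N0 HN0] := small_index.
pose h N (p : BV * BV) : R := (N + N0).+1%:R * (k (vshift t p.1 + (N + N0).+1%:R^-1 *: e i) p.2 - k (vshift t p.1) p.2).
apply: (@measurable_fun_cvg _ _ _ _ h).
  move=> N; apply: measurable_funM => //; apply: measurable_funB.
    under eq_fun do rewrite /vshift -addrA.
    apply: measurable_kernel_shift => x Sx; rewrite addrA.
    have [] := near_boundary_vshift (h := (N + N0).+1%:R^-1) i Sx => //.
    by apply: HN0; rewrite leq_addl.
  by apply: measurable_kernel_shift => x Sx; exact: Ot.
move=> [x xi] /= [Sx Sxi]; rewrite /h /=.
by have := dkernel_cvg (i := i) Sx Sxi; rewrite -(cvg_shiftn N0).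
Qed.

Lemma measurable_section (F : BV * BV -> R) x :
  measurable_fun ((S : set BV) `*` (S : set BV)) F -> S x ->
  measurable_fun (S : set BV) (fun xi => F (x, xi)).
Proof.
move=> mF Sx; apply: (measurable_comp mSS _ mF) => //; first by move=> _ [y Sy <-].
by apply: measurable_funTS; exact: pair1_measurable.
Qed.

Lemma measurable_section2 (F : BV * BV -> R) xi :
  measurable_fun ((S : set BV) `*` (S : set BV)) F -> S xi ->
  measurable_fun (S : set BV) (fun x => F (x, xi)).
Proof.
move=> mF Sx; apply: (measurable_comp mSS _ mF) => //; first by move=> _ [y Sy <-].
by apply: measurable_funTS; exact: pair2_measurable.
Qed.

Lemma kernel_integrable f z : bdd f -> O z -> mu.-integrable (S : set BV) (fun xi => (k z xi * f xi)%:E).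
Proof.
move=> bf Oz; apply/integrableP; split.
  by apply/measurable_EFinP; apply: measurable_funM; [have h := measurable_kernel K0 PhiK mk Oz; apply: h|case: bf].
rewrite (eq_integral (fun xi : BV => (k z xi * f xi)%:E)); last first.
  by move=> x; rewrite inE => Sx; rewrite /= ger0_norm// mulr_ge0 ?(bdd_ge0 bf)// ltW// kg0.
by rewrite -(poisson_kernel K0 PhiK mk)// ltry.
Qed.

(** Differentiation under the integral sign by dominated convergence: Harnack bounds the difference
    quotients of the kernel by [C0 / t] times the kernel itself, which is integrable against [f]. *)
Lemma dkernel_integral i f x (df : R) : bdd f -> S x -> is_derive (vshift t x) (e i) (H f) df ->
  (\int[mu]_(xi in S) (dkernel i x xi * f xi)%:E = df%:E)%E.
Proof.
move=> bf Sx dH; have [N0 HN0] := small_index.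
pose q N xi : R := (N + N0).+1%:R * (k (vshift t x + (N + N0).+1%:R^-1 *: e i) xi - k (vshift t x) xi) * f xi.
have i0 N : 0 < (N + N0).+1%:R^-1 :> R by rewrite invr_gt0.
pose g xi : \bar R := (C0 / t * (k (vshift t x) xi * f xi))%:E.
have hh N := near_boundary_vshift i Sx (i0 N) (HN0 _ (leq_addl N N0)).
have Oh N : O (vshift t x + (N + N0).+1%:R^-1 *: e i).
  by have [] := hh N.
have ig : mu.-integrable (S : set BV) g.
  apply: (eq_integrable mS (fun xi => ((C0 / t)%:E * (k (vshift t x) xi * f xi)%:E)%E)) => //.
  by apply: integrableZl => //; exact: kernel_integrable bf (Ot Sx).
have mk1 z : O z -> measurable_fun (S : set BV) (fun xi : BV => k z xi).
  by move=> Oz; have h := measurable_kernel K0 PhiK mk Oz; apply: h.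
have mf : measurable_fun (S : set BV) (f : BV -> R) by case: bf.
have [] := @dominated_convergence _ BV R mu (S : set BV) mS (fun N xi => (q N xi)%:E)
  (fun xi => (dkernel i x xi * f xi)%:E) g.
- by move=> N; apply/measurable_EFinP; do ?[apply: measurable_funM|apply: measurable_funB] => //; apply: mk1 => //; exact: Ot.
- apply/measurable_EFinP; apply: measurable_funM => //.
  exact: (measurable_section (measurable_dkernel i) Sx).
- apply: aeW => xi Sxi; apply: cvg_EFin; first exact: nearW.
  apply: (@cvgM _ _ _ _ _ (fun=> f xi)); last exact: cvg_cst.
  by have := dkernel_cvg (i := i) Sx Sxi; rewrite -(cvg_shiftn N0).
- exact: ig.
- apply: aeW => xi N Sxi; rewrite /g /q /= lee_fin mulrA normrM (ger0_norm (bdd_ge0 bf Sxi)).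
  apply: ler_wpM2r; first exact: bdd_ge0 bf Sxi.
  have [_ /(_ xi Sxi) le1] := hh N.
  rewrite normrM ger0_norm// -ler_pdivlMl//; apply: (le_trans le1).
  by rewrite le_eqVlt; apply/orP; left; apply/eqP; ring.
move=> _ _ cv; have cv2 : (fun N => (\int[mu]_(xi in S) (q N xi)%:E)%E) @ \oo --> df%:E.
  have E N : (\int[mu]_(xi in S) (q N xi)%:E)%E =
      ((N + N0).+1%:R * (H f (vshift t x + (N + N0).+1%:R^-1 *: e i) - H f (vshift t x)))%:E.
    rewrite EFinM EFinB !(poisson_kernel K0 PhiK mk)//; last exact: Ot.
    have i1 := kernel_integrable bf (Oh N); have i2 := kernel_integrable bf (Ot Sx).
    rewrite -integralB_EFin// -integralZl//; last exact: integrableB.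
    by apply: eq_integral => xi _; rewrite /q -EFinB -EFinM; congr _%:E; ring.
  under eq_fun do rewrite E.
  apply: cvg_EFin; first exact: nearW.
  by have := quotient_cvg dH; rewrite -(cvg_shiftn N0).
exact: (cvg_unique _ cv cv2).
Qed.

Lemma grad_directionE z : grad_direction u z = (enorm (grad u z))^-1 *: grad u z.
Proof. by rewrite /grad_direction; case: eqP => // ->; rewrite scaler0. Qed.

Lemma grad_direction_le1 z i : `|grad_direction u z 0 i| <= 1.
Proof.
rewrite grad_directionE mxE normrM normfV (ger0_norm (enorm_ge0 _)).
have le : `|grad u z 0 i| <= enorm (grad u z).
  by apply: le_trans (norm_le_enorm _); exact: coord_le_norm.
have := enorm_ge0 (grad u z); rewrite le_eqVlt => /orP[/eqP <-|g0]; first by rewrite invr0 mul0r.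
by rewrite mulrC ler_pdivrMr// mul1r.
Qed.

Lemma dotp_grad_direction z : dotp (grad u z) (grad_direction u z) = enorm (grad u z).
Proof.
rewrite grad_directionE; move: (grad u z) => g.
have -> : dotp g ((enorm g)^-1 *: g) = (enorm g)^-1 * enorm g ^+ 2.
  by rewrite sqr_enorm /dotp mulr_sumr; apply: eq_bigr => i _; rewrite mxE mulrCA.
have := enorm_ge0 g; rewrite le_eqVlt => /orP[/eqP <-|g0]; first by rewrite invr0 mul0r.
by rewrite expr2 mulrA mulVf ?mul1r// gt_eqF.
Qed.

Lemma measurable_grad_direction i :
  measurable_fun (S : set BV) (fun x : BV => grad_direction u (vshift (2 * t) x) 0 i).
Proof.
have oO : open O := open_nhs K0 PhiK; have t20 : 0 < 2 * t by rewrite mulr_gt0.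
have c := harmonic_vshift (s := 2 * t) (harmonic_on_c2 oO hu).
have md j : measurable_fun (S : set BV) (fun x : BV => grad u (vshift (2 * t) x) 0 j).
  apply: measurable_rel_continuous => //; apply: continuous_rel => x Sx.
  have [_ /(_ j)[_ _ + _]] := c x (boundary_vshift Sx t20).
  by rewrite (_ : (fun x : BV => _) = 'D_(e j) u \o vshift (2 * t))//; apply/funext => y; rewrite mxE.
have E : (fun x : BV => grad_direction u (vshift (2 * t) x) 0 i) =
   (fun x => ((\sum_j grad u (vshift (2 * t) x) 0 j * grad u (vshift (2 * t) x) 0 j) `^ 2^-1) `^ (-1) *
      grad u (vshift (2 * t) x) 0 i).
  apply/funext => x; rewrite grad_directionE mxE; congr (_ * _).
  by rewrite powR_inv1 ?powR_ge0// powR12_sqrt//; exact: dotp_ge0.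
rewrite E; apply: measurable_funM => //.
apply: (@measurableT_comp _ _ _ _ _ _ (fun y : R => y `^ (-1))); first exact: measurable_powR.
apply: (@measurableT_comp _ _ _ _ _ _ (fun y : R => y `^ 2^-1)); first exact: measurable_powR.
by apply: measurable_sum => j; exact: measurable_funM.
Qed.

Lemma c_kernelE x xi : c_kernel k u t x xi = \sum_i dkernel i x xi * grad_direction u (vshift (2 * t) x) 0 i.
Proof. by rewrite /c_kernel /dotp; apply: eq_bigr => i _; rewrite mxE. Qed.

Lemma c_kernel_bound x xi : S x -> S xi ->
  `|c_kernel k u t x xi| <= n.+1%:R * (C0 / t) * k (vshift t x) xi.
Proof.
move=> Sx Sxi; rewrite c_kernelE; apply: (le_trans (ler_norm_sum _ _ _)).
have -> : n.+1%:R * (C0 / t) * k (vshift t x) xi = \sum_(i < n.+1) C0 / t * k (vshift t x) xi.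
  by rewrite sumr_const card_ord -[RHS]mulr_natr; ring.
apply: ler_sum => i _; rewrite normrM -[leRHS]mulr1; apply: ler_pM => //.
  exact: dkernel_bound.
exact: grad_direction_le1.
Qed.

Lemma measurable_c_kernel :
  measurable_fun ((S : set BV) `*` (S : set BV)) (fun p : BV * BV => c_kernel k u t p.1 p.2).
Proof.
under eq_fun do rewrite c_kernelE.
apply: measurable_sum => i; apply: measurable_funM; first exact: measurable_dkernel.
apply: (measurable_comp mS _ (measurable_grad_direction i)); first by move=> _ [p [Sp _] <-].
by apply: measurable_funTS; exact: measurable_fst.
Qed.

(** The extension of [u_t] is [u] shifted by [t], so differentiating it at height [t] gives the
    gradient of [u] at height [2 * t]; its product with its own direction is its norm. *)
Lemma c_kernel_integral x : S x ->
  (\int[mu]_(xi in S) (c_kernel k u t x xi * u (vshift t xi))%:E =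
   (enorm (grad u (vshift (2 * t) x)))%:E)%E.
Proof.
move=> Sx; have oO : open O := open_nhs K0 PhiK; have bu := bdd_vshift t0.
have t20 : 0 < 2 * t by rewrite mulr_gt0.
have O2 : O (vshift (2 * t) x) by exact: boundary_vshift.
have mf : measurable_fun (S : set BV) (u \o vshift t : BV -> R) by case: bu.
have dH i : is_derive (vshift t x) (e i) (H (u \o vshift t)) (grad u (vshift (2 * t) x) 0 i).
  have c := harmonic_vshift (s := t) (harmonic_on_c2 oO hu).
  have Ox' : O (vshift t (vshift t x)) by rewrite vshiftD -mulr2n -mulr_natl.
  have [_ /(_ i)[dv _ _ _]] := c _ Ox'.
  have -> : grad u (vshift (2 * t) x) 0 i = ('D_(e i) u \o vshift t) (vshift t x).
    by rewrite mxE /= vshiftD (_ : 2 * t = t + t)//; ring.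
  apply: near_eq_is_derive dv.
  near=> y; rewrite poisson_vshift//.
  by near: y; apply: open_nbhs_nbhs; split => //; exact: Ot.
have id i : mu.-integrable (S : set BV) (fun xi => (dkernel i x xi * u (vshift t xi))%:E).
  apply: (le_integrable mS _ _ (integrableZl mS (C0 / t) (kernel_integrable bu (Ot Sx)))).
    by apply/measurable_EFinP; apply: measurable_funM => //; exact: (measurable_section (measurable_dkernel i) Sx).
  move=> xi Sxi; rewrite -EFinM !abse_EFin lee_fin mulrA !(normrM _ (u _)).
  apply: ler_wpM2r => //; apply: (le_trans (dkernel_bound i Sx Sxi)); exact: ler_norm.
transitivity (\int[mu]_(xi in S) \sum_i ((grad_direction u (vshift (2 * t) x) 0 i)%:E * (dkernel i x xi * u (vshift t xi))%:E))%E.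
  apply: eq_integral => xi _; rewrite c_kernelE mulr_suml sumEFin; congr _%:E.
  by apply: eq_bigr => i _; ring.
rewrite integral_sum//; last by move=> i; apply: integrableZl.
rewrite -dotp_grad_direction /dotp -sumEFin; apply: eq_bigr => i _.
by rewrite integralZl// (dkernel_integral bu Sx (dH i)) -EFinM mulrC.
Unshelve. all: by end_near. Qed.

Lemma kernel_shift_integrable z xi : O z -> S xi ->
  mu.-integrable (S : set BV) (fun zeta : BV => (k z zeta * k (vshift t zeta) xi)%:E).
Proof.
move=> Oz Sxi; have mk1 := measurable_kernel K0 PhiK mk Oz.
have mk2 : measurable_fun (S : set BV) (fun x : BV => k (vshift t x) xi).
  exact: (measurable_section2 (measurable_kernel_shift (v := t *: e ord_max) Ot) Sxi).
apply/integrableP; split; first by apply/measurable_EFinP; exact: measurable_funM.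
apply: le_lt_trans (ltry (k (vshift t z) xi)).
apply: le_trans (vshift_kernel_dynkin K0 PhiK hm mk Oz Sxi t0).
rewrite (@integral_density _ BV R (omega z) mu S (k z))//.
- apply: ge0_le_integral_nonmeasurable => [x Sx|x Sx]; first exact: abse_ge0.
  have p0 : 0 <= k z x * k (vshift t x) xi by rewrite mulr_ge0// ltW// kg0//; exact: Ot.
  by rewrite abse_EFin (ger0_norm p0) -EFinM lee_fin mulrC.
- by move=> x Sx; rewrite ltW// kg0.
- by move=> A mA AS; case: mk => _ [_ [_ Hk]]; exact: Hk.
- exact/measurable_EFinP.
- by move=> x Sx; rewrite lee_fin ltW// kg0//; exact: Ot.
Qed.

(** After Fubini the integral over [xi] comes first and is given by [c_kernel_integral]. The Harnack
    bound on [c_kernel] provides absolute convergence, and shows that the real-valued integrals in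
    [b_kernel] and [B_operator] come from finite ones. *)
Lemma B_operatorE x : S x -> (B_operator S mu k u t (u \o vshift t) x)%:E =
  (\int[mu]_(zeta in S) (k (vshift t x) zeta * enorm (grad u (vshift (2 * t) zeta)))%:E)%E.
Proof.
move=> Sx; have bu := bdd_vshift t0; have mf := bu.1.
pose Kt := n.+1%:R * (C0 / t).
have ke0 y : S y -> (0 <= (k (vshift t x) y * enorm (grad u (vshift (2 * t) y)))%:E)%E.
  by move=> Sy; rewrite lee_fin mulr_ge0 ?enorm_ge0// ltW// kg0//; exact: Ot.
have Kt0 : 0 <= Kt by rewrite !mulr_ge0// ?invr_ge0 ?(ltW t0)//; have := C01; lra.
pose F (p : BV * BV) := k (vshift t x) p.1 * c_kernel k u t p.1 p.2 * u (vshift t p.2).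
have mkx := measurable_kernel K0 PhiK mk (Ot Sx).
have mkc : measurable_fun ((S : set BV) `*` (S : set BV)) (fun p : BV * BV => k (vshift t x) p.1 * c_kernel k u t p.1 p.2).
  apply: measurable_funM; last exact: measurable_c_kernel.
  apply: (measurable_comp mS _ mkx); first by move=> _ [p [Sp _] <-].
  by apply: measurable_funTS; exact: measurable_fst.
have mF : measurable_fun ((S : set BV) `*` (S : set BV)) F.
  apply: measurable_funM => //.
  apply: (measurable_comp (F := S : set BV) mS _ mf); first by move=> _ [p [_ Sp] <-].
  by apply: measurable_funTS; exact: measurable_snd.
have kc0 zeta xi : S zeta -> S xi ->
    `|k (vshift t x) zeta * c_kernel k u t zeta xi| <= Kt * (k (vshift t x) zeta * k (vshift t zeta) xi).
  move=> Sz Sxi; rewrite normrM (gtr0_norm (kg0 (Ot Sx) Sz)) mulrCA.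
  by apply: ler_wpM2l; [rewrite ltW// kg0//; exact: Ot|exact: c_kernel_bound].
have cint xi : S xi -> mu.-integrable (S : set BV) (fun zeta : BV => (k (vshift t x) zeta * c_kernel k u t zeta xi)%:E).
  move=> Sxi; apply: (le_integrable mS _ _ (integrableZl mS Kt (kernel_shift_integrable (Ot Sx) Sxi))).
    by apply/measurable_EFinP; exact: (measurable_section2 mkc Sxi).
  by move=> zeta Sz; rewrite -EFinM !abse_EFin lee_fin (le_trans (kc0 _ _ Sz Sxi))// ler_norm.
have fin : (\int[mu]_(zeta in S) \int[mu]_(xi in S) `|(F (zeta, xi))%:E| < +oo)%E.
  have bs := bdd_smooth K0 PhiK PhiB hm mk HC t0 bu.
  apply: (@le_lt_trans _ _ (\int[mu]_(zeta in S) (Kt%:E * (k (vshift t x) zeta * smooth t (u \o vshift t) zeta)%:E))%E); last first.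
    by rewrite integralZl//; [rewrite -(poisson_kernel K0 PhiK mk)//; [rewrite -EFinM ltry|exact: Ot]|exact: kernel_integrable bs (Ot Sx)].
  apply: ge0_le_integral_nonmeasurable => [zeta Sz|zeta Sz]; first by apply: integral_ge0 => xi _; exact: abse_ge0.
  apply: (@le_trans _ _ (\int[mu]_(xi in S) ((Kt * k (vshift t x) zeta)%:E * (k (vshift t zeta) xi * u (vshift t xi))%:E))%E).
    apply: ge0_le_integral_nonmeasurable => [xi Sxi|xi Sxi]; first exact: abse_ge0.
    rewrite abse_EFin -EFinM lee_fin /F/= normrM [`|u _|]ger0_norm ?(bdd_ge0 bu Sxi)//.
    rewrite mulrA; apply: ler_wpM2r; first exact: bdd_ge0 bu Sxi.
    by rewrite -mulrA; exact: kc0.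
  rewrite integralZl//; last exact: kernel_integrable bu (Ot Sz).
  by rewrite -(poisson_kernel K0 PhiK mk bu (Ot Sz)) -!EFinM mulrA.
have inner zeta : S zeta -> (\int[mu]_(xi in S) (F (zeta, xi))%:E =
    (k (vshift t x) zeta * enorm (grad u (vshift (2 * t) zeta)))%:E)%E.
  move=> Sz; rewrite EFinM -(c_kernel_integral Sz) -integralZl//.
    by apply: eq_integral => xi _; rewrite /F/= -EFinM mulrA.
  apply: (le_integrable mS _ _ (integrableZl mS Kt (kernel_integrable bu (Ot Sz)))).
    apply/measurable_EFinP; apply: measurable_funM => //.
    exact: (measurable_section measurable_c_kernel Sz).
  move=> xi Sxi; rewrite -EFinM !abse_EFin lee_fin mulrA !(normrM _ (u _)).
  apply: ler_wpM2r => //; apply: (le_trans (c_kernel_bound Sz Sxi)); exact: ler_norm.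
have mFE : measurable_fun ((S : set BV) `*` (S : set BV)) (EFin \o F) by exact/measurable_EFinP.
have swap := @fubini_on _ _ _ BV BV mu mu S S (EFin \o F) mS mS mFE fin.
rewrite /B_operator /Rintegral.
rewrite (_ : (\int[mu]_(xi in S) _)%E = (\int[mu]_(zeta in S) (k (vshift t x) zeta * enorm (grad u (vshift (2 * t) zeta)))%:E)%E).
  rewrite fineK; [by []|]; rewrite ge0_fin_numE; last first.
    apply: integral_ge0; exact: ke0.
  apply: le_lt_trans fin; apply: ge0_le_integral_nonmeasurable => y Sy.
    exact: ke0.
  rewrite -(inner _ Sy); apply: le_trans (lee_abs _) _; apply: le_abse_integral => //.
  by apply/measurable_EFinP; exact: (measurable_section mF Sy).
transitivity (\int[mu]_(xi in S) \int[mu]_(zeta in S) (F (zeta, xi))%:E)%E.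
  apply: eq_integral => xi; rewrite inE => Sxi.
  rewrite /b_kernel /Rintegral EFinM fineK; last exact: (integrable_fin_num mS (cint xi Sxi)).
  rewrite muleC -integralZl; [|exact: mS|exact: (cint _ Sxi)].
  by apply: eq_integral => zeta _; rewrite /F/= -EFinM mulrC.
rewrite -[LHS]swap; apply: eq_integral => zeta; rewrite inE => Sz; exact: inner.
Qed.

End time.
End variation.

(** * Bounding the mean vertical variation *)

Section variation_bound.
Context {R : realType} {n : nat} (Phi : 'rV[R]_n -> R) (K B : R).
Context (K0 : 0 <= K).
Context (PhiK : forall x y : 'rV[R]_n, `|Phi x - Phi y| <= K * `|x - y|).
Context (PhiB : forall x, `|Phi x| <= B).
Local Notation O := (near_half_space Phi).
Local Notation S := (nhs_boundary Phi).
Local Notation gp := (gap Phi).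
Local Notation BV := (borel_rV R n.+1).
Local Notation e := (basis_vec R n.+1).
Context (omega : 'rV[R]_n.+1 -> probability BV R) (k : 'rV[R]_n.+1 -> 'rV[R]_n.+1 -> R).
Context (z0 : 'rV[R]_n.+1).
Context (hm : harmonic_measure O omega) (mk : martin_kernel O S omega z0 k).
Context (C0 C2 : R) (HC : harnack_at Phi C0) (HW : harnack_wide Phi C0 C2).
Local Notation mu := (omega z0).
Local Notation bdd := (bdd Phi).
Local Notation H := (poisson Phi omega).
Local Notation smooth := (smooth Phi omega).
Context (u : 'rV[R]_n.+1 -> R) (hu : harmonic_on O u) (u0 : forall z, O z -> 0 < u z).
Context (ub : forall t : R, 0 < t -> exists M : R, forall z, O z -> `|u (vshift t z)| <= M).
Local Notation bdd_vshift := (bdd_vshift K0 PhiK hu u0 ub).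
Local Notation poisson_vshift := (poisson_vshift K0 PhiK PhiB z0 hm hu u0 ub).

Let mS : measurable (S : set BV) := measurable_boundary K0 PhiK.

Local Notation ez := (basis_vec R n.+1 ord_max).
Local Notation var b := (variation C0 u b).

Let C01 : 1 <= C0. Proof. by case: HC. Qed.
Let C21 : 1 <= C2. Proof. by case: HW. Qed.

(** The point at height [2 * t] is reached from height [3 * b] by an admissible vertical
    displacement, and so is a cube of radius [b / (2 * C0)] around it. There [u] differs from its
    value at height [3 * b] by at most twice the variation, and the gradient estimate applies to
    this difference. *)
Lemma grad_variation (b t : R) zeta : 0 < b -> S zeta -> 3 * b < 2 * t <= 6 * b ->
  enorm (grad u (vshift (2 * t) zeta)) <= 4 * n.+1%:R ^+ 2 * C0 / b * var b zeta.
Proof.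
move=> b0 Sz tb; have oO : open O := open_nhs K0 PhiK; have c := harmonic_on_c2 oO hu.
have C0' : 0 < C0 by have := C01; lra.
set p := vshift (3 * b) zeta; set z := vshift (2 * t) zeta.
pose a := (2 * t - 3 * b) / b.
have a3 : 0 <= a <= 3.
  by rewrite /a divr_ge0 ?(ltW b0)//= ?ler_pdivrMr//; move: tb => /andP[]; lra.
have zE : z = p + b *: (a *: ez).
  rewrite /z /p /vshift -addrA scalerA -scalerDl; congr (_ + _ *: _).
  by rewrite /a; field; rewrite gt_eqF.
have r0 : 0 < b / (2 * C0) by rewrite divr_gt0// mulr_gt0.
have near y : `|y - z| <= b / (2 * C0) -> exists2 v, `|v| < C0^-1 & y = p + b *: (a *: ez + v).
  move=> yz; exists (b^-1 *: (y - z)).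
    rewrite normrZ gtr0_norm ?invr_gt0// mulrC ltr_pdivrMr//; apply: le_lt_trans yz _.
    rewrite mulrC ltr_pM2r// ltf_pV2 ?posrE ?mulr_gt0//; lra.
  rewrite scalerDr [b *: (b^-1 *: _)]scalerA divff ?gt_eqF// scale1r addrA -zE addrC subrK//.
have Op : O p by apply: boundary_vshift => //; rewrite mulr_gt0.
have gap_p : gp p = 3 * b by exact: gap_boundary_vshift.
have nearO y : `|y - z| <= b / (2 * C0) -> O y.
  move=> /near[v v1 ->]; have [_ _ HW'] := HW.
  have [] // := HW' u (conj hu u0) p b a v Op _ a3 (ltW v1).
  by rewrite b0 gap_p; lra.
have cf := c2D c (@c2_cst R n.+1 O (- u p)).
have lap y : `|y - z| <= b / (2 * C0) -> \sum_i ('D_(e i) ('D_(e i) u) y + 0) = 0.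
  by move=> /nearO Oy; under eq_bigr do rewrite addr0; case: hu => _ [_ [_ h]]; exact: h.
have bound y : `|y - z| <= b / (2 * C0) -> `|u y + - u p| <= 2 * var b zeta.
  by move=> /near[v v1 ->]; exact: (variation_wide K0 PhiK HC HW hu u0 b0 Sz a3 v1).
have gb := gradient_bound_cube r0 nearO cf lap bound.
have v0 : 0 <= var b zeta by exact: normr_ge0.
apply: le_trans (enorm_le_norm _) _.
have -> : 4 * n.+1%:R ^+ 2 * C0 / b * var b zeta = n.+1%:R * (n.+1%:R * (2 * var b zeta) / (b / (2 * C0))).
  by field; rewrite !gt_eqF.
rewrite ler_wpM2l//; apply: norm_le_coord => [|i].
  by rewrite divr_ge0 ?(ltW r0)// !mulr_ge0.
by rewrite mxE; have := gb i; rewrite addr0.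
Qed.

(** The constant of [grad_variation] times the factor [1 + C2] for replacing the kernel at height
    [t] by the kernel at height [b]. *)
Definition window_const : R := 4 * n.+1%:R ^+ 2 * C0 * (1 + C2).

Lemma B_operator_le (b t : R) x : 0 < b -> S x -> 3 * b < 2 * t <= 6 * b ->
  B_operator S mu k u t (u \o vshift t) x <= window_const / b * smooth b (var b) x.
Proof.
move=> b0 Sx tb; have t0 : 0 < t by move: tb => /andP[]; lra.
have [C01' C21'] := (C01, C21).
have bv := bdd_variation K0 PhiK z0 HC HW hu u0 ub b0.
have Ob : O (vshift b x) by exact: boundary_vshift.
have Ot : O (vshift t x) by exact: boundary_vshift.
have W0 : 0 <= window_const / b by rewrite divr_ge0 ?(ltW b0)// !mulr_ge0// ?sqr_ge0//; lra.
rewrite -lee_fin (B_operatorE K0 PhiK PhiB hm mk HC hu u0 ub t0 Sx).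
apply: (@le_trans _ _ (\int[mu]_(xi in S) ((window_const / b)%:E * (k (vshift b x) xi * var b xi)%:E))%E).
  apply: ge0_le_integral_nonmeasurable => y Sy.
    by rewrite lee_fin mulr_ge0 ?enorm_ge0// ltW// (kernel_gt0 mk).
  have gv := grad_variation b0 Sy tb.
  have kb0 := kernel_gt0 mk Ob Sy; have kt0 := kernel_gt0 mk Ot Sy.
  have kle : k (vshift t x) y <= (1 + C2) * k (vshift b x) y.
    have [_ _ HW'] := HW; pose a := (t - b) / b.
    have [|||_] := HW' _ (kernel_pos_harmonic mk Sy) (vshift b x) b a 0 Ob.
    - by rewrite b0 gap_boundary_vshift// lexx.
    - by rewrite /a divr_ge0 ?(ltW b0)//= ?ler_pdivrMr//; move: tb => /andP[]; lra.
    - by rewrite normr0 invr_ge0; lra.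
    rewrite gap_boundary_vshift// divff ?gt_eqF// mulr1 addr0 scalerA.
    rewrite -/(vshift (b * a) _) vshiftD (_ : b + b * a = t); last first.
      by rewrite /a; field; rewrite gt_eqF.
    by rewrite ler_norml => /andP[_]; lra.
  rewrite -EFinM lee_fin.
  have -> : window_const / b * (k (vshift b x) y * var b y) =
      ((1 + C2) * k (vshift b x) y) * (4 * n.+1%:R ^+ 2 * C0 / b * var b y).
    by rewrite /window_const; ring.
  by apply: ler_pM => //; [exact: ltW|exact: enorm_ge0].
rewrite integralZl//; last exact: (kernel_integrable K0 PhiK mk bv Ob).
by rewrite -(poisson_kernel K0 PhiK mk bv Ob) -EFinM.
Qed.

Local Notation A j := (smooth (scale j) (var (scale j))).

Lemma window_ex (t : R) : 0 < t < 1 -> exists j, 3 * scale j < 2 * t <= 6 * scale j.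
Proof.
move=> /andP[t0 t1].
have ex : exists j, 3 * scale j < 2 * t.
  have [j Hj] := @scale_small R (t / 3) (divr_gt0 t0 (ltr0Sn R 2)); exists j.
  by have := Hj j (leqnn j); rewrite ler_pdivlMr//; lra.
have [j Hj jmin] := ex_minnP ex; exists j; rewrite Hj/=.
case: j Hj jmin => [_ _|j Hj jmin]; first by rewrite /scale expr0; lra.
have : ~~ (3 * scale j < 2 * t) by apply/negP => /jmin; rewrite ltnn.
by rewrite -leNgt (scaleS j); lra.
Qed.

(** The windows [W j] cover the unit interval. The length [3 / 2 * scale j] of a window cancels the
    denominator in [B_operator_le], so each scale contributes a constant times [A j x]. *)
Lemma mean_vertical_variation_le x : S x ->
  (mean_vertical_variation S mu k u x <= \sum_(0 <= j <oo) (3 / 2 * window_const * A j x)%:E)%E.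
Proof.
move=> Sx; have [C01' C21'] := (C01, C21).
have W0 : 0 <= window_const by rewrite !mulr_ge0// ?sqr_ge0//; lra.
have A0 j : 0 <= A j x.
  by apply: poisson_ge0; exact: (bdd_variation K0 PhiK z0 HC HW hu u0 ub (scale_gt0 j)).
have s0 := @scale_gt0 R.
pose c j := window_const / scale j * A j x.
have c0 j : 0 <= c j by rewrite mulr_ge0// divr_ge0// ltW.
pose W j : set R := `]3 / 2 * scale j, 3 * scale j]%classic.
pose f j (t : R) : \bar R := ((c j)%:E * (\1_(W j) t)%:E)%E.
have f0 j t : (0 <= f j t)%E by rewrite mule_ge0// lee_fin// indicE; case: (_ \in _).
have mf j : measurable_fun (`]0%R, 1%R[%classic : set R) (f j).
  apply: emeasurable_funM => //; apply/measurable_EFinP.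
  by apply: measurable_funTS; apply: measurable_indic; exact: measurable_itv.
apply: (@le_trans _ _ (\int[lebesgue_measure]_(t in `]0%R, 1%R[%classic) \sum_(0 <= j <oo) f j t)%E).
  apply: ge0_le_integral_nonmeasurable => t /=; rewrite in_itv/= => t01.
    have t0 : 0 < t by case/andP: t01.
    rewrite (B_operatorE K0 PhiK PhiB hm mk HC hu u0 ub t0 Sx); apply: integral_ge0 => y Sy.
    by rewrite lee_fin mulr_ge0 ?enorm_ge0// ltW// (kernel_gt0 mk)//; exact: boundary_vshift.
  have [j Hj] := window_ex t01.
  apply: (@le_trans _ _ (f j t)).
    rewrite /f indicE mem_set; last by rewrite /W/= in_itv/=; move: Hj => /andP[? ?]; apply/andP; split; lra.
    by rewrite mule1 lee_fin; exact: B_operator_le.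
  rewrite (@nneseriesD1 R (fun j => f j t) j xpredT)// leeDl//.
  by apply: nneseries_ge0.
rewrite integral_nneseries//.
apply: lee_nneseries => [j _ _|j _].
  by apply: integral_ge0.
rewrite /f ge0_integralZl//; last 2 first.
- apply/measurable_EFinP; apply: measurable_funTS; apply: measurable_indic; exact: measurable_itv.
- by rewrite lee_fin.
rewrite integral_indic; [|by []|exact: measurable_itv].
apply: (@le_trans _ _ ((c j)%:E * (3 / 2 * scale j)%:E)%E).
  apply: lee_wpmul2l; first by rewrite lee_fin.
  apply: (@le_trans _ _ (lebesgue_measure (W j))); first by apply: le_measure; rewrite ?inE//; [by apply: measurableI; exact: measurable_itv|exact: measurable_itv].
  rewrite lebesgue_measure_itv/= lte_fin; case: ifP => _; rewrite -?EFinB lee_fin; have := s0 j; lra.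
rewrite -EFinM lee_fin /c le_eqVlt; apply/orP; left; apply/eqP.
by field; rewrite gt_eqF.
Qed.

Lemma mean_vertical_variation_finite x k0 (M : R) : S x ->
  (forall m, \sum_(i < m) A (k0 + i) x <= M) -> (mean_vertical_variation S mu k u x < +oo)%E.
Proof.
move=> Sx HM; have [C01' C21'] := (C01, C21).
have W0 : 0 <= 3 / 2 * window_const by rewrite !mulr_ge0// ?sqr_ge0//; lra.
have A0 j : 0 <= A j x.
  by apply: poisson_ge0; exact: (bdd_variation K0 PhiK z0 HC HW hu u0 ub (scale_gt0 j)).
apply: le_lt_trans (mean_vertical_variation_le Sx) _.
apply: le_lt_trans (ltry (3 / 2 * window_const * (\sum_(0 <= j < k0) A j x + M))).
apply: lime_le.
  by apply: is_cvg_nneseries => j _ _; rewrite lee_fin mulr_ge0.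
apply: nearW => m; rewrite sumEFin lee_fin -mulr_sumr ler_wpM2l//.
apply: (@le_trans _ _ (\sum_(0 <= j < k0 + m) A j x)).
  by rewrite (big_cat_nat (leq0n m) (leq_addl k0 m))/= lerDl sumr_ge0.
rewrite (big_cat_nat (leq0n k0) (leq_addr m k0))/= lerD2l.
by rewrite -{1}(add0n k0) big_addn addKn big_mkord; under eq_bigr do rewrite addnC.
Qed.

End variation_bound.

(** * Hausdorff measure *)

Section hausdorff.
Context {R : realType} {d : nat}.

Lemma powR_addr_le (a b s : R) : 0 <= a -> 0 <= b -> 0 < s ->
  (a + b) `^ s <= 2 `^ s * (a `^ s + b `^ s).
Proof.
move=> a0 b0 s0; wlog ab : a b a0 b0 / a <= b.
  move=> H; have [|/ltW] := leP a b; first exact: H.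
  by rewrite (addrC a) (addrC (a `^ s)); exact: H.
apply: (@le_trans _ _ ((2 * b) `^ s)).
  by apply: ge0_ler_powR; rewrite ?nnegrE ?(ltW s0) ?addr_ge0 ?mulr_ge0//; lra.
by rewrite powRM// ler_wpM2l ?powR_ge0// lerDr powR_ge0.
Qed.

Lemma sum_scale (N : nat) : \sum_(i < N) scale i.+1 = 1 - scale N :> R.
Proof.
elim: N => [|N IH]; first by rewrite big_ord0 /scale expr0 subrr.
by rewrite big_ord_recr/= IH (scaleS N); ring.
Qed.

Lemma ediam_ge (A : set 'rV[R]_d) x y : A x -> A y -> ((enorm (x - y))%:E <= ediam A)%E.
Proof. by move=> Ax Ay; apply: ereal_sup_ubound; right; exists (x, y). Qed.

(** Covering sets become open balls with centres in [X], or [p] for sets that miss [X]. The padding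
    [th i] makes the radii positive and the balls open, and its powers sum to at most [e1]; working
    at mesh 1/4 keeps the radii below 1. *)
Lemma hausdorff_cover (s e : R) (X : set 'rV[R]_d) p : 0 < s -> 0 < e -> hausdorff_measure s X = 0%E ->
  exists (y : nat -> 'rV[R]_d) (r : nat -> R), [/\ forall i, y i = p \/ X (y i),
   forall i, 0 < r i <= 1, forall x, X x -> exists i, `|x - y i| < r i &
   forall N, \sum_(i < N) r i `^ s <= e].
Proof.
(* Diameters and paddings each contribute [e1], and [powR_addr_le] costs the factor [2 ^ s]. *)
move=> s0 e0 HX; pose e1 := e / (2 * 2 `^ s).
have ps0 : 0 < 2 `^ s :> R by rewrite powR_gt0.
have e10 : 0 < e1 by rewrite divr_gt0// mulr_gt0.
have : (hausdorff_premeasure s (4^-1) X < e1%:E)%E.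
  apply: (@le_lt_trans _ _ (hausdorff_measure s X)); last by rewrite HX lte_fin.
  by apply: ereal_sup_ubound; exists 4^-1 => //; rewrite /= invr_gt0.
move=> /ereal_inf_lt[_ [U [XU Ud] <-] Us].
pose D i := fine (ediam (U i)).
have d0 i : (0 <= ediam (U i))%E by apply: ereal_sup_ubound; left.
have dE i : ediam (U i) = (D i)%:E.
  by rewrite /D fineK// ge0_fin_numE//; apply: le_lt_trans (Ud i) (ltry _).
have D0 i : 0 <= D i by rewrite fine_ge0.
have D1 i : D i <= 4^-1 by rewrite -lee_fin -dE.
pose w i := e1 * scale i.+1.
have w0 i : 0 < w i by rewrite mulr_gt0// scale_gt0.
pose th i := Num.min 4^-1 (w i `^ s^-1).
have th0 i : 0 < th i by rewrite /th lt_min invr_gt0 ltr0n powR_gt0 ?w0.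
have th1 i : th i <= 4^-1 by rewrite ge_min lexx.
have ths i : th i `^ s <= w i.
  apply: (@le_trans _ _ ((w i `^ s^-1) `^ s)).
    by apply: ge0_ler_powR; rewrite ?nnegrE ?powR_ge0 ?(ltW s0) ?(ltW (th0 i))// ge_min lexx orbT.
  by rewrite -powRrM mulVf ?gt_eqF// powRr1// ltW.
have /choice[y Hy] : forall i, exists y, (y = p \/ X y) /\ (U i `&` X !=set0 -> U i y).
  move=> i; have [[z [Uz Xz]]|ne] := pselect (U i `&` X !=set0).
    by exists z; split => //; right.
  by exists p; split => //; left.
exists y, (fun i => D i + th i); split.
- by move=> i; have [] := Hy i.
- by move=> i; have := D0 i; have := D1 i; have := th0 i; have := th1 i; move=> ? ? ? ?; apply/andP; split; lra.
- move=> x Xx; have [i _ Ux] := XU x Xx; exists i.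
  have Uy : U i (y i) by apply: (Hy i).2; exists x.
  apply: (@le_lt_trans _ _ (D i)); last by rewrite ltrDl.
  by apply: le_trans (norm_le_enorm _) _; rewrite -lee_fin -dE; exact: ediam_ge.
- move=> N; apply: (@le_trans _ _ (\sum_(i < N) 2 `^ s * (D i `^ s + w i))).
    apply: ler_sum => i _; apply: (le_trans (powR_addr_le (D0 i) (ltW (th0 i)) s0)).
    by rewrite ler_pM2l// lerD2l.
  rewrite -mulr_sumr big_split/= -mulr_sumr sum_scale.
  have sD : \sum_(i < N) D i `^ s <= e1.
    rewrite -lee_fin -sumEFin; apply: le_trans (ltW Us).
    apply: (@le_trans _ _ (\sum_(0 <= i < N) poweR (ediam (U i)) s)%E).
      by rewrite big_mkord; apply: lee_sum => i _; rewrite dE.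
    by apply: nneseries_lim_ge => i _ _; exact: poweR_ge0.
  have sN := scale_gt0 (R := R) N.
  apply: (@le_trans _ _ (2 `^ s * (e1 + e1))).
    by rewrite ler_pM2l// lerD// ger_pMr//; lra.
  by rewrite /e1 le_eqVlt; apply/orP; left; apply/eqP; field; rewrite gt_eqF.
Qed.

(** A countable family of small balls covers [X], and the sets where some [F m] exceeds [M], open in
    [S], cover the rest of the boundary ball. By compactness, and because [F m] increases with [m],
    a single index [N] serves for both families, so the finite-step inequality [Hc] can be
    contradicted. *)
Lemma hausdorff_measure_neq0 (S X : set 'rV[R]_d) (F : nat -> 'rV[R]_d -> R) x0 (rho c E C alpha s : R) :
  closed S -> S x0 -> X `<=` S -> 0 < c -> 0 <= C -> 0 < s <= alpha ->
  (forall m n x, S x -> (m <= n)%N -> F m x <= F n x) ->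
  (forall m x (M : R), S x -> M < F m x -> exists2 r : R, 0 < r & forall z, S z -> `|z - x| < r -> M < F m z) ->
  (forall x, S x -> `|x - x0| <= rho -> ~ X x -> forall M, exists m, M < F m x) ->
  (forall m (y : nat -> 'rV[R]_d) (r : nat -> R) (M : R), 0 < M -> (forall i, S (y i)) ->
    (forall i, 0 < r i <= 1) ->
    (forall x, S x -> `|x - x0| < rho -> (exists2 i, (i < m.+1)%N & `|x - y i| < r i) \/ M < F m.+1 x) ->
    c <= C * (\sum_(i < m.+1) r i `^ alpha) + E / M) ->
  hausdorff_measure s X <> 0%E.
Proof.
move=> cS Sx0 XS c0 C0 /andP[s0 sa] Fm Fo FX Hc HX.
(* These choices make the covering term and the term [E / M] at most [c / 4] each. *)
pose e := c / (4 * (C + 1)); pose M := 4 * (`|E| + 1) / c.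
have C10 : 0 < C + 1 by lra.
have e0 : 0 < e by rewrite divr_gt0// mulr_gt0.
have E10 : 0 < `|E| + 1 by have := normr_ge0 E; lra.
have M0 : 0 < M by rewrite divr_gt0// mulr_gt0.
have [y [r [yX r01 cov sumr]]] := hausdorff_cover x0 s0 e0 HX.
have Sy i : S (y i) by have [->//|/XS] := yX i.
pose G N z := S z -> (exists2 i, (i < N)%N & `|z - y i| < r i) \/ M < F N z.
have cK : compact (S `&` [set z | `|z - x0| <= rho]).
  by apply: (@compact_sub_cube _ _ x0 rho) => [|z [_]//]; apply: closedI => //; apply: closed_preimage_le; exact: continuous_norm_sub.
have /compact_near_coveringP/(_ nat \oo G) := cK.
case.
  move=> x [Sx xr].
  suff [N [q q0 HN]] : exists N, exists2 q : R, 0 < q & forall z, `|z - x| < q -> G N z.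
    near_simpl; exists ([set z | `|z - x| < q], [set j | (N <= j)%N]) => /=.
      split; last by exists N.
      by apply: open_nbhs_nbhs; split; [exact: open_ballS|rewrite /= subrr normr0].
    move=> [z j] /= [zx Nj] Sz; have [[i iN zi]|MF] := HN z zx Sz.
      by left; exists i => //; exact: leq_trans Nj.
    by right; apply: lt_le_trans MF (Fm _ _ _ Sz Nj).
  have [Xx|nX] := pselect (X x).
    have [i xi] := cov x Xx; exists i.+1, (r i - `|x - y i|); first by rewrite subr_gt0.
    move=> z zx _; left; exists i => //; have := ler_distD x z (y i); lra.
  have [m Hm] := FX x Sx xr nX M; have [q q0 Hq] := Fo m x M Sx Hm.
  by exists m, q => // z zx Sz; right; exact: Hq.
move=> N _ HN; have := Hc N y r M M0 Sy r01.
move=> /(_ (fun x Sx xr => HN N.+1 (leqnSn N) x (conj Sx (ltW xr)) Sx)) le.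
have le1 : \sum_(i < N.+1) r i `^ alpha <= e.
  apply: le_trans (sumr N.+1); apply: ler_sum => i _.
  have /andP[ri0 ri1] := r01 i.
  by apply: ger_powR => //; rewrite ri0.
have le2 : C * (\sum_(i < N.+1) r i `^ alpha) <= c / 4.
  apply: (@le_trans _ _ (C * e)); first by rewrite ler_wpM2l.
  rewrite /e mulrA ler_pdivrMr ?mulr_gt0//; nra.
have le3 : E / M <= c / 4.
  rewrite ler_pdivrMr// /M; have -> : c / 4 * (4 * (`|E| + 1) / c) = `|E| + 1 by field; rewrite gt_eqF.
  have := ler_norm E; lra.
lra.
Qed.

End hausdorff.

(** * Lower bound for the dimension *)

Section main.
Context {R : realType} {n : nat} (Phi : 'rV[R]_n -> R) (K B : R).
Context (K0 : 0 <= K).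
Context (PhiK : forall x y : 'rV[R]_n, `|Phi x - Phi y| <= K * `|x - y|).
Context (PhiB : forall x, `|Phi x| <= B).
Local Notation O := (near_half_space Phi).
Local Notation S := (nhs_boundary Phi).
Local Notation gp := (gap Phi).
Local Notation BV := (borel_rV R n.+1).
Local Notation e := (basis_vec R n.+1).
Context (omega : 'rV[R]_n.+1 -> probability BV R) (k : 'rV[R]_n.+1 -> 'rV[R]_n.+1 -> R).
Context (z0 : 'rV[R]_n.+1).
Context (hm : harmonic_measure O omega) (mk : martin_kernel O S omega z0 k).
Context (C0 C2 : R) (HC : harnack_at Phi C0) (HW : harnack_wide Phi C0 C2).
Local Notation mu := (omega z0).
Local Notation bdd := (bdd Phi).
Local Notation H := (poisson Phi omega).
Local Notation smooth := (smooth Phi omega).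
Context (u : 'rV[R]_n.+1 -> R) (hu : harmonic_on O u) (u0 : forall z, O z -> 0 < u z).
Context (ub : forall t : R, 0 < t -> exists M : R, forall z, O z -> `|u (vshift t z)| <= M).
Local Notation bdd_vshift := (bdd_vshift K0 PhiK hu u0 ub).
Local Notation poisson_vshift := (poisson_vshift K0 PhiK PhiB z0 hm hu u0 ub).

Let mS : measurable (S : set BV) := measurable_boundary K0 PhiK.

Context (eps : R) (eps0 : 0 < eps) (epsC2 : eps * C2 <= 2^-1).
Context (gamma Cd c1 : R) (gamma0 : 0 < gamma) (Cd1 : 1 <= Cd) (c10 : 0 < c1).
Context (decay : forall z y (r : R), O z -> S y -> 0 < r -> r <= `|z - y| ->
  (omega z (surface_ball Phi y r) <= (Cd * (r / `|z - y|) `^ gamma)%:E)%E).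
Context (mass : forall y (r : R), S y -> 0 < r -> (c1%:E <= omega (vshift r y) (surface_ball Phi y (5 * r)))%E).
Context (alpha : R) (alpha_gamma : alpha <= gamma) (eps_small : 1 + eps * C2 <= 2 `^ (gamma - alpha)).
Local Notation var b := (variation C0 u b).
Local Notation A j := (smooth (scale j) (var (scale j))).
Local Notation ball y r := (surface_ball Phi y r).

Let C21 : 1 <= C2. Proof. by case: HW. Qed.
Let C30 : 0 <= 2 * C2. Proof. by have := C21; lra. Qed.
Let kap0 : 0 <= eps * C2. Proof. by rewrite mulr_ge0// ?(ltW eps0)//; have := C21; lra. Qed.

Definition tilted_kernel (j : nat) := tilted Phi omega eps (scale j) (directions C0)
  (select C0 u (scale j)) (diff_sign C0 u (scale j)).

Let sc := @scale_gt0 R.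
Let wd := wide_directions HC.
Let ms j := measurable_select K0 PhiK HC HW hu u0 (sc j).
Let md j := measurable_diff_sign K0 PhiK HC HW hu u0 (sc j).
Let d1 j := diff_sign_le1 C0 u (scale j).

Let bddQ j f : bdd f -> bdd (tilted_kernel j f).
Proof. exact: (bdd_tilted K0 PhiK PhiB hm mk HC HW eps0 epsC2 (sc j) wd (ms j) (md j) (d1 j)). Qed.

Let QD j f g x : bdd f -> bdd g -> S x -> tilted_kernel j (fun x => f x + g x) x = tilted_kernel j f x + tilted_kernel j g x.
Proof. exact: (tiltedD K0 PhiK PhiB hm mk HC HW eps0 epsC2 (sc j) wd (ms j) (md j) (d1 j)). Qed.

Let QZ j (c : R) f x : 0 <= c -> bdd f -> S x -> tilted_kernel j (fun x => c * f x) x = c * tilted_kernel j f x.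
Proof. exact: (tiltedZ K0 PhiK PhiB hm mk HC HW eps0 epsC2 (sc j) wd (ms j) (md j) (d1 j)). Qed.

Let Qeq j f g x : (forall x, S x -> f x = g x) -> S x -> tilted_kernel j f x = tilted_kernel j g x.
Proof. exact: tilted_eq. Qed.

Let Q1 j x : S x -> tilted_kernel j (fun=> 1) x = 1.
Proof. exact: (tilted1 K0 PhiK PhiB hm mk HW eps (sc j) wd). Qed.

Let Q_smooth j f x : bdd f -> S x -> tilted_kernel j f x <= (1 + eps * C2) * smooth (2 * scale j) f x.
Proof. exact: (tilted_smooth K0 PhiK PhiB hm mk HC HW eps0 epsC2 (sc j) wd (ms j) (md j) (d1 j)). Qed.

Let Q_near j f (s : R) x : bdd f -> S x -> scale j <= s ->
  `|tilted_kernel j (smooth s f) x - smooth s f x| <= 2 * C2 * (scale j / s) * smooth s f x.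
Proof. exact: (tilted_near K0 PhiK PhiB hm mk HC HW eps0 epsC2 (sc j) wd (ms j) (md j) (d1 j)). Qed.

Let bu (s : R) : 0 < s -> bdd (u \o vshift s). Proof. exact: bdd_vshift. Qed.

Let bv j : bdd (var (scale j)). Proof. have h := bdd_variation K0 PhiK z0 HC HW hu u0 ub (sc j). exact: h. Qed.

Let bA j : exists2 a, bdd a & A j = smooth (scale j) a.
Proof. by exists (var (scale j)); [exact: bv|]. Qed.

Let Qu j x : S x -> tilted_kernel j (u \o vshift (4 * scale j.+1)) x + eps * A j x = u (vshift (4 * scale j) x).
Proof.
have -> : 4 * scale j.+1 = 2 * scale j :> R by rewrite (scaleS j); ring.
exact: (tilted_vshift K0 PhiK PhiB hm mk HC HW eps0 epsC2 hu u0 ub (sc j)).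
Qed.

Lemma smooth_continuous (s : R) f x : 0 < s -> bdd f -> S x -> {for x, continuous (smooth s f)}.
Proof.
move=> s0 bf Sx; have cs : {for x, continuous (vshift s : 'rV[R]_n.+1 -> 'rV[R]_n.+1)}.
  by apply: (@cvgD _ _ _ (nbhs x)); [exact: cvg_id|exact: cvg_cst].
exact: (continuous_comp cs (poisson_continuous K0 PhiK mk HC bf (boundary_vshift Sx s0))).
Qed.

Lemma scale_powR (q : R) l : scale l `^ q * (2 `^ q) ^+ l = 1.
Proof.
elim: l => [|l IH]; first by rewrite /scale !expr0 powR1 mulr1.
by rewrite exprS mulrA -[RHS]IH (scaleS l) powRM// ?(ltW (sc _))// [_ * 2 `^ q]mulrC.
Qed.

(** [l] is the first index at which the chain resolves the ball, so that [r <= scale l]. Since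
    [1 + eps * C2 <= 2 ^ (gamma - alpha)], the accumulated factor is absorbed by
    [r ^ (gamma - alpha)], leaving [r ^ alpha]. *)
Lemma nu_ball_power x0 k0 y (r : R) m : S x0 -> S y -> 0 < r <= 1 ->
  nu tilted_kernel x0 k0 m.+1 \1_(ball y r) <=
  ball_const K (2 * C2) k0 gamma Cd c1 * 2 `^ (gamma - alpha) * r `^ alpha.
Proof.
move=> Sx0 Sy /andP[r0 r1].
have ex : exists l, scale (k0 + l.+1) <= r.
  have [j Hj] := @scale_small R r r0; exists j; apply: Hj.
  by rewrite addnS ltnW// ltnS leq_addl.
have [l Hl lmin] := ex_minnP ex.
have rl : r <= scale l.
  case: l lmin {Hl} => [_|l lmin]; first by rewrite /scale expr0.
  have : ~~ (scale (k0 + l.+1) <= r) by apply/negP => /lmin; rewrite ltnn.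
  rewrite -ltNge => /ltW/le_trans; apply; rewrite scaleD ger_pMl//; exact: scale_le1.
have Bc0 : 0 <= ball_const K (2 * C2) k0 gamma Cd c1.
  have K0' := K0; have Cd1' := Cd1.
  rewrite !mulr_ge0 ?invr_ge0 ?expR_ge0 ?powR_ge0 ?(ltW c10)//; lra.
apply: (le_trans (nu_ball K0 PhiK PhiB hm mk HC C30 kap0 bddQ QD QZ Qeq Q_smooth Q_near Sx0
  gamma0 Cd1 c10 decay mass m Sy r0 Hl)).
rewrite -mulrA ler_wpM2l//.
set q := gamma - alpha; have q0 : 0 <= q by rewrite subr_ge0.
have -> : r `^ gamma = r `^ q * r `^ alpha.
  by rewrite -powRD ?subrK//; apply/implyP => _; rewrite gt_eqF.
rewrite mulrA; apply: ler_wpM2r; first exact: powR_ge0.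
have kap0' := kap0.
apply: (@le_trans _ _ ((2 `^ q) ^+ l.+1 * scale l `^ q)).
  apply: ler_pM; rewrite ?exprn_ge0 ?powR_ge0 ?ler_pXn2r ?nnegrE ?powR_ge0//; try lra.
  by apply: ge0_ler_powR; rewrite ?nnegrE ?(ltW r0) ?(ltW (sc l)).
by rewrite exprS -mulrA [_ ^+ _ * _]mulrC scale_powR mulr1.
Qed.

Lemma hausdorff_measure_finite_variation x0 (r0 s : R) : S x0 -> 0 < r0 -> 0 < s <= alpha ->
  hausdorff_measure s ([set y | S y /\ (mean_vertical_variation S mu k u y < +oo)%E] `&` eball x0 r0) <> 0%E.
Proof.
move=> Sx0 r00 sa; have C21' := C21; have Cd1' := Cd1.
(* Balls of the chain are sup-norm balls: radius [rho] keeps the Euclidean norm at most [r0 / 2]. *)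
pose rho := r0 / (2 * n.+1%:R); have rho0 : 0 < rho by rewrite divr_gt0// mulr_gt0.
(* [t] is the ratio [10 * delta / rho] required by [nu_ball_lower], small enough for the decay bound
   to be at most [c1 / 4]. *)
pose t := Num.min 1 ((c1 / (4 * Cd)) `^ gamma^-1).
have cd0 : 0 < c1 / (4 * Cd) by rewrite divr_gt0// mulr_gt0//; lra.
have t0 : 0 < t by rewrite /t lt_min ltr01 powR_gt0.
have t1 : t <= 1 by rewrite ge_min lexx.
have tg : Cd * t `^ gamma <= c1 / 4.
  apply: (@le_trans _ _ (Cd * (c1 / (4 * Cd)))); last by rewrite le_eqVlt; apply/orP; left; apply/eqP; field; rewrite gt_eqF//; lra.
  apply: ler_wpM2l; first lra.
  apply: (@le_trans _ _ (((c1 / (4 * Cd)) `^ gamma^-1) `^ gamma)).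
    by apply: ge0_ler_powR; rewrite ?nnegrE ?powR_ge0 ?(ltW t0) ?(ltW gamma0)// ge_min lexx orbT.
  by rewrite -powRrM mulVf ?gt_eqF// powRr1// ltW.
pose delta := rho / 10 * t; have delta0 : 0 < delta by rewrite mulr_gt0// divr_gt0.
have d10 : 10 * delta / rho = t by rewrite /delta; field; rewrite gt_eqF.
have drho : 10 * delta <= rho.
  by rewrite -[leRHS]mul1r -ler_pdivrMr// d10.
(* The chain starts at a scale so fine against [delta] that it moves the test function of
   [nu_ball_lower] by at most half. *)
have [k0 /(_ k0 (leqnn k0)) Hk0] := @scale_small R (delta / (4 * (2 * C2) + 1)) ltac:(by rewrite divr_gt0//; lra).
have {Hk0} Hk0 : (4 * (2 * C2) + 1) * scale k0 <= delta.
  by move: Hk0; rewrite ler_pdivlMr ?[_ * (_ + 1)]mulrC//; lra.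
have sk := sc k0.
have kd1 : 4 * (2 * C2) * scale k0 <= delta by nra.
have kd2 : scale k0 <= delta by nra.
have bAj j : bdd (A j) by have h := bddA K0 PhiK PhiB hm mk HC bA j; exact: h.
have A0 j x : S x -> 0 <= A j x by move=> Sx; exact: bdd_ge0 (bAj j) Sx.
apply: (@hausdorff_measure_neq0 R n.+1 S _ (fun m x => \sum_(i < m) A (k0 + i) x) x0 rho (c1 / 4)
   (expR (2 * (2 * C2)) / eps * u (vshift (4 * scale k0) x0))
   (ball_const K (2 * C2) k0 gamma Cd c1 * 2 `^ (gamma - alpha)) alpha) => //.
- exact: closed_nhs_boundary K0 PhiK.
- by move=> x [[]].
- by rewrite divr_gt0.
- have K0' := K0; rewrite !mulr_ge0 ?invr_ge0 ?expR_ge0 ?powR_ge0 ?(ltW c10)//; lra.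
- move=> m m' x Sx mm'; rewrite -!(big_mkord xpredT (fun i => A (k0 + i) x)).
  by rewrite (big_cat_nat (leq0n m) mm')/= lerDl sumr_ge0// => i _; exact: A0.
- move=> m x M Sx Mx.
  have cF : {for x, continuous (fun z => \sum_(i < m) A (k0 + i) z)}.
    elim: m {Mx} => [|m IH].
      rewrite (_ : (fun z => _) = fun=> 0); first exact: cst_continuous.
      by apply/funext => z; rewrite big_ord0.
    rewrite (_ : (fun z => _) = fun z => \sum_(i < m) A (k0 + i) z + A (k0 + m) z); last first.
      by apply/funext => z; rewrite big_ord_recr.
    by apply: (@cvgD _ _ _ (nbhs x)); [exact: IH|exact: smooth_continuous].
  have Mx' : 0 < \sum_(i < m) A (k0 + i) x - M by rewrite subr_gt0.
  have H0 := @cvgr_dist_lt _ _ _ (nbhs x) _ _ _ cF _ Mx'.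
  have [q /= q0 Hq] := (nbhs_ballP _ _).1 (H0 _); exists q => // z Sz zx.
  have : `|\sum_(i < m) A (k0 + i) x - \sum_(i < m) A (k0 + i) z| < \sum_(i < m) A (k0 + i) x - M.
    by apply: Hq; rewrite -ball_normE /ball_/= distrC.
  by rewrite ltr_norml => /andP[_]; lra.
- move=> x Sx xr nX M; apply: contrapT => H.
  have VM : (mean_vertical_variation S mu k u x < +oo)%E.
    have h := mean_vertical_variation_finite K0 PhiK PhiB hm mk HC HW hu u0 ub (k0 := k0) (M := M) Sx; apply: h.
    by move=> m; rewrite leNgt; apply/negP => Hm; apply: H; exists m.
  apply: nX; split => //; rewrite /eball/=; apply: (le_lt_trans (enorm_le_norm _)).
  apply: (@le_lt_trans _ _ (n.+1%:R * rho)); first by rewrite ler_wpM2l.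
  rewrite /rho (_ : n.+1%:R * (r0 / (2 * n.+1%:R)) = r0 / 2); last by field.
  by rewrite ltr_pdivrMr//; lra.
- move=> m y r M M0 Sy r01 cov.
  have mball z (q : R) : measurable (ball z q : set BV) := measurable_surface_ball K0 PhiK z q.
  have bI z q : bdd \1_(ball z q) := bdd_indic Phi (mball z q).
  have low := nu_ball_lower K0 PhiK PhiB hm mk HC C30 bddQ QD QZ Qeq Q1 Q_near Sx0
    gamma0 Cd1 c10 decay mass m.+1 delta0 drho _ kd1 kd2.
  rewrite d10 in low; apply: (le_trans (low tg)).
  have [bs1 E1] := nu_sum bddQ QD QZ Qeq Sx0 k0 m.+1 (index_enum 'I_m.+1) (fun i => bI (y i) (r i)).
  have [bs2 _] := nu_sum bddQ QD QZ Qeq Sx0 k0 m.+1 (index_enum 'I_m.+1) (fun i => bAj (k0 + i)%N).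
  have bM := bddZ (ltW (ltac:(by rewrite invr_gt0) : 0 < M^-1)) bs2.
  (* A Markov inequality: a point of the ball is either in one of the covering balls or has partial
     variation above [M]. *)
  apply: (@le_trans _ _ (nu tilted_kernel x0 k0 m.+1 (fun x => \sum_(i < m.+1) \1_(ball (y i) (r i)) x +
     M^-1 * \sum_(i < m.+1) A (k0 + i) x))).
    apply: (nu_le bddQ QD Qeq Sx0) => //; first exact: bddD.
    move=> x Sx; rewrite indicE.
    have P1 : 0 <= \sum_(i < m.+1) (\1_(ball (y i) (r i)) x : R) by apply: sumr_ge0 => i _; rewrite indicE.
    have P2 : 0 <= M^-1 * \sum_(i < m.+1) A (k0 + i) x.
      by rewrite mulr_ge0 ?invr_ge0 ?(ltW M0)// sumr_ge0// => i _; exact: A0.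
    case: (boolP (x \in _)) => [|_]; last by rewrite addr_ge0.
    rewrite inE => -[_ /(cov _ Sx)[[i im xi]|MF]].
      rewrite -[1]addr0 lerD// (bigD1 (Ordinal im))//= indicE mem_set// lerDl.
      by apply: sumr_ge0 => j _; rewrite indicE.
    by rewrite -[1]add0r lerD// mulrC ler_pdivlMr// mul1r ltW.
  rewrite (nuD bddQ QD Qeq)// (nuZ bddQ QZ Qeq)//; last by rewrite invr_ge0 ltW.
  rewrite E1 mulr_sumr; apply: lerD.
    by apply: ler_sum => i _; exact: nu_ball_power.
  rewrite mulrC ler_wpM2r ?invr_ge0 ?(ltW M0)//.
  have sumv := nu_sum_variation (A := fun j => A j) K0 PhiK PhiB hm mk HC C30 bddQ QD QZ Qeq Q_near Sx0 k0 eps0 bu bA Qu m.+1.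
  exact: sumv.
Qed.

End main.

Theorem theorem4p2 (R : realType) (n : nat) (hn : (0 < n)%N)
  (Phi : 'rV[R]_n -> R) (hPhi : near_half_space_fun Phi)
  (z0 : 'rV[R]_n.+1) (hz0 : near_half_space Phi z0) :
  exists eta : R, 0 < eta /\
    forall (omega : 'rV[R]_n.+1 -> probability (borel_rV R n.+1) R)
           (k : 'rV[R]_n.+1 -> 'rV[R]_n.+1 -> R)
           (u : 'rV[R]_n.+1 -> R),
      harmonic_measure (near_half_space Phi) omega ->
      martin_kernel (near_half_space Phi) (nhs_boundary Phi) omega z0 k ->
      harmonic_on (near_half_space Phi) u ->
      (forall z, near_half_space Phi z -> 0 < u z) ->
      (forall t : R, 0 < t -> exists M : R,
         forall z, near_half_space Phi z -> `|u (vshift t z)| <= M) ->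
      (forall t : R, 0 < t -> forall e : R, 0 < e -> exists M : R,
         forall x, nhs_boundary Phi x -> M < enorm x ->
           `|u (vshift t x)| < e) ->
      forall (x : 'rV[R]_n.+1) (r : R), nhs_boundary Phi x -> 0 < r ->
        ((n%:R * ((1 + eta) / (2 + eta)))%:E <=
         hausdorff_dim
           ([set y | nhs_boundary Phi y /\
              (mean_vertical_variation (nhs_boundary Phi) (omega z0) k u y
                 < +oo)%E]
            `&` eball x r))%E.
Proof.
have n0 : 0 < n%:R :> R by rewrite ltr0n.
case: hPhi => [[L HL] [rho [/andP[rho0 rho1] Hrho]]].
pose K := `|L| * n%:R.
have K0 : 0 <= K by rewrite mulr_ge0.
have PhiK x y : `|Phi x - Phi y| <= K * `|x - y|.
  apply: (le_trans (HL x y)); apply: (@le_trans _ _ (`|L| * enorm (x - y))).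
    by rewrite ler_wpM2r ?enorm_ge0// ler_norm.
  by rewrite /K -mulrA ler_wpM2l// enorm_le_norm.
have PhiB x : `|Phi x| <= K * 2.
  have [xin|/Hrho ->] := pselect (eball 0 rho x); last by rewrite normr0 mulr_ge0.
  (* A basis vector has norm 1 and lies outside the ball of radius [rho < 1], so [Phi] vanishes
     there; its distance to any point of that ball is at most 2. *)
  pose y := basis_vec R n (Ordinal hn).
  have y1 : `|y| = 1 by exact: norm_basis_vec.
  have Phiy : Phi y = 0.
    apply: Hrho; rewrite /eball/= subr0 => yrho.
    by have := norm_le_enorm y; rewrite y1; lra.
  have x1 : `|x| <= 1.
    by move: xin; rewrite /eball/= subr0; have := norm_le_enorm x; lra.
  rewrite -[Phi x]subr0 -Phiy; apply: (le_trans (PhiK x y)); rewrite ler_wpM2l//.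
  by apply: le_trans (ler_normB _ _) _; rewrite y1; lra.
have [C0 C01 HC'] := nhs_harnack K0 PhiK.
have HC : harnack_at Phi C0 := conj C01 HC'.
have [C2 HW] := harnack_wideP HC.
have C21 : 1 <= C2 by case: HW.
have [gamma [Cd [gn Cd1 decay]]] := ball_decay hn K0 PhiK.
have [c1 c10 mass] := ball_mass K0 PhiK PhiB.
have gamma0 : 0 < gamma by apply: lt_trans gn; rewrite divr_gt0.
(* The midpoint of n/2 and [gamma]: the gap up to [gamma] pays for the tilts, the gap down to n/2 is
   the gain. *)
pose alpha := (n%:R / 2 + gamma) / 2.
have ag : alpha < gamma by rewrite /alpha; lra.
have D1 : 1 < 2 `^ (gamma - alpha).
  have q0 : 0 < gamma - alpha by rewrite subr_gt0.
  have := gt0_ltr_powR q0 (ler01 : 1 \in Num.nneg) (ler0n _ 2 : 2 \in Num.nneg).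
  by rewrite powR1; apply; rewrite ltr1n.
(* The first bound keeps the kernels positive, the second keeps their growth within
   [2 ^ (gamma - alpha)] per scale. *)
pose eps := Num.min 2^-1 (2 `^ (gamma - alpha) - 1) / C2.
have epsE : eps * C2 = Num.min 2^-1 (2 `^ (gamma - alpha) - 1).
  by rewrite /eps divfK// gt_eqF//; lra.
have eps0 : 0 < eps.
  by rewrite /eps divr_gt0//; [rewrite lt_min invr_gt0 ltr0n subr_gt0|lra].
have epsC2 : eps * C2 <= 2^-1 by rewrite epsE ge_min lexx.
have eps_small : 1 + eps * C2 <= 2 `^ (gamma - alpha).
  by rewrite -lerBrDl epsE ge_min lexx orbT.
(* Chosen so that [alpha = n * (2 + eta) / 4]. The claimed dimension is below this because
   [4 * (1 + eta) <= (2 + eta) ^ 2]. *)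
pose eta := 2 * (gamma - n%:R / 2) / n%:R.
have eta0 : 0 < eta by rewrite divr_gt0// mulr_gt0// subr_gt0.
exists eta; split => // omega k u hm mk hu u0 ub _ x r Sx r0.
apply: le_ereal_inf_tmp => _ [s [s0 Hs] <-]; rewrite lee_fin leNgt; apply/negP => sb.
have bound : n%:R * ((1 + eta) / (2 + eta)) <= alpha.
  have aE : alpha = n%:R * ((2 + eta) / 4) by rewrite /alpha /eta; field; rewrite gt_eqF.
  rewrite aE ler_pM2l// ler_pdivrMr; last lra.
  by rewrite mulrAC ler_pdivlMr//; nra.
have sa : 0 < s <= alpha by rewrite s0 ltW// (lt_le_trans sb).
exact: (hausdorff_measure_finite_variation K0 PhiK PhiB hm mk HC HW hu u0 ub eps0 epsC2
  gamma0 Cd1 c10 (decay omega hm) (mass omega hm) (ltW ag) eps_small Sx r0 sa Hs).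
Qed.
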